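(* Let $C_1:f_1=0$ and $C_2:f_2=0$ be reduced curves in $\mathbb{P}^2$ without common irreducible components, of degrees $d_1,d_2$, let $C=C_1\cup C_2:f=f_1f_2=0$, and put $r_1=mdr(f_1)$, $r=mdr(f)$. Assume that $C_2$ is a smooth rational curve (hence $d_2\in\{1,2\}$), that all singularities of $C_1$ and $C$ are quasihomogeneous, and that $C_1$ is a free curve. Let $R$ be the reduced scheme of $C_1\cap C_2$, $|R|$ its number of points, and set $$k_0=d_2-2+\left\lceil\frac{|R|}{d_2}\right\rceil.$$ Then $|R|\le(r_1+1)d_2$ implies $k_0\ge r_1$ and $$r_1\le r=k_0\le r_1+d_2-1.$$ In particular, $|R|>(r_1+1)d_2-d_2^2$, that is, we have the following cases. (1) Let $C_1:f_1=0$ be a free curve and $L$ be a line, not a component of $C_1$, such that $C_1$ and $C_1\cup L$ have only quasihomogeneous singularities. Then $|C_1\cap L|>r_1=mdr(f_1)$. (2) Let $C_1:f_1=0$ be a free curve and $Q$ be a smooth conic, not a component of $C_1$, such that $C_1$ and $C_1\cup Q$ have only quasihomogeneous singularities. Then $|C_1\cap Q|>2r_1-2$, where $r_1=mdr(f_1)$.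
   Context: $S=\mathbb{C}[x,y,z]$. For homogeneous $g\in S$, $AR(g)=\{(a,b,c)\in S^3: ag_x+bg_y+cg_z=0\}$ is the graded $S$-module of Jacobian syzygies (with $AR(g)_s$ the triples with entries in $S_s$), and $mdr(g)=\min\{s\in\mathbb{N}:AR(g)_s\neq0\}$. A reduced curve $C_g:g=0$ is free if $AR(g)$ is a free graded $S$-module. A singular point of a reduced plane curve is quasihomogeneous if, in suitable local analytic coordinates, the curve germ is defined by a weighted homogeneous polynomial (with positive weights). *)

(* Defs.v *)
(* MathComp + MathComp-Analysis.  The notations of [mpoly] clash with those of
   MathComp-Analysis, so [mpoly] is imported without them. *)
From HB Require Import structures.
From mathcomp Require Export all_boot all_order all_algebra.
From mathcomp Require Export finmap.
From mathcomp Require Export all_classical all_reals.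
From mathcomp Require Export topology normedtype derive.
From mathcomp Require Export complex.
From mathcomp Require Export -(notations) mpoly.
Export numFieldNormedType.Exports.

Set Implicit Arguments.
Unset Strict Implicit.
Unset Printing Implicit Defensive.

Import Order.TTheory GRing.Theory Num.Theory.

Local Open Scope classical_set_scope.
Local Open Scope ring_scope.

(* Declaring the type of R[i] to be [numClosedFieldType] is what makes the
   normed-module structure (hence [differentiable]) available on it. *)
Definition Cplx (R : realType) : numClosedFieldType := R[i].

(* Cpoly R 3 is S = C[x,y,z], with x, y, z the variables of index 0, 1, 2. *)
Notation Cpoly R n := (mpoly n (Cplx R)).

Definition homogeneous (R : realType) (n d : nat) (g : Cpoly R n) : Prop :=
  g \is ishomog1 d mdeg.

Definition evalv (R : realType) (n : nat) (g : Cpoly R n)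
  (v : 'rV[Cplx R]_n) : Cplx R := meval (fun i => v ord0 i) g.

Definition pdvd (R : realType) (n : nat) (h g : Cpoly R n) : Prop :=
  exists q : Cpoly R n, g = q * h.

Definition pirreducible (R : realType) (n : nat) (h : Cpoly R n) : Prop :=
  [/\ h != 0, h \isn't a GRing.unit &
      forall a b : Cpoly R n, h = a * b ->
        a \is a GRing.unit \/ b \is a GRing.unit].

(* The curve g = 0 in P^2 is a reduced curve of degree d. *)
Definition reduced_curve (R : realType) (d : nat) (g : Cpoly R 3) : Prop :=
  [/\ (0 < d)%N, homogeneous d g &
      forall h : Cpoly R 3, pdvd (h ^+ 2) g -> h \is a GRing.unit].

Definition no_common_component (R : realType) (g h : Cpoly R 3) : Prop :=
  forall p : Cpoly R 3, pirreducible p -> pdvd p g -> ~ pdvd p h.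

(* AR(g), as a set of vectors in S^3. *)
Definition AR (R : realType) (g : Cpoly R 3) : set ('I_3 -> Cpoly R 3) :=
  [set a | \sum_(i < 3) a i * mderiv i g = 0].

Definition AR_deg (R : realType) (g : Cpoly R 3) (s : nat) :
    set ('I_3 -> Cpoly R 3) :=
  AR g `&` [set a | forall i, homogeneous s (a i)].

Definition AR_deg_neq0 (R : realType) (g : Cpoly R 3) (s : nat) : bool :=
  `[< exists2 a, AR_deg g s a & exists i, a i != 0 >].

(* The default value 0 is only used when every AR(g)_s vanishes, which never
   happens for homogeneous g, see [mdrP]. *)
Definition mdr (R : realType) (g : Cpoly R 3) : nat :=
  if pselect (exists s, AR_deg_neq0 g s) is left h then ex_minn h else 0%N.

Lemma homogeneous_mderiv (R : realType) (n d : nat) (g : Cpoly R n)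
    (i : 'I_n) : homogeneous d g -> homogeneous d.-1 (mderiv i g).
Proof.
rewrite /homogeneous => /dhomogP hg; apply/dhomogP => m.
rewrite mcoeff_msupp mcoeff_deriv => nz.
have /hg : mnm_add m (mnm1 i) \in msupp g.
  by rewrite mcoeff_msupp; apply: contraNneq nz => ->; rewrite mul0rn.
by rewrite /= mdegD mdeg1 addn1 => <-.
Qed.

Lemma AR_deg_neq0_ex (R : realType) (d : nat) (g : Cpoly R 3) :
  homogeneous d g -> exists s, AR_deg_neq0 g s.
Proof.
move=> hg; have hd k := homogeneous_mderiv k hg.
have [g0|] := boolP [forall i : 'I_3, mderiv i g == 0].
  exists 0%N; apply/asboolP; exists (fun=> 1); last first.
    by exists ord0; exact: oner_neq0.
  split => /=; last by move=> _; exact: dhomog1.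
  by apply: big1 => i _; rewrite (eqP (forallP g0 i)) mulr0.
move=> /forallPn[i gi0]; exists d.-1; apply/asboolP.
pose j : 'I_3 := lift i ord0; have ij : j != i by rewrite eq_sym neq_lift.
exists (fun k => if k == i then mderiv j g else
                 if k == j then - mderiv i g else 0).
  split => /=.
    rewrite /AR /= (bigD1 i) //= eqxx (bigD1 j) //= (negPf ij) eqxx big1 ?addr0.
      by rewrite mulNr [X in _ - X]mulrC subrr.
    by move=> k /andP[/negPf-> /negPf->]; rewrite mul0r.
  move=> k; case: ifP => _; first exact: hd.
  case: ifP => _; last exact: dhomog0.
  by rewrite /homogeneous dhomogN; exact: hd.
by exists j; rewrite (negPf ij) eqxx oppr_eq0.
Qed.

Lemma mdrP (R : realType) (d : nat) (g : Cpoly R 3) : homogeneous d g ->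
  AR_deg_neq0 g (mdr g) /\ (forall s, AR_deg_neq0 g s -> (mdr g <= s)%N).
Proof.
move=> /AR_deg_neq0_ex gs; rewrite /mdr; case: pselect => // h.
by case: ex_minnP.
Qed.

Definition free_curve (R : realType) (g : Cpoly R 3) : Prop :=
  exists (n : nat) (deg : 'I_n -> nat) (e : 'I_n -> 'I_3 -> Cpoly R 3),
    (forall j, AR_deg g (deg j) (e j)) /\
    (forall a, AR g a ->
       exists! c : 'I_n -> Cpoly R 3,
         forall i, a i = \sum_(j < n) c j * e j i).

Definition singular_point (R : realType) (g : Cpoly R 3) (v : 'rV[Cplx R]_3) :
    Prop :=
  [/\ v != 0, evalv g v = 0 & forall i, evalv (mderiv i g) v = 0].

Definition smooth_curve (R : realType) (g : Cpoly R 3) : Prop :=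
  forall v, ~ singular_point g v.

(* Holomorphic = complex differentiable in a neighbourhood of the point. *)
Definition holomorphic_near (R : realType) (V W : normedModType (Cplx R))
  (F : V -> W) (p : V) : Prop := \forall x \near p, differentiable F x.

(* phi is a system of local analytic coordinates centred at p: a germ of
   biholomorphism (C^2, p) -> (C^2, 0). *)
Definition local_coordinates (R : realType)
    (phi : 'rV[Cplx R]_2 -> 'rV[Cplx R]_2) (p : 'rV[Cplx R]_2) : Prop :=
  phi p = 0 /\ holomorphic_near phi p /\
  exists psi : 'rV[Cplx R]_2 -> 'rV[Cplx R]_2,
    [/\ psi 0 = p, holomorphic_near psi 0,
        (\forall x \near p, psi (phi x) = x) &
        (\forall y \near (0 : 'rV[Cplx R]_2), phi (psi y) = y)].

Definition weighted_homogeneous (R : realType) (n : nat) (w : 'I_n -> nat)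
    (d : nat) (g : Cpoly R n) : Prop :=
  forall m, m \in msupp g -> (\sum_(i < n) w i * m i)%N = d.

(* The germ G = 0 at p is defined by a weighted homogeneous polynomial W in
   suitable coordinates: G and W o phi generate the same ideal of the local
   ring of germs of holomorphic functions at p. *)
Definition quasihomogeneous_germ (R : realType) (G : 'rV[Cplx R]_2 -> Cplx R)
    (p : 'rV[Cplx R]_2) : Prop :=
  exists (w : 'I_2 -> nat) (d : nat) (W : Cpoly R 2)
         (phi : 'rV[Cplx R]_2 -> 'rV[Cplx R]_2) (u : 'rV[Cplx R]_2 -> Cplx R),
    [/\ (forall i, (0 < w i)%N) /\ weighted_homogeneous w d W,
        local_coordinates phi p,
        holomorphic_near u p /\ u p != 0 &
        \forall x \near p, G x = u x * evalv W (phi x)].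

(* The standard affine chart C^2 -> {x_i = 1} of P^2. *)
Definition chart (R : realType) (i : 'I_3) (u : 'rV[Cplx R]_2) :
    'rV[Cplx R]_3 :=
  \row_j (if unlift i j is Some k then u ord0 k else 1).

(* Every singular point of g = 0 is seen in at least one of the charts; the
   condition on the germ does not depend on the chart. *)
Definition quasihomogeneous_singularities (R : realType) (g : Cpoly R 3) :
    Prop :=
  forall (i : 'I_3) (p : 'rV[Cplx R]_2), singular_point g (chart i p) ->
    quasihomogeneous_germ (fun u => evalv g (chart i u)) p.

(* The curve g = 0 is irreducible and birational to P^1: P (three forms of
   degree m in two variables) and Q (two forms of degree n in three variables)
   define mutually inverse rational maps between P^1 and the curve.  Equality
   of points in projective space is proportionality of the coordinates, and an
   identity holds on the curve when it holds modulo g. *)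
Definition rational_curve (R : realType) (g : Cpoly R 3) : Prop :=
  pirreducible g /\
  exists (m n : nat) (P : 3.-tuple (Cpoly R 2)) (Q : 2.-tuple (Cpoly R 3)),
    [/\ (forall i, homogeneous m (tnth P i)) /\
        (forall j, homogeneous n (tnth Q j)),
        comp_mpoly P g = 0,
        (exists j, comp_mpoly P (tnth Q j) != 0) /\
        (forall j k : 'I_2,
           comp_mpoly P (tnth Q j) * mpolyX _ (mnm1 k) =
           comp_mpoly P (tnth Q k) * mpolyX _ (mnm1 j)) &
        (exists i, ~ pdvd g (comp_mpoly Q (tnth P i))) /\
        (forall i k : 'I_3,
           pdvd g (comp_mpoly Q (tnth P i) * mpolyX _ (mnm1 k) -
                   comp_mpoly Q (tnth P k) * mpolyX _ (mnm1 i)))].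

(* A point of P^2 is a line <[v]> through the origin of C^3. *)
Definition intersection_points (R : realType) (g h : Cpoly R 3) :
    set {vspace 'rV[Cplx R]_3} :=
  [set <[v]>%VS | v in [set v | [/\ v != 0, evalv g v = 0 & evalv h v = 0]]].

(* Two curves without common components meet in finitely many points; fset_set
   sends infinite sets to the empty one. *)
Definition num_intersection (R : realType) (g h : Cpoly R 3) : nat :=
  #|` fset_set (intersection_points g h)|.

(* Main.v *)
(* Parametrize C_2 by gamma : C -> C^3 of degree d_2 in {1, 2}, the point at
   infinity being chosen off C_1.  A syzygy rho of f_1, seen as a vector field,
   yields the polynomial u = rho(f_2)(gamma).  At a point of C_1 /\ C_2 where
   f_1(gamma) vanishes to order m, the germ of f is quasihomogeneous, hence is
   preserved by an Euler field chi with invertible linear part; the determinant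
   of rho and chi is divisible by f_1 along C_1, and this forces u to vanish to
   order m - 1.  For a basis rho_1, rho_2 of AR(f_1), of degrees with sum d_1 - 1,
   dividing u_1, u_2 by these common factors leaves w_1, w_2 of low degree, and
   w_2 rho_1 - w_1 rho_2, lifted to C[x,y,z], is tangent to C_2: this is a syzygy of f
   of degree k_0, up to a multiple of the Euler field.  Conversely a syzygy of f
   restricts to alpha gamma + beta gamma' along C_2, where beta vanishes at the |R|
   common points; below degree k_0 this gives beta = 0, and dividing by f_2
   produces a syzygy of f_1 of degree smaller by d_2.  The degree d_2 <= 2 comes from
   gamma x gamma' being a multiple of grad f_2 (gamma).

   Quasihomogeneity is stated with holomorphic coordinates, of which only the
   Taylor polynomials of finite order are used.  Complex differentiable functions
   are shown to have such polynomials through a maximum principle, itself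
   obtained from Goursat's bisection with discrete contour sums. *)
From HB Require Import structures.
Require Import Defs.
From mathcomp Require Import separable matrix_normedtype ring lra zify.
From mathcomp Require Import -(notations) landau.

Set Implicit Arguments.
Unset Strict Implicit.
Unset Printing Implicit Defensive.

Import Order.TTheory GRing.Theory Num.Theory.

Local Open Scope ring_scope.

(** The analytic coordinates are known only through Taylor polynomials, so local identities hold
    modulo powers (X, Y)^N. The local argument cancels a discriminant p(X), nonzero because f_1 is
    reduced but possibly zero at the point itself, and each such cancellation loses orders. What
    makes it work is that the loss depends on f_1 and p only, so N can be chosen afterwards.

    The number k_0 is where two degree counts meet. A syzygy of f of degree k exists as soon as |R|
    + d_2^2 <= d_2 (k + 2), which means k >= k_0. Under the opposite inequality beta has more zeros
    than its degree allows, and the two thresholds coincide exactly because (d_2 - 1)(d_2 - 2) = 0.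
    So r <= k_0, and r < k_0 would force r >= r_1 + d_2, which the upper bound on |R| excludes. The
    lower bound on |R| only expresses r_1 <= r <= k_0.

    Placing the point at infinity of C_2 off C_1 gives f_1(gamma) its full degree d_1 d_2: its roots
    are then all the common points, and the factor removed from u_1 and u_2 has degree d_1 d_2 -
    |R|. *)

Section MPolyEval.
Variables (K : comNzRingType) (n : nat).
Implicit Types p q : mpoly n K.
Local Notation "''X_' i" := (mpolyX K (mnm1 i)) (at level 8, i at level 2, format "''X_' i").
Local Notation "''X_[' m ]" := (mpolyX K m).

Lemma mpoly_closure_ind (P : mpoly n K -> Prop) :
  (forall c, P (mpolyC n c)) -> (forall i, P 'X_i) ->
  (forall p q, P p -> P q -> P (p + q)) -> (forall p q, P p -> P q -> P (p * q)) ->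
  forall p, P p.
Proof.
move=> hC hX hD hM p; elim/mpolyind: p => [|c m p _ _ hp].
  by rewrite -mpolyC0; apply: hC.
apply: (hD _ _ _ hp); rewrite -mul_mpolyC; apply: (hM _ _ (hC c)).
rewrite mpolyXE_id; apply: (big_ind P); [exact: (hC 1)|exact: hM|move=> i _].
by elim: (m i) => [|k IH]; [exact: (hC 1)|rewrite exprS; exact: hM].
Qed.

Section Eval.
Variables (B : comNzRingType) (iota : {rmorphism K -> B}).

Lemma mmap_U (h : 'I_n -> B) i : mmap iota h 'X_i = h i.
Proof. by rewrite mmapX mmap1U. Qed.

Lemma eq_mmap (h1 h2 : 'I_n -> B) p : h1 =1 h2 -> mmap iota h1 p = mmap iota h2 p.
Proof.
move=> e; apply: eq_bigr => m _; congr (_ * _).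
by apply: eq_bigr => i _; rewrite e.
Qed.

(** The chain rule for an arbitrary derivation of the target that kills the coefficients. It serves
    for [dX], for [dY] and for the derivative along a parametrization. *)
Lemma mmap_derivation (D : B -> B) (h : 'I_n -> B) p :
  (forall x y, D (x + y) = D x + D y) -> (forall x y, D (x * y) = D x * y + x * D y) ->
  (forall c, D (iota c) = 0) ->
  D (mmap iota h p) = \sum_(i < n) mmap iota h (mderiv i p) * D (h i).
Proof.
move=> DD DM DC; elim/mpoly_closure_ind: p => [c|i|p q hp hq|p q hp hq].
- by rewrite mmapC DC big1 // => i _; rewrite mderivC mmap0 mul0r.
- rewrite mmap_U (bigD1 i) //= big1 ?addr0 => [|j ji].
    by rewrite mderivX mnm1E eqxx -{1}[mnm1 i]add0m addmK mpolyX0 scale1r rmorph1 mul1r.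
  by rewrite mderivX mnm1E eq_sym (negPf ji) scale0r mmap0 mul0r.
- by rewrite mmapD DD hp hq -big_split; apply: eq_bigr => i _; rewrite mderivD mmapD mulrDl.
rewrite rmorphM DM hp hq mulr_suml mulr_sumr -big_split; apply: eq_bigr => i _ /=.
by rewrite mderivM mmapD !rmorphM /=; ring.
Qed.

Lemma mmap_homogeneous (d : nat) (c : B) (h : 'I_n -> B) p : p \is ishomog1 d mdeg ->
  mmap iota (fun i => c * h i) p = c ^+ d * mmap iota h p.
Proof.
move=> /dhomogP hp; rewrite /mmap mulr_sumr big_seq [RHS]big_seq; apply: eq_bigr => m /hp /= <-.
rewrite mulrCA; congr (_ * _); rewrite /mmap1 mdegE -prodrXr -big_split /=.
by apply: eq_bigr => i _; rewrite exprMn.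
Qed.

End Eval.

Lemma mderiv_mpolyXE (m : multinom n) i : 'X_i * mderiv i 'X_[m] = (m i)%:R *: 'X_[m].
Proof.
rewrite mderivX; have [->|m0] := eqVneq (m i) 0%N; first by rewrite !scale0r mulr0.
rewrite -scalerAr -mpolyXD; congr (_ *: 'X_[_]); apply/mnmP => j.
rewrite mnmDE mnmBE mnm1E; case: eqP => [<-|_] /=; last by rewrite subn0.
by rewrite subnKC // lt0n.
Qed.

Lemma weighted_euler (w : 'I_n -> nat) (d : nat) p :
  (forall m, m \in msupp p -> (\sum_(i < n) w i * m i)%N = d) ->
  \sum_(i < n) (w i)%:R *: ('X_i * mderiv i p) = d%:R *: p.
Proof.
move=> h; rewrite {2}[p]mpolyE scaler_sumr.
transitivity (\sum_(i < n) \sum_(m <- msupp p) ((w i)%:R * (mcoeff m p * (m i)%:R)) *: 'X_[m]).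
  apply: eq_bigr => i _; rewrite {1}[p]mpolyE raddf_sum mulr_sumr scaler_sumr.
  apply: eq_bigr => m _; rewrite /= mderivZ -scalerAr mderiv_mpolyXE.
  by rewrite !scalerA mulrA.
rewrite exchange_big /= big_seq [RHS]big_seq; apply: eq_bigr => m /h <-.
rewrite -scaler_suml scalerA; congr (_ *: _).
rewrite natr_sum mulr_suml; apply: eq_bigr => i _; rewrite natrM; ring.
Qed.

Lemma mmap_weighted_euler (B : comNzRingType) (iota : {rmorphism K -> B}) (h : 'I_n -> B)
    (w : 'I_n -> nat) (d : nat) p :
  (forall m, m \in msupp p -> (\sum_(i < n) w i * m i)%N = d) ->
  \sum_(i < n) (w i)%:R * h i * mmap iota h (mderiv i p) = d%:R * mmap iota h p.
Proof.
move=> /weighted_euler e; rewrite -[d%:R](rmorph_nat iota) -mmapZ -e raddf_sum.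
by apply: eq_bigr => i _; rewrite /= mmapZ rmorphM /= mmap_U rmorph_nat mulrA.
Qed.

Lemma euler (d : nat) p : p \is ishomog1 d mdeg ->
  \sum_(i < n) 'X_i * mderiv i p = d%:R *: p.
Proof.
move=> /dhomogP hp; rewrite -(@weighted_euler (fun=> 1%N)) => [|m /hp <-].
  by apply: eq_bigr => i _; rewrite scale1r.
by rewrite /= mdegE; apply: eq_bigr => i _; rewrite mul1n.
Qed.

End MPolyEval.

(** * Maximum principle and Taylor polynomials *)

Section Modulus.
Variable R : realType.
Local Notation C := (Cplx R).
Implicit Types (z w : C) (x y r : R).

Definition cr (x : R) : C := (real_complex R x : R[i]).
Definition ci : C := (Complex 0 1 : R[i]).
(** The norm of [C] takes its values in [C] itself; this real-valued version lets the estimates take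
    place in the ordered field [R]. *)
Definition nm z : R := complex.Re (`|z| : R[i]).
Definition rp z : R := complex.Re (z : R[i]).
Definition ip z : R := complex.Im (z : R[i]).

Lemma nmE z : `|z| = cr (nm z).
Proof. by rewrite /nm /cr (normc_def (z : R[i])). Qed.

Lemma cr_inj : injective cr. Proof. exact: complexI. Qed.
Lemma crD x y : cr (x + y) = cr x + cr y. Proof. exact: (rmorphD (real_complex R)). Qed.
Lemma crM x y : cr (x * y) = cr x * cr y. Proof. exact: (rmorphM (real_complex R)). Qed.
Lemma crN x : cr (- x) = - cr x. Proof. exact: (rmorphN (real_complex R)). Qed.
Lemma cr0 : cr 0 = 0. Proof. exact: (rmorph0 (real_complex R)). Qed.
Lemma cr1 : cr 1 = 1. Proof. exact: (rmorph1 (real_complex R)). Qed.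
Lemma crn n : cr n%:R = n%:R. Proof. exact: (rmorph_nat (real_complex R)). Qed.
Lemma crV x : cr x^-1 = (cr x)^-1. Proof. exact: (fmorphV (real_complex R)). Qed.
Lemma cr_le x y : (cr x <= cr y) = (x <= y). Proof. exact: lecR. Qed.
Lemma cr_lt x y : (cr x < cr y) = (x < y). Proof. exact: ltcR. Qed.

Lemma cE z : z = cr (rp z) + ci * cr (ip z).
Proof. exact: (complexE (z : R[i])). Qed.

Lemma ci2 : ci * ci = -1.
Proof. by have := sqr_i R; rewrite expr2. Qed.

Lemma rpD z w : rp (z + w) = rp z + rp w. Proof. by case: z w => a b [c d]. Qed.
Lemma ipD z w : ip (z + w) = ip z + ip w. Proof. by case: z w => a b [c d]. Qed.
Lemma rpN z : rp (- z) = - rp z. Proof. by case: z. Qed.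
Lemma ipN z : ip (- z) = - ip z. Proof. by case: z. Qed.
Lemma rpM z w : rp (z * w) = rp z * rp w - ip z * ip w.
Proof. by case: z w => a b [c d]. Qed.
Lemma ipM z w : ip (z * w) = rp z * ip w + ip z * rp w.
Proof. by case: z w => a b [c d]. Qed.
Lemma rp_cr x : rp (cr x) = x. Proof. by []. Qed.
Lemma ip_cr x : ip (cr x) = 0. Proof. by []. Qed.
Lemma rp_ci : rp ci = 0. Proof. by []. Qed.
Lemma ip_ci : ip ci = 1. Proof. by []. Qed.

Lemma nm0 : nm 0 = 0. Proof. by apply: cr_inj; rewrite -nmE normr0 cr0. Qed.
Lemma nm1 : nm 1 = 1. Proof. by apply: cr_inj; rewrite -nmE normr1 cr1. Qed.
Lemma nmM z w : nm (z * w) = nm z * nm w.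
Proof. by apply: cr_inj; rewrite crM -!nmE normrM. Qed.
Lemma nmN z : nm (- z) = nm z.
Proof. by apply: cr_inj; rewrite -!nmE normrN. Qed.
Lemma nmB z w : nm (z - w) = nm (w - z). Proof. by rewrite -nmN opprB. Qed.
Lemma nmV z : nm z^-1 = (nm z)^-1.
Proof. by apply: cr_inj; rewrite crV -!nmE normfV. Qed.
Lemma nmX z n : nm (z ^+ n) = nm z ^+ n.
Proof. by elim: n => [|n IH]; rewrite ?nm1 // !exprS nmM IH. Qed.
Lemma nm_ge0 z : 0 <= nm z.
Proof. by rewrite -cr_le -nmE cr0 normr_ge0. Qed.
Lemma nmD z w : nm (z + w) <= nm z + nm w.
Proof. by rewrite -cr_le crD -!nmE ler_normD. Qed.
Lemma nm_sub z w : nm (z - w) <= nm z + nm w.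
Proof. by rewrite -(nmN w) nmD. Qed.
Lemma nm_sub_ge z w : nm z - nm w <= nm (z - w).
Proof. by have := nmD (z - w) w; rewrite subrK; lra. Qed.
Lemma nm_tri z w u : nm (z - u) <= nm (z - w) + nm (w - u).
Proof. by have := nmD (z - w) (w - u); rewrite addrA subrK. Qed.
Lemma nm_eq0 z : (nm z == 0) = (z == 0).
Proof. by rewrite -(inj_eq cr_inj) -nmE cr0 normr_eq0. Qed.
Lemma nm_gt0 z : (0 < nm z) = (z != 0).
Proof. by rewrite lt_def nm_ge0 andbT nm_eq0. Qed.
Lemma nm_cr x : nm (cr x) = `|x|.
Proof.
apply: cr_inj; rewrite -nmE; have [h|h] := ger0P x.
  by rewrite ger0_norm // -cr0 cr_le.
by rewrite ltr0_norm ?crN // -cr0 cr_lt.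
Qed.
Lemma nm_ci : nm ci = 1.
Proof.
have h : nm ci * nm ci = 1 by rewrite -nmM ci2 nmN nm1.
by have := nm_ge0 ci; nra.
Qed.
Lemma nmn n : nm n%:R = n%:R. Proof. by rewrite -crn nm_cr normr_nat. Qed.
Lemma rp_le z : `|rp z| <= nm z.
Proof. by rewrite -cr_le -nmE; exact: (normc_ge_Re (z : R[i])). Qed.
Lemma ip_le z : `|ip z| <= nm z.
Proof.
have -> : ip z = - rp (ci * z) by rewrite rpM rp_ci ip_ci; ring.
by rewrite normrN (le_trans (rp_le _)) // nmM nm_ci mul1r.
Qed.
Lemma nm_le z : nm z <= `|rp z| + `|ip z|.
Proof.
by rewrite {1}[z]cE (le_trans (nmD _ _)) // nmM nm_ci mul1r !nm_cr.
Qed.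
Lemma nm_sum (I : Type) (s : seq I) (P : pred I) (F : I -> C) :
  nm (\sum_(i <- s | P i) F i) <= \sum_(i <- s | P i) nm (F i).
Proof.
elim/big_rec2: _ => [|i y z _ h]; first by rewrite nm0.
by rewrite (le_trans (nmD _ _)) // lerD2l.
Qed.
Lemma nm_sum_le n (F : nat -> C) (K : R) :
  (forall i, (i < n)%N -> nm (F i) <= K) ->
  nm (\sum_(i < n) F i) <= n%:R * K.
Proof.
move=> h; rewrite (le_trans (nm_sum _ _ _)) //.
apply: (@le_trans _ _ (\sum_(i < n) K)); first by apply: ler_sum => i _; exact: h.
by rewrite sumr_const card_ord mulr_natl.
Qed.

(** The restriction to e <= 1 lets quadratic error terms be absorbed into linear ones. *)
Lemma le_eps x y K : (forall e, 0 < e -> e <= 1 -> x <= y + e * K) -> x <= y.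
Proof.
move=> h; apply/ler_addgt0Pr => e e0.
have K0 : 0 < `|K| + 1 by have := normr_ge0 K; lra.
have d0 : 0 < Num.min 1 (e / (`|K| + 1)) by rewrite lt_min ltr01 divr_gt0.
have /(_ _)/le_trans -> // := h _ d0; first by rewrite ge_min lexx.
rewrite lerD2l; have h1 : Num.min 1 (e / (`|K| + 1)) <= e / (`|K| + 1).
  by rewrite ge_min lexx orbT.
have h2 : e / (`|K| + 1) * (`|K| + 1) = e by rewrite divfK // gt_eqF.
have := ler_norm K; set m := Num.min _ _ in d0 h1 *.
have := ler_wpM2r (ltW K0) h1; rewrite h2; nra.
Qed.

(** By Bernoulli's inequality (A / M)^n would outgrow B / c if A exceeded M. This is how constants
    are removed from estimates valid for all powers of a function. *)
Lemma pow_root (A M c B : R) : 0 <= A -> 0 <= M -> 0 < c ->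
  (forall n, A ^+ n * c <= M ^+ n * B) -> A <= M.
Proof.
move=> A0 M0 c0 h; rewrite leNgt; apply/negP => MA.
have {M0} [M0|M0] : M = 0 \/ 0 < M by move: M0; rewrite le_eqVlt => /orP[/eqP|]; auto.
  have := h 1%N; rewrite M0 !expr1 mul0r; nra.
pose q := A / M - 1.
have q0 : 0 < q by rewrite subr_gt0 ltr_pdivlMr // mul1r.
have bern n : 1 + n%:R * q <= (A / M) ^+ n.
  elim: n => [|n IH]; first by rewrite mul0r addr0.
  rewrite exprS; have -> : A / M = 1 + q by rewrite /q; ring.
  have n0 : 0 <= (n%:R : R) by exact: ler0n.
  have q1 : 0 <= 1 + q by lra.
  have := ler_wpM2l q1 IH; rewrite -natr1 (_ : A / M = 1 + q); last by rewrite /q; ring.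
  nra.
have bnd n : (1 + n%:R * q) * c <= B.
  have := h n; rewrite -ler_pdivrMl ?exprn_gt0 // => /(le_trans _) -> //.
  rewrite mulrA [_^-1 * _]mulrC -expr_div_n.
  by rewrite ler_wpM2r // ltW.
have [n hn] : exists n, B / (q * c) < n%:R.
  exists (Num.trunc `|B / (q * c)|).+1.
  by rewrite (le_lt_trans (ler_norm _)) // truncnS_gt.
have := bnd n; move: hn; rewrite ltr_pdivrMr ?mulr_gt0 // => hn; nra.
Qed.

End Modulus.

(** * Goursat's bisection with discrete contour sums *)

Section Goursat.
Variable R : realType.
Local Notation C := (Cplx R).
Local Notation ci := (ci R).

Definition cdiff (f : C -> C) (z : C) := exists l : C, forall e : R, 0 < e ->
  exists2 d : R, 0 < d & forall w, nm (w - z) < d ->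
    nm (f w - f z - l * (w - z)) <= e * nm (w - z).

(** The Riemann sum, up to the mesh, of the integral of [P] counterclockwise around the square with
    lower left corner (x, y) and side N, each step being evaluated at its left or lower end. *)
Definition gridsum (P : nat -> nat -> C) (x y N : nat) : C :=
  \sum_(k < N) (P (x + k)%N y - P (x + k)%N (y + N)%N +
                ci * (P (x + N)%N (y + k)%N - P x (y + k)%N)).

(** The contributions of the inner sides cancel term by term: the subdivision is exact, with no
    passage to the limit. *)
Lemma gridsum_quarters P x y N :
  gridsum P x y (N + N) =
  gridsum P x y N + gridsum P (x + N) y N + gridsum P x (y + N) N +
  gridsum P (x + N) (y + N) N.
Proof.
rewrite /gridsum big_split_ord /= -!big_split /=; apply: eq_bigr => k _.
by rewrite !addnA; ring.
Qed.

(** For each k the horizontal sides contribute - i B N D and the vertical ones i B N D, so the sum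
    vanishes exactly on affine functions. *)
Lemma gridsum_affine (A B D : C) x y N :
  gridsum (fun i j => A + B * (i%:R * D) + B * (ci * (j%:R * D))) x y N = 0.
Proof.
rewrite /gridsum big1 // => k _; rewrite !natrD.
by rewrite /=; ring.
Qed.

Definition gp (f : C -> C) (a : C) (d : R) (i j : nat) : C :=
  f (a + cr d * (i%:R + ci * j%:R)).

Definition contour n (f : C -> C) (a : C) (L : R) : C :=
  cr (L / 2 ^+ n) * gridsum (gp f a (L / 2 ^+ n)) 0 0 (2 ^ n).

Lemma gridsum_shift f a d x y N :
  gridsum (gp f a d) x y N = gridsum (gp f (a + cr d * (x%:R + ci * y%:R)) d) 0 0 N.
Proof.
apply: eq_bigr => k _; rewrite /gp !add0n !natrD.
by congr (f _ - f _ + _ * (f _ - f _)); ring.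
Qed.

(** A quarter at level n has the same mesh as the whole square at level n + 1. *)
Lemma contour_quarters n f a L :
  contour n.+1 f a L = contour n f a (L / 2) +
    contour n f (a + cr (L / 2)) (L / 2) +
    contour n f (a + ci * cr (L / 2)) (L / 2) +
    contour n f (a + cr (L / 2) + ci * cr (L / 2)) (L / 2).
Proof.
have e : L / 2 ^+ n.+1 = L / 2 / 2 ^+ n by rewrite exprS invfM mulrA.
rewrite /contour e expnS mul2n -addnn gridsum_quarters !add0n.
set d := L / 2 / 2 ^+ n.
have h : cr d * (2 ^ n)%:R = cr (L / 2).
  by rewrite -crn -crM natrX /d divfK // expf_neq0 // pnatr_eq0.
rewrite !(gridsum_shift _ _ _ (2 ^ n)) (gridsum_shift _ _ _ 0 (2 ^ n)) -!mulrDr.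
congr (_ * (_ + gridsum (gp f _ d) _ _ _ + gridsum (gp f _ d) _ _ _ +
   gridsum (gp f _ d) _ _ _)); rewrite -h; ring.
Qed.

Definition in_sq (a : C) (L : R) (w : C) : Prop :=
  (0 <= rp (w - a) <= L) /\ (0 <= ip (w - a) <= L).

Lemma in_sq_nm a L z w : in_sq a L z -> in_sq a L w -> nm (w - z) <= 2 * L.
Proof.
rewrite /in_sq !rpD !ipD !rpN !ipN => -[/andP[h1 h2] /andP[h3 h4]].
move=> [/andP[h5 h6] /andP[h7 h8]].
rewrite (le_trans (nm_le _)) // rpD ipD rpN ipN mulr2n mulrDl mul1r.
by apply: lerD; rewrite ler_norml; apply/andP; split; lra.
Qed.

Definition on_grid (a : C) (L : R) (w : C) : Prop :=
  exists n i j, [/\ (i <= 2 ^ n)%N, (j <= 2 ^ n)%N,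
    w = a + cr (L / 2 ^+ n) * (i%:R + ci * j%:R) &
    [\/ i = 0, i = 2 ^ n, j = 0 | j = 2 ^ n]%N].

Lemma on_grid_sq a L w : 0 <= L -> on_grid a L w -> in_sq a L w.
Proof.
move=> L0 [n [i [j [hi hj -> _]]]].
rewrite /in_sq addrC addKr rpM ipM rp_cr ip_cr !(rpD, ipD, rpM, ipM) rp_ci ip_ci.
rewrite -!crn !rp_cr !ip_cr !mul0r !mul1r !subr0 !add0r !addr0.
have p : (0 : R) < 2 ^+ n by rewrite exprn_gt0.
have k m : (m <= 2 ^ n)%N -> 0 <= L / 2 ^+ n * m%:R <= L.
  move=> hm; rewrite mulr_ge0 ?divr_ge0 ?ler0n ?(ltW p) //=.
  have hm' : (m%:R : R) <= 2 ^+ n by rewrite -natrX ler_nat.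
  have -> : L / 2 ^+ n * m%:R = L * m%:R / 2 ^+ n by ring.
  by rewrite ler_pdivrMr // ler_wpM2l.
by split; apply: k.
Qed.

Lemma contour_bound n f a L (K : R) : 0 <= L ->
  (forall w, on_grid a L w -> nm (f w) <= K) -> nm (contour n f a L) <= 4 * L * K.
Proof.
move=> L0 h; have p : (0 : R) < 2 ^+ n by rewrite exprn_gt0.
rewrite /contour nmM nm_cr ger0_norm ?divr_ge0 // ?(ltW p) //.
have : nm (gridsum (gp f a (L / 2 ^+ n)) 0 0 (2 ^ n)) <= (2 ^ n)%:R * (4 * K).
  set P := gp f a _.
  apply: (@nm_sum_le _ _ (fun k => P (0 + k)%N 0%N - P (0 + k)%N (0 + 2 ^ n)%N +
    ci * (P (0 + 2 ^ n)%N (0 + k)%N - P 0%N (0 + k)%N))) => k kn; rewrite /P /gp !add0n.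
  have H i j : (i <= 2 ^ n)%N -> (j <= 2 ^ n)%N ->
     [\/ i = 0, i = 2 ^ n, j = 0 | j = 2 ^ n]%N ->
     nm (f (a + cr (L / 2 ^+ n) * (i%:R + ci * j%:R))) <= K.
    by move=> hi hj hij; apply: h; exists n, i, j.
  have l1 := ltnW kn.
  have h1 := H k 0%N l1 (leq0n _) (Or43 _ _ _ erefl).
  have h2 := H k (2 ^ n)%N l1 (leqnn _) (Or44 _ _ _ erefl).
  have h3 := H (2 ^ n)%N k (leqnn _) l1 (Or42 _ _ _ erefl).
  have h4 := H 0%N k (leq0n _) l1 (Or41 _ _ _ erefl).
  move: h1 h2 h3 h4; set u1 := f _; set u2 := f _; set u3 := f _; set u4 := f _.
  move=> h1 h2 h3 h4.
  have := nmD (u1 - u2) (ci * (u3 - u4)); rewrite nmM nm_ci mul1r.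
  by have := nm_sub u1 u2; have := nm_sub u3 u4; lra.
rewrite natrX => hb.
rewrite -(ler_pM2l (divr_gt0 ltr01 p)) in hb; move: hb.
have -> : 1 / 2 ^+ n * (2 ^+ n * (4 * K)) = 4 * K by field; rewrite gt_eqF.
move=> hb; have -> : 4 * L * K = L * (4 * K) by ring.
by rewrite -mulrA ler_wpM2l // (le_trans _ hb) // div1r.
Qed.

Lemma contour_affine n (A B a : C) L : contour n (fun w => A + B * w) a L = 0.
Proof.
rewrite /contour -[RHS](mulr0 (cr (L / 2 ^+ n))); congr (_ * _).
rewrite -[RHS](gridsum_affine (A + B * a) B (cr (L / 2 ^+ n)) 0 0 (2 ^ n)).
by apply: eq_bigr => k _; rewrite /gp; ring.
Qed.

Lemma contour_lin n (u : C) f g a L :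
  contour n (fun w => f w + u * g w) a L = contour n f a L + u * contour n g a L.
Proof.
rewrite /contour /gridsum (mulrCA u) -mulrDr; congr (_ * _).
rewrite [u * _]mulr_sumr -big_split /=.
by apply: eq_bigr => k _; rewrite /gp; ring.
Qed.

Lemma eq_contour n f g a L : (forall w, on_grid a L w -> f w = g w) ->
  contour n f a L = contour n g a L.
Proof.
move=> h; rewrite /contour; congr (_ * _); apply: eq_bigr => k _; rewrite /gp !add0n.
have l1 := ltnW (ltn_ord k).
congr (_ - _ + _ * (_ - _)); apply: h.
- by exists n, k, 0%N; split=> //; apply: Or43.
- by exists n, k, (2 ^ n)%N; split=> //; apply: Or44.
- by exists n, (2 ^ n)%N, k; split=> //; apply: Or42.
- by exists n, 0%N, k; split=> //; apply: Or41.
Qed.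

(** Only large levels are constrained, because each bisection shifts the level by one. The failure
    of this bound is what passes to a quarter. *)
Definition small_contour (f : C -> C) (e : R) (a : C) (L : R) : Prop :=
  exists n0, forall n, (n0 <= n)%N -> nm (contour n f a L) <= e * L ^+ 2.

Lemma small_quarters f e a L :
  small_contour f e a (L / 2) ->
  small_contour f e (a + cr (L / 2)) (L / 2) ->
  small_contour f e (a + ci * cr (L / 2)) (L / 2) ->
  small_contour f e (a + cr (L / 2) + ci * cr (L / 2)) (L / 2) ->
  small_contour f e a L.
Proof.
move=> [n1 h1] [n2 h2] [n3 h3] [n4 h4].
exists (maxn (maxn n1 n2) (maxn n3 n4)).+1 => -[//|n]; rewrite ltnS !geq_max.
move=> /andP[/andP[/h1 k1 /h2 k2] /andP[/h3 k3 /h4 k4]].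
rewrite contour_quarters.
have -> : e * L ^+ 2 = e * (L / 2) ^+ 2 + e * (L / 2) ^+ 2 + e * (L / 2) ^+ 2 + e * (L / 2) ^+ 2.
  by field.
do 3 (rewrite (le_trans (nmD _ _)) // lerD //).
Qed.

Lemma small_local f e a L z : 0 < e -> cdiff f z -> in_sq a L z ->
  exists2 d : R, 0 < d & forall a' L', 0 <= L' -> L' < d -> in_sq a' L' z ->
    small_contour f e a' L'.
Proof.
(* The affine part has zero contour sum. The rest is at most e / 8 times the diameter bound 2 L',
   and the perimeter factor 4 L' turns this into e L'^2. *)
move=> e0 [l hl] _; have [|d d0 hd] := hl (e / 8); first by rewrite divr_gt0.
exists (d / 2); first by rewrite divr_gt0.
move=> a' L' L0 Ld hz; exists 0%N => n _.
pose err w := f w - f z - l * (w - z).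
rewrite (@eq_contour _ _ (fun w => err w + 1 * ((f z - l * z) + l * w))); last first.
  by move=> w _; rewrite /err; ring.
rewrite contour_lin contour_affine mulr0 addr0.
have -> : e * L' ^+ 2 = 4 * L' * (e / 8 * (2 * L')) by field.
apply: contour_bound => // w /(on_grid_sq L0) hw.
have h := in_sq_nm hz hw.
rewrite (le_trans (hd _ _)) //; first by lra.
by rewrite ler_wpM2l // divr_ge0 // ltW.
Qed.

Lemma goursat f a L e : 0 < L -> 0 < e ->
  (forall w, in_sq a L w -> cdiff f w) -> small_contour f e a L.
Proof.
move=> L0 e0 hf; case: (pselect (small_contour f e a L)) => // nb; exfalso.
(* A quarter on which the bound still fails, with the displacement (u, v) of its corner. *)
have step b M : { b' : C | ~ small_contour f e b M -> ~ small_contour f e b' (M / 2) /\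
    (exists u v : R, [/\ b' = b + cr u + ci * cr v, 0 <= M -> 0 <= u <= M / 2 & 0 <= M -> 0 <= v <= M / 2])}.
  apply: cid; case: (pselect (small_contour f e b M)) => [h|h]; first by exists b.
  have M2 : 0 <= M -> 0 <= M / 2 <= M / 2 by move=> M0; rewrite lexx andbT divr_ge0.
  have M3 : 0 <= M -> 0 <= (0 : R) <= M / 2 by move=> M0; rewrite lexx divr_ge0.
  apply: contrapT => /forallNP hn; apply: h.
  apply: small_quarters; apply: contrapT => hb.
  - by apply: (hn b) => _; split=> //; exists 0, 0; rewrite cr0 mulr0 !addr0.
  - by apply: (hn _) => _; split; [exact: hb|]; exists (M / 2), 0; rewrite cr0 mulr0 !addr0.
  - by apply: (hn _) => _; split; [exact: hb|]; exists 0, (M / 2); rewrite cr0 !addr0.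
  - by apply: (hn _) => _; split; [exact: hb|]; exists (M / 2), (M / 2).
pose Ls n : R := L / 2 ^+ n.
pose s := fix s n := if n is n'.+1 then sval (step (s n') (Ls n')) else a.
have LsS n : Ls n.+1 = Ls n / 2 by rewrite /Ls exprS invfM mulrCA mulrC.
have Ls0 n : 0 < Ls n by rewrite divr_gt0 // exprn_gt0.
have bad n : ~ small_contour f e (s n) (Ls n).
  elim: n => [|n IH] /=; first by rewrite /Ls expr0 divr1.
  by have := svalP (step (s n) (Ls n)) IH; rewrite LsS => -[].
have mv n : exists u v : R, [/\ s n.+1 = s n + cr u + ci * cr v, 0 <= u <= Ls n.+1 & 0 <= v <= Ls n.+1].
  have [_ [u [v [h1 h2 h3]]]] := svalP (step (s n) (Ls n)) (bad n).
  by exists u, v; split; rewrite ?LsS; [exact: h1|apply: h2; exact: ltW|apply: h3; exact: ltW].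
(* Each coordinate of the corners increases while coordinate plus side decreases, so its supremum
   lies in all the nested squares. *)
have mono (p : C -> R) (x := fun n => p (s n)) :
    (forall n, 0 <= x n.+1 - x n <= Ls n.+1) -> exists t, forall n, 0 <= t - x n <= Ls n.
  move=> hx.
  have inc m n : x m <= x (m + n)%N.
    elim: n => [|n IH]; rewrite ?addn0 // addnS (le_trans IH) //.
    by have /andP[] := hx (m + n)%N; lra.
  have dec m n : x (m + n)%N + Ls (m + n)%N <= x m + Ls m.
    elim: n => [|n IH]; rewrite ?addn0 // addnS (le_trans _ IH) //.
    by have /andP[_] := hx (m + n)%N; have := LsS (m + n)%N; lra.
  have ub m n : x m <= x n + Ls n.
    have [mn|/ltnW mn] := leqP m n.
      have := inc m (n - m)%N; rewrite subnKC // => /le_trans; apply.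
      by have := Ls0 n; lra.
    have := dec n (m - n)%N; rewrite subnKC //; apply: le_trans.
    by have := Ls0 m; lra.
  have hs : has_sup (range x).
    split; first by exists (x 0%N); exists 0%N.
    by exists (x 0%N + Ls 0%N) => _ [m _ <-].
  exists (sup (range x)) => n; rewrite subr_ge0 lerBlDl; apply/andP; split.
    by apply: sup_upper_bound => //; exists n.
  by apply: sup_le_ub => [|_ [m _ <-]]; [exact: hs.1|exact: ub].
have [|X hX] := mono (@rp R).
  move=> n; have [u [v [es hu hv]]] := mv n.
  change (0 <= rp (s n.+1) - rp (s n) <= Ls n.+1); rewrite es.
  by rewrite !rpD rpM rp_cr rp_ci ip_ci ip_cr; rewrite mul0r mulr0 subr0 addr0 addrC addKr.
have [|Y hY] := mono (@ip R).
  move=> n; have [u [v [es hu hv]]] := mv n.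
  change (0 <= ip (s n.+1) - ip (s n) <= Ls n.+1); rewrite es.
  by rewrite !ipD ipM ip_cr rp_ci ip_ci rp_cr mul0r mul1r add0r addr0 addrC addKr.
pose z : C := cr X + ci * cr Y.
have zin n : in_sq (s n) (Ls n) z.
  rewrite /in_sq !rpD !ipD rpN ipN rpM ipM !rp_cr !ip_cr rp_ci ip_ci.
  by rewrite !mul0r !mul1r !add0r !subr0; split; [exact: hX|exact: hY].
have zf : cdiff f z by apply: hf; have := zin 0%N; rewrite /Ls expr0 divr1.
have [d d0 hd] := small_local e0 zf (zin 0%N).
have [n hn] : exists n, Ls n < d.
  exists (Num.trunc (L / d)).+1; rewrite /Ls ltr_pdivrMr ?exprn_gt0 // mulrC -ltr_pdivrMr //.
  apply: (lt_le_trans (truncnS_gt _)); rewrite -natrX ler_nat.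
  exact: ltnW (ltn_expl _ _).
by apply: (bad n); apply: (hd _ _ (ltW (Ls0 n)) hn (zin n)).
Qed.

End Goursat.

Local Open Scope classical_set_scope.
Local Open Scope ring_scope.

(** * Rules for complex differentiation *)

Section Cdiff.
Variable R : realType.
Local Notation C := (Cplx R).
Local Notation ci := (ci R).

Lemma cpos (e : C) : 0 < e -> exists2 r : R, 0 < r & e = cr r.
Proof.
move=> e0; exists (nm e); first by rewrite nm_gt0 gt_eqF.
by rewrite -nmE gtr0_norm.
Qed.

Definition ccont (g : C -> C) (z : C) := forall e : R, 0 < e ->
  exists2 d : R, 0 < d & forall w, nm (w - z) < d -> nm (g w - g z) <= e.

Lemma ccontP (g : C -> C) (z : C) : {for z, continuous g} <-> ccont g z.
Proof.
split=> [h e e0|h].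
  have e0' : 0 < cr e by rewrite -cr0 cr_lt.
  have /cvgrPdist_lt/(_ _ e0') := h; rewrite -filter_from_ballE.
  case=> d /= /cpos[r r0 ->] hr; exists r => // w hw; apply: ltW.
  rewrite nmB in hw; have := hr w; rewrite /ball /= nmE cr_lt => /(_ hw).
  by rewrite nmE cr_lt (nmB (g z)).
apply/(@cvgrPdist_le _ C C (nbhs z) _ g (g z)) => e /cpos[r r0 ->]; have [d d0 hd] := h r r0.
rewrite -filter_from_ballE; exists (cr d); first by rewrite /= -cr0 cr_lt.
by move=> w; rewrite /ball /= !nmE cr_lt cr_le (nmB z) (nmB (g z)) => /hd.
Qed.

(** Carathéodory's form of differentiability: the rules of calculus reduce to algebra and to the
    continuity of the slope [q]. *)
Lemma cdiffP (f : C -> C) (z : C) : cdiff f z <->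
  exists2 q : C -> C, (forall w, f w = f z + q w * (w - z)) & ccont q z.
Proof.
split=> [[l hl]|[q hq cq]]; last first.
  exists (q z) => e e0; have [d d0 hd] := cq e e0; exists d => // w /hd h.
  have -> : f w - f z - q z * (w - z) = (q w - q z) * (w - z) by rewrite hq; ring.
  by rewrite nmM ler_wpM2r ?nm_ge0.
exists (fun w => if w == z then l else (f w - f z) / (w - z)).
  move=> w; case: eqP => [->|/eqP wz]; first by rewrite subrr mulr0 addr0.
  by rewrite divfK ?subr_eq0 // addrC subrK.
move=> e e0; have [d d0 hd] := hl e e0; exists d => // w hw.
rewrite eqxx; case: eqP => [_|/eqP wz]; first by rewrite subrr nm0 ltW.
have wz' : w - z != 0 by rewrite subr_eq0.
have -> : (f w - f z) / (w - z) - l = (f w - f z - l * (w - z)) / (w - z) by field.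
by rewrite nmM nmV ler_pdivrMr ?nm_gt0 // hd.
Qed.

Lemma ccont_cst (c z : C) : ccont (fun=> c) z.
Proof. by apply/ccontP; exact: cst_continuous. Qed.
Lemma ccont_id (z : C) : ccont id z.
Proof. by move=> e e0; exists e => // w /ltW. Qed.
Lemma ccontD (f g : C -> C) (z : C) : ccont f z -> ccont g z -> ccont (fun w => f w + g w) z.
Proof. by move=> /ccontP cf /ccontP cg; apply/ccontP; exact: (continuousD cf cg). Qed.
Lemma ccontM (f g : C -> C) (z : C) : ccont f z -> ccont g z -> ccont (fun w => f w * g w) z.
Proof. by move=> /ccontP cf /ccontP cg; apply/ccontP; exact: (continuousM cf cg). Qed.
Lemma ccontN (f : C -> C) (z : C) : ccont f z -> ccont (fun w => - f w) z.
Proof. by move=> /ccontP cf; apply/ccontP; exact: (continuousN cf). Qed.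
Lemma ccontB (f g : C -> C) (z : C) : ccont f z -> ccont g z -> ccont (fun w => f w - g w) z.
Proof. by move=> cf cg; exact: (ccontD cf (ccontN cg)). Qed.
Lemma ccontV (f : C -> C) (z : C) : f z != 0 -> ccont f z -> ccont (fun w => (f w)^-1) z.
Proof. by move=> f0 /ccontP cf; apply/ccontP; exact: (continuousV f0 cf). Qed.

Lemma cdiff_cont f z : cdiff f z -> ccont f z.
Proof.
move=> /cdiffP[q hq cq]; 
have -> : f = (fun w => f z + q w * (w - z)) by apply: funext => w; exact: hq.
apply: ccontD; first exact: ccont_cst.
by apply: (ccontM cq); apply: ccontB; [exact: ccont_id|exact: ccont_cst].
Qed.

Lemma ccont_eq (f g : C -> C) (z : C) (d : R) : 0 < d ->
  (forall w, nm (w - z) < d -> f w = g w) -> ccont f z -> ccont g z.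
Proof.
move=> d0 h cf e /cf[d' d'0 hd'].
exists (Num.min d d'); first by rewrite lt_min d0.
move=> w; rewrite lt_min => /andP[h1 h2]; rewrite -!h ?subrr ?nm0 //; exact: hd'.
Qed.

Lemma cdiff_eq (f g : C -> C) (z : C) (d : R) : 0 < d ->
  (forall w, nm (w - z) < d -> f w = g w) -> cdiff f z -> cdiff g z.
Proof.
move=> d0 h [l hl]; exists l => e /hl[d' d'0 hd'].
exists (Num.min d d'); first by rewrite lt_min d0.
move=> w; rewrite lt_min => /andP[h1 h2]; rewrite -!h ?subrr ?nm0 //; exact: hd'.
Qed.

Lemma cdiff_cst (c z : C) : cdiff (fun=> c) z.
Proof.
by apply/cdiffP; exists (fun=> 0); [move=> w; rewrite mul0r addr0|exact: ccont_cst].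
Qed.

Lemma cdiff_id (z : C) : cdiff id z.
Proof.
apply/cdiffP; exists (fun=> 1); last exact: ccont_cst.
by move=> w /=; rewrite mul1r addrC subrK.
Qed.

Lemma cdiffD (f g : C -> C) (z : C) : cdiff f z -> cdiff g z -> cdiff (fun w => f w + g w) z.
Proof.
move=> /cdiffP[p hp cp] /cdiffP[q hq cq]; apply/cdiffP.
exists (fun w => p w + q w); last exact: (ccontD cp cq).
by move=> w; rewrite hp hq; ring.
Qed.

Lemma cdiffM (f g : C -> C) (z : C) : cdiff f z -> cdiff g z -> cdiff (fun w => f w * g w) z.
Proof.
move=> df dg; have cf := cdiff_cont df.
move: df dg => /cdiffP[p hp cp] /cdiffP[q hq cq]; apply/cdiffP.
exists (fun w => p w * g z + f w * q w); first by move=> w; rewrite hp hq; ring.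
by apply: ccontD; [apply: (ccontM cp); exact: ccont_cst|exact: (ccontM cf cq)].
Qed.

Lemma cdiffN (f : C -> C) (z : C) : cdiff f z -> cdiff (fun w => - f w) z.
Proof.
move=> df; apply: (@cdiff_eq (fun w => -1 * f w) _ _ 1) => //.
  by move=> w _; rewrite mulN1r.
by apply: cdiffM => //; exact: cdiff_cst.
Qed.

Lemma cdiffB (f g : C -> C) (z : C) : cdiff f z -> cdiff g z -> cdiff (fun w => f w - g w) z.
Proof. by move=> df dg; apply: cdiffD => //; apply: cdiffN. Qed.

Lemma cdiffX (f : C -> C) n (z : C) : cdiff f z -> cdiff (fun w => f w ^+ n) z.
Proof.
move=> df; elim: n => [|n IH]; first exact: cdiff_cst.
apply: (@cdiff_eq (fun w => f w * f w ^+ n) _ _ 1) => // [w _|]; first by rewrite exprS.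
exact: cdiffM.
Qed.

Lemma cdiffV (f : C -> C) (z : C) : f z != 0 -> cdiff f z -> cdiff (fun w => (f w)^-1) z.
Proof.
move=> fz df; have cf := cdiff_cont df.
move/cdiffP: (df) => [q hq cq].
have [|d d0 hd] := cf (nm (f z) / 2); first by rewrite divr_gt0 // nm_gt0.
have nz w : nm (w - z) < d -> f w != 0.
  move=> /hd h; rewrite -nm_gt0; have := nm_sub_ge (f z) (f w); rewrite (nmB (f z)).
  have : 0 < nm (f z) by rewrite nm_gt0.
  by lra.
apply: (@cdiff_eq (fun w => (f z)^-1 + (- q w * (f z)^-1 * (f w)^-1) * (w - z)) _ _ d) => //.
  by move=> w /nz h; have := hq w => e; field: e; rewrite h fz.
apply/cdiffP; exists (fun w => - q w * (f z)^-1 * (f w)^-1).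
  by move=> w; rewrite subrr mulr0 addr0.
apply: ccontM; last exact: (ccontV fz (cdiff_cont df)).
by apply: (ccontM (ccontN cq)); exact: ccont_cst.
Qed.

Lemma cdiff_prod (s : seq C) z : cdiff (fun w => \prod_(a <- s) (w - a)) z.
Proof.
elim: s => [|a s IH].
  by apply: (@cdiff_eq (fun=> 1) _ _ 1) => // [w _|]; rewrite ?big_nil //; exact: cdiff_cst.
apply: (@cdiff_eq (fun w => (w - a) * \prod_(a <- s) (w - a)) _ _ 1) => //.
  by move=> w _; rewrite big_cons.
by apply: cdiffM => //; apply: cdiffB; [exact: cdiff_id|exact: cdiff_cst].
Qed.

End Cdiff.

(** * Maximum principle *)

Section MaxMod.
Variable R : realType.
Local Notation C := (Cplx R).
Local Notation ci := (ci R).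

Lemma on_grid_annulus z0 (r : R) w : 0 < r ->
  on_grid (z0 - cr r - ci * cr r) (2 * r) w -> r <= nm (w - z0) <= 2 * r.
Proof.
move=> r0 hg; have [] := on_grid_sq (ltW (mulr_gt0 (ltr0n _ 2) r0)) hg.
set a := z0 - _ - _ => h1 h2.
have ra : rp (w - z0) = rp (w - a) - r.
  rewrite /a !(rpD, rpN, rpM, ipD, ipN, ipM) !rp_cr !ip_cr rp_ci ip_ci; ring.
have ia : ip (w - z0) = ip (w - a) - r.
  rewrite /a !(rpD, rpN, rpM, ipD, ipN, ipM) !rp_cr !ip_cr rp_ci ip_ci; ring.
have side : [\/ rp (w - a) = 0, rp (w - a) = 2 * r, ip (w - a) = 0 | ip (w - a) = 2 * r].
  case: hg => n [i [j [hi hj -> hs]]]; rewrite addrC addKr.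
  rewrite rpM ipM rp_cr ip_cr !(rpD, ipD, rpM, ipM) rp_ci ip_ci.
  rewrite -!crn !rp_cr !ip_cr !mul0r !mul1r !subr0 !add0r !addr0.
  have e : 2 * r / 2 ^+ n * (2 ^ n)%:R = 2 * r by rewrite natrX divfK // expf_neq0 // pnatr_eq0.
  case: hs => ->; rewrite ?e ?mulr0.
  - exact: Or41. - exact: Or42. - exact: Or43. - exact: Or44.
apply/andP; split; last first.
  rewrite (le_trans (nm_le _)) // ra ia mulr2n mulrDl mul1r.
  by apply: lerD; rewrite ler_norml; apply/andP; split; lra.
case: side => e; [ | | | ].
- by apply: le_trans (rp_le _); rewrite ra e sub0r normrN ler_norm.
- by apply: le_trans (rp_le _); rewrite ra e (le_trans _ (ler_norm _)) //; lra.
- by apply: le_trans (ip_le _); rewrite ia e sub0r normrN ler_norm.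
- by apply: le_trans (ip_le _); rewrite ia e (le_trans _ (ler_norm _)) //; lra.
Qed.

Lemma in_sq_disc z0 (r : R) w : 0 < r ->
  in_sq (z0 - cr r - ci * cr r) (2 * r) w -> nm (w - z0) <= 2 * r.
Proof.
move=> r0; set a := z0 - _ - _ => -[h1 h2].
have ra : rp (w - z0) = rp (w - a) - r.
  rewrite /a !(rpD, rpN, rpM, ipD, ipN, ipM) !rp_cr !ip_cr rp_ci ip_ci; ring.
have ia : ip (w - z0) = ip (w - a) - r.
  rewrite /a !(rpD, rpN, rpM, ipD, ipN, ipM) !rp_cr !ip_cr rp_ci ip_ci; ring.
rewrite (le_trans (nm_le _)) // ra ia mulr2n mulrDl mul1r.
by apply: lerD; rewrite ler_norml; apply/andP; split; lra.
Qed.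

Lemma ip_inv (z : C) : ip z^-1 = - ip z / (rp z ^+ 2 + ip z ^+ 2).
Proof. by case: z => a b; rewrite mulNr. Qed.
Lemma rp_inv (z : C) : rp z^-1 = rp z / (rp z ^+ 2 + ip z ^+ 2).
Proof. by case: z => a b. Qed.

Lemma ip_sum n (F : 'I_n -> C) : ip (\sum_(k < n) F k) = \sum_(k < n) ip (F k).
Proof. by elim/big_rec2: _ => // k x y _ <-; rewrite ipD. Qed.

(** A lower bound replaces the exact value 2 pi i. In the imaginary part each of the four terms of a
    step is at least 1 / (2 r), because r / (x^2 + r^2) >= 1 / (2 r) for |x| <= r; summing over a
    side of length 2 r gives 4. *)
Lemma winding n z0 (r : R) : 0 < r ->
  4 <= nm (contour n (fun w => (w - z0)^-1) (z0 - cr r - ci * cr r) (2 * r)).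
Proof.
move=> r0; apply: le_trans (ip_le _); apply: le_trans (ler_norm _).
set d := 2 * r / 2 ^+ n; set N := (2 ^ n)%N.
have dN : d * N%:R = 2 * r by rewrite /d /N natrX divfK // expf_neq0 // pnatr_eq0.
have d0 : 0 < d by rewrite divr_gt0 ?exprn_gt0 // mulr_gt0.
rewrite /contour -/d -/N ipM rp_cr ip_cr mul0r addr0.
have : (N%:R : R) * (2 / r) <= ip (gridsum (gp (fun w => (w - z0)^-1) (z0 - cr r - ci * cr r) d) 0 0 N).
  rewrite /gridsum ip_sum mulr_natl.
  rewrite -{1}[N]card_ord -sumr_const; apply: ler_sum => k _.
  rewrite /gp !add0n ipD ipM rp_ci ip_ci mul0r mul1r add0r ipD ipN rpD rpN.
  rewrite !rp_inv !ip_inv !(rpD, rpN, rpM, ipD, ipN, ipM) -!crn !rp_cr !ip_cr rp_ci ip_ci.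
  have hk : 0 <= d * k%:R <= 2 * r.
    rewrite mulr_ge0 ?ler0n ?(ltW d0) //= -dN ler_wpM2l ?(ltW d0) //.
    by rewrite ler_nat ltnW.
  set t := d * k%:R - r.
  have ht : - r <= t <= r by rewrite /t; lra.
  have key x y : x = t -> y = r \/ y = - r -> 1 / (2 * r) <= r / (x ^+ 2 + y ^+ 2).
    move=> -> hy; have -> : y ^+ 2 = r ^+ 2 by case: hy => ->; rewrite ?sqrrN.
    have p : 0 < t ^+ 2 + r ^+ 2 by rewrite ltr_wpDl ?sqr_ge0 ?exprn_gt0.
    rewrite ler_pdivrMr ?mulr_gt0 // mulrAC ler_pdivlMr //; nra.
  rewrite ?mul0r ?mulr0 ?mul1r ?subr0 ?addr0 ?add0r.
  rewrite dN !mulr0 !addr0.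
  have e1 x : x - r - x = - r by ring.
  have e2 x : x - r + d * k%:R - x = t by rewrite /t; ring.
  have e3 x : x - r + 2 * r - x = r by ring.
  rewrite !e1 !e2 !e3 opprK mulNr opprK mulNr opprK.
  have k1 := key t (- r) erefl (or_intror erefl).
  have k2 := key t r erefl (or_introl erefl).
  rewrite (addrC (r ^+ 2)) (addrC ((- r) ^+ 2)).
  have -> : 2 / r = 4 * (1 / (2 * r)) by field; rewrite gt_eqF.
  by lra.
rewrite -(ler_pM2l d0); have -> : d * (N%:R * (2 / r)) = 4; last by [].
have -> : d * (N%:R * (2 / r)) = (d * N%:R) * (2 / r) by ring.
by rewrite dN; field; rewrite gt_eqF.
Qed.

(** Goursat is applied to (f - f z0)^2 / (w - z0). The square makes this function differentiable at
    z0 as well, where f - f z0 = q (w - z0) with q merely continuous. Expanding it and using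
    [winding] gives 4 A^2 <= 16 M A + 8 M^2 for A = |f z0|, which excludes A > 5 M. *)
Lemma weak_maxmod f z0 (r M : R) : 0 < r ->
  (forall w, nm (w - z0) <= 2 * r -> cdiff f w) ->
  (forall w, r <= nm (w - z0) <= 2 * r -> nm (f w) <= M) ->
  nm (f z0) <= 5 * M.
Proof.
move=> r0 df bf; set a := z0 - cr r - ci * cr r; set L := 2 * r.
have L0 : 0 < L by rewrite mulr_gt0.
have ann w : on_grid a L w -> r <= nm (w - z0) <= L by exact: on_grid_annulus.
pose h w := (f w - f z0) ^+ 2 * (w - z0)^-1.
have dh w : in_sq a L w -> cdiff h w.
  move=> /(in_sq_disc r0)/df dfw; have [->|wz] := eqVneq w z0.
    have /cdiffP[q hq cq] : cdiff f z0 by apply: df; rewrite subrr nm0 ltW.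
    apply/cdiffP; exists (fun w => q w * q w); last exact: ccontM.
    move=> x; rewrite /h hq; have [->|xz] := eqVneq x z0.
      by rewrite !subrr invr0 !mulr0 addr0.
    by rewrite [f z0 + _]addrC addrK subrr expr0n mul0r add0r; field; rewrite subr_eq0.
  apply: cdiffM; first by apply: cdiffX; apply: cdiffB => //; exact: cdiff_cst.
  apply: cdiffV; first by rewrite subr_eq0.
  by apply: cdiffB; [exact: cdiff_id|exact: cdiff_cst].
have M0 : 0 <= M.
  apply: le_trans (nm_ge0 _) (bf (z0 + cr r) _).
  by rewrite addrC addKr nm_cr gtr0_norm // lexx /=; lra.
set A := nm (f z0); have A0 : 0 <= A := nm_ge0 _.
have inv w : on_grid a L w -> nm (w - z0)^-1 <= r^-1.
  move=> /ann /andP[h1 _]; rewrite nmV lef_pV2 // posrE; exact: lt_le_trans h1.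
have main : 4 * A ^+ 2 <= 16 * M * A + 8 * M ^+ 2.
  apply: (@le_eps _ _ _ (L ^+ 2)) => e e0 _.
  have [n /(_ n (leqnn n)) hn] := goursat L0 e0 dh.
  pose g0 w : C := (w - z0)^-1; pose g1 w := f w * (w - z0)^-1.
  pose g2 w := f w ^+ 2 * (w - z0)^-1.
  have w0 := winding n z0 r0; rewrite -/a -/L -/g0 in w0.
  have eq : contour n h a L = contour n g2 a L + (- 2 * f z0) * contour n g1 a L
      + (f z0) ^+ 2 * contour n g0 a L.
    rewrite -!contour_lin; apply: eq_contour => w _.
    by rewrite /h /g0 /g1 /g2; ring.
  have b1 : nm (contour n g1 a L) <= 8 * M.
    have -> : 8 * M = 4 * L * (M * r^-1) by rewrite /L; field; rewrite gt_eqF.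
    apply: contour_bound (ltW L0) _ => w hw; rewrite nmM.
    by apply: ler_pM; rewrite ?nm_ge0 ?inv // bf // ann.
  have b2 : nm (contour n g2 a L) <= 8 * M ^+ 2.
    have -> : 8 * M ^+ 2 = 4 * L * (M ^+ 2 * r^-1) by rewrite /L; field; rewrite gt_eqF.
    apply: contour_bound (ltW L0) _ => w hw; rewrite nmM nmX.
    apply: ler_pM; rewrite ?inv ?exprn_ge0 ?nm_ge0 //.
    by apply: lerXn2r; rewrite ?nnegrE ?nm_ge0 ?M0 // bf // ann.
  have e1 : f z0 ^+ 2 * contour n g0 a L = contour n h a L +
    (- contour n g2 a L + 2 * f z0 * contour n g1 a L) by rewrite eq; ring.
  have h1 : nm (f z0 ^+ 2 * contour n g0 a L) <= e * L ^+ 2 + (8 * M ^+ 2 + 2 * A * (8 * M)).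
    rewrite e1 (le_trans (nmD _ _)) // lerD // (le_trans (nmD _ _)) // nmN lerD //.
    by rewrite nmM (nmM 2) nmn ler_wpM2l // mulr_ge0 // nm_ge0.
  rewrite nmM nmX -/A in h1.
  have : A ^+ 2 * 4 <= A ^+ 2 * nm (contour n g0 a L) by rewrite ler_wpM2l ?exprn_ge0.
  by lra.
by rewrite leNgt; apply/negP => hA; nra.
Qed.

(** The weak estimate for all powers f^n: the constant 5 disappears with the n-th root. *)
Lemma maxmod f z0 (r M : R) : 0 < r ->
  (forall w, nm (w - z0) <= 2 * r -> cdiff f w) ->
  (forall w, r <= nm (w - z0) <= 2 * r -> nm (f w) <= M) ->
  nm (f z0) <= M.
Proof.
move=> r0 df bf.
have M0 : 0 <= M.
  apply: le_trans (nm_ge0 _) (bf (z0 + cr r) _).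
  by rewrite addrC addKr nm_cr gtr0_norm // lexx /=; lra.
apply: (@pow_root _ _ _ 1 5) => //; first exact: nm_ge0.
move=> n; rewrite mulr1 -nmX mulrC.
apply: (@weak_maxmod (fun w => f w ^+ n) z0 r) => // w hw; first by apply: cdiffX; exact: df.
by rewrite nmX lerXn2r ?nnegrE ?nm_ge0 // bf.
Qed.

(** At the points of [s] the function is only continuous. The product P of the w - a, a in [s],
    makes f^n P differentiable there as well, and the n-th root removes P, which is nonzero at
    z0. *)
Lemma maxmod_except (s : seq C) f z0 (r M : R) : 0 < r -> z0 \notin s ->
  (forall w, nm (w - z0) <= 2 * r -> ccont f w) ->
  (forall w, nm (w - z0) <= 2 * r -> w \notin s -> cdiff f w) ->
  (forall w, r <= nm (w - z0) <= 2 * r -> nm (f w) <= M) ->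
  nm (f z0) <= M.
Proof.
move=> r0 zs cf df bf.
have M0 : 0 <= M.
  apply: le_trans (nm_ge0 _) (bf (z0 + cr r) _).
  by rewrite addrC addKr nm_cr gtr0_norm // lexx /=; lra.
pose P w := \prod_(a <- s) (w - a).
have Pz : P z0 != 0.
  by rewrite /P prodf_seq_neq0; apply/allP => a as_; rewrite subr_eq0; apply: contraNneq zs => ->.
have [B B0 hB] : exists2 B, 0 <= B & forall w, r <= nm (w - z0) <= 2 * r -> nm (P w) <= B.
  rewrite /P; elim: s {zs df P Pz} => [|a s [B B0 hB]].
    by exists 1 => // w _; rewrite big_nil nm1.
  exists ((2 * r + nm (z0 - a)) * B).
    by rewrite mulr_ge0 ?addr_ge0 ?nm_ge0 // mulr_ge0 // ltW.
  move=> w hw; rewrite big_cons nmM ler_pM ?nm_ge0 ?hB //.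
  by rewrite (le_trans (nm_tri _ z0 _)) // lerD2r; case/andP: hw.
apply: (@pow_root _ _ _ (nm (P z0)) B) => //; rewrite ?nm_ge0 ?nm_gt0 //.
move=> n; rewrite -nmX -nmM.
apply: (@maxmod (fun w => f w ^+ n * P w) z0 r) => // w hw; last first.
  by rewrite nmM nmX ler_pM ?exprn_ge0 ?nm_ge0 ?hB // lerXn2r ?nnegrE ?nm_ge0 // bf.
have [ws|ws] := boolP (w \in s); last first.
  by apply: cdiffM; [apply: cdiffX; exact: df|exact: cdiff_prod].
have Pw : P w = 0 by rewrite /P (big_rem w) //= subrr mul0r.
have /cdiffP[q hq cq] : cdiff P w by exact: cdiff_prod.
apply/cdiffP; exists (fun x => f x ^+ n * q x).
  by move=> x; rewrite Pw hq Pw; ring.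
apply: (fun h => ccontM h cq); have cfw := cf w hw.
elim: n => [|n IH]; first exact: ccont_cst.
apply: (@ccont_eq _ (fun x => f x * f x ^+ n) _ _ 1 ltr01); last exact: ccontM.
by move=> x _; rewrite exprS.
Qed.

End MaxMod.

(** * Divided differences, removable singularities and Taylor polynomials *)

Section Jets.
Variable R : realType.
Local Notation C := (Cplx R).
Local Notation ci := (ci R).

Lemma ccont_near (g : C -> C) (z : C) (e d : R) : ccont g z -> 0 < e -> 0 < d ->
  exists w, [/\ w != z, nm (w - z) < d & nm (g w - g z) <= e].
Proof.
move=> cg e0 d0; have [d' d'0 hd'] := cg e e0.
have m0 : 0 < Num.min d d' / 2 by rewrite divr_gt0 // lt_min d0.
set m := Num.min d d' / 2 in m0; have [h1 h2] : m < d /\ m < d'.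
  have p : 0 < Num.min d d' by rewrite lt_min d0.
  have : Num.min d d' <= d by rewrite ge_min lexx.
  have : Num.min d d' <= d' by rewrite ge_min lexx orbT.
  by rewrite /m; split; lra.
have e1 : nm (z + cr m - z) = m by rewrite addrC addKr nm_cr gtr0_norm.
exists (z + cr m); split; rewrite ?e1 //; last by apply: hd'; rewrite e1.
by rewrite -subr_eq0 -nm_eq0 e1 gt_eqF.
Qed.

Lemma ccont_bound (g : C -> C) (z : C) (d B : R) : ccont g z -> 0 < d ->
  (forall w, w != z -> nm (w - z) < d -> nm (g w) <= B) -> nm (g z) <= B.
Proof.
move=> cg d0 h; apply: (@le_eps _ _ _ 1) => e e0 _.
have [w [wz wd we]] := ccont_near cg e0 d0; have := h w wz wd.
by have := nm_sub_ge (g z) (g w); rewrite (nmB (g z)); lra.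
Qed.

(** The difference quotient completed by the derivative. At b itself only continuity is available,
    which is why b joins the exceptional points in what follows. *)
Lemma slope (f : C -> C) (b : C) : cdiff f b -> exists q : C -> C,
  [/\ forall w, f w = f b + q w * (w - b), ccont q b,
      forall w, w != b -> ccont f w -> ccont q w,
      forall w, w != b -> cdiff f w -> cdiff q w &
      forall w, w != b -> q w = (f w - f b) / (w - b)].
Proof.
move=> /cdiffP[q hq cq]; exists q.
have E w : w != b -> q w = (f w - f b) / (w - b).
  by move=> wb; rewrite hq addrC addKr mulfK // subr_eq0.
have near w x : w != b -> nm (x - w) < nm (w - b) -> x != b.
  by move=> wb; apply: contraTneq => ->; rewrite nmB ltxx.
split; [exact: hq|exact: cq| | |exact: E] => w wb hw;
  have d0 : 0 < nm (w - b) by rewrite nm_gt0 subr_eq0.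
  apply: (@ccont_eq _ (fun x => (f x - f b) * (x - b)^-1) _ _ _ d0).
    by move=> x /(near _ _ wb) xb; rewrite E.
  apply: ccontM; first by apply: ccontB => //; exact: ccont_cst.
  apply: ccontV; first by rewrite subr_eq0.
  by apply: ccontB; [exact: ccont_id|exact: ccont_cst].
apply: (@cdiff_eq _ (fun x => (f x - f b) * (x - b)^-1) _ _ _ d0).
  by move=> x /(near _ _ wb) xb; rewrite E.
apply: cdiffM; first by apply: cdiffB => //; exact: cdiff_cst.
apply: cdiffV; first by rewrite subr_eq0.
by apply: cdiffB; [exact: cdiff_id|exact: cdiff_cst].
Qed.

Section DividedDifferences.
Variables (s : seq C) (f : C -> C) (r M : R).
Hypotheses (r0 : 0 < r) (cf : forall w, nm w < r -> ccont f w)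
  (df : forall w, nm w < r -> w \notin s -> cdiff f w)
  (bf : forall w, nm w < r -> nm (f w) <= M).

(** The radii are used throughout: for z and a within r / 16 of 0, the annulus of radii r / 4 and r
    / 2 around z stays in the disc of radius r and keeps distance r / 8 from a. *)
Lemma annulus_dist (z a w : C) : nm z < r / 16 -> nm a < r / 16 ->
  r / 4 <= nm (w - z) <= 2 * (r / 4) -> nm w < r /\ r / 8 <= nm (w - a).
Proof.
move=> hz ha /andP[h1 h2]; split.
  by have := nmD (w - z) z; rewrite subrK; lra.
by have := nm_tri w a z; have := nm_sub a z; lra.
Qed.

Lemma disc_in (z w : C) : nm z < r / 16 -> nm (w - z) <= 2 * (r / 4) -> nm w < r.
Proof. by have := r0; move=> r0' hz h; have := nmD (w - z) z; rewrite subrK; lra. Qed.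

Lemma small_in (z : C) : nm z < r / 16 -> nm z < r. Proof. by have := nm_ge0 z; lra. Qed.

Lemma slope_bound (z a w : C) (h : C -> C) (B : R) : nm z < r / 16 -> nm a < r / 16 ->
  (forall w, r / 4 <= nm (w - z) <= 2 * (r / 4) -> nm (h w) <= B) -> nm (h a) <= B ->
  r / 4 <= nm (w - z) <= 2 * (r / 4) -> nm ((h w - h a) / (w - a)) <= 16 * B / r.
Proof.
have r0' := r0; move=> hz ha hB hBa hw; have [_ h8] := annulus_dist hz ha hw.
have p : 0 < nm (w - a) by lra.
rewrite nmM nmV ler_pdivrMr //; apply: (le_trans (nm_sub _ _)).
apply: (@le_trans _ _ (B + B)); first by apply: lerD; [exact: hB|].
have B0 : 0 <= B := le_trans (nm_ge0 _) hBa.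
have -> : 16 * B / r * nm (w - a) = 16 * B * nm (w - a) / r by ring.
by rewrite ler_pdivlMr //; have := ler_wpM2l B0 h8; lra.
Qed.

(** The maximum principle for the slope at a, with a exceptional. On the annulus the numerator is at
    most 2 M and the denominator at least r / 8, whence 16 M / r. *)
Lemma dd1 z a : nm z < r / 16 -> nm a < r / 16 -> z \notin s -> a \notin s ->
  z != a -> nm ((f z - f a) / (z - a)) <= 16 * M / r.
Proof.
move=> hz ha zs as_ za; have hza := df (small_in ha) as_.
have [q [hq cq cq' dq Eq]] := slope hza; rewrite -Eq //.
have r4 : 0 < r / 4 by rewrite divr_gt0.
apply: (@maxmod_except _ (a :: s) q z (r / 4) _ r4).
- by rewrite in_cons negb_or za.
- move=> w /(disc_in hz) hw; have [->|wa] := eqVneq w a; first exact: cq.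
  by apply: cq' => //; exact: cf.
- move=> w /(disc_in hz) hw; rewrite in_cons negb_or => /andP[wa ws].
  by apply: dq => //; exact: df.
move=> w hw; have [hr h8] := annulus_dist hz ha hw.
rewrite Eq; last by rewrite -subr_eq0 -nm_gt0 (lt_le_trans _ h8) // divr_gt0.
apply: slope_bound hw => //; last by apply: bf; exact: small_in.
by move=> x hx; apply: bf; have [] := annulus_dist hz ha hx.
Qed.

Lemma dd2 z a b : nm z < r / 16 -> nm a < r / 16 -> nm b < r / 16 ->
  z \notin s -> a \notin s -> b \notin s -> z != a -> z != b -> b != a ->
  nm (((f z - f a) / (z - a) - (f b - f a) / (b - a)) / (z - b)) <=
  16 * (16 * M / r) / r.
Proof.
move=> hz ha hb zs as_ bs za zb ba.
have [q [hq cq cq' dq Eq]] := slope (df (small_in ha) as_).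
have dqb : cdiff q b by apply: dq => //; apply: df => //; exact: small_in.
have [p [hp cp cp' dp Ep]] := slope dqb; rewrite -!Eq // -Ep //.
have r4 : 0 < r / 4 by rewrite divr_gt0.
have cqw w : nm w < r -> ccont q w.
  by move=> hw; have [->|wa] := eqVneq w a; [exact: cq|apply: cq' => //; exact: cf].
apply: (@maxmod_except _ (b :: a :: s) p z (r / 4) _ r4).
- by rewrite !in_cons !negb_or za zb.
- move=> w /(disc_in hz) hw; have [->|wb] := eqVneq w b; first exact: cp.
  by apply: cp' => //; exact: cqw.
- move=> w /(disc_in hz) hw; rewrite !in_cons !negb_or => /and3P[wb wa ws].
  by apply: dp => //; apply: dq => //; exact: df.
move=> w hw; have [hr h8] := annulus_dist hz hb hw.
rewrite Ep; last by rewrite -subr_eq0 -nm_gt0 (lt_le_trans _ h8) // divr_gt0.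
apply: slope_bound hw => //; last by rewrite Eq //; exact: dd1.
move=> x hx; have [hr' h8'] := annulus_dist hz ha hx.
rewrite Eq; last by rewrite -subr_eq0 -nm_gt0 (lt_le_trans _ h8') // divr_gt0.
apply: slope_bound hx => //; last by apply: bf; exact: small_in.
by move=> y hy; apply: bf; have [] := annulus_dist hz ha hy.
Qed.

End DividedDifferences.

(** The second divided difference times (z - a)(b - a)(z - b): without denominators it can be
    estimated when points coincide and under limits. *)
Definition dd3 (f : C -> C) (z a b : C) := f z * (b - a) - f b * (z - a) + f a * (z - b).

Lemma dd3_bound (s : seq C) (f : C -> C) (r M : R) (z a b : C) : 0 < r ->
  (forall w, nm w < r -> ccont f w) ->
  (forall w, nm w < r -> w \notin s -> cdiff f w) ->
  (forall w, nm w < r -> nm (f w) <= M) ->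
  nm z < r / 16 -> nm a < r / 16 -> nm b < r / 16 ->
  z \notin s -> a \notin s -> b \notin s ->
  nm (dd3 f z a b) <= 16 * (16 * M / r) / r * (nm (z - a) * nm (b - a) * nm (z - b)).
Proof.
move=> r0 cf df bf hz ha hb zs as_ bs; rewrite /dd3.
have [->|za] := eqVneq z a.
  by rewrite !subrr nm0 !mul0r !mulr0 subr0 -mulrDr addrA subrK subrr mulr0 nm0.
have [->|zb] := eqVneq z b.
  by rewrite !subrr nm0 !mulr0 addr0 nm0.
have [->|ba] := eqVneq b a.
  by rewrite !subrr nm0 !mulr0 !mul0r mulr0 add0r addrC subrr nm0.
have := dd2 r0 cf df bf hz ha hb zs as_ bs za zb ba.
set K := 16 * _ / r; rewrite nmM nmV ler_pdivrMr ?nm_gt0 ?subr_eq0 // => h.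
have -> : f z * (b - a) - f b * (z - a) + f a * (z - b) =
  ((f z - f a) / (z - a) - (f b - f a) / (b - a)) * (z - a) * (b - a).
  by field; rewrite !subr_eq0 ba za.
have p : 0 <= nm (z - a) * nm (b - a) by rewrite mulr_ge0 ?nm_ge0.
by have := ler_wpM2r p h; rewrite !nmM; nra.
Qed.

(** The bound says that the difference quotients q at a satisfy |q z - q b| <= K |z - b|. Their
    limit is built from suprema: for the real part, of Re (q z) - K |z - a| over z, and likewise for
    the imaginary part. *)
Lemma dd3_cdiff (f : C -> C) (a : C) (d K : R) : 0 < d -> 0 <= K ->
  (forall z b, z != a -> b != a -> nm (z - a) < d -> nm (b - a) < d ->
     nm (dd3 f z a b) <= K * (nm (z - a) * nm (b - a) * nm (z - b))) ->
  cdiff f a.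
Proof.
move=> d0 K0 h; pose q z := (f z - f a) / (z - a).
have lip z b : z != a -> b != a -> nm (z - a) < d -> nm (b - a) < d ->
    nm (q z - q b) <= K * (nm (z - a) + nm (b - a)).
  move=> za ba hz hb; have {h} := h z b za ba hz hb.
  have -> : dd3 f z a b = (q z - q b) * (z - a) * (b - a).
    by rewrite /dd3 /q; field; rewrite !subr_eq0 za ba.
  have pz : 0 < nm (z - a) by rewrite nm_gt0 subr_eq0.
  have pb : 0 < nm (b - a) by rewrite nm_gt0 subr_eq0.
  rewrite !nmM => h.
  have pp : 0 < nm (z - a) * nm (b - a) by rewrite mulr_gt0.
  have : nm (z - a) * nm (b - a) * nm (q z - q b) <=
         nm (z - a) * nm (b - a) * (K * nm (z - b)) by lra.
  rewrite ler_pM2l // => /le_trans; apply; rewrite ler_wpM2l //.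
  by rewrite (le_trans (nm_tri z a b)) // lerD2l nmB.
have sep (p : C -> R) : (forall z b, `|p z - p b| <= nm (z - b)) ->
  (forall z w, p (z - w) = p z - p w) ->
  exists l : R, forall z, z != a -> nm (z - a) < d -> `|p (q z) - l| <= K * nm (z - a).
  move=> hp _; pose E := [set x | exists z, [/\ z != a, nm (z - a) < d & x = p (q z) - K * nm (z - a)]].
  have ub b : b != a -> nm (b - a) < d -> forall x, E x -> x <= p (q b) + K * nm (b - a).
    move=> ba hb _ [z [za hz ->]]; have := lip z b za ba hz hb.
    by have := hp (q z) (q b); have := ler_norm (p (q z) - p (q b)); lra.
  have [b0 [b0a hb0]] : exists b0, b0 != a /\ nm (b0 - a) < d.
    have [b [h1 h2 _]] := @ccont_near id a 1 d (ccont_id a) ltr01 d0.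
    by exists b.
  have hs : has_sup E.
    split; first by exists (p (q b0) - K * nm (b0 - a)), b0.
    by exists (p (q b0) + K * nm (b0 - a)); exact: ub.
  exists (sup E) => z za hz; rewrite ler_norml; apply/andP; split.
    have : sup E <= p (q z) + K * nm (z - a).
      by apply: sup_le_ub; [exact: hs.1|exact: ub].
    by lra.
  have : p (q z) - K * nm (z - a) <= sup E.
    by apply: sup_upper_bound => //; exists z.
  by lra.
have [||lx hx] := sep (@rp R).
- by move=> z b; have := rp_le (z - b); rewrite rpD rpN.
- by move=> z b; rewrite rpD rpN.
have [||ly hy] := sep (@ip R).
- by move=> z b; have := ip_le (z - b); rewrite ipD ipN.
- by move=> z b; rewrite ipD ipN.
pose l : C := cr lx + ci * cr ly.
have hl z : z != a -> nm (z - a) < d -> nm (q z - l) <= 2 * K * nm (z - a).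
  move=> za hz; rewrite (le_trans (nm_le _)) // /l !rpD !ipD rpN ipN rpD ipD rpM ipM.
  rewrite !rp_cr !ip_cr rp_ci ip_ci mul0r mulr0 subr0 addr0 mul0r mul1r !add0r.
  by have := hx z za hz; have := hy z za hz; lra.
exists l => e e0; exists (Num.min d (e / (2 * K + 1))).
  by rewrite lt_min d0 divr_gt0 //; lra.
move=> w; rewrite lt_min => /andP[hd he]; have [->|wa] := eqVneq w a.
  by rewrite !subrr mulr0 subr0 nm0 mulr0.
have -> : f w - f a - l * (w - a) = (q w - l) * (w - a).
  by rewrite /q; field; rewrite subr_eq0.
rewrite nmM ler_wpM2r ?nm_ge0 // (le_trans (hl _ wa hd)) //.
move: he; rewrite ltr_pdivlMr; last by lra.
by have := nm_ge0 (w - a); nra.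
Qed.

(** The bound on [dd3] holds at (z, a, b) for a != 0 close to 0. By continuity of f it passes to a =
    0, where it yields differentiability. *)
Lemma removable (f : C -> C) (r M : R) : 0 < r ->
  (forall w, nm w < r -> ccont f w) -> (forall w, nm w < r -> w != 0 -> cdiff f w) ->
  (forall w, nm w < r -> nm (f w) <= M) -> cdiff f 0.
Proof.
move=> r0 cf df bf; have r16 : 0 < r / 16 by rewrite divr_gt0.
have M0 : 0 <= M by apply: le_trans (nm_ge0 _) (bf 0 _); rewrite nm0.
set K := 16 * (16 * M / r) / r.
have K0 : 0 <= K by rewrite /K; do ?[apply: divr_ge0|apply: mulr_ge0]; rewrite // ltW.
apply: (dd3_cdiff r16 K0) => z b z0 b0; rewrite !subr0 => hz hb.
apply: (@le_eps _ _ _ (K * nm (z - b) * (nm z + nm b + 1) + nm (f b - f z) + nm (z - b))).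
move=> e e0 e1; have d0 : 0 < Num.min e (r / 16) by rewrite lt_min e0.
have [|a [a0]] := @ccont_near f 0 e _ _ e0 d0; first by apply: cf; rewrite nm0.
rewrite subr0 lt_min => /andP[ha har] hfa.
have hh := @dd3_bound [:: 0] f r M z a b r0 cf _ bf hz har hb.
rewrite !inE in hh; have {}hh := hh _ z0 a0 b0.
have /hh : forall w, nm w < r -> w \notin [:: 0] -> cdiff f w.
  by move=> w hw; rewrite !inE; exact: df.
rewrite -/K => h.
have e2 : dd3 f z 0 b = dd3 f z a b + (- (a * (f b - f z)) - (f a - f 0) * (z - b)).
  by rewrite /dd3; ring.
have h1 : nm (dd3 f z 0 b) <= nm (dd3 f z a b) + (e * nm (f b - f z) + e * nm (z - b)).
  rewrite e2 (le_trans (nmD _ _)) // lerD2l (le_trans (nm_sub _ _)) // nmN !nmM.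
  by apply: lerD; apply: ler_wpM2r; rewrite ?nm_ge0 // ltW.
have hz' : nm (z - a) <= nm z + e by have := nm_sub z a; lra.
have hb' : nm (b - a) <= nm b + e by have := nm_sub b a; lra.
have p : nm (z - a) * nm (b - a) <= (nm z + e) * (nm b + e).
  by apply: ler_pM; rewrite ?nm_ge0.
have q0 : 0 <= K * nm (z - b) by rewrite mulr_ge0 ?nm_ge0.
have p2 : (nm z + e) * (nm b + e) <= nm z * nm b + e * (nm z + nm b + 1).
  by have := nm_ge0 z; have := nm_ge0 b; nra.
have := ler_wpM2l q0 (le_trans p p2); lra.
Qed.

(** The slope at 0 is again bounded, by [dd1], and differentiable everywhere, by [removable]; so the
    expansion proceeds by f = f 0 + w q. *)
Lemma taylor1 N (f : C -> C) (r M : R) : 0 < r ->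
  (forall w, nm w < r -> cdiff f w) -> (forall w, nm w < r -> nm (f w) <= M) ->
  exists p : {poly C}, exists K : R, exists2 d : R, 0 < d &
    forall w, nm w < d -> nm (f w - p.[w]) <= K * nm w ^+ N.
Proof.
elim: N f r M => [|N IH] f r M r0 df bf.
  by exists 0, M, r => // w hw; rewrite horner0 subr0 expr0 mulr1 bf.
have z0 : nm (0 : C) < r by rewrite nm0.
have [q [hq cq cq' dq Eq]] := slope (df 0 z0).
have r16 : 0 < r / 16 by rewrite divr_gt0.
have cf w : nm w < r -> ccont f w by move=> hw; exact: cdiff_cont (df w hw).
have M0 : 0 <= 16 * M / r.
  by rewrite divr_ge0 ?(ltW r0) // mulr_ge0 // (le_trans (nm_ge0 _) (bf 0 z0)).
have bq w : nm w < r / 16 -> nm (q w) <= 16 * M / r + nm (q 0).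
  move=> hw; have [->|w0] := eqVneq w 0; first by rewrite lerDr.
  rewrite Eq // (le_trans (@dd1 [::] f r M r0 cf _ bf w 0 _ _ _ _ _)) ?nm0 ?lerDl ?nm_ge0 //.
  by move=> x hx _; exact: df.
have sm w : nm w < r / 16 -> nm w < r by have := nm_ge0 w; lra.
have dq' w : nm w < r / 16 -> w != 0 -> cdiff q w.
  by move=> /sm hw w0; apply: dq => //; exact: df.
have cqw w : nm w < r / 16 -> ccont q w.
  move=> /sm hw; have [->|w0] := eqVneq w 0; first exact: cq.
  by apply: cq' => //; exact: cf.
have dq0 : cdiff q 0 := removable r16 cqw dq' bq.
have [|p [K [d d0 hd]]] := IH q _ _ r16 _ bq.
  by move=> w hw; have [->|w0] := eqVneq w 0; [exact: dq0|exact: dq'].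
exists ((f 0)%:P + p * 'X), K, d => // w hw.
have -> : f w - ((f 0)%:P + p * 'X).[w] = (q w - p.[w]) * w.
  by rewrite hq !hornerE; ring.
by rewrite nmM exprSr mulrA ler_wpM2r ?nm_ge0 // hd.
Qed.

Definition sepdiff (F : C -> C -> C) (r M : R) := forall x y, nm x < r -> nm y < r ->
  [/\ cdiff (F x) y, cdiff (fun x => F x y) x & nm (F x y) <= M].

Lemma dd3_near (g h : C -> C) z a b (e : R) :
  nm (g z - h z) <= e -> nm (g a - h a) <= e -> nm (g b - h b) <= e ->
  nm (dd3 g z a b) <= nm (dd3 h z a b) + e * (nm (b - a) + nm (z - a) + nm (z - b)).
Proof.
move=> hz ha hb.
have -> : dd3 g z a b = dd3 h z a b + ((g z - h z) * (b - a) - (g b - h b) * (z - a) + (g a - h a) * (z - b)).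
  by rewrite /dd3; ring.
have w3 u v : nm u <= e -> nm (u * v) <= e * nm v.
  by move=> hu; rewrite nmM ler_wpM2r ?nm_ge0.
rewrite (le_trans (nmD _ _)) // lerD2l (le_trans (nmD _ _)) //.
have := nm_sub ((g z - h z) * (b - a)) ((g b - h b) * (z - a)).
by have := w3 _ (b - a) hz; have := w3 _ (z - a) hb; have := w3 _ (z - b) ha; lra.
Qed.

(** Away from y = 0 the quotient G = (F x y - F x 0) / y inherits everything. In the direction x at
    y = 0, the bounds on [dd3] for G at y = w are uniform in w and survive the pointwise limit w ->
    0. *)
Lemma sepdiff_slope F (r M : R) : 0 < r -> sepdiff F r M ->
  exists G : C -> C -> C, [/\ forall x y, nm x < r -> F x y = F x 0 + y * G x y &
    exists r' M' : R, 0 < r' /\ sepdiff G r' M'].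
Proof.
move=> r0 hF; have z0 : nm (0 : C) < r by rewrite nm0.
have /choice[G hG] : forall x, exists q : C -> C, nm x < r ->
  [/\ forall w, F x w = F x 0 + q w * (w - 0), ccont q 0,
      forall w, w != 0 -> ccont (F x) w -> ccont q w,
      forall w, w != 0 -> cdiff (F x) w -> cdiff q w &
      forall w, w != 0 -> q w = (F x w - F x 0) / (w - 0)].
  move=> x; case: (pselect (nm x < r)) => hx; last by exists (fun=> 0).
  by have [q hq] := slope (let: And3 h _ _ := hF x 0 hx z0 in h); exists q.
exists G; split.
  by move=> x y hx; have [h _ _ _ _] := hG x hx; rewrite h subr0 mulrC.
have r16 : 0 < r / 16 by rewrite divr_gt0.
have sm w : nm w < r / 16 -> nm w < r by have := nm_ge0 w; lra.
have M0 : 0 <= M by have [_ _] := hF 0 0 z0 z0; apply: le_trans; exact: nm_ge0.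
set M' := 16 * M / r.
have M'0 : 0 <= M' by rewrite divr_ge0 ?(ltW r0) // mulr_ge0.
have bG1 x y : nm x < r / 16 -> nm y < r / 16 -> y != 0 -> nm (G x y) <= M'.
  move=> /sm hx hy y0; have [_ _ _ _ ->] := hG x hx; last by [].
  apply: (@dd1 [::] (F x) r M r0 _ _ _ y 0); rewrite ?nm0 //.
  - by move=> w hw; have [h _ _] := hF x w hx hw; exact: cdiff_cont.
  - by move=> w hw _; have [] := hF x w hx hw.
  - by move=> w hw; have [] := hF x w hx hw.
have cG0 x : nm x < r / 16 -> ccont (G x) 0.
  by move=> /sm hx; have [] := hG x hx.
have bG x y : nm x < r / 16 -> nm y < r / 16 -> nm (G x y) <= M'.
  move=> hx hy; have [->|y0] := eqVneq y 0; last exact: bG1.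
  apply: (ccont_bound (cG0 x hx) r16) => w w0; rewrite subr0 => hw; exact: bG1.
have cG x y : nm x < r / 16 -> nm y < r / 16 -> ccont (G x) y.
  move=> hx hy; have [->|y0] := eqVneq y 0; first exact: cG0.
  have hx' := sm _ hx; have [_ _ h _ _] := hG x hx'; apply: h => //.
  by have [h _ _] := hF x y hx' (sm _ hy); exact: cdiff_cont.
have dG x y : nm x < r / 16 -> nm y < r / 16 -> y != 0 -> cdiff (G x) y.
  move=> hx hy y0; have hx' := sm _ hx; have [_ _ _ h _] := hG x hx'; apply: h => //.
  by have [] := hF x y hx' (sm _ hy).
have dGx x y : nm x < r / 16 -> nm y < r / 16 -> y != 0 -> cdiff (G^~ y) x.
  move=> hx hy y0; have hx' := sm _ hx.
  have d0 : 0 < r - nm x by rewrite subr_gt0.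
  apply: (@cdiff_eq _ (fun x => (F x y - F x 0) * y^-1) _ _ _ d0).
    move=> w hw; have hwr : nm w < r by have := nm_sub_ge w x; lra.
    by have [_ _ _ _ ->] := hG w hwr; rewrite ?subr0.
  apply: cdiffM; last exact: cdiff_cst.
  by apply: cdiffB; [have [] := hF x y hx' (sm _ hy)|have [] := hF x 0 hx' z0].
have r2 : 0 < r / 16 / 16 by rewrite divr_gt0.
have sm2 w : nm w < r / 16 / 16 -> nm w < r / 16 by have := nm_ge0 w; lra.
exists (r / 16 / 16), M'; split => // x y hx hy.
split; last by apply: bG; exact: sm2.
  have [->|y0] := eqVneq y 0; last by apply: dG => //; exact: sm2.
  apply: (removable r16 (M := M')) => w hw; first by apply: cG => //; exact: sm2.
    by apply: dG => //; exact: sm2.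
  by apply: bG => //; exact: sm2.
have [->|y0] := eqVneq y 0; last by apply: dGx => //; exact: sm2.
set K := 16 * (16 * M' / (r / 16)) / (r / 16).
have K0 : 0 <= K by rewrite /K; do ?[apply: divr_ge0|apply: mulr_ge0]; rewrite // ltW.
have d0 : 0 < r / 16 / 16 - nm x by rewrite subr_gt0.
apply: (dd3_cdiff d0 K0) => z b _ _ hz hb.
have hz' : nm z < r / 16 / 16 by have := nm_sub_ge z x; lra.
have hb' : nm b < r / 16 / 16 by have := nm_sub_ge b x; lra.
apply: (@le_eps _ _ _ (nm (b - x) + nm (z - x) + nm (z - b))) => e e0 _.
have [d1 d10 hd1] := cG0 z (sm2 _ hz') e e0.
have [d2 d20 hd2] := cG0 x (sm2 _ hx) e e0.
have [d3 d30 hd3] := cG0 b (sm2 _ hb') e e0.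
have dd : 0 < Num.min (Num.min d1 d2) (Num.min d3 (r / 16)) by rewrite !lt_min d10 d20 d30.
have [w [w0 + _]] := @ccont_near id 0 1 _ (ccont_id 0) ltr01 dd.
rewrite subr0 !lt_min => /andP[/andP[w1 w2] /andP[w3 w4]].
have n1 : nm (G z 0 - G z w) <= e by rewrite nmB; apply: hd1; rewrite subr0.
have n2 : nm (G x 0 - G x w) <= e by rewrite nmB; apply: hd2; rewrite subr0.
have n3 : nm (G b 0 - G b w) <= e by rewrite nmB; apply: hd3; rewrite subr0.
apply: (le_trans (@dd3_near (G^~ 0) (G^~ w) z x b e n1 n2 n3)); rewrite lerD2r.
apply: (@dd3_bound [::] (G^~ w) (r / 16) M' z x b r16) => // v hv.
- by apply: cdiff_cont; exact: dGx.
- by move=> _; exact: dGx.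
- exact: bG.
Qed.

Definition ev2 (T : {poly {poly C}}) (x y : C) : C := T.[y%:P].[x].

Lemma jets N F (r M : R) : 0 < r -> sepdiff F r M ->
  exists T : {poly {poly C}}, exists K : R, exists2 d : R, 0 < d &
    forall x y, nm x < d -> nm y < d ->
      nm (F x y - ev2 T x y) <= K * (nm x + nm y) ^+ N.
Proof.
elim: N F r M => [|N IH] F r M r0 hF.
  exists 0, M, r => // x y hx hy; rewrite /ev2 horner0 horner0 subr0 expr0 mulr1.
  by have [] := hF x y hx hy.
have [G [hG [r' [M' [r'0 hG']]]]] := sepdiff_slope r0 hF.
have [T [K [d d0 hd]]] := IH G r' M' r'0 hG'.
have z0 : nm (0 : C) < r by rewrite nm0.
have [||p [K1 [d1 d10 hd1]]] := @taylor1 N.+1 (F^~ 0) r M r0.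
- by move=> w hw; have [] := hF w 0 hw z0.
- by move=> w hw; have [] := hF w 0 hw z0.
have K10 : 0 <= `|K1| by [].
have K0 : 0 <= `|K| by [].
exists (p%:P + T * 'X), (`|K1| + `|K|), (Num.min (Num.min d d1) r); first by rewrite !lt_min d0 d10.
move=> x y; rewrite !lt_min => /andP[/andP[x1 x2] x3] /andP[/andP[y1 y2] y3].
have -> : F x y - ev2 (p%:P + T * 'X) x y = (F x 0 - p.[x]) + y * (G x y - ev2 T x y).
  by rewrite hG // /ev2 !hornerE; ring.
have hx := nm_ge0 x; have hy := nm_ge0 y.
have xs : nm x <= nm x + nm y by rewrite lerDl.
have ys : nm y <= nm x + nm y by rewrite lerDr.
have S0 : 0 <= nm x + nm y by rewrite addr_ge0.
rewrite (le_trans (nmD _ _)) // mulrDl nmM; apply: lerD.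
  apply: (le_trans (hd1 x x2)); apply: (@le_trans _ _ (`|K1| * nm x ^+ N.+1)).
    by rewrite ler_wpM2r ?ler_norm ?exprn_ge0.
  by rewrite ler_wpM2l // lerXn2r ?nnegrE.
apply: (@le_trans _ _ (nm y * (`|K| * (nm x + nm y) ^+ N))).
  rewrite ler_wpM2l // (le_trans (hd x y x1 y1)) // ler_wpM2r ?ler_norm ?exprn_ge0 //.
by rewrite mulrCA exprS ler_wpM2l // ler_wpM2r // exprn_ge0.
Qed.

End Jets.

(** * Quasihomogeneous germs *)

Section TotalDiff.
Variable R : realType.
Local Notation C := (Cplx R).
Local Notation ci := (ci R).
Local Notation V := ('rV[C]_2).
Let i0 : 'I_2 := ord0.
Let i1 : 'I_2 := lift ord0 ord0.

Definition dist1 (p q : V) : R := nm (p ord0 i0 - q ord0 i0) + nm (p ord0 i1 - q ord0 i1).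

Lemma ord2 (P : 'I_2 -> Prop) : P i0 -> P i1 -> forall k, P k.
Proof.
move=> h0 h1 k; case: (unliftP ord0 k) => [j ->|->] //.
by rewrite (_ : j = ord0) //; apply: ord_inj; case: j => -[].
Qed.

Lemma near_dist1 (p : V) (Q : V -> Prop) : (\forall x \near p, Q x) ->
  exists2 d : R, 0 < d & forall x, dist1 x p < d -> Q x.
Proof.
move=> /nbhs_ballP[e /= /cpos[r r0 ->] h]; exists r => // x hx; apply: h.
split; first by rewrite -cr0 cr_lt.
move=> j k; rewrite /ball /= nmE cr_lt nmB ord1; apply: le_lt_trans hx.
move: k; apply: ord2; rewrite /dist1.
  by rewrite lerDl nm_ge0.
by rewrite lerDr nm_ge0.
Qed.

Definition l1 (p : V) : R := nm (p ord0 i0) + nm (p ord0 i1).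

Lemma norm_l1 (p : V) : `|p| <= cr (l1 p).
Proof.
rewrite (_ : `|p| = mx_norm p) //.
have [->|] := eqVneq (mx_norm p) 0; first by rewrite -cr0 cr_le addr_ge0 ?nm_ge0.
move=> /mx_norm_neq0[[i k] /= ->]; rewrite nmE cr_le ord1.
by move: k; apply: ord2; rewrite /l1 ?lerDl ?lerDr nm_ge0.
Qed.

Definition total_diff (f : V -> C) (p : V) := exists a b : C, forall e : R, 0 < e ->
  exists2 d : R, 0 < d & forall x, dist1 x p < d ->
    nm (f x - f p - (a * (x ord0 i0 - p ord0 i0) + b * (x ord0 i1 - p ord0 i1))) <= e * dist1 x p.

Lemma differentiable_total (f : V -> C) (p : V) : differentiable f p -> total_diff f p.
Proof.
move=> /diff_locally/eqaddoP hf.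
exists ('d f p (delta_mx ord0 i0) : C), ('d f p (delta_mx ord0 i1) : C) => e e0.
have e0' : 0 < cr e by rewrite -cr0 cr_lt.
have /nbhs_ballP[_ /= /cpos[r r0 ->] h] := hf _ e0'.
exists r => // x hx; have := h (x - p).
have l1x : l1 (x - p) = dist1 x p by rewrite /l1 !mxE.
have dec : x - p = (x ord0 i0 - p ord0 i0) *: delta_mx ord0 i0 +
                   (x ord0 i1 - p ord0 i1) *: delta_mx ord0 i1.
  by apply/rowP; apply: ord2; rewrite !mxE !eqxx /= ?mulr0 ?mulr1 ?addr0 ?add0r.
have -> : 'd f p (delta_mx ord0 i0) * (x ord0 i0 - p ord0 i0) +
      'd f p (delta_mx ord0 i1) * (x ord0 i1 - p ord0 i1) = 'd f p (x - p).
  by rewrite [in RHS]dec linearD !linearZ /= /GRing.scale /= mulrC [X in _ + X]mulrC.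
move=> H; have {H} : `|(f \o +%R^~ p - (cst (f p) + 'd f p)) (x - p)| <= cr e * `|x - p|.
  apply: H; split; first by rewrite -cr0 cr_lt.
  move=> j k; rewrite /ball /= nmE cr_lt ord1 !mxE sub0r nmN; apply: le_lt_trans hx.
  by move: k; apply: ord2; rewrite /dist1 ?lerDl ?lerDr nm_ge0.
rewrite /= !fctE /= subrK => h1.
rewrite -cr_le -nmE; have -> : f x - f p - 'd f p (x - p) = f x - (f p + 'd f p (x - p)) by ring.
apply: (le_trans h1); rewrite crM -l1x; apply: ler_wpM2l; first exact: ltW.
exact: norm_l1.
Qed.

Lemma dist1_ge0 p q : 0 <= dist1 p q. Proof. by rewrite addr_ge0 ?nm_ge0. Qed.

Lemma total_diff_lip f p : total_diff f p -> exists K d : R, [/\ 0 <= K, 0 < d &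
  forall x, dist1 x p < d -> nm (f x - f p) <= K * dist1 x p].
Proof.
move=> [a [b h]]; have [d d0 hd] := h 1 ltr01.
exists (nm a + nm b + 1), d; split=> //; first by rewrite !addr_ge0 ?nm_ge0.
move=> x hx; have := hd x hx; set u := x ord0 i0 - _; set v := x ord0 i1 - _.
have := nmD (f x - f p - (a * u + b * v)) (a * u + b * v); rewrite subrK.
have := nmD (a * u) (b * v); rewrite !nmM /dist1 -/u -/v.
have := nm_ge0 a; have := nm_ge0 b; have := nm_ge0 u; have := nm_ge0 v.
move=> h1 h2 h3 h4 h5 h6 h7.
have : 0 <= nm a * nm v by rewrite mulr_ge0.
have : 0 <= nm b * nm u by rewrite mulr_ge0.
lra.
Qed.

Definition pt (x y : C) : V := \row_k (if k == i0 then x else y).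

Lemma pt0 x y : pt x y ord0 i0 = x. Proof. by rewrite mxE. Qed.
Lemma pt1 x y : pt x y ord0 i1 = y. Proof. by rewrite mxE. Qed.

Lemma total_diff_curve f (c0 c1 : C -> C) (t : C) :
  total_diff f (pt (c0 t) (c1 t)) -> cdiff c0 t -> cdiff c1 t ->
  cdiff (fun s => f (pt (c0 s) (c1 s))) t.
Proof.
move=> [a [b h]] /cdiffP[p hp cp] /cdiffP[q hq cq].
exists (a * p t + b * q t) => e e0.
set P := nm (p t) + 1; set Q := nm (q t) + 1.
have P0 : 0 < P by rewrite ltr_wpDl ?nm_ge0 // ltr01.
have Q0 : 0 < Q by rewrite ltr_wpDl ?nm_ge0 // ltr01.
pose e1 := e / 2 / (P + Q).
have PQ : 0 < P + Q by apply: addr_gt0.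
have e10 : 0 < e1 by apply: divr_gt0 => //; apply: divr_gt0.
have [d d0 hd] := h e1 e10.
pose e2 := Num.min 1 (e / 2 / (nm a + nm b + 1)).
have ab : 0 < nm a + nm b + 1 by rewrite ltr_wpDl ?addr_ge0 ?nm_ge0 // ltr01.
have e20 : 0 < e2 by rewrite lt_min ltr01 /=; apply: divr_gt0 => //; apply: divr_gt0.
have e21 : e2 <= 1 by rewrite ge_min lexx.
have [d1 d10 hd1] := cp e2 e20; have [d2 d20 hd2] := cq e2 e20.
exists (Num.min (Num.min d1 d2) (d / (P + Q))).
  by rewrite !lt_min d10 d20 divr_gt0.
move=> w; rewrite !lt_min => /andP[/andP[/hd1 w1 /hd2 w2]].
rewrite ltr_pdivlMr // => w3.
have pw : nm (p w) <= P.
  by have := nmD (p w - p t) (p t); rewrite subrK /P; lra.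
have qw : nm (q w) <= Q.
  by have := nmD (q w - q t) (q t); rewrite subrK /Q; lra.
have D : dist1 (pt (c0 w) (c1 w)) (pt (c0 t) (c1 t)) <= nm (w - t) * (P + Q).
  have E0 : c0 w - c0 t = p w * (w - t) by rewrite (hp w); ring.
  have E1 : c1 w - c1 t = q w * (w - t) by rewrite (hq w); ring.
  rewrite /dist1 !pt0 !pt1 E0 E1.
  by rewrite !nmM mulrDr ![nm (w - t) * _]mulrC lerD // ler_wpM2r ?nm_ge0.
have Dd := le_lt_trans D w3.
have := hd _ Dd; rewrite !pt0 !pt1; set F := f _; set F0 := f _ => H.
have e3 : F - F0 - (a * p t + b * q t) * (w - t) =
  (F - F0 - (a * (c0 w - c0 t) + b * (c1 w - c1 t))) +
  (a * (p w - p t) + b * (q w - q t)) * (w - t).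
  by rewrite (hp w) (hq w); ring.
rewrite e3 (le_trans (nmD _ _)) //.
have H1 : e1 * dist1 (pt (c0 w) (c1 w)) (pt (c0 t) (c1 t)) <= e / 2 * nm (w - t).
  have := ler_wpM2l (ltW e10) D.
  have -> : e1 * (nm (w - t) * (P + Q)) = e / 2 * nm (w - t).
    by rewrite /e1; field; rewrite gt_eqF.
  by [].
have H2 : nm (a * (p w - p t) + b * (q w - q t)) <= e / 2.
  apply: (le_trans (nmD _ _)); rewrite !nmM.
  have k1 := ler_wpM2l (nm_ge0 a) w1; have k2 := ler_wpM2l (nm_ge0 b) w2.
  have k3 : e2 <= e / 2 / (nm a + nm b + 1) by rewrite ge_min lexx orbT.
  move: k3; rewrite ler_pdivlMr //; lra.
rewrite nmM; have := ler_wpM2r (nm_ge0 (w - t)) H2; lra.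
Qed.

End TotalDiff.

(** * Passage from local coordinates to estimates at the origin *)

Section Germ.
Variable R : realType.
Local Notation C := (Cplx R).
Local Notation V := ('rV[C]_2).
Local Notation i0 := (ord0 : 'I_2).
Local Notation i1 := (lift ord0 ord0 : 'I_2).

(** What is kept of the coordinate change: of the inverse map, only the Lipschitz lower bound, which
    is enough to make the Jacobian of the Taylor polynomials nonzero. *)
Definition quasihomogeneous_at0 (F : C -> C -> C) : Prop :=
  exists (w : 'I_2 -> nat) (d : nat) (W : Cpoly R 2) (f1 f2 u : C -> C -> C)
         (r M K : R),
    [/\ (forall i, (0 < w i)%N) /\ weighted_homogeneous w d W,
        0 < r /\ [/\ sepdiff f1 r M, sepdiff f2 r M & sepdiff u r M],
        [/\ f1 0 0 = 0, f2 0 0 = 0 & u 0 0 != 0] &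
        forall x y, nm x < r -> nm y < r ->
          nm x + nm y <= K * (nm (f1 x y) + nm (f2 x y)) /\
          F x y = u x y * evalv W (pt (f1 x y) (f2 x y))].

Lemma ptE (v : V) : v = pt (v ord0 i0) (v ord0 i1).
Proof. by apply/rowP; apply: ord2; rewrite !mxE. Qed.

Lemma differentiable_comp_coord (f : V -> V) p k : differentiable f p ->
  differentiable (fun x => f x ord0 k : C) p.
Proof.
move=> df; have h := @differentiable_coord C 1 2 (f p) ord0 k.
exact: (@differentiable_comp C _ _ _ f (fun v : V => v ord0 k : C) p df h).
Qed.

(** Composition of the given coordinates with a bi-Lipschitz map (c0, c1) to the chart, the
    nonvanishing factor [h] joining the unit. The lower bound comes from the Lipschitz constants of
    psi. *)
Lemma quasihomogeneous_chart (G : V -> C) (p : V) (F c0 c1 h : C -> C -> C) (r M L : R) :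
  quasihomogeneous_germ G p -> 0 < r -> 0 < L ->
  sepdiff c0 r M -> sepdiff c1 r M -> sepdiff h r M -> h 0 0 != 0 ->
  pt (c0 0 0) (c1 0 0) = p ->
  (forall x y, nm x < r -> nm y < r ->
    [/\ dist1 (pt (c0 x y) (c1 x y)) p <= L * (nm x + nm y),
        nm x + nm y <= L * dist1 (pt (c0 x y) (c1 x y)) p &
        F x y = h x y * G (pt (c0 x y) (c1 x y))]) ->
  quasihomogeneous_at0 F.
Proof.
move=> [w [d [W [phi [u [[w0 hW] [phip [dphi [psi [psi0 dpsi psiphi _]]]] [du up] hG]]]]]].
move=> r0 L0 sc0 sc1 sh h0 c00 hF.
have [d1 d10 hd1] := near_dist1 dphi; have [d2 d20 hd2] := near_dist1 du.
have [d3 d30 hd3] := near_dist1 psiphi; have [d4 d40 hd4] := near_dist1 hG.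
have [d5 d50 hd5] := near_dist1 dpsi.
have dpp q : dist1 q q = 0 by rewrite /dist1 !subrr nm0 addr0.
have lip0 k q (f : V -> V) : differentiable f q -> exists K d : R, [/\ 0 <= K, 0 < d &
    forall x, dist1 x q < d -> nm (f x ord0 k - f q ord0 k) <= K * dist1 x q].
  by move=> df; exact: (total_diff_lip (differentiable_total (differentiable_comp_coord k df))).
have dpp1 : dist1 p p < d1 by rewrite dpp.
have dpp2 : dist1 p p < d2 by rewrite dpp.
have dpp5 : dist1 (0 : V) 0 < d5 by rewrite dpp.
have [K1 [e1 [K10 e10 hK1]]] := lip0 i0 p phi (hd1 p dpp1).
have [K2 [e2 [K20 e20 hK2]]] := lip0 i1 p phi (hd1 p dpp1).
have [K3 [e3 [K30 e30 hK3]]] := total_diff_lip (differentiable_total (hd2 p dpp2)).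
have [K4 [e4 [K40 e40 hK4]]] := lip0 i0 0 psi (hd5 0 dpp5).
have [K5 [e5 [K50 e50 hK5]]] := lip0 i1 0 psi (hd5 0 dpp5).
(* Since phi has Lipschitz constant K1 + K2, the ball of radius e6 is sent to where the estimates on
   psi hold. *)
pose e6 := Num.min e4 e5 / (K1 + K2 + 1).
have e60 : 0 < e6 by rewrite divr_gt0 ?lt_min ?e40 // ltr_wpDl ?addr_ge0.
have [e e0 le_e0] : exists2 e : R, 0 < e & forall v, v < e ->
    [/\ v < d1 /\ v < d2, v < d3 /\ v < d4, v < e1 /\ v < e2 & v < e3 /\ v < e6].
  exists (Num.min (Num.min (Num.min d1 d2) (Num.min d3 d4)) (Num.min (Num.min e1 e2) (Num.min e3 e6))).
    by rewrite !lt_min d10 d20 d30 d40 e10 e20 e30 e60.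
  by move=> v; rewrite !lt_min => /andP[/andP[/andP[h1 h2] /andP[h3 h4]] /andP[/andP[h5 h6] /andP[h7 h8]]].
have le_e q := le_e0 (dist1 q p).
have [s s0 le_s] : exists2 s : R, 0 < s & forall v, v < s -> v < r /\ v * (2 * L) < e.
  exists (Num.min r (e / (2 * L))); first by rewrite lt_min r0 divr_gt0 // mulr_gt0.
  by move=> v; rewrite lt_min ltr_pdivlMr ?mulr_gt0 // => /andP[].
pose P x y := pt (c0 x y) (c1 x y).
have near x y : nm x < s -> nm y < s -> [/\ nm x < r, nm y < r & dist1 (P x y) p < e].
  move=> /le_s[xr xe] /le_s[yr ye]; split=> //.
  by have [h1 _ _] := hF x y xr yr; apply: le_lt_trans h1 _; lra.
pose phi0 x := phi x ord0 i0 : C; pose phi1 x := phi x ord0 i1 : C.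
have smooth (f : V -> C) (K e' : R) x y : (forall q, dist1 q p < e -> differentiable f q) ->
    0 <= K -> (forall q, dist1 q p < e -> nm (f q - f p) <= K * dist1 q p) ->
    nm x < s -> nm y < s ->
    [/\ cdiff (fun y => f (P x y)) y, cdiff (fun x => f (P x y)) x & nm (f (P x y)) <= nm (f p) + K * e].
  move=> df K0 lf hx hy; have [xr yr he] := near x y hx hy.
  have td := differentiable_total (df _ he).
  have [a1 b1 _] := sc0 x y xr yr; have [a2 b2 _] := sc1 x y xr yr.
  split; [exact: total_diff_curve td a1 a2|exact: (@total_diff_curve _ f (c0^~ y) (c1^~ y) x td)|].
  have := nmD (f (P x y) - f p) (f p); rewrite subrK; have := lf _ he.
  by have := ler_wpM2l K0 (ltW he); lra.
have S1 x y : nm x < s -> nm y < s -> _ := @smooth phi0 K1 e x y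
  (fun q h => differentiable_comp_coord i0 (hd1 q (let: And4 (conj h1 _) _ _ _ := le_e q h in h1)))
  K10 (fun q h => hK1 q (let: And4 _ _ (conj h1 _) _ := le_e q h in h1)).
have S2 x y : nm x < s -> nm y < s -> _ := @smooth phi1 K2 e x y
  (fun q h => differentiable_comp_coord i1 (hd1 q (let: And4 (conj h1 _) _ _ _ := le_e q h in h1)))
  K20 (fun q h => hK2 q (let: And4 _ _ (conj _ h1) _ := le_e q h in h1)).
have S3 x y : nm x < s -> nm y < s -> _ := @smooth u K3 e x y
  (fun q h => hd2 q (let: And4 (conj _ h1) _ _ _ := le_e q h in h1))
  K30 (fun q h => hK3 q (let: And4 _ _ _ (conj h1 _) := le_e q h in h1)).
pose B0 := nm (phi0 p) + K1 * e; pose B1 := nm (phi1 p) + K2 * e; pose B2 := M * (nm (u p) + K3 * e).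
exists w, d, W, (fun x y => phi0 (P x y)), (fun x y => phi1 (P x y)), (fun x y => h x y * u (P x y)).
exists s, (`|B0| + `|B1| + `|B2|), (L * (K4 + K5)).
have z0 : nm (0 : C) < s by rewrite nm0.
have [zr _ zp] := near 0 0 z0 z0.
split; first by [].
- split=> //; split=> x y hx hy.
  + have [a b c] := S1 x y hx hy; split=> //; rewrite (le_trans c) // -/B0.
    by have := ler_norm B0; have := normr_ge0 B1; have := normr_ge0 B2; lra.
  + have [a b c] := S2 x y hx hy; split=> //; rewrite (le_trans c) // -/B1.
    by have := ler_norm B1; have := normr_ge0 B0; have := normr_ge0 B2; lra.
  + have [xr yr he] := near x y hx hy; have [h1 h2 h3] := sh x y xr yr.
    have [a b c] := S3 x y hx hy.
    split; [exact: cdiffM|exact: (cdiffM h2 b)|].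
    rewrite nmM; apply: (@le_trans _ _ B2); first by apply: ler_pM; rewrite ?nm_ge0.
    by have := ler_norm B2; have := normr_ge0 B0; have := normr_ge0 B1; lra.
- by rewrite /P c00 /phi0 /phi1 phip !mxE mulf_neq0.
move=> x y hx hy; have [xr yr he] := near x y hx hy.
have [[q1 q2] [q3 q4] [q5 q6] [q7 q8]] := le_e _ he.
have [h1 h2 h3] := hF x y xr yr.
split; last first.
  by rewrite h3 hd4 // mulrA /phi0 /phi1 -ptE.
apply: (le_trans h2); rewrite -mulrA ler_wpM2l ?(ltW L0) //.
set q := phi (P x y).
have dq : dist1 q 0 = nm (phi0 (P x y)) + nm (phi1 (P x y)).
  by rewrite /dist1 !mxE !subr0.
have dq2 : dist1 q 0 < Num.min e4 e5.
  have k1 := hK1 _ q5; have k2 := hK2 _ q6.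
  rewrite !phip !mxE !subr0 in k1 k2.
  rewrite dq /phi0 /phi1; apply: (le_lt_trans (lerD k1 k2)).
  move: q8; rewrite /e6 ltr_pdivlMr ?ltr_wpDl ?addr_ge0 // => q8.
  by apply: le_lt_trans q8; have := dist1_ge0 (P x y) p; lra.
move: dq2; rewrite lt_min => /andP[g4 g5].
have k4 := hK4 _ g4; have k5 := hK5 _ g5.
rewrite !psi0 [psi q](hd3 _ q3) in k4 k5.
change (dist1 (P x y) p <= (K4 + K5) * (nm (phi0 (P x y)) + nm (phi1 (P x y)))).
by rewrite -dq mulrDl; exact: lerD.
Qed.

End Germ.

(** * Passage from a standard chart to an arbitrary affine plane *)

Section Plane.
Variable R : realType.
Local Notation C := (Cplx R).
Local Notation i0 := (ord0 : 'I_2).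
Local Notation i1 := (lift ord0 ord0 : 'I_2).

Lemma evalv_scale d (g : Cpoly R 3) (c : C) (v : 'rV[C]_3) : homogeneous d g ->
  evalv g (c *: v) = c ^+ d * evalv g v.
Proof.
move=> hg; rewrite /evalv /meval -(mmap_homogeneous _ _ _ hg).
by apply: eq_mmap => i; rewrite mxE.
Qed.

Lemma sum_lift (i : 'I_3) (F : 'I_3 -> C) :
  \sum_(j < 3) F j = F i + F (lift i i0) + F (lift i i1).
Proof.
rewrite (bigD1 i) //= -addrA; congr (_ + _).
rewrite (reindex_omap (lift i) (unlift i)) => /=; last first.
  by move=> j; case: unliftP => [k ->|->]; rewrite ?eqxx.
by rewrite (eq_bigl xpredT) => [|k]; rewrite ?big_ord_recl ?big_ord0 ?addr0 // liftK eqxx andbT eq_sym neq_lift.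
Qed.

Lemma chart_point (v : 'rV[C]_3) i : v ord0 i != 0 ->
  chart i (pt (v ord0 (lift i i0) / v ord0 i) (v ord0 (lift i i1) / v ord0 i)) = (v ord0 i)^-1 *: v.
Proof.
move=> vi; apply/rowP => j; rewrite !mxE; case: unliftP => [k ->|->]; last by rewrite mulVf.
by move: k; apply: ord2; rewrite ?mxE /= mulrC.
Qed.

Lemma chart_difference (s t vl vi al ai bl bi : C) : vi + s * ai + t * bi != 0 -> vi != 0 ->
  (vl + s * al + t * bl) / (vi + s * ai + t * bi) - vl / vi =
  (s * (al * vi - vl * ai) + t * (bl * vi - vl * bi)) / ((vi + s * ai + t * bi) * vi).
Proof. by move=> h1 h2; field; rewrite h1 h2. Qed.

(** The chart coordinates of v + x a + y b are quotients by its i-th coordinate, and g changes by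
    the D-th power of that coordinate. The linear forms [la] and [mu] recover x and y, which
    supplies the bound in the inverse direction. *)
Lemma quasihomogeneous_plane (g : Cpoly R 3) D (v a b la mu : 'rV[C]_3) (i : 'I_3) :
  homogeneous D g -> v ord0 i != 0 ->
  \sum_(j < 3) la ord0 j * v ord0 j = 0 -> \sum_(j < 3) la ord0 j * a ord0 j = 1 ->
  \sum_(j < 3) la ord0 j * b ord0 j = 0 -> \sum_(j < 3) mu ord0 j * v ord0 j = 0 ->
  \sum_(j < 3) mu ord0 j * a ord0 j = 0 -> \sum_(j < 3) mu ord0 j * b ord0 j = 1 ->
  quasihomogeneous_germ (fun u => evalv g (chart i u))
    (pt (v ord0 (lift i i0) / v ord0 i) (v ord0 (lift i i1) / v ord0 i)) ->
  quasihomogeneous_at0 (fun x y => evalv g (v + x *: a + y *: b)).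
Proof.
move=> hg vi lv la1 lb mv ma mb hG.
pose q j x y : C := v ord0 j + x * a ord0 j + y * b ord0 j.
(* On this bidisc the denominator [q i x y] stays above |v i| / 2. *)
pose r := Num.min 1 (nm (v ord0 i) / 2 / (nm (a ord0 i) + nm (b ord0 i) + 1)).
have ab : 0 < nm (a ord0 i) + nm (b ord0 i) + 1 by rewrite ltr_wpDl ?addr_ge0 ?nm_ge0 // ltr01.
have vi0 : 0 < nm (v ord0 i) by rewrite nm_gt0.
have r0 : 0 < r by rewrite lt_min ltr01 /=; apply: divr_gt0 => //; apply: divr_gt0.
have r1 x : nm x < r -> nm x < 1 by rewrite lt_min => /andP[].
have r2 x : nm x < r -> nm x * (nm (a ord0 i) + nm (b ord0 i) + 1) < nm (v ord0 i) / 2.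
  by rewrite lt_min => /andP[_]; rewrite ltr_pdivlMr.
clearbody r; set H := nm (v ord0 i) / 2 in r2; have H0 : 0 < H by rewrite divr_gt0.
have qi x y : nm x < r -> nm y < r -> H <= nm (q i x y).
  move=> /r2 hx /r2 hy; have := nm_sub_ge (v ord0 i) (- (x * a ord0 i + y * b ord0 i)).
  rewrite opprK nmN -/(q i x y) addrA -/(q i x y).
  have := nmD (x * a ord0 i) (y * b ord0 i); rewrite !nmM.
  have := nm_ge0 x; have := nm_ge0 y; have := nm_ge0 (a ord0 i); have := nm_ge0 (b ord0 i).
  rewrite /H in hx hy *; nra.
have qi0 x y : nm x < r -> nm y < r -> q i x y != 0.
  by move=> hx hy; rewrite -nm_gt0 (lt_le_trans H0) // qi.
clearbody H.
pose B := \sum_(j < 3) (nm (v ord0 j) + nm (a ord0 j) + nm (b ord0 j)).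
have B0 : 0 <= B by apply: sumr_ge0 => j _; rewrite !addr_ge0 ?nm_ge0.
have qB j x y : nm x < r -> nm y < r -> nm (q j x y) <= B.
  move=> /r1 hx /r1 hy; rewrite /B (bigD1 j) //= (@le_trans _ _ (nm (v ord0 j) + nm (a ord0 j) + nm (b ord0 j))) //.
    have := nmD (v ord0 j + x * a ord0 j) (y * b ord0 j).
    have := nmD (v ord0 j) (x * a ord0 j); rewrite !nmM -/(q j x y).
    have := nm_ge0 x; have := nm_ge0 y; have := nm_ge0 (a ord0 j); have := nm_ge0 (b ord0 j); nra.
  by rewrite lerDl sumr_ge0 // => k _; rewrite !addr_ge0 ?nm_ge0.
have dqy j x y : cdiff (q j x) y.
  by apply: cdiffD; [exact: cdiff_cst|apply: cdiffM; [exact: cdiff_id|exact: cdiff_cst]].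
have dqx j x y : cdiff ((q j)^~ y) x.
  apply: cdiffD; last exact: cdiff_cst.
  by apply: cdiffD; [exact: cdiff_cst|apply: cdiffM; [exact: cdiff_id|exact: cdiff_cst]].
pose c k x y := q (lift i k) x y * (q i x y)^-1.
pose M := B / H + B ^+ D.
have sc k : sepdiff (c k) r M.
  move=> x y hx hy; split.
  - by apply: cdiffM => //; apply: cdiffV => //; exact: qi0.
  - apply: (cdiffM (dqx _ _ _)); apply: (@cdiffV _ ((q i)^~ y)) => //; exact: qi0.
  rewrite /M nmM nmV (@le_trans _ _ (B / H)) ?lerDl ?exprn_ge0 //.
  by apply: ler_pM; rewrite ?nm_ge0 ?invr_ge0 ?nm_ge0 ?qB // lef_pV2 ?qi // posrE nm_gt0 qi0.
have sh : sepdiff (fun x y => q i x y ^+ D) r M.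
  move=> x y hx hy; split; [exact: cdiffX|exact: (cdiffX D (dqx i x y))|].
  rewrite nmX /M (@le_trans _ _ (B ^+ D)) ?lerDr ?divr_ge0 ?(ltW H0) //.
  by rewrite lerXn2r ?nnegrE ?nm_ge0 // qB.
have q00 j : q j 0 0 = v ord0 j by rewrite /q !mul0r !addr0.
pose p := pt (v ord0 (lift i i0) / v ord0 i) (v ord0 (lift i i1) / v ord0 i).
have diffc : forall k x y, nm x < r -> nm y < r ->
   c k x y - v ord0 (lift i k) / v ord0 i =
   (x * (a ord0 (lift i k) * v ord0 i - v ord0 (lift i k) * a ord0 i) +
    y * (b ord0 (lift i k) * v ord0 i - v ord0 (lift i k) * b ord0 i)) / (q i x y * v ord0 i).
  by move=> k x y hx hy; apply: chart_difference => //; exact: qi0.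
pose A := \sum_(k < 2) (nm (a ord0 (lift i k) * v ord0 i - v ord0 (lift i k) * a ord0 i) +
   nm (b ord0 (lift i k) * v ord0 i - v ord0 (lift i k) * b ord0 i)).
have A0 : 0 <= A by apply: sumr_ge0 => j _; rewrite !addr_ge0 ?nm_ge0.
have up k x y : nm x < r -> nm y < r ->
   nm (c k x y - v ord0 (lift i k) / v ord0 i) <= A / (H * nm (v ord0 i)) * (nm x + nm y).
  move=> hx hy; rewrite diffc // nmM nmV nmM.
  set u1 := a ord0 _ * _ - _; set u2 := b ord0 _ * _ - _.
  have hA : nm u1 + nm u2 <= A.
    by rewrite /A (bigD1 k) //= lerDl sumr_ge0 // => j _; rewrite !addr_ge0 ?nm_ge0.
  have h1 : nm (x * u1 + y * u2) <= A * (nm x + nm y).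
    have := nmD (x * u1) (y * u2); rewrite !nmM.
    have := nm_ge0 x; have := nm_ge0 y; have := nm_ge0 u1; have := nm_ge0 u2; nra.
  rewrite mulrAC; apply: ler_pM; rewrite ?nm_ge0 //.
    by rewrite invr_ge0 mulr_ge0 ?nm_ge0.
  rewrite lef_pV2 ?posrE ?mulr_gt0 ?nm_gt0 ?qi0 //.
  by rewrite ler_wpM2r ?nm_ge0 ?qi.
(* A linear form vanishing at v is, after division by [q i], a combination of the two displacements
   in the chart. *)
have low (l : 'rV[C]_3) x y : nm x < r -> nm y < r -> \sum_(j < 3) l ord0 j * v ord0 j = 0 ->
   nm (\sum_(j < 3) l ord0 j * q j x y) <=
   B * (nm (l ord0 (lift i i0)) + nm (l ord0 (lift i i1))) * dist1 (pt (c i0 x y) (c i1 x y)) p.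
  move=> hx hy lv0; have qn := qi0 x y hx hy.
  have -> : \sum_(j < 3) l ord0 j * q j x y =
    q i x y * (l ord0 (lift i i0) * (c i0 x y - v ord0 (lift i i0) / v ord0 i) +
               l ord0 (lift i i1) * (c i1 x y - v ord0 (lift i i1) / v ord0 i)).
    move: lv0; rewrite !(sum_lift i) => lv0.
    have -> : l ord0 i = - (l ord0 (lift i i0) * v ord0 (lift i i0) + l ord0 (lift i i1) * v ord0 (lift i i1)) / v ord0 i.
      apply: (mulIf vi); rewrite mulfVK //; apply/eqP; rewrite -addr_eq0 -lv0; apply/eqP; ring.
    by rewrite /c; field; rewrite vi qn.
  rewrite /dist1 !pt0 !pt1; set e0 := c i0 x y - _; set e1 := c i1 x y - _.
  rewrite nmM -mulrA; apply: ler_pM; rewrite ?nm_ge0 ?qB //.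
  have := nmD (l ord0 (lift i i0) * e0) (l ord0 (lift i i1) * e1); rewrite !nmM.
  have := nm_ge0 (l ord0 (lift i i0)); have := nm_ge0 (l ord0 (lift i i1)).
  have := nm_ge0 e0; have := nm_ge0 e1; nra.
have lin (l : 'rV[C]_3) x y : \sum_(j < 3) l ord0 j * q j x y =
   \sum_(j < 3) l ord0 j * v ord0 j + x * \sum_(j < 3) l ord0 j * a ord0 j + y * \sum_(j < 3) l ord0 j * b ord0 j.
  by rewrite /q !big_ord_recl !big_ord0; ring.
pose L1 := B * (nm (la ord0 (lift i i0)) + nm (la ord0 (lift i i1))).
pose L2 := B * (nm (mu ord0 (lift i i0)) + nm (mu ord0 (lift i i1))).
pose L3 := A / (H * nm (v ord0 i)).
have L10 : 0 <= L1 by rewrite mulr_ge0 ?addr_ge0 ?nm_ge0.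
have L20 : 0 <= L2 by rewrite mulr_ge0 ?addr_ge0 ?nm_ge0.
have L30 : 0 <= L3 by rewrite divr_ge0 ?mulr_ge0 ?nm_ge0 // ltW.
have Lpos : 0 < L1 + L2 + 2 * L3 + 1 by lra.
have h00 : q i 0 0 ^+ D != 0 by rewrite q00 expf_neq0.
have cp : pt (c i0 0 0) (c i1 0 0) = p by rewrite /p /c !q00.
apply: (@quasihomogeneous_chart _ _ p _ (c i0) (c i1) (fun x y => q i x y ^+ D) r M
  (L1 + L2 + 2 * L3 + 1) hG r0 Lpos (sc i0) (sc i1) sh h00 cp).
move=> x y hx hy; set dd := dist1 _ _.
have dd0 : 0 <= dd := dist1_ge0 _ _.
have s0 : 0 <= nm x + nm y by rewrite addr_ge0 ?nm_ge0.
split.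
- have : dd <= L3 * (nm x + nm y) + L3 * (nm x + nm y).
    by rewrite /dd /dist1 /p !pt0 !pt1; apply: lerD; exact: up.
  have : 0 <= (L1 + L2 + 1) * (nm x + nm y) by rewrite mulr_ge0 // !addr_ge0.
  lra.
- have := low la x y hx hy lv; rewrite lin lv la1 lb mulr0 mulr1 add0r addr0 -/dd -/L1.
  have := low mu x y hx hy mv; rewrite lin mv ma mb mulr0 mulr1 !add0r -/dd -/L2.
  have : 0 <= (2 * L3 + 1) * dd by rewrite mulr_ge0 // !addr_ge0 // mulr_ge0.
  lra.
have e : v + x *: a + y *: b = q i x y *: chart i (pt (c i0 x y) (c i1 x y)).
  apply/rowP => j; rewrite !mxE; case: unliftP => [k ->|->]; last by rewrite mulr1.
  by move: k; apply: ord2; rewrite !mxE /= /c [RHS]mulrC mulfVK ?qi0.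
by rewrite e (evalv_scale _ _ hg).
Qed.

End Plane.

Local Close Scope classical_set_scope.

(** * Local divisibility *)

Section Bivariate.
Variable K : closedFieldType.
Local Notation BP := {poly {poly K}}.
Implicit Types (F G H : BP) (p q : {poly K}) (N m : nat).

(* In [BP] the inner variable is X and the outer one is Y. *)
Definition dX H : BP := map_poly (@deriv K) H.
Definition dY H : BP := deriv H.
Definition curve (x y : {poly K}) H : {poly K} := (map_poly (comp_poly x) H).[y].
(** Membership in the N-th power of the ideal (X, Y), read on coefficients. *)
Definition vanish N H : Prop := forall i j, (i + j < N)%N -> H`_j`_i = 0.

HB.instance Definition _ x y := GRing.RMorphism.copy (curve x y)
  (horner_eval y \o map_poly (comp_poly x)).

Lemma coef_dX H i : (dX H)`_i = (H`_i)^`().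
Proof. by rewrite coef_map_id0 // deriv0. Qed.

Lemma dXD F G : dX (F + G) = dX F + dX G.
Proof. by apply/polyP => i; rewrite !(coefD, coef_dX) derivD. Qed.

Lemma dXN F : dX (- F) = - dX F.
Proof. by apply/polyP => i; rewrite !(coefN, coef_dX) derivN. Qed.

Lemma dXM F G : dX (F * G) = dX F * G + F * dX G.
Proof.
apply/polyP => i; rewrite coefD coef_dX !coefM raddf_sum -big_split.
by apply: eq_bigr => k _; rewrite /= derivM !coef_dX.
Qed.

Lemma dYD F G : dY (F + G) = dY F + dY G. Proof. exact: derivD. Qed.
Lemma dYN F : dY (- F) = - dY F. Proof. exact: derivN. Qed.
Lemma dYM F G : dY (F * G) = dY F * G + F * dY G. Proof. exact: derivM. Qed.
Lemma dXC p : dX p%:P = p^`()%:P.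
Proof. by apply/polyP => i; rewrite coef_dX !coefC; case: eqP; rewrite ?deriv0. Qed.
Lemma dYC p : dY p%:P = 0. Proof. exact: derivC. Qed.
Lemma dXX : dX 'X = 0.
Proof. by apply/polyP => i; rewrite coef_dX coefX coef0; case: eqP; rewrite ?deriv0 ?derivC. Qed.
Lemma dYX : dY 'X = 1. Proof. exact: derivX. Qed.

Lemma curveC x y p : curve x y p%:P = p \Po x.
Proof. by rewrite /curve map_polyC hornerC. Qed.
Lemma curveX x y : curve x y 'X = y.
Proof. by rewrite /curve map_polyX hornerX. Qed.

Lemma curve_deriv x y H :
  (curve x y H)^`() = curve x y (dX H) * x^`() + curve x y (dY H) * y^`().
Proof.
elim/poly_ind: H => [|H p IH].
  by rewrite /dX /dY map_poly0 deriv0 rmorph0 deriv0 !mul0r addr0.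
rewrite dXD dYD dXM dYM dXX dYX dXC dYC !rmorphD !rmorphM !rmorph0 rmorph1 /= curveX !curveC.
by rewrite derivD derivM IH deriv_comp; ring.
Qed.

Lemma curve_at0 x y H : x.[0] = 0 -> y.[0] = 0 -> (curve x y H).[0] = H`_0`_0.
Proof.
move=> x0 y0; elim/poly_ind: H => [|H p IH]; first by rewrite rmorph0 horner0 coef0 coef0.
rewrite rmorphD rmorphM /= curveX curveC hornerD hornerM y0 mulr0 add0r.
by rewrite horner_comp x0 coefD coefMX coefC /= add0r horner_coef0.
Qed.

Lemma vanishD N F G : vanish N F -> vanish N G -> vanish N (F + G).
Proof. by move=> hF hG i j ij; rewrite !coefD hF // hG // addr0. Qed.

Lemma vanishN N F : vanish N F -> vanish N (- F).
Proof. by move=> hF i j ij; rewrite !coefN hF // oppr0. Qed.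

Lemma vanishB N F G : vanish N F -> vanish N G -> vanish N (F - G).
Proof. by move=> hF hG; apply: vanishD => //; exact: vanishN. Qed.

Lemma vanishMl N F G : vanish N F -> vanish N (G * F).
Proof.
move=> hF i j ij; rewrite coefM coef_sum big1 // => k _; rewrite coefM big1 // => l _.
rewrite hF ?mulr0 //; apply: leq_ltn_trans ij.
by apply: leq_add; apply: leq_subr.
Qed.

Lemma vanishW N M F : (M <= N)%N -> vanish N F -> vanish M F.
Proof. by move=> MN hF i j ij; apply: hF; apply: leq_trans MN. Qed.

Lemma vanish_dX N F : vanish N F -> vanish N.-1 (dX F).
Proof.
move=> hF i j ij; rewrite coef_dX coef_deriv hF ?mul0rn //.
by move: ij; case: N {hF} => // N /=; rewrite addSn ltnS.
Qed.

Lemma vanish_dY N F : vanish N F -> vanish N.-1 (dY F).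
Proof.
move=> hF i j ij; rewrite /dY coef_deriv coefMn hF ?mul0rn //.
by move: ij; case: N {hF} => // N /=; rewrite addnS ltnS.
Qed.

Lemma vanish_curve N x y F : 'X %| x -> 'X %| y -> vanish N F -> 'X^N %| curve x y F.
Proof.
move=> hx hy hF; rewrite /curve horner_coef.
apply: (big_ind (fun p => 'X^N %| p)) => [|p q|j _]; [exact: dvdp0|exact: dvdp_add|].
rewrite coef_map_id0 ?comp_poly0 // comp_polyE mulr_suml.
apply: (big_ind (fun p => 'X^N %| p)) => [|p q|i _]; [exact: dvdp0|exact: dvdp_add|].
have [ij|ij] := ltnP (i + j) N; first by rewrite hF // scale0r mul0r dvdp0.
rewrite -scalerAl -mul_polyC; apply: dvdp_mull.
apply: (dvdp_trans (dvdp_exp2l _ ij)); rewrite exprD.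
by apply: dvdp_mul; apply: dvdp_exp2r.
Qed.

Lemma divides_X H : (forall j, H`_j`_0 = 0) -> exists G, H = 'X%:P * G.
Proof.
move=> h; exists (map_poly (fun p => drop_poly 1 p) H); apply/polyP => j.
rewrite coefCM coef_map_id0 ?drop_poly0r //; apply/polyP => i.
by rewrite coefXM coef_drop_poly; case: i => [|i] /=; rewrite ?h ?addn1.
Qed.

Lemma vanish_divX N H : vanish N.+1 ('X%:P * H) -> vanish N H.
Proof.
move=> h i j ij; have := h i.+1 j; rewrite coefCM coefXM /=; apply.
by rewrite addSn ltnS.
Qed.

Lemma vanish_lift N p : 'X^N %| p -> vanish N (map_poly (@polyC K) p).
Proof.
move=> /dvdpP[q ->] i j ij; rewrite coef_map /= coefC coefMXn.
by case: i ij => //= ; rewrite add0n => ->.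
Qed.

Lemma dvd_Xn_mul N p q : p != 0 -> 'X^N %| p * q -> 'X^(N - mup 0 p) %| q.
Proof.
move=> p0; have Xe k : 'X^k = ('X - 0%:P) ^+ k :> {poly K} by rewrite subr0.
have [->|q0] := eqVneq q 0; first by rewrite dvdp0.
by rewrite !Xe -!mup_geq ?mulf_neq0 // mupM // leq_subLR.
Qed.

Lemma mup_Xn m : mup 0 ('X^m : {poly K}) = m.
Proof. by have := @mup_XsubCX K m 0 0; rewrite subr0 eqxx. Qed.

Lemma dvd_Xn_unit N p q : p.[0] != 0 -> 'X^N %| p * q -> 'X^N %| q.
Proof.
move=> p0 /dvd_Xn_mul h; have := h _; rewrite mupNroot ?subn0; last by rewrite rootE.
by apply; apply: contraNneq p0 => ->; rewrite horner0.
Qed.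

Definition at_X0 H : {poly K} := map_poly (horner_eval 0) H.

Lemma at_X0M F G : at_X0 (F * G) = at_X0 F * at_X0 G.
Proof. exact: rmorphM. Qed.

Lemma coef_at_X0 H j : (at_X0 H)`_j = H`_j`_0.
Proof. by rewrite coef_map /= /horner_eval horner_coef0. Qed.

Lemma dvdXnP N p : reflect (forall i, (i < N)%N -> p`_i = 0) ('X^N %| p).
Proof.
apply: (iffP idP) => [/dvdpP[q ->] i iN|h]; first by rewrite coefMXn iN.
rewrite -[p](poly_take_drop N) dvdp_addr ?dvdp_mull //.
suff -> : take_poly N p = 0 by rewrite dvdp0.
by apply/polyP => i; rewrite coef_take_poly coef0; case: ifP => // /h.
Qed.

(** Restricting to X = 0 shows F1(0, Y) G(0, Y) = 0 modulo Y^N, so G(0, Y) vanishes to order N minus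
    the order of F1(0, Y). Removing it leaves a multiple of X; dividing by X costs one order
    more. *)
Lemma cancel_X F1 : at_X0 F1 != 0 -> exists o, forall N D G,
  vanish N ('X%:P * D - F1 * G) -> exists G', vanish (N - o) (D - F1 * G').
Proof.
move=> F10; set o := mup 0 (at_X0 F1); exists o.+1 => N D G h.
have h0 : 'X^(N - o) %| at_X0 G.
  apply: dvd_Xn_mul => //; apply/dvdXnP => j jN.
  have := h 0%N j; rewrite -at_X0M coef_at_X0 add0n => /(_ jN).
  rewrite !coefB coefCM coefXM /= sub0r => /eqP; rewrite oppr_eq0 => /eqP ->.
  by [].
pose G0 := map_poly (@polyC K) (at_X0 G).
have [j|G1 hG] := @divides_X (G - G0).
  by rewrite !coefB coef_map /= coefC /= coef_at_X0 subrr.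
exists G1; rewrite subnS; move: (N - o)%N (leq_subr o N) h0 => [|n] nN h0 //.
apply: vanish_divX.
have -> : 'X%:P * (D - F1 * G1) = ('X%:P * D - F1 * G) + F1 * G0.
  have -> : G = G0 + 'X%:P * G1 by rewrite -hG addrC subrK.
  ring.
apply: vanishD; first exact: vanishW h.
by apply: vanishMl; exact: vanish_lift.
Qed.

Lemma vanish_Xn N : vanish N ('X^N)%:P.
Proof.
move=> i j ij; rewrite coefC; case: eqP => [j0|_]; last by rewrite coef0.
by rewrite coefXn; case: eqP => // iN; move: ij; rewrite iN j0 addn0 ltnn.
Qed.

(** For z != 0 the factor X - z is a unit modulo X^N, its inverse being a geometric sum: no order is
    lost. *)
Lemma cancel_XsubC F1 (z : K) N D G : z != 0 ->
  vanish N (('X - z%:P)%:P * D - F1 * G) -> exists G', vanish N (D - F1 * G').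
Proof.
move=> z0 h; pose S : {poly K} := \sum_(i < N) 'X^(N.-1 - i) * z%:P ^+ i.
have hS : ('X - z%:P) * S = 'X^N - (z ^+ N)%:P by rewrite polyC_exp subrXX.
exists (- ((z ^+ N)^-1)%:P%:P * S%:P * G).
have zN : (((z ^+ N)^-1)%:P%:P : BP) * (z ^+ N)%:P%:P = 1.
  by rewrite -!polyCM mulVf ?expf_neq0.
have hS' : (('X - z%:P)%:P : BP) * S%:P = ('X^N)%:P - (z ^+ N)%:P%:P.
  by rewrite -polyCM hS rmorphB.
set Z := ((z ^+ N)^-1)%:P%:P in zN *; set Z' := (z ^+ N)%:P%:P in zN hS'.
have -> : D - F1 * (- Z * S%:P * G) = Z * (D * ('X^N)%:P) - Z * S%:P * (('X - z%:P)%:P * D - F1 * G).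
  have -> : Z * S%:P * (('X - z%:P)%:P * D - F1 * G) =
    Z * (('X - z%:P)%:P * S%:P) * D - Z * S%:P * F1 * G by ring.
  rewrite hS'; have -> : Z * (('X^N)%:P - Z') * D = Z * 'X^N%:P * D - (Z * Z') * D by ring.
  by rewrite zN; ring.
apply: vanishB; last exact: vanishMl.
by do 2!apply: vanishMl; exact: vanish_Xn.
Qed.

(** The linear factors of p are cancelled one at a time. The total loss [o] is chosen before N, as
    the local argument requires. *)
Lemma cancel_polyX F1 p : at_X0 F1 != 0 -> p != 0 -> exists o, forall N D G,
  vanish N (p%:P * D - F1 * G) -> exists G', vanish (N - o) (D - F1 * G').
Proof.
move=> F10; have [s ->] := closed_field_poly_normal p.
set c := lead_coef p => p0; have {p0} c0 : c != 0.
  by apply: contraNneq p0 => ->; rewrite scale0r.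
elim: s => [|z s [o ho]].
  exists 0%N => N D G; rewrite big_nil subn0 => h; exists ((c^-1)%:P%:P * G).
  have cc : ((c^-1)%:P%:P : BP) * (c *: 1)%:P = 1.
    by rewrite -polyCM -mul_polyC mulr1 -polyCM mulVf.
  have -> : D - F1 * ((c^-1)%:P%:P * G) = (c^-1)%:P%:P * ((c *: 1)%:P * D - F1 * G).
    rewrite mulrBr [X in _ = X - _]mulrA cc; ring.
  exact: vanishMl.
have [o1 ho1] := cancel_X F10.
have [->|z0] := eqVneq z 0.
  exists (o + o1)%N => N D G; rewrite big_cons subr0 scalerAr.
  have -> (q : {poly K}) : ('X * q)%:P * D - F1 * G = 'X%:P * (q%:P * D) - F1 * G.
    by rewrite polyCM mulrA.
  by move=> /ho1[G' /ho[G'' h]]; exists G''; rewrite addnC subnDA.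
exists o => N D G; rewrite big_cons scalerAr.
have -> (q r : {poly K}) : (q * r)%:P * D - F1 * G = q%:P * (r%:P * D) - F1 * G.
  by rewrite polyCM mulrA.
by move=> /(cancel_XsubC z0)[G' /ho].
Qed.

Lemma curve_coef1 x y H : 'X %| x -> 'X %| y ->
  (curve x y H)`_1 = (dX H)`_0`_0 * x`_1 + (dY H)`_0`_0 * y`_1.
Proof.
move=> /dvdpP[x' ex] /dvdpP[y' ey].
have x0 : x.[0] = 0 by rewrite ex hornerM hornerX mulr0.
have y0 : y.[0] = 0 by rewrite ey hornerM hornerX mulr0.
have d1 p : p^`().[0] = p`_1 by rewrite horner_coef0 coef_deriv.
by rewrite -d1 curve_deriv hornerD !hornerM !d1 !curve_at0.
Qed.

(* A truncated Euler field: it fixes the origin with invertible linear part and preserves [F] modulo order [N]. *)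
Definition flow_adapted F N (c1 c2 e : BP) : Prop :=
  [/\ c1`_0`_0 = 0, c2`_0`_0 = 0,
      (dX c1)`_0`_0 * (dY c2)`_0`_0 - (dY c1)`_0`_0 * (dX c2)`_0`_0 != 0 &
      vanish N (c1 * dX F + c2 * dY F - e * F)].

(** Here theta = (th1, th2) is tangent to F1 = 0 and chi = (c1, c2) is the Euler field of F1 F2.
    Both being tangent to F1, their determinant D satisfies F2 D = F1 H up to high order. Along the
    curve, chi F2 and the products of D with the derivatives of F2 then vanish to order m, and
    Cramer's rule recovers theta F2 up to a factor with a simple zero. *)
Lemma local_divisibility F1 F2 p U V A th1 th2 m :
  p != 0 -> p%:P = U * F1 + V * dY F1 -> at_X0 F1 != 0 ->
  th1 * dX F1 + th2 * dY F1 = A * F1 ->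
  (forall N, exists c1 c2 e, flow_adapted (F1 * F2) N c1 c2 e) ->
  exists M, forall x y phi : {poly K},
    'X %| x -> 'X %| y -> (x`_1 != 0) || (y`_1 != 0) ->
    'X^M %| curve x y F2 -> curve x y F1 = 'X^m * phi -> phi.[0] != 0 ->
    'X^(m.-1) %| curve x y (th1 * dX F2 + th2 * dY F2).
Proof.
move=> p0 hp F10 hA hflow; have [o ho] := cancel_polyX F10 p0.
(* After the loss of [o] in cancelling p, order 2 m + 1 remains: m to divide by F1 along the curve,
   one for a derivative, and m for the conclusion. *)
pose M := (m + m + o).+1; exists M => x y phi x0 y0 xy1 hF2 hF1 phi0.
have [c1 [c2 [e [c10 c20 hJ hc]]]] := hflow M.
pose chi H := c1 * dX H + c2 * dY H.
pose D := th1 * c2 - th2 * c1.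
pose E := c1 * dX (F1 * F2) + c2 * dY (F1 * F2) - e * (F1 * F2).
have EE : E = F1 * chi F2 + F2 * chi F1 - e * (F1 * F2).
  by rewrite /E dXM dYM /chi; ring.
(* Modulo E the right side is a multiple of F1. Since p is a combination of F1 and dY F1, the same
   holds for p F2 D. *)
have ring_E : F2 * D * dY F1 = F1 * (th1 * (e * F2 - chi F2) - c1 * F2 * A) + th1 * E.
  have -> : F2 * D * dY F1 = th1 * (F2 * chi F1) - c1 * F2 * (th1 * dX F1 + th2 * dY F1).
    by rewrite /D /chi; ring.
  by rewrite hA EE; ring.
pose G := V * (th1 * (e * F2 - chi F2) - c1 * F2 * A) + F2 * D * U.
have hG : vanish M (p%:P * (F2 * D) - F1 * G).
  have -> : p%:P * (F2 * D) - F1 * G = V * (th1 * E).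
    rewrite hp /G; have -> : (U * F1 + V * dY F1) * (F2 * D) = U * F1 * (F2 * D) + V * (F2 * D * dY F1) by ring.
    by rewrite ring_E; ring.
  by do 2!apply: vanishMl; exact: hc.
have [H hH] := ho _ _ _ hG.
have Mo : (M - o = (m + m).+1)%N by rewrite /M -addSn addnK.
rewrite Mo in hH.
have cur N F : vanish N F -> 'X^N %| curve x y F by exact: vanish_curve.
have le_dvd (a b : nat) (q : {poly K}) : (a <= b)%N -> 'X^b %| q -> 'X^a %| q.
  by move=> ab; apply: dvdp_trans; exact: dvdp_exp2l.
have mM : (m + m < M)%N by rewrite /M ltnS leq_addr.
have cancel_phi N q : 'X^N %| 'X^m * phi * q -> 'X^(N - m) %| q.
  rewrite -mulrA => h; apply: (dvd_Xn_unit phi0).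
  have Xm0 : 'X^m != 0 :> {poly K} by rewrite expf_neq0 // polyX_eq0.
  by have := dvd_Xn_mul Xm0 h; rewrite mup_Xn.
have hchi : 'X^m %| curve x y (chi F2).
  have : 'X^(m + m) %| 'X^m * phi * curve x y (chi F2).
    rewrite -hF1 -rmorphM; have -> : F1 * chi F2 = E - F2 * (chi F1 - e * F1) by rewrite EE; ring.
    rewrite rmorphB rmorphM /= dvdp_sub //; first by apply: le_dvd (cur _ _ hc); exact: ltnW.
    by apply: dvdp_mulr; apply: le_dvd hF2; exact: ltnW.
  by move=> /cancel_phi; rewrite addnK.
have hHc : 'X^m %| curve x y H.
  have : 'X^(m + m) %| 'X^m * phi * curve x y H.
    rewrite -hF1 -rmorphM; have -> : F1 * H = F2 * D - (F2 * D - F1 * H) by ring.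
    rewrite rmorphB rmorphM /= dvdp_sub //; last by apply: le_dvd (cur _ _ hH).
    by apply: dvdp_mulr; apply: le_dvd hF2; exact: ltnW.
  by move=> /cancel_phi; rewrite addnK.
(* The relation F2 D = F1 H is differentiated before restriction to the curve, on which F1, H and F2
   all vanish to order m. *)
have hDer (d : BP -> BP) : (forall F G, d (F + G) = d F + d G) -> (forall F, d (- F) = - d F) ->
    (forall F G, d (F * G) = d F * G + F * d G) -> (forall N F, vanish N F -> vanish N.-1 (d F)) ->
    'X^m %| curve x y (d F2 * D).
  move=> dD dN dM dv; have := cur _ _ (dv _ _ hH); rewrite /= => h.
  have -> : d F2 * D = d (F2 * D - F1 * H) - F2 * d D + d F1 * H + F1 * d H.
    by rewrite dD dN !dM; ring.
  rewrite !rmorphD rmorphN !rmorphM /= hF1.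
  do !apply: dvdp_add.
  - by apply: le_dvd h; exact: leq_addr.
  - rewrite dvdpNr; apply: dvdp_mulr; apply: le_dvd hF2; apply: ltnW; apply: leq_ltn_trans mM; exact: leq_addr.
  - exact: dvdp_mull.
  - by rewrite -mulrA dvdp_mulr.
have hX := hDer dX dXD dXN dXM vanish_dX.
have hY := hDer dY dYD dYN dYM vanish_dY.
pose W := th1 * dX F2 + th2 * dY F2.
(* Cramer's rule: W c1 and W c2 are combinations of chi F2 and of the derivatives of F2 times D. *)
have W1 : 'X^m %| curve x y (W * c1).
  have -> : W * c1 = chi F2 * th1 - dY F2 * D by rewrite /W /chi /D; ring.
  by rewrite rmorphB /= dvdp_sub // rmorphM dvdp_mulr.
have W2 : 'X^m %| curve x y (W * c2).
  have -> : W * c2 = chi F2 * th2 + dX F2 * D by rewrite /W /chi /D; ring.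
  by rewrite rmorphD /= dvdp_add // rmorphM dvdp_mulr.
have [x00 y00] : x.[0] = 0 /\ y.[0] = 0.
  by move: x0 y0 => /dvdpP[x' ->] /dvdpP[y' ->]; rewrite !hornerM hornerX !mulr0.
(* The curve is immersed and chi has invertible linear part, so c1 or c2 has a simple zero along it;
   this is the one order lost in m - 1. *)
have fin (c : BP) : c`_0`_0 = 0 -> (curve x y c)`_1 != 0 -> 'X^m %| curve x y (W * c) -> 'X^(m.-1) %| curve x y W.
  move=> c0 c1n; have /dvdpP[q hq] : 'X %| curve x y c.
    by rewrite -['X]subr0 dvdp_XsubCl rootE curve_at0 // c0.
  rewrite rmorphM /= hq => h; have q0 : q.[0] != 0.
    by move: c1n; rewrite hq coefMX /= horner_coef0.
  apply: (dvd_Xn_unit q0); rewrite -subn1 -(mup_Xn 1); apply: dvd_Xn_mul.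
    by rewrite expr1 polyX_eq0.
  by move: h; set w := curve x y W; have -> : w * (q * 'X) = 'X^1 * (q * w) by rewrite expr1; ring.
have [n1|] := boolP ((curve x y c1)`_1 == 0); last by move=> n1; exact: fin W1.
have [n2|] := boolP ((curve x y c2)`_1 == 0); last by move=> n2; exact: fin W2.
move: n1 n2 hJ; rewrite !curve_coef1 //.
set a11 := (dX c1)`_0`_0; set a12 := (dY c1)`_0`_0.
set a21 := (dX c2)`_0`_0; set a22 := (dY c2)`_0`_0 => /eqP n1 /eqP n2 hJ'; exfalso.
have k1 : (a11 * a22 - a12 * a21) * x`_1 = 0.
  have -> : (a11 * a22 - a12 * a21) * x`_1 = a22 * (a11 * x`_1 + a12 * y`_1) - a12 * (a21 * x`_1 + a22 * y`_1) by ring.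
  by rewrite n1 n2 !mulr0 subrr.
have k2 : (a11 * a22 - a12 * a21) * y`_1 = 0.
  have -> : (a11 * a22 - a12 * a21) * y`_1 = a11 * (a21 * x`_1 + a22 * y`_1) - a21 * (a11 * x`_1 + a12 * y`_1) by ring.
  by rewrite n1 n2 !mulr0 subrr.
move: k1 k2 xy1 => /eqP + /eqP; rewrite !mulf_eq0.
by rewrite (negPf hJ') /= => -> ->.
Qed.

End Bivariate.

(** * Taylor polynomials of germs and truncated Euler fields *)

Section Flow.
Variable R : realType.
Local Notation C := (Cplx R).
Local Notation BP := {poly {poly C}}.
Implicit Types (H T : BP) (p : {poly C}).

Lemma poly_zero_everywhere (p : {poly C}) : (forall x, p.[x] = 0) -> p = 0.
Proof.
move=> h; apply: (@roots_geq_poly_eq0 _ p [seq (i%:R : C) | i <- iota 0 (size p)]).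
- by apply/allP => x _; rewrite rootE h.
- by rewrite map_inj_uniq ?iota_uniq // => i j /eqP; rewrite eqr_nat => /eqP.
by rewrite size_map size_iota.
Qed.

Lemma cdiff_poly p (z : C) : cdiff (fun x => p.[x]) z.
Proof.
elim/poly_ind: p => [|p c IH].
  by apply: (@cdiff_eq _ (fun=> 0) _ _ 1 ltr01) => [w _|]; [rewrite horner0|exact: cdiff_cst].
apply: (@cdiff_eq _ (fun x => p.[x] * x + c) _ _ 1 ltr01) => [w _|]; first by rewrite !hornerE.
by apply: cdiffD; [apply: cdiffM => //; exact: cdiff_id|exact: cdiff_cst].
Qed.

Lemma small_poly N p (K d : R) : 0 < d ->
  (forall s, s != 0 -> nm s < d -> nm p.[s] <= K * nm s ^+ N) -> 'X^N %| p.
Proof.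
elim: N p => [|N IH] p d0 h; first by rewrite expr0 dvd1p.
have p0 : p.[0] = 0.
  apply/eqP; rewrite -nm_eq0 eq_le nm_ge0 andbT.
  apply: (@le_eps _ _ _ (1 + `|K|)) => e e0 e1; rewrite add0r.
  have m0 : 0 < Num.min d e by rewrite lt_min d0.
  have [w [w0 +]] := ccont_near (cdiff_cont (cdiff_poly p 0)) e0 m0.
  rewrite subr0 lt_min => /andP[wd we] hw.
  have hK : nm p.[w] <= `|K| * e.
    apply: (le_trans (h w w0 wd)); apply: (@le_trans _ _ (`|K| * nm w ^+ N.+1)).
      by rewrite ler_wpM2r ?ler_norm ?exprn_ge0 ?nm_ge0.
    rewrite ler_wpM2l // exprS -[X in _ <= X]mulr1; apply: ler_pM; rewrite ?nm_ge0 ?exprn_ge0 ?nm_ge0 //.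
      exact: ltW.
    by rewrite exprn_ile1 ?nm_ge0 // ltW // (lt_le_trans we).
  have := nm_sub_ge p.[0] p.[w]; rewrite (nmB p.[0]); lra.
have /dvdpP[q hq] : 'X %| p by rewrite -['X]subr0 dvdp_XsubCl rootE p0.
rewrite hq exprSr dvdp_mul2r ?polyX_eq0 //; apply: (IH q) => // s s0 sd.
have := h s s0 sd; rewrite hq hornerM hornerX nmM exprSr mulrA.
by rewrite ler_pM2r // nm_gt0.
Qed.

Lemma ev2_curve x y H (s : C) : (curve x y H).[s] = ev2 H x.[s] y.[s].
Proof.
rewrite /ev2; elim/poly_ind: H => [|H p IH]; first by rewrite rmorph0 !horner0.
by rewrite rmorphD rmorphM /= curveX curveC !hornerE horner_comp IH.
Qed.

Lemma coef_comp_scale p (a : C) k : (p \Po (a *: 'X))`_k = p`_k * a ^+ k.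
Proof.
rewrite comp_polyE coef_sum.
rewrite (eq_bigr (fun i : 'I__ => if i == k :> nat then p`_k * a ^+ k else 0)); last first.
  move=> i _; rewrite exprZn coefZ coefZ coefXn [k == i]eq_sym.
  by case: eqP => [->|_]; rewrite ?mulr1 ?mulr0.
have [kp|kp] := ltnP k (size p).
  by rewrite (bigD1 (Ordinal kp)) //= eqxx big1 ?addr0 // => i /eqP ik; case: eqP => // e; case: ik; apply: val_inj.
by rewrite big1 ?nth_default ?mul0r // => i _; case: eqP.
Qed.

Lemma coef_curve_line H (a : C) k : (curve (a *: 'X) 'X H)`_k =
  \sum_(j < size H) (if (k < j)%N then 0 else H`_j`_(k - j) * a ^+ (k - j)).
Proof.
rewrite /curve horner_coef coef_sum.
have sz : (size (map_poly (comp_poly (a *: 'X)) H) <= size H)%N by exact: size_poly.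
rewrite (big_ord_widen _ (fun i => ((map_poly (comp_poly (a *: 'X)) H)`_i * 'X^i)`_k) sz).
rewrite big_mkcond; apply: eq_bigr => j _ /=; rewrite coefMXn coef_map_id0 ?comp_poly0 // coef_comp_scale.
case: ifP => // /negbT; rewrite -leqNgt => hj.
have : (map_poly (comp_poly (a *: 'X)) H)`_j = 0 by rewrite nth_default.
by rewrite coef_map_id0 ?comp_poly0 // => h; case: ifP => // _; rewrite -coef_comp_scale h coef0.
Qed.

(** On the line x = a y the coefficient of order i + j is a polynomial in a that vanishes for every
    a; each coefficient of H in that total degree is one of its coefficients. *)
Lemma small_vanish N H (K d : R) : 0 < d ->
  (forall x y, nm x < d -> nm y < d -> nm (ev2 H x y) <= K * (nm x + nm y) ^+ N) ->
  vanish N H.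
Proof.
move=> d0 h i j ij.
pose Q k : {poly C} := \sum_(j < size H) (if (k < j)%N then 0 else H`_j`_(k - j) *: 'X^(k - j)).
have Q0 : Q (i + j)%N = 0.
  apply: poly_zero_everywhere => a.
  have -> : (Q (i + j)%N).[a] = (curve (a *: 'X) 'X H)`_(i + j).
    rewrite coef_curve_line horner_sum; apply: eq_bigr => l _.
    by case: ifP => _; rewrite ?horner0 // hornerZ hornerXn.
  have a1 : 0 < nm a + 1 by rewrite ltr_wpDl ?nm_ge0 // ltr01.
  have /dvdXnP : 'X^N %| curve (a *: 'X) 'X H; last by apply.
  have d'0 : 0 < Num.min d (d / (nm a + 1)) by rewrite lt_min d0 divr_gt0.
  apply: (small_poly (K := K * (nm a + 1) ^+ N) d'0) => s s0.
  rewrite lt_min ltr_pdivlMr // => /andP[sd sa].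
  rewrite ev2_curve hornerZ hornerX; apply: (le_trans (h _ _ _ _)) => //.
    rewrite nmM mulrC; apply: le_lt_trans sa; rewrite ler_wpM2l ?nm_ge0 //.
    by rewrite lerDl.
  by rewrite nmM -[X in _ + X]mul1r -mulrDl exprMn mulrA.
have [jH|jH] := ltnP j (size H); last by rewrite [H`_j]nth_default // coef0.
move/(congr1 (fun q : {poly C} => q`_i)): Q0; rewrite coef0 coef_sum (bigD1 (Ordinal jH)) //=.
rewrite ltnNge leq_addl /= addnK coefZ coefXn eqxx mulr1 big1 ?addr0 // => l lj.
case: ifP => [_|/negbT]; rewrite ?coef0 // -leqNgt => hl; rewrite coefZ coefXn.
case: eqP => [e|]; rewrite ?mulr0 // ; case/eqP: lj; apply: val_inj => /=; lia.
Qed.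

(** The bound on g itself is included so that the notion is stable under products. *)
Definition approx N (g : C -> C -> C) T := exists K d : R, 0 < d /\
  forall x y, nm x < d -> nm y < d ->
    nm (g x y) <= K /\ nm (g x y - ev2 T x y) <= K * (nm x + nm y) ^+ N.

Lemma ev2D T U x y : ev2 (T + U) x y = ev2 T x y + ev2 U x y.
Proof. by rewrite /ev2 !hornerD. Qed.
Lemma ev2M T U x y : ev2 (T * U) x y = ev2 T x y * ev2 U x y.
Proof. by rewrite /ev2 !hornerM. Qed.
Lemma ev2N T x y : ev2 (- T) x y = - ev2 T x y.
Proof. by rewrite /ev2 !hornerN. Qed.
Lemma ev2C (c x y : C) : ev2 c%:P%:P x y = c.
Proof. by rewrite /ev2 !hornerC. Qed.

Lemma approxD N g h T U : approx N g T -> approx N h U ->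
  approx N (fun x y => g x y + h x y) (T + U).
Proof.
move=> [K [d [d0 hg]]] [L [e [e0 hh]]]; exists (K + L), (Num.min d e).
split; first by rewrite lt_min d0.
move=> x y; rewrite !lt_min => /andP[xd xe] /andP[yd ye].
have [g1 g2] := hg x y xd yd; have [h1 h2] := hh x y xe ye.
split; first by rewrite (le_trans (nmD _ _)) ?lerD.
rewrite ev2D (_ : _ - _ = (g x y - ev2 T x y) + (h x y - ev2 U x y)); last by ring.
by rewrite (le_trans (nmD _ _)) // mulrDl lerD.
Qed.

Lemma approxM N g h T U : approx N g T -> approx N h U ->
  approx N (fun x y => g x y * h x y) (T * U).
Proof.
move=> [K [d [d0 hg]]] [L [e [e0 hh]]].
exists (K * L + (K + K * 2 ^+ N) * L), (Num.min (Num.min d e) 1).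
split; first by rewrite !lt_min d0 e0 ltr01.
move=> x y; rewrite !lt_min => /andP[/andP[xd xe] x1] /andP[/andP[yd ye] y1].
have [g1 g2] := hg x y xd yd; have [h1 h2] := hh x y xe ye.
have K0 : 0 <= K := le_trans (nm_ge0 _) g1.
have L0 : 0 <= L := le_trans (nm_ge0 _) h1.
have S0 : 0 <= nm x + nm y by rewrite addr_ge0 ?nm_ge0.
have S2 : (nm x + nm y) ^+ N <= 2 ^+ N by rewrite lerXn2r ?nnegrE //; lra.
have KK : 0 <= K * 2 ^+ N by rewrite mulr_ge0 // exprn_ge0.
have T1 : nm (ev2 T x y) <= K + K * 2 ^+ N.
  have := nmD (- (g x y - ev2 T x y)) (g x y); rewrite nmN opprB subrK.
  by have := ler_wpM2l K0 S2; lra.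
split.
  rewrite nmM (@le_trans _ _ (K * L)) ?ler_pM ?nm_ge0 // lerDl mulr_ge0 // addr_ge0 //.
rewrite ev2M (_ : _ - _ = (g x y - ev2 T x y) * h x y + ev2 T x y * (h x y - ev2 U x y)); last by ring.
rewrite (le_trans (nmD _ _)) // [X in _ <= X]mulrDl !nmM; apply: lerD.
  by rewrite mulrAC ler_pM ?nm_ge0.
by rewrite -mulrA ler_pM ?nm_ge0.
Qed.

Lemma approxC N c : approx N (fun _ _ => c) c%:P%:P.
Proof.
exists (nm c), 1; split=> // x y _ _; split=> //.
by rewrite ev2C subrr nm0 mulr_ge0 ?nm_ge0 // exprn_ge0 // addr_ge0 ?nm_ge0.
Qed.

Lemma approx_jets N g (r M : R) : 0 < r -> sepdiff g r M -> exists T, approx N g T.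
Proof.
move=> r0 hg; have [T [K [d d0 hd]]] := jets N r0 hg; exists T, (`|M| + `|K|), (Num.min r d).
split; first by rewrite lt_min r0.
move=> x y; rewrite !lt_min => /andP[xr xd] /andP[yr yd].
have [_ _ hM] := hg x y xr yr; split.
  by rewrite (le_trans hM) // (le_trans (ler_norm _)) // lerDl.
apply: (le_trans (hd x y xd yd)); rewrite ler_wpM2r ?exprn_ge0 ?addr_ge0 ?nm_ge0 //.
by rewrite (le_trans (ler_norm _)) // lerDr.
Qed.

Lemma approx_vanish N g T U : approx N g T -> approx N g U -> vanish N (T - U).
Proof.
move=> [K [d [d0 hg]]] [L [e [e0 hh]]].
have m0 : 0 < Num.min d e by rewrite lt_min d0.
apply: (@small_vanish N (T - U) (K + L) _ m0) => x y.
rewrite !lt_min => /andP[xd xe] /andP[yd ye].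
have [g1 g2] := hg x y xd yd; have [h1 h2] := hh x y xe ye.
rewrite ev2D ev2N (_ : _ - _ = - (g x y - ev2 T x y) + (g x y - ev2 U x y)); last by ring.
by rewrite (le_trans (nmD _ _)) // nmN mulrDl lerD.
Qed.

Definition iota2 : {rmorphism C -> BP} := (@polyC {poly C}) \o (@polyC C).

Lemma approx_mmap N (g h : C -> C -> C) T U (W : Cpoly R 2) : approx N g T -> approx N h U ->
  approx N (fun x y => evalv W (pt (g x y) (h x y))) (mmap iota2 (fun i => if i == ord0 then T else U) W).
Proof.
move=> hg hh; elim/mpoly_closure_ind: W => [c|i|p q hp hq|p q hp hq].
- rewrite mmapC; have := approxC N c; congr approx; apply: funext => x; apply: funext => y.
  by rewrite /evalv mevalC.
- rewrite mmap_U; have e : (fun x y => evalv (mpolyX C (mnm1 i)) (pt (g x y) (h x y))) = if i == ord0 then g else h.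
    apply: funext => x; apply: funext => y; rewrite /evalv mevalXU mxE; by case: ifP.
  by rewrite e; case: ifP.
- rewrite mmapD; have := approxD hp hq; congr approx; apply: funext => x; apply: funext => y.
  by rewrite /evalv mevalD.
rewrite rmorphM; have := approxM hp hq; congr approx; apply: funext => x; apply: funext => y.
by rewrite /evalv mevalM.
Qed.

Lemma ev2_00 T : ev2 T 0 0 = T`_0`_0.
Proof. by rewrite /ev2 horner_coef0 horner_coef0. Qed.

Lemma approx_at0 N g T : approx N.+1 g T -> T`_0`_0 = g 0 0.
Proof.
move=> [K [d [d0 /(_ 0 0)]]]; rewrite nm0 => /(_ d0 d0)[_].
rewrite addr0 expr0n mulr0 => h; apply/esym/eqP; rewrite -subr_eq0 -nm_eq0 -ev2_00.
by rewrite eq_le h nm_ge0.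
Qed.

End Flow.

Section Flow.
Variable R : realType.
Local Notation C := (Cplx R).
Local Notation BP := {poly {poly C}}.
Implicit Types (H T : BP) (p : {poly C}).

Definition c00 (H : BP) : C := H`_0`_0.
Lemma c00M (F G : BP) : c00 (F * G) = c00 F * c00 G. Proof. by rewrite /c00 !coef0M. Qed.
Lemma c00D (F G : BP) : c00 (F + G) = c00 F + c00 G. Proof. by rewrite /c00 !coefD. Qed.
Lemma c00N (F : BP) : c00 (- F) = - c00 F. Proof. by rewrite /c00 !coefN. Qed.
Lemma c00C (c : C) : c00 c%:P%:P = c. Proof. by rewrite /c00 !coefC. Qed.

Lemma poly_bounded p : exists K d : R, [/\ 0 <= K, 0 < d & forall s, nm s < d -> nm p.[s] <= K].
Proof.
have [d d0 hd] := cdiff_cont (cdiff_poly p 0) ltr01.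
exists (1 + nm p.[0]), d; split; rewrite ?addr_ge0 ?nm_ge0 // => s hs.
have := hd s; rewrite subr0 => /(_ hs); have := nmD (p.[s] - p.[0]) p.[0]; rewrite subrK; lra.
Qed.

(** If the Jacobian vanished, both linear parts would kill some direction (a, b). Along it f1 and f2
    would be of order s^2, against the lower bound, which is linear in s. *)
Lemma jacobian_neq0 (f1 f2 : C -> C -> C) (T1 T2 : BP) N (r K : R) : 0 < r ->
  approx N.+2 f1 T1 -> approx N.+2 f2 T2 -> c00 T1 = 0 -> c00 T2 = 0 ->
  (forall x y, nm x < r -> nm y < r -> nm x + nm y <= K * (nm (f1 x y) + nm (f2 x y))) ->
  c00 (dX T1) * c00 (dY T2) - c00 (dY T1) * c00 (dX T2) != 0.
Proof.
move=> r0 [K1 [d1 [d10 h1]]] [K2 [d2 [d20 h2]]] T10 T20 hK; apply/negP => /eqP J0.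
have [[a b] [ab0 ha hb]] : exists ab : C * C, [/\ (ab.1 != 0) || (ab.2 != 0),
    c00 (dX T1) * ab.1 + c00 (dY T1) * ab.2 = 0 & c00 (dX T2) * ab.1 + c00 (dY T2) * ab.2 = 0].
  have [z1|n1] := boolP ((c00 (dX T1) == 0) && (c00 (dY T1) == 0)).
    case/andP: z1 => /eqP -> /eqP ->.
    have [z2|n2] := boolP ((c00 (dX T2) == 0) && (c00 (dY T2) == 0)).
      case/andP: z2 => /eqP -> /eqP ->; exists (1, 0); rewrite /= oner_neq0.
      by split=> //; rewrite !mul0r addr0.
    exists (c00 (dY T2), - c00 (dX T2)) => /=; split; rewrite ?mul0r ?addr0 //; last by ring.
    by move: n2; rewrite negb_and oppr_eq0 orbC.
  exists (c00 (dY T1), - c00 (dX T1)) => /=; split; last 2 first.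
  - by ring.
  - rewrite -[RHS]oppr0 -J0; ring.
  by move: n1; rewrite negb_and oppr_eq0 orbC.
rewrite /= in ab0 ha hb.
have quad (T : BP) : c00 T = 0 -> c00 (dX T) * a + c00 (dY T) * b = 0 ->
    exists2 q : {poly C}, True & forall s, ev2 T (a * s) (b * s) = q.[s] * s ^+ 2.
  move=> z0 z1; have Xa (k : C) : 'X %| k *: 'X by rewrite -mul_polyC dvdp_mull.
  have /dvdpP[q hq] : 'X^2 %| curve (a *: 'X) (b *: 'X) T.
    apply/dvdXnP => -[|[|//]] _.
      by rewrite -horner_coef0 curve_at0 // hornerZ hornerX mulr0.
    rewrite curve_coef1 // !coefZ coefX /= !mulr1.
    by [].
  exists q => // s; have := ev2_curve (a *: 'X) (b *: 'X) T s.
  by rewrite !hornerZ !hornerX hq hornerM hornerXn.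
have [q1 _ e1] := quad T1 T10 ha; have [q2 _ e2] := quad T2 T20 hb.
have [B1 [b1 [B10 b10 hB1]]] := poly_bounded q1; have [B2 [b2 [B20 b20 hB2]]] := poly_bounded q2.
set A := nm a + nm b; have A0 : 0 < A.
  have ha0 := nm_ge0 a; have hb0 := nm_ge0 b.
  by case/orP: ab0; rewrite -nm_gt0 /A; lra.
pose D := Num.min 1 (Num.min (Num.min r d1) (Num.min d2 (Num.min b1 b2))).
have D0 : 0 < D by rewrite !lt_min r0 d10 d20 b10 b20 ltr01.
pose E := `|K1| * A ^+ N.+2 + `|K2| * A ^+ N.+2 + (B1 + B2).
have A2 : 0 <= A ^+ N.+2 by rewrite exprn_ge0 // ltW.
have E0 : 0 <= E by rewrite !addr_ge0 // mulr_ge0.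
have main s : 0 < nm s -> nm s * (A + 1) < D -> nm s < D -> A <= `|K| * E * nm s.
  move=> s0 sA sD.
  have as_ : nm (a * s) < D.
    rewrite nmM mulrC; apply: le_lt_trans sA; rewrite ler_wpM2l ?ltW // /A.
    by have := nm_ge0 b; lra.
  have bs_ : nm (b * s) < D.
    rewrite nmM mulrC; apply: le_lt_trans sA; rewrite ler_wpM2l ?ltW // /A.
    by have := nm_ge0 a; lra.
  move: as_ bs_ sD; rewrite !lt_min.
  move=> /and3P[_ /andP[a1 a2] /and3P[a3 _ _]] /and3P[_ /andP[b1' b2'] /and3P[b3 _ _]].
  move=> /and3P[s1 _ /and3P[_ s2 s3]].
  have [_ k1] := h1 _ _ a2 b2'; have [_ k2] := h2 _ _ a3 b3.
  have k3 := hK _ _ a1 b1'.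
  have sN : nm s ^+ N.+2 <= nm s ^+ 2.
    rewrite -addn2 exprD -[X in _ <= X]mul1r ler_wpM2r ?exprn_ge0 ?nm_ge0 //.
    by rewrite exprn_ile1 ?nm_ge0 // ltW.
  have S : nm (a * s) + nm (b * s) = A * nm s by rewrite !nmM /A; ring.
  rewrite S exprMn in k1 k2; rewrite S in k3.
  have bnd (k : R) : k * (A ^+ N.+2 * nm s ^+ N.+2) <= `|k| * A ^+ N.+2 * nm s ^+ 2.
    apply: (@le_trans _ _ (`|k| * (A ^+ N.+2 * nm s ^+ N.+2))).
      by rewrite ler_wpM2r ?ler_norm // mulr_ge0 // exprn_ge0 ?nm_ge0.
    by rewrite mulrA ler_wpM2l // mulr_ge0.
  have f1b : nm (f1 (a * s) (b * s)) <= (`|K1| * A ^+ N.+2 + B1) * nm s ^+ 2.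
    have := nmD (f1 (a * s) (b * s) - ev2 T1 (a * s) (b * s)) (ev2 T1 (a * s) (b * s)).
    rewrite subrK {2}e1 nmM nmX; have := bnd K1; have := ler_wpM2r (exprn_ge0 2 (nm_ge0 s)) (hB1 s s2).
    by lra.
  have f2b : nm (f2 (a * s) (b * s)) <= (`|K2| * A ^+ N.+2 + B2) * nm s ^+ 2.
    have := nmD (f2 (a * s) (b * s) - ev2 T2 (a * s) (b * s)) (ev2 T2 (a * s) (b * s)).
    rewrite subrK {2}e2 nmM nmX; have := bnd K2; have := ler_wpM2r (exprn_ge0 2 (nm_ge0 s)) (hB2 s s3).
    by lra.
  have : A * nm s <= `|K| * E * nm s * nm s.
    apply: (le_trans k3); apply: (@le_trans _ _ (`|K| * (nm (f1 (a * s) (b * s)) + nm (f2 (a * s) (b * s))))).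
      by rewrite ler_wpM2r ?ler_norm // addr_ge0 ?nm_ge0.
    have -> : `|K| * E * nm s * nm s = `|K| * (E * nm s ^+ 2) by ring.
    by rewrite ler_wpM2l // /E; lra.
  by rewrite ler_pM2r.
have KE : 0 <= `|K| * E by rewrite mulr_ge0.
pose t := Num.min (D / (A + 2)) (A / (`|K| * E + 1)) / 2.
have A2' : 0 < A + 2 by lra.
have KE1 : 0 < `|K| * E + 1 by lra.
have t0' : 0 < Num.min (D / (A + 2)) (A / (`|K| * E + 1)) by rewrite lt_min !divr_gt0.
have [t1 t2] : t < D / (A + 2) /\ t < A / (`|K| * E + 1).
  have l1 : Num.min (D / (A + 2)) (A / (`|K| * E + 1)) <= D / (A + 2) by rewrite ge_min lexx.
  have l2 : Num.min (D / (A + 2)) (A / (`|K| * E + 1)) <= A / (`|K| * E + 1) by rewrite ge_min lexx orbT.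
  by rewrite /t; split; lra.
have t0 : 0 < t by rewrite divr_gt0.
move: t1 t2; rewrite !ltr_pdivlMr // => t1 t2.
have := main (cr t); rewrite nm_cr gtr0_norm // => /(_ t0).
have u1 : t * (A + 1) < D by nra.
have u2 : t < D by nra.
move=> /(_ u1 u2); nra.
Qed.

(** The weighted Euler field of W is pulled back by Cramer's rule and multiplied by U J to clear
    denominators, J being the Jacobian: the field (c1, c2) takes the coordinates to U J t1 and U J
    t2. The two sides differ by U^2 J times the Euler relation of W. *)
Lemma flow_identity (A : comNzRingType) (U t1 t2 m1 m2 W X1 Y1 X2 Y2 UX UY TX TY T d : A) :
  t1 * m1 + t2 * m2 = d * W ->
  let c1 := U * (t1 * Y2 - t2 * Y1) in let c2 := U * (t2 * X1 - t1 * X2) in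
  let e := (t1 * Y2 - t2 * Y1) * UX + (t2 * X1 - t1 * X2) * UY + U * (X1 * Y2 - Y1 * X2) * d in
  c1 * TX + c2 * TY - e * T =
  c1 * (TX - (UX * W + U * (m1 * X1 + m2 * X2))) +
  c2 * (TY - (UY * W + U * (m1 * Y1 + m2 * Y2))) - e * (T - U * W).
Proof.
move=> h c1 c2 e; apply/eqP; rewrite -subr_eq0; apply/eqP.
transitivity (U * U * (X1 * Y2 - Y1 * X2) * (t1 * m1 + t2 * m2 - d * W)).
  by rewrite /c1 /c2 /e; ring.
by rewrite h subrr mulr0.
Qed.

Lemma sum2 (V : nmodType) (G : 'I_2 -> V) : \sum_(i < 2) G i = G ord0 + G (lift ord0 ord0).
Proof. by rewrite !big_ord_recl big_ord0 addr0. Qed.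

Lemma flow_exists (F : C -> C -> C) (T : BP) : quasihomogeneous_at0 F ->
  (forall x y, F x y = ev2 T x y) -> forall N, exists c1 c2 e, flow_adapted T N c1 c2 e.
Proof.
move=> [w [d [W [f1 [f2 [u [r [M [K [[w0 hW] [r0 [s1 s2 su]] [f10 f20 u0] hF]]]]]]]]]] hT N.
(* Order N + 2 leaves room for the derivative in the final relation and determines the linear
   parts. *)
have [T1 a1] := approx_jets N.+2 r0 s1; have [T2 a2] := approx_jets N.+2 r0 s2.
have [U aU] := approx_jets N.+2 r0 su.
have aW := approx_mmap W a1 a2.
set h := (fun i : 'I_2 => if i == ord0 then T1 else T2) in aW.
set WT := mmap (iota2 R) h W in aW.
have aF : approx N.+2 F T.
  have [L [l [l0 hl]]] := approxM aU aW.
  exists L, (Num.min r l); split; first by rewrite lt_min r0.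
  move=> x y; rewrite !lt_min => /andP[xr xl] /andP[yr yl].
  have [_ FE] := hF x y xr yr; have [g1 g2] := hl x y xl yl.
  split; first by rewrite FE.
  have L0 : 0 <= L := le_trans (nm_ge0 _) g1.
  by rewrite hT subrr nm0 mulr_ge0 // exprn_ge0 // addr_ge0 ?nm_ge0.
have aUW : approx N.+2 F (U * WT).
  have [L [l [l0 hl]]] := approxM aU aW.
  exists L, (Num.min r l); split; first by rewrite lt_min r0.
  move=> x y; rewrite !lt_min => /andP[xr xl] /andP[yr yl].
  by have [_ ->] := hF x y xr yr; exact: hl.
have hE : vanish N.+2 (T - U * WT) := approx_vanish aF aUW.
have T10 : c00 T1 = 0 by rewrite /c00 (approx_at0 a1).
have T20 : c00 T2 = 0 by rewrite /c00 (approx_at0 a2).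
have U0 : c00 U != 0 by rewrite /c00 (approx_at0 aU).
have J0 := jacobian_neq0 r0 a1 a2 T10 T20 (fun x y hx hy => proj1 (hF x y hx hy)).
pose w1 : BP := (w ord0)%:R; pose w2 : BP := (w (lift ord0 ord0))%:R.
pose c1 := U * (w1 * T1 * dY T2 - w2 * T2 * dY T1).
pose c2 := U * (w2 * T2 * dX T1 - w1 * T1 * dX T2).
pose J := dX T1 * dY T2 - dY T1 * dX T2.
pose e := (w1 * T1 * dY T2 - w2 * T2 * dY T1) * dX U + (w2 * T2 * dX T1 - w1 * T1 * dX T2) * dY U + U * J * d%:R.
have dXr n : dX (n%:R : BP) = 0.
  by rewrite -polyC_natr dXC -polyC_natr derivC.
have dYr n : dY (n%:R : BP) = 0 by rewrite -polyC_natr dYC.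
have wE : w1 * T1 * mmap (iota2 R) h (mderiv ord0 W) + w2 * T2 * mmap (iota2 R) h (mderiv (lift ord0 ord0) W) = d%:R * WT.
  have := mmap_weighted_euler (iota2 R) h hW.
  rewrite sum2.
  rewrite /w1 /w2.
  have -> : h ord0 = T1 by [].
  have -> : h (lift ord0 ord0) = T2 by [].
  set u1 := mmap _ _ _. set u2 := mmap _ _ _. set u3 := mmap _ _ _.
  exact.
have dXW : dX WT = mmap (iota2 R) h (mderiv ord0 W) * dX T1 + mmap (iota2 R) h (mderiv (lift ord0 ord0) W) * dX T2.
  rewrite /WT (@mmap_derivation _ _ _ _ (@dX C)) ?big_ord_recl ?big_ord0 ?addr0 //; first exact: dXD.
    exact: dXM.
  by move=> c; rewrite /iota2 /= dXC derivC.
have dYW : dY WT = mmap (iota2 R) h (mderiv ord0 W) * dY T1 + mmap (iota2 R) h (mderiv (lift ord0 ord0) W) * dY T2.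
  rewrite /WT (@mmap_derivation _ _ _ _ (@dY C)) ?big_ord_recl ?big_ord0 ?addr0 //; first exact: dYD.
    exact: dYM.
  by move=> c; rewrite /iota2 /= dYC.
exists c1, c2, e; split.
- by rewrite -/(c00 _) c00M c00D c00N !c00M T10 T20; ring.
- by rewrite -/(c00 _) c00M c00D c00N !c00M T10 T20; ring.
- rewrite -!/(c00 _) /c1 /c2 /w1 /w2.
  rewrite !(dXM, dYM, dXD, dYD, dXN, dYN, dXr, dYr) !(c00M, c00D, c00N) T10 T20.
  have wn n : c00 (n%:R : BP) = n%:R by rewrite -2!polyC_natr c00C.
  rewrite !wn.
  (* At the origin the field acts on the linear coordinates by U J w1 and U J w2, so its determinant
     is U^2 w1 w2 J^2. *)
  set X := (X in X != 0).
  have -> : X = c00 U ^+ 2 * (w ord0)%:R * (w (lift ord0 ord0))%:R *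
     (c00 (dX T1) * c00 (dY T2) - c00 (dY T1) * c00 (dX T2)) ^+ 2.
    by rewrite /X; ring.
  by rewrite !mulf_neq0 ?expf_neq0 // pnatr_eq0 -lt0n.
have -> : c1 * dX T + c2 * dY T - e * T =
  c1 * dX (T - U * WT) + c2 * dY (T - U * WT) - e * (T - U * WT).
  rewrite !(dXD, dYD, dXN, dYN, dXM, dYM) dXW dYW; exact: flow_identity.
apply: vanishB; last by apply: vanishMl; apply: vanishW hE; rewrite -addn2 leq_addr.
by apply: vanishD; apply: vanishMl; [apply: (vanishW _ (vanish_dX hE))|apply: (vanishW _ (vanish_dY hE))].
Qed.

End Flow.

(** * Discriminants *)

Section Gauss.
Variable R : realType.
Local Notation C := (Cplx R).
Local Notation BP := {poly {poly C}}.
Implicit Types (F w e : BP) (c p : {poly C}).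

Lemma divides_XsubC (z : C) (H : BP) : (forall j, (H`_j).[z] = 0) ->
  exists G : BP, H = ('X - z%:P)%:P * G.
Proof.
move=> h; exists (map_poly (fun p => p %/ ('X - z%:P)) H); apply/polyP => j.
rewrite coefCM coef_map_id0 ?div0p // mulrC divpK //.
by rewrite dvdp_XsubCl rootE h.
Qed.

(** Gauss's lemma by induction on the degree of c. At a root z of c, either w or e is divisible by X
    - z. If it is w, then (X - z)^2 divides c, because the leading coefficient of F is a
    constant. *)
Lemma gauss_square F c w e (k : C) : k != 0 -> lead_coef F = k%:P -> c != 0 ->
  c *: F = w ^+ 2 * e -> (1 < size w)%N ->
  exists w' e' : BP, F = w' ^+ 2 * e' /\ (1 < size w')%N.
Proof.
move=> k0 lF; have [n] := ubnP (size c); elim: n c w e => // n IH c w e cn c0 hF sw.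
have [sc|sc] := leqP (size c) 1.
  have [a ec] : exists a, c = a%:P by exists (c`_0); exact: size1_polyC.
  have a0 : a != 0 by move: c0; rewrite ec polyC_eq0.
  exists w, ((a^-1)%:P%:P * e); split=> //.
  rewrite mulrCA -hF ec -mul_polyC mulrA -!polyCM mulVf // polyC1 mul1r //.
have [z /rootP cz] : exists z, root c z by apply/closed_rootP; rewrite gtn_eqF.
have [c1 hc1] : exists c1, c = c1 * ('X - z%:P) by apply/factor_theorem/rootP.
set dl := 'X - z%:P in hc1; have dl0 : dl != 0 by rewrite polyXsubC_eq0.
have c10 : c1 != 0 by apply: contraNneq c0 => h; rewrite hc1 h mul0r.
have sc1 : size c = (size c1).+1.
  by rewrite hc1 size_mul ?polyXsubC_eq0 // size_XsubC addn2.
pose at_z (H : BP) : {poly C} := map_poly (horner_eval z) H.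
have atz H j : (at_z H)`_j = (H`_j).[z] by rewrite coef_map.
have : (at_z w) ^+ 2 * at_z e = 0.
  have -> : at_z w ^+ 2 * at_z e = at_z (w ^+ 2 * e) by rewrite /at_z rmorphM rmorphXn.
  by rewrite -hF; apply/polyP => j; rewrite atz coefZ hornerM cz mul0r coef0.
move/eqP; rewrite mulf_eq0 expf_eq0 /= => /orP[/eqP w0|/eqP e0]; last first.
  have [j|e1 he1] := @divides_XsubC z e; first by rewrite -atz e0 coef0.
  apply: (IH c1 w e1) => //; first by rewrite -ltnS -sc1.
  have dlP : dl%:P != 0 :> BP by rewrite polyC_eq0.
  apply: (mulfI dlP); rewrite -/dl in he1; move: hF; rewrite he1 hc1 => hF.
  by rewrite mulrCA -hF -mul_polyC mulrA -polyCM [dl * _]mulrC mul_polyC.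
have [j|w1 hw1] := @divides_XsubC z w; first by rewrite -atz w0 coef0.
rewrite -/dl in hw1.
have sw1 : size w = size w1.
  by rewrite hw1 size_Cmul.
(* Comparison of the coefficients in the top degree of F: on the left it is c k. *)
have : dl ^+ 2 %| c * k%:P.
  have := congr1 (fun H : BP => H`_(size F).-1) hF.
  rewrite coefZ -lead_coefE lF hw1 exprMn -polyC_exp -mulrA coefCM => ->.
  exact: dvdp_mulr.
move=> hdiv; have {hdiv} : dl ^+ 2 %| c.
  have -> : c = c * k%:P * (k^-1)%:P by rewrite -mulrA -polyCM mulfV // polyC1 mulr1.
  exact: dvdp_mulr.
move=> /dvdpP[c2 hc2]; have c20 : c2 != 0 by apply: contraNneq c0 => h; rewrite hc2 h mul0r.
apply: (IH c2 w1 e) => //; last by rewrite -sw1.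
  move: cn; rewrite hc2 size_mul ?expf_neq0 // size_exp_XsubC addn3 /= => cn.
  by rewrite -ltnS (leq_trans _ cn).
have dlP : (dl ^+ 2)%:P != 0 :> BP by rewrite polyC_eq0 expf_neq0.
apply: (mulfI dlP); move: hF; rewrite hw1 hc2 exprMn -polyC_exp -mulrA => <-.
by rewrite -mul_polyC mulrA -polyCM [_ * c2]mulrC mul_polyC.
Qed.

Lemma polyC_natr_neq0 n : (0 < n)%N -> (n%:R : {poly C}) != 0.
Proof. by move=> n0; rewrite -polyC_natr polyC_eq0 pnatr_eq0 -lt0n. Qed.

(** Over the field of fractions of C[X], either Bezout holds for F and its derivative, and clearing
    denominators gives p, or in characteristic 0 there is a repeated factor, which [gauss_square]
    makes polynomial. *)
Lemma coprime_deriv_or_square F (k : C) : k != 0 -> lead_coef F = k%:P -> (1 < size F)%N ->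
  (exists w e : BP, F = w ^+ 2 * e /\ (1 < size w)%N) \/
  (exists p : {poly C}, exists U V : BP, p != 0 /\ p%:P = U * F + V * dY F).
Proof.
move=> k0 lF sF; have [cop|ncop] := boolP (coprimep F F^`()); [right|left].
  have [[u v] /= /eqpP[[c1 c2] /= /andP[c10 c20] e]] := Bezoutp F F^`().
  have [p hp] : exists p, gcdp F F^`() = p%:P.
    by move: cop; rewrite coprimep_def => /eqP h; exists ((gcdp F F^`())`_0); apply: size1_polyC; rewrite h.
  have p0 : p != 0.
    by move: cop; rewrite coprimep_def hp; apply: contraTneq => ->; rewrite size_poly0.
  exists (c2 * p), (c1%:P * u), (c1%:P * v); split; first by rewrite mulf_neq0.
  by rewrite polyCM -hp mul_polyC -e -mul_polyC /dY; ring.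
have F0 : F != 0 by rewrite -size_poly_gt0 ltnW.
have nsep : ~~ separable_poly F by rewrite unlock.
have [u [v [huv hcop]]] : exists u v : BP, u * v %| F /\ ~~ coprimep u v.
  apply: contrapT => h; move/negP: nsep; apply; apply/separable_polyP; split.
    by move=> u v huv; apply/negPn/negP => hc; apply: h; exists u, v.
  move=> u _ su; apply/eqP => /(congr1 (fun H : BP => H`_(size u).-2)).
  rewrite coef_deriv coef0 prednK -?subn1 ?subn_gt0 // subn1 => /eqP.
  rewrite -mulr_natr mulf_eq0 -lead_coefE lead_coef_eq0 -size_poly_eq0 gtn_eqF ?(ltnW su) //=.
  by apply/negP; apply: polyC_natr_neq0; rewrite -subn1 subn_gt0.
set w := gcdp u v.
have uv0 : u * v != 0.
  by apply: contraNneq F0 => h; move: huv; rewrite h dvd0p.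
have w0 : w != 0.
  rewrite gcdp_eq0 negb_and; have [u0|//] := eqVneq u 0.
  by move: uv0; rewrite u0 mul0r eqxx.
have sw : (1 < size w)%N.
  by move: hcop; rewrite coprimep_def -/w; have := size_poly_gt0 w; rewrite w0; case: (size w) => [|[|]].
have : w ^+ 2 %| F.
  by apply: dvdp_trans huv; rewrite expr2 dvdp_mul // ?dvdp_gcdl ?dvdp_gcdr.
move/Pdiv.Idomain.dvdpP => [[c qq] /= c0 hc].
by apply: (@gauss_square F c w qq k) => //; rewrite hc mulrC.
Qed.

End Gauss.

(** * Restriction of forms to affine planes, and homogenization *)

Definition k0 : 'I_3 := ord0.
Definition k1 : 'I_3 := lift ord0 ord0.
Definition k2 : 'I_3 := lift ord0 (lift ord0 ord0).

Lemma kE : ((k0 == k1) = false) * ((k0 == k2) = false) * ((k1 == k0) = false) *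
  ((k1 == k2) = false) * ((k2 == k0) = false) * ((k2 == k1) = false).
Proof. by []. Qed.

Lemma sum3 (V : nmodType) (G : 'I_3 -> V) : \sum_(i < 3) G i = G k0 + G k1 + G k2.
Proof. by rewrite !big_ord_recl big_ord0 addr0 addrA. Qed.

Lemma ord3 (P : 'I_3 -> Prop) : P k0 -> P k1 -> P k2 -> forall k, P k.
Proof.
move=> h0 h1 h2 k; case: (unliftP ord0 k) => [j ->|-> //].
case: (unliftP ord0 j) => [l ->|-> //].
by rewrite (_ : l = ord0) //; apply: ord_inj; case: l => -[].
Qed.

Section TopCoefficient.
Variables (K B : comNzRingType) (iota : {rmorphism K -> B}) (n : nat).

(** The value 0 is allowed for [c]: for forms restricted to a curve of known degree, [c] is the
    value at the point at infinity. *)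
Definition top_coef (e : nat) (h : {poly B}) (c : B) : Prop := (size h <= e.+1)%N /\ h`_e = c.

Lemma top_coefM e1 e2 (h1 h2 : {poly B}) c1 c2 :
  top_coef e1 h1 c1 -> top_coef e2 h2 c2 -> top_coef (e1 + e2) (h1 * h2) (c1 * c2).
Proof.
move=> [s1 t1] [s2 t2]; split.
  by apply: (leq_trans (size_polyMleq _ _)); lia.
have e1lt : (e1 < (e1 + e2).+1)%N by lia.
rewrite coefM (bigD1 (Ordinal e1lt)) //= addKn t1 t2 big1 ?addr0 // => i /eqP ie.
have [lt|gt|eq] := ltngtP i e1; last by case: ie; exact: val_inj.
  by rewrite [h2`_(_)]nth_default ?mulr0 // (leq_trans s2) //; lia.
by rewrite [h1`_(_)]nth_default ?mul0r // (leq_trans s1).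
Qed.

Lemma top_coef_prod (I : Type) (r : seq I) (e : I -> nat) (h : I -> {poly B}) c :
  (forall i, top_coef (e i) (h i) (c i)) ->
  top_coef (\sum_(i <- r) e i) (\prod_(i <- r) h i) (\prod_(i <- r) c i).
Proof.
move=> H; elim: r => [|i r IH]; last by rewrite !big_cons; exact: top_coefM.
by rewrite !big_nil; split; rewrite ?size_poly1 // coef1.
Qed.

Lemma top_coefX e k (h : {poly B}) c : top_coef e h c -> top_coef (e * k) (h ^+ k) (c ^+ k).
Proof.
move=> H; elim: k => [|k IH]; last by rewrite mulnS !exprS; exact: top_coefM.
by rewrite muln0 !expr0; split; rewrite ?size_poly1 // coef1.
Qed.

Lemma top_coef_mmap (e d : nat) (h : 'I_n -> {poly B}) (c : 'I_n -> B) (g : mpoly n K) :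
  (forall i, top_coef e (h i) (c i)) -> g \is ishomog1 d mdeg ->
  top_coef (e * d) (mmap ((@polyC B) \o iota) h g) (mmap iota c g).
Proof.
move=> H /dhomogP hg.
have mono m : m \in msupp g -> top_coef (e * d) (((@polyC B) \o iota) (mcoeff m g) * mmap1 h m)
    (iota (mcoeff m g) * mmap1 c m).
  move=> /hg /= <-; rewrite -[(e * _)%N]add0n; apply: top_coefM.
    by split; [exact: size_polyC_leq1|rewrite coefC].
  rewrite mdegE big_distrr /=; apply: top_coef_prod => i.
  exact: top_coefX.
split.
  rewrite /mmap big_seq; apply: (leq_trans (size_sum _ _ _)).
  by apply/bigmax_leqP_seq => m _ /mono[].
by rewrite /mmap coef_sum big_seq [RHS]big_seq; apply: eq_bigr => m /mono[].
Qed.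

End TopCoefficient.

Section Nonvanishing.
Variable R : realType.
Local Notation C := (Cplx R).

(** Kronecker's substitution (t, t^N, t^(N^2)): with N above all exponents, these are the digits of
    the exponent of t in base N, so distinct monomials stay distinct. *)
Lemma mpoly_eval_eq0 (g : Cpoly R 3) : (forall v, evalv g v = 0) -> g = 0.
Proof.
move=> h; apply/mpolyP => m0; rewrite mcoeff0.
pose N := (\sum_(m <- msupp g) mdeg m + mdeg m0).+1.
pose e (m : multinom 3) := (m k0 + N * (m k1 + N * m k2))%N.
pose X : {poly C} := \sum_(m <- msupp g) mcoeff m g *: 'X^(e m).
have degle (m : multinom 3) (i : 'I_3) : (m i <= mdeg m)%N.
  by rewrite mdegE (bigD1 i) //= leq_addr.
have small m : m \in msupp g \/ m = m0 -> forall i, (m i < N)%N.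
  move=> hm i; rewrite /N ltnS (leq_trans (degle m i)) //.
  case: hm => [hm|->]; last by rewrite leq_addl.
  by rewrite (big_rem m) //= -addnA leq_addr.
have e_inj (m m' : multinom 3) : (forall i, (m i < N)%N) -> (forall i, (m' i < N)%N) -> e m = e m' -> m = m'.
  move=> hm hm' ee; have key a b c d : (a < N)%N -> (c < N)%N -> (a + N * b = c + N * d)%N -> a = c /\ b = d.
    move=> aN cN h1; have := congr1 (modn^~ N) h1; rewrite ![(_ + N * _)%N]addnC ![(N * _)%N]mulnC.
    rewrite !modnMDl !modn_small // => ac; split=> //.
    by move: h1; rewrite ac => /addnI/eqP; rewrite eqn_mul2l => /orP[//|/eqP].
  have [h0 h12] := key _ _ _ _ (hm k0) (hm' k0) ee.
  have [h1 h2] := key _ _ _ _ (hm k1) (hm' k1) h12.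
  by apply/mnmP; apply: ord3.
have X0 : X = 0.
  apply: poly_zero_everywhere => t.
  rewrite -[RHS](h (\row_i (if i == k0 then t else if i == k1 then t ^+ N else t ^+ (N * N)))).
  rewrite /evalv mevalE horner_sum; apply: eq_bigr => m _; rewrite hornerZ hornerXn; congr (_ * _).
  rewrite !big_ord_recl big_ord0 mulr1 !mxE /= -!exprM -!exprD; congr (_ ^+ _).
  by rewrite /e /k0 /k1 /k2; lia.
move/(congr1 (fun p : {poly C} => p`_(e m0))): X0; rewrite coef0 coef_sum => E.
have [m0s|] := boolP (m0 \in msupp g); last by rewrite -mcoeff_eq0 => /eqP.
rewrite -E (big_rem m0) //= coefZ coefXn eqxx mulr1 big_seq big1 ?addr0 // => m mrem.
have ms := mem_rem mrem; rewrite coefZ coefXn; case: eqP => [ee|_]; last by rewrite mulr0.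
have mm : m0 = m by apply: e_inj ee; apply: small; [right|left].
by move: mrem; rewrite -mm mem_rem_uniq ?msupp_uniq // inE eqxx.
Qed.

End Nonvanishing.

Lemma bool_polyC (K : nzRingType) (b : bool) : (b%:R : K)%:P%:P = b%:R :> {poly {poly K}}.
Proof. by rewrite !polyC_natr. Qed.

Lemma frame0 (A : nzRingType) (x y : A) : true%:R + false%:R * x + false%:R * y = 1.
Proof. by rewrite !mul0r !addr0. Qed.
Lemma frame1 (A : nzRingType) (x y : A) : false%:R + true%:R * x + false%:R * y = x.
Proof. by rewrite mul0r mul1r addr0 add0r. Qed.
Lemma frame2 (A : nzRingType) (x y : A) : false%:R + false%:R * x + true%:R * y = y.
Proof. by rewrite mul0r mul1r addr0 add0r. Qed.

Lemma affine_rescale (K : fieldType) (c s t m0 m1 m2 : K) : c != 0 ->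
  m0 * c + m1 * s + m2 * t = c * (m0 + s / c * m1 + t / c * m2).
Proof. by move=> c0; field. Qed.

Lemma frame_zero (A : nzRingType) (x y : A) : false%:R * x + false%:R * y = 0.
Proof. by rewrite !mul0r addr0. Qed.

Lemma add_sub_cancel (A : zmodType) (x y z : A) : x + y + z - (y + z) = x.
Proof. by rewrite -[x + y + z]addrA addrK. Qed.

Lemma mul_expr1n (A : nzRingType) (x y z : A) n : x * (1 ^+ n * y * z) = x * y * z.
Proof. by rewrite expr1n mul1r mulrA. Qed.

Lemma one_expr_sub (A : nzRingType) (x : A) n : 1 ^+ n * x - x = 0.
Proof. by rewrite expr1n mul1r subrr. Qed.

Lemma cancel_square_factor (A : comNzRingType) (l f Q E : A) k :
  l ^+ k.+1 * f = (Q * l) ^+ 2 * E -> l * (l ^+ k * f) = l * (Q ^+ 2 * (l * E)).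
Proof. by rewrite exprS => h; rewrite mulrA h; ring. Qed.
Lemma cancel_factor (A : comNzRingType) (l f Q W : A) k :
  l ^+ k.+1 * f = W ^+ 2 * (Q * l) -> l * (l ^+ k * f) = l * (W ^+ 2 * Q).
Proof. by rewrite exprS => h; rewrite mulrA h; ring. Qed.

Section Plane.
Variable R : realType.
Local Notation C := (Cplx R).
Local Notation BP := {poly {poly C}}.
Local Notation S := (Cpoly R 3).
Local Notation X_ := (fun i : 'I_3 => mpolyX C (mnm1 i)).
Implicit Types (g h : S) (M : 'M[C]_3).

Definition inner_plane M (j : 'I_3) : {poly C} := (M k0 j)%:P + (M k1 j)%:P * 'X.
Definition plane_coord M (j : 'I_3) : BP := (inner_plane M j)%:P + (M k2 j)%:P%:P * 'X.
(* The restriction of [g] to the affine plane [row k0 M + X (row k1 M) + Y (row k2 M)]. *)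
Definition plane M : S -> BP := mmap (iota2 R) (plane_coord M).
HB.instance Definition _ M := GRing.RMorphism.copy (plane M) (mmap (iota2 R) (plane_coord M)).

Lemma evalvD g h v : evalv (g + h) v = evalv g v + evalv h v. Proof. exact: mevalD. Qed.
Lemma evalvM g h v : evalv (g * h) v = evalv g v * evalv h v. Proof. exact: mevalM. Qed.
Lemma evalvZ c g v : evalv (c *: g) v = c * evalv g v. Proof. exact: mevalZ. Qed.
Lemma evalvX j v : evalv (X_ j) v = v ord0 j. Proof. exact: mevalXU. Qed.
Lemma evalvC c v : evalv (mpolyC 3 c : S) v = c. Proof. exact: mevalC. Qed.
Lemma evalv0 v : evalv (0 : S) v = 0. Proof. exact: meval0. Qed.

Lemma ev2_plane M g x y :
  ev2 (plane M g) x y = evalv g (row k0 M + x *: row k1 M + y *: row k2 M).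
Proof.
elim/mpoly_closure_ind: g => [c|i|p q hp hq|p q hp hq].
- by rewrite /plane mmapC ev2C /evalv mevalC.
- rewrite /plane mmap_U /plane_coord /inner_plane /evalv mevalXU !mxE /ev2.
  by rewrite !hornerE; ring.
- by rewrite /plane mmapD ev2D hp hq /evalv mevalD.
by rewrite /plane rmorphM ev2M hp hq /evalv mevalM.
Qed.

Lemma plane_dX M g : dX (plane M g) = \sum_(j < 3) plane M (mderiv j g) * (M k1 j)%:P%:P.
Proof.
rewrite /plane (@mmap_derivation _ _ _ _ (@dX C)).
- apply: eq_bigr => j _; congr (_ * _); rewrite /plane_coord /inner_plane.
  by rewrite dXD dXM dXX !dXC !(derivD, derivM, derivC, derivX, polyC0, mul0r, mulr0, addr0, add0r, mulr1).
- exact: dXD. - exact: dXM.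
by move=> c; rewrite /iota2 /= dXC derivC.
Qed.

Lemma plane_dY M g : dY (plane M g) = \sum_(j < 3) plane M (mderiv j g) * (M k2 j)%:P%:P.
Proof.
rewrite /plane (@mmap_derivation _ _ _ _ (@dY C)).
- apply: eq_bigr => j _; congr (_ * _); rewrite /plane_coord.
  by rewrite dYD dYM dYX !dYC mul0r !add0r mulr1.
- exact: dYD. - exact: dYM.
by move=> c; rewrite /iota2 /= dYC.
Qed.

Lemma plane_top M g d : homogeneous d g -> top_coef d (plane M g) (evalv g (row k2 M))%:P.
Proof.
move=> hg; have := @top_coef_mmap C {poly C} (@polyC C) 3 1 d (plane_coord M)
  (fun j => (M k2 j)%:P) g _ hg.
rewrite mul1n; have -> : mmap (@polyC C) (fun j => (M k2 j)%:P) g = (evalv g (row k2 M))%:P.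
  rewrite /evalv /meval /mmap [RHS]rmorph_sum; apply: eq_bigr => m _ /=.
  rewrite polyCM; congr (_ * _); rewrite /mmap1 rmorph_prod; apply: eq_bigr => i _.
  by rewrite /= polyC_exp mxE.
apply=> j; rewrite /plane_coord; split.
  by rewrite addrC mul_polyC (leq_trans (size_polyD _ _)) // geq_max (leq_trans (size_scale_leq _ _)) ?size_polyX // (leq_trans (size_polyC_leq1 _)).
by rewrite coefD coefC coefMX coefC add0r.
Qed.

(** A last frame vector off the curve g = 0 makes the leading coefficient in Y a nonzero constant,
    as Gauss's lemma and the degree counts require. *)
Lemma plane_size M g d : homogeneous d g -> evalv g (row k2 M) != 0 ->
  size (plane M g) = d.+1 /\ lead_coef (plane M g) = (evalv g (row k2 M))%:P.
Proof.
move=> hg gb; have [s t] := plane_top M hg.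
have -> : size (plane M g) = d.+1.
  apply/eqP; rewrite eqn_leq s /= ltnNge; apply/negP => s'.
  by move/eqP: t; rewrite nth_default // eq_sym polyC_eq0 (negPf gb).
split=> //; rewrite lead_coefE; have [sz|sz] := ltnP (size (plane M g)) d.+1.
  by move/eqP: t; rewrite nth_default // eq_sym polyC_eq0 (negPf gb).
by have -> : size (plane M g) = d.+1 by apply/eqP; rewrite eqn_leq s sz.
Qed.

Lemma plane_at_X0 M g d : homogeneous d g -> evalv g (row k2 M) != 0 -> at_X0 (plane M g) != 0.
Proof.
move=> hg gb; have [_ t] := plane_top M hg; apply: contra_neq gb => h.
by have := coef_at_X0 (plane M g) d; rewrite h coef0 t coefC.
Qed.

(** The coordinates of a point in the basis formed by the rows of M, when M is invertible. *)
Definition dual_form M (k : 'I_3) : S := \sum_(j < 3) (invmx M j k) *: X_ j.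

Lemma dual_form_homogeneous M k : homogeneous 1 (dual_form M k).
Proof.
apply: rpred_sum => j _; apply: rpredZ; rewrite dhomogX; apply/eqP; exact: mdeg1.
Qed.

Lemma dual_form_reconstruct M : M \in unitmx ->
  forall j, \sum_(k < 3) M k j *: dual_form M k = X_ j.
Proof.
move=> uM j; rewrite (eq_bigr (fun k => \sum_(l < 3) (invmx M l k * M k j) *: X_ l)); last first.
  by move=> k _; rewrite scaler_sumr; apply: eq_bigr => l _; rewrite scalerA mulrC.
rewrite exchange_big /= (bigD1 j) //= [X in _ + X]big1 ?addr0 => [|l lj]; rewrite -scaler_suml.
  have := congr1 (fun A : 'M_3 => A j j) (mulVmx uM).
  by rewrite !mxE eqxx => ->; rewrite scale1r.
have := congr1 (fun A : 'M_3 => A l j) (mulVmx uM).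
by rewrite !mxE (negPf lj) => ->; rewrite scale0r.
Qed.

Lemma dual_form_eval M k i : M \in unitmx -> evalv (dual_form M k) (row i M) = (i == k)%:R.
Proof.
move=> uM; have := congr1 (fun A : 'M_3 => A i k) (mulmxV uM); rewrite !mxE => <-.
rewrite /evalv /dual_form rmorph_sum; apply: eq_bigr => j _.
by rewrite /= mevalZ mevalXU mxE mulrC.
Qed.

Lemma plane_linear M (l : 'I_3 -> C) :
  plane M (\sum_(j < 3) l j *: X_ j) =
  (\sum_(j < 3) l j * M k0 j)%:P%:P + (\sum_(j < 3) l j * M k1 j)%:P%:P * 'X%:P +
  (\sum_(j < 3) l j * M k2 j)%:P%:P * 'X.
Proof.
rewrite rmorph_sum /= !rmorph_sum /= !mulr_suml -!big_split; apply: eq_bigr => j _ /=.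
rewrite /plane mmapZ mmap_U /plane_coord /inner_plane /iota2 /= !polyCM polyCD polyCM; ring.
Qed.

Lemma planeM M g h : plane M (g * h) = plane M g * plane M h. Proof. exact: rmorphM. Qed.
Lemma planeXn M g n : plane M (g ^+ n) = plane M g ^+ n. Proof. exact: rmorphXn. Qed.
Lemma planeB M g h : plane M (g - h) = plane M g - plane M h. Proof. exact: rmorphB. Qed.
Lemma planeD M g h : plane M (g + h) = plane M g + plane M h. Proof. exact: rmorphD. Qed.
Lemma plane_sum M (I : Type) (r : seq I) (P : pred I) (F : I -> S) :
  plane M (\sum_(i <- r | P i) F i) = \sum_(i <- r | P i) plane M (F i).
Proof. exact: rmorph_sum. Qed.

Lemma plane0 M : plane M 0 = 0. Proof. exact: rmorph0. Qed.
Lemma planeC M c : plane M (mpolyC 3 c) = c%:P%:P.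
Proof. by rewrite /plane mmapC. Qed.

Lemma planeZ M c g : plane M (c *: g) = c%:P%:P * plane M g.
Proof. by rewrite /plane mmapZ. Qed.

Lemma plane_dual M k : M \in unitmx ->
  plane M (dual_form M k) = if k == k0 then 1 else if k == k1 then 'X%:P else 'X.
Proof.
move=> uM; rewrite /dual_form plane_linear.
have E i : \sum_(j < 3) invmx M j k * M i j = (i == k)%:R.
  have := congr1 (fun A : 'M_3 => A i k) (mulmxV uM); rewrite !mxE => <-.
  by apply: eq_bigr => j _; rewrite mulrC.
rewrite !E !bool_polyC; move: k {E}.
by apply: ord3; rewrite !kE !eqxx; [exact: frame0|exact: frame1|exact: frame2].
Qed.

Lemma evalv_reconstruct M j (v : 'rV[C]_3) : M \in unitmx ->
  M k0 j * evalv (dual_form M k0) v + M k1 j * evalv (dual_form M k1) v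
  + M k2 j * evalv (dual_form M k2) v = v ord0 j.
Proof.
move=> /dual_form_reconstruct/(_ j) e; rewrite -(evalvX j v) -e sum3.
move: (dual_form M k0) (dual_form M k1) (dual_form M k2) => f0 f1 f2.
by rewrite !evalvD !evalvZ.
Qed.

Lemma mmap_difference (B : comNzRingType) (iota : {rmorphism C -> B}) (h1 h2 : 'I_3 -> B) (l : B) g :
  (forall j, exists c, h1 j - h2 j = c * l) -> exists c, mmap iota h1 g - mmap iota h2 g = c * l.
Proof.
move=> H; elim/mpoly_closure_ind: g => [c|i|p q [c1 e1] [c2 e2]|p q [c1 e1] [c2 e2]].
- by exists 0; rewrite !mmapC subrr mul0r.
- by rewrite !mmap_U.
- by exists (c1 + c2); rewrite !mmapD mulrDl -e1 -e2; ring.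
exists (c1 * mmap iota h1 q + mmap iota h2 p * c2); rewrite !rmorphM /=.
have -> : (c1 * mmap iota h1 q + mmap iota h2 p * c2) * l =
  c1 * l * mmap iota h1 q + mmap iota h2 p * (c2 * l) by ring.
by rewrite -e1 -e2; ring.
Qed.

Lemma mmap_id g : mmap (@mpolyC 3 C) X_ g = g.
Proof.
elim/mpoly_closure_ind: g => [c|i|p q hp hq|p q hp hq].
- by rewrite mmapC. - by rewrite mmap_U. - by rewrite mmapD hp hq.
by rewrite rmorphM /= hp hq.
Qed.

Lemma mmap_comp (B1 B2 : comNzRingType) (f1 : {rmorphism C -> B1}) (f2 : {rmorphism C -> B2})
    (phi : {rmorphism B1 -> B2}) (h : 'I_3 -> B1) g : (forall c, phi (f1 c) = f2 c) ->
  phi (mmap f1 h g) = mmap f2 (phi \o h) g.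
Proof.
move=> H; elim/mpoly_closure_ind: g => [c|i|p q hp hq|p q hp hq].
- by rewrite !mmapC H. - by rewrite !mmap_U. - by rewrite !mmapD rmorphD hp hq.
by rewrite !rmorphM /= hp hq.
Qed.

(** The restriction to the plane through 0 spanned by the last two rows, that is, to the points at
    infinity of the affine plane. *)
Definition at_infinity M : S -> BP :=
  mmap (iota2 R) (fun j => (M k1 j)%:P%:P * 'X%:P + (M k2 j)%:P%:P * 'X).
HB.instance Definition _ M := GRing.RMorphism.copy (at_infinity M)
  (mmap (iota2 R) (fun j => (M k1 j)%:P%:P * 'X%:P + (M k2 j)%:P%:P * 'X)).

Lemma at_infinity_dual M : M \in unitmx -> at_infinity M (dual_form M k0) = 0.
Proof.
move=> uM; rewrite /dual_form rmorph_sum /=.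
have E i : \sum_(j < 3) invmx M j k0 * M i j = (i == k0)%:R.
  have := congr1 (fun A : 'M_3 => A i k0) (mulmxV uM); rewrite !mxE => <-.
  by apply: eq_bigr => j _; rewrite mulrC.
transitivity ((\sum_(j < 3) invmx M j k0 * M k1 j)%:P%:P * 'X%:P +
              (\sum_(j < 3) invmx M j k0 * M k2 j)%:P%:P * 'X : BP).
  rewrite !rmorph_sum /= !mulr_suml -big_split; apply: eq_bigr => j _ /=.
  by rewrite /at_infinity mmapZ mmap_U /iota2 /= !polyCM; ring.
by rewrite !E !kE !bool_polyC; exact: frame_zero.
Qed.

Local Opaque dual_form evalv plane at_infinity.

(** Substituting [dual_form] for the two variables brings the restriction back to S, and changes
    each coordinate only by a multiple of [dual_form M k0]. *)
Lemma at_infinity_dvd M g : M \in unitmx -> at_infinity M g = 0 -> exists q, g = q * dual_form M k0.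
Proof.
move=> uM h.
have [phi [phiC phiX phiX1]] : exists phi : {rmorphism BP -> S},
    [/\ forall c, phi c%:P%:P = mpolyC 3 c, phi 'X = dual_form M k2 & phi 'X%:P = dual_form M k1].
  exists (horner_eval (dual_form M k2) \o
   map_poly (horner_eval (dual_form M k1) \o map_poly (@mpolyC 3 C))); split=> [c||] /=.
  - by rewrite map_polyC /= /horner_eval hornerC map_polyC /= hornerC.
  - by rewrite map_polyX /horner_eval hornerX.
  - by rewrite map_polyC /horner_eval /= hornerC /horner_eval map_polyX hornerX.
have E := congr1 phi h; rewrite rmorph0 (@mmap_comp _ _ (iota2 R) (@mpolyC 3 C) phi _ _ phiC) in E.
have [j|c hc] := @mmap_difference S (@mpolyC 3 C) X_
   (phi \o (fun j => (M k1 j)%:P%:P * 'X%:P + (M k2 j)%:P%:P * 'X)) (dual_form M k0) g.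
  exists (mpolyC 3 (M k0 j)); rewrite -(dual_form_reconstruct uM j) sum3 /comp rmorphD.
  rewrite (rmorphM phi) (rmorphM phi) !phiC phiX phiX1 -!mul_mpolyC; exact: add_sub_cancel.
by exists c; rewrite -hc E subr0 mmap_id.
Qed.

(** By homogeneity g vanishes wherever l = [dual_form M k0] does not, so l g = 0. *)
Lemma homogeneous_plane_eq0 M g d : M \in unitmx -> homogeneous d g -> plane M g = 0 -> g = 0.
Proof.
move=> uM hg h.
have l0 : dual_form M k0 != 0.
  apply/eqP => l0; have := dual_form_eval k0 k0 uM.
  by rewrite l0 evalv0 eqxx => /eqP; rewrite eq_sym oner_eq0.
suff : dual_form M k0 * g = 0 by move/eqP; rewrite mulf_eq0 (negPf l0) => /eqP.
apply: mpoly_eval_eq0 => v; rewrite evalvM.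
have [->|c0] := eqVneq (evalv (dual_form M k0) v) 0; first by rewrite mul0r.
suff -> : evalv g v = 0 by rewrite mulr0.
transitivity (evalv g (evalv (dual_form M k0) v *: (row k0 M +
   (evalv (dual_form M k1) v / evalv (dual_form M k0) v) *: row k1 M +
   (evalv (dual_form M k2) v / evalv (dual_form M k0) v) *: row k2 M))).
  congr evalv; apply/rowP => j; rewrite !mxE -[LHS](evalv_reconstruct j v uM).
  exact: affine_rescale.
by rewrite (evalv_scale _ _ hg) -ev2_plane h /ev2 !horner0 mulr0.
Qed.

Lemma homogeneousM d1 d2 g h : homogeneous d1 g -> homogeneous d2 h -> homogeneous (d1 + d2) (g * h).
Proof. by move=> hg hh; apply: dhomogM. Qed.

Lemma plane_monomial M c n i j : M \in unitmx ->
  plane M (c *: (dual_form M k0 ^+ n * dual_form M k1 ^+ i * dual_form M k2 ^+ j)) =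
  c%:P%:P * 'X%:P ^+ i * 'X ^+ j.
Proof.
move=> uM; have := plane_dual k0 uM; have := plane_dual k1 uM; have := plane_dual k2 uM.
rewrite !kE !eqxx; move: (dual_form M k0) (dual_form M k1) (dual_form M k2) => f0 f1 f2 e2 e1 e0.
rewrite planeZ (planeM M (f0 ^+ n * f1 ^+ i) (f2 ^+ j)) (planeM M (f0 ^+ n) (f1 ^+ i)).
rewrite (planeXn M f0) (planeXn M f1) (planeXn M f2) e0 e1 e2.
exact: mul_expr1n.
Qed.

(** The exponent D - (i + j) is a truncated subtraction, so D must be large for the result to be
    homogeneous. *)
Definition homogenize M (D : nat) (q : BP) : S :=
  \sum_(j < size q) \sum_(i < size q`_j)
    (q`_j)`_i *: (dual_form M k0 ^+ (D - (i + j)) * dual_form M k1 ^+ i * dual_form M k2 ^+ j).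

Lemma homogenize_spec M (q : BP) : M \in unitmx -> exists D0, forall D, (D0 <= D)%N ->
  homogeneous D (homogenize M D q) /\ plane M (homogenize M D q) = q.
Proof.
move=> uM; exists (\sum_(j < size q) (size (q`_j)%R + j))%N => D hD; split.
  apply: rpred_sum => j _; apply: rpred_sum => i _; apply: rpredZ.
  have ijD : (i + j <= D)%N.
    apply: leq_trans hD; rewrite (bigD1 j) //= (leq_trans _ (leq_addr _ _)) // leq_add2r.
    exact: ltnW (ltn_ord i).
  have hX k e : homogeneous e (dual_form M k ^+ e).
    by have := dhomogMn e (dual_form_homogeneous M k); rewrite mul1n.
  have := homogeneousM (homogeneousM (hX k0 (D - (i + j))%N) (hX k1 i)) (hX k2 j).
  by rewrite -addnA subnK.
rewrite /homogenize plane_sum -[RHS]coefK poly_def; apply: eq_bigr => j _.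
rewrite plane_sum -[in RHS](coefK q`_j) poly_def scaler_suml; apply: eq_bigr => i _.
rewrite plane_monomial //.
by rewrite -mul_polyC -mul_polyC polyCM polyC_exp.
Qed.

Lemma homogeneousX d k g : homogeneous d g -> homogeneous (d * k) (g ^+ k).
Proof. by move=> hg; apply: dhomogMn. Qed.

Lemma homogeneousB d g h : homogeneous d g -> homogeneous d h -> homogeneous d (g - h).
Proof. by move=> hg hh; apply: rpredB. Qed.

End Plane.

(** Powers of l are removed one at a time: l divides W or E. If it divides W, one of the two factors
    l cancels and the other is moved into E. As P l = 1, the image of W does not change. *)
Lemma square_descent (A B : idomainType) (P I : {rmorphism A -> B}) (l : A) :
  P l = 1 -> l != 0 -> I l = 0 -> (forall g, I g = 0 -> exists q, g = q * l) ->
  forall k f W E, l ^+ k * f = W ^+ 2 * E -> exists W' E', P W' = P W /\ f = W' ^+ 2 * E'.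
Proof.
move=> Pl l0 Il dvd; elim=> [|k IH] f W E hk.
  by exists W, E; rewrite -hk expr0 mul1r.
have : I W ^+ 2 * I E = 0 by rewrite -rmorphXn -rmorphM -hk exprS !rmorphM /= Il !mul0r.
move/eqP; rewrite mulf_eq0 expf_eq0 /= => /orP[/eqP/dvd|/eqP/dvd] [Q hQ].
  have [|W' [E' [h1 h2]]] := IH f Q (l * E); last first.
    by exists W', E'; rewrite h1 hQ rmorphM /= Pl mulr1.
  by apply: (mulfI l0); rewrite hQ in hk; exact: cancel_square_factor.
apply: (IH f W Q).
by apply: (mulfI l0); rewrite hQ in hk; exact: cancel_factor.
Qed.

Section Plane.
Variable R : realType.
Local Notation C := (Cplx R).
Local Notation BP := {poly {poly C}}.
Local Notation S := (Cpoly R 3).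
Implicit Types (g h : S) (M : 'M[C]_3).
Local Opaque dual_form evalv plane at_infinity.

(** A square factor of the restriction, homogenized, gives one of l^k f, and by descent one of f
    itself; it would be a constant. *)
Lemma reduced_no_square M f d (w e : BP) : M \in unitmx -> reduced_curve d f ->
  plane M f = w ^+ 2 * e -> (1 < size w)%N -> False.
Proof.
move=> uM [d0 hf red] hwe sw.
have [D1 h1] := homogenize_spec w uM; have [D2 h2] := homogenize_spec e uM.
have [hW pW] := h1 D1 (leqnn _); have [hE pE] := h2 (D2 + d)%N (leq_addr _ _).
have [W0 hW0] : exists W, homogenize M D1 w = W by eexists.
move: hW pW; rewrite hW0; move: W0 {hW0} => W hW pW.
have [E0 hE0] : exists E, homogenize M (D2+d) e = E by eexists.
move: hE pE; rewrite hE0; move: E0 {hE0} => E hE pE.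
set l := dual_form M k0.
have pl : plane M l = 1 by rewrite /l plane_dual // eqxx.
have hl : homogeneous 1 l := dual_form_homogeneous M k0.
pose k := (D1 * 2 + D2)%N.
have hk : l ^+ k * f = W ^+ 2 * E.
  apply/eqP; rewrite -subr_eq0; apply/eqP; apply: (@homogeneous_plane_eq0 _ M _ (k + d)%N uM).
    have h3 := homogeneousX k hl; rewrite mul1n in h3.
    have h4 := homogeneousM (homogeneousX 2 hW) hE; rewrite addnA in h4.
    exact: (homogeneousB (homogeneousM h3 hf) h4).
  by rewrite planeB (planeM M (l ^+ k)) (planeM M (W ^+ 2)) (planeXn M l) (planeXn M W) pl pW pE hwe; exact: one_expr_sub.
have l0 : l != 0 by apply/eqP => l0; move/eqP: pl; rewrite l0 plane0 eq_sym oner_eq0.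
pose P0 : {rmorphism S -> BP} := plane M.
pose I0 : {rmorphism S -> BP} := at_infinity M.
have D := @square_descent S BP P0 I0 l.
have D2x := D pl.
have D3 := D2x l0.
have D4 := D3 (at_infinity_dual uM).
have D5 := D4 (fun g => @at_infinity_dvd _ M g uM).
have [W' [E' [h3 h4]]] := D5 _ _ _ _ hk.
have Wu : W' \is a GRing.unit by apply: red; exists E'; rewrite mulrC.
have [c hc] : exists c, W' = mpolyC 3 c by move: Wu => /andP[/eqP -> _]; eexists.
have h5 : plane M W' = w by rewrite -pW; exact: h3.
by move: sw; rewrite -h5 hc planeC size_polyC; case: eqP.
Qed.

Lemma reduced_discriminant M f d : M \in unitmx -> reduced_curve d f -> evalv f (row k2 M) != 0 ->
  exists p : {poly C}, exists U V : BP, p != 0 /\ p%:P = U * plane M f + V * dY (plane M f).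
Proof.
move=> uM rf fb; have [d0 hf _] := rf; have [sz lc] := plane_size hf fb.
have s1 : (1 < size (plane M f))%N by rewrite sz ltnS.
have [[w [e [hwe sw]]]|] := coprime_deriv_or_square fb lc s1; last by [].
by have := reduced_no_square uM rf hwe sw.
Qed.

End Plane.

(** Subtracting [rr k0] times the Euler field makes a homogeneous field tangent to the affine plane;
    Euler's relation accounts for the last term. *)
Lemma frame_gradient (B : comNzRingType) (dt : B) (r g c : 'I_3 -> B) (M N : 'I_3 -> 'I_3 -> B) (X Y G : B) :
  (forall i j, \sum_(k < 3) N j k * M k i = (i == j)%:R) ->
  (forall j, c j = M k0 j + M k1 j * X + M k2 j * Y) ->
  \sum_(j < 3) c j * g j = dt * G ->
  let rr k := \sum_(j < 3) r j * N j k in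
  (rr k1 - X * rr k0) * (\sum_(j < 3) g j * M k1 j) + (rr k2 - Y * rr k0) * (\sum_(j < 3) g j * M k2 j)
   = \sum_(j < 3) r j * g j - dt * rr k0 * G.
Proof.
move=> hNM hc hE rr.
have hr i : r i = \sum_(k < 3) rr k * M k i.
  rewrite (eq_bigr (fun k => \sum_(j < 3) r j * (N j k * M k i))); last first.
    by move=> k _; rewrite mulr_suml; apply: eq_bigr => j _; rewrite mulrA.
  rewrite exchange_big /= (bigD1 i) //= -mulr_sumr hNM eqxx mulr1 big1 ?addr0 // => j ji.
  by rewrite -mulr_sumr hNM eq_sym (negPf ji) mulr0.
have hG : \sum_(j < 3) r j * g j = rr k0 * \sum_(j < 3) g j * M k0 j +
   rr k1 * (\sum_(j < 3) g j * M k1 j) + rr k2 * (\sum_(j < 3) g j * M k2 j).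
  by rewrite !sum3 !hr !sum3; ring.
have hE' : \sum_(j < 3) g j * M k0 j + (\sum_(j < 3) g j * M k1 j) * X + (\sum_(j < 3) g j * M k2 j) * Y = dt * G.
  by rewrite -hE !sum3 !hc; ring.
rewrite hG; move: hE'; move: (\sum_(j < 3) g j * M k0 j) (\sum_(j < 3) g j * M k1 j) (\sum_(j < 3) g j * M k2 j) => a b e h.
have -> : dt * rr k0 * G = rr k0 * (dt * G) by ring.
by rewrite -h; ring.
Qed.

Lemma frame_curve (B : comNzRingType) (s t x y g0 a b c l e : B) :
  s * t = 1 + e * l -> a * t + b * x + c * y = g0 ->
  (a + b * (s * x) + c * (s * y)) - s * g0 = (- (a * e)) * l.
Proof. 
move=> h <-; have -> : - (a * e) * l = a * (1 - s * t) by rewrite h; ring.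
ring. 
Qed.

Lemma inverse_mod (K : fieldType) (t : {poly K}) n : t`_0 = 1 ->
  exists s e : {poly K}, s * t = 1 + e * 'X^n /\ ((0 < n)%N -> s`_0 = 1).
Proof.
move=> t0.
have [q hq] : exists q, 1 - t = q * 'X.
  apply/dvdpP; rewrite -['X]subr0 -(polyC0 K) dvdp_XsubCl /root hornerD hornerN hornerC.
  by rewrite horner_coef0 t0 subrr.
exists (\sum_(i < n) (1 - t) ^+ i), (- q ^+ n); split=> [|n0].
  have := subrX1 (1 - t) n; have -> : 1 - t - 1 = - t by ring.
  by move: (\sum_(i < n) _) => s; rewrite hq exprMn => h; rewrite [s * t]mulrC -[LHS]opprK -mulNr -h; ring.
case: n n0 => // n _; rewrite -horner_coef0 horner_sum big_ord_recl expr0 hornerC big1 ?addr0 // => i _.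
by rewrite horner_exp hornerD hornerN hornerC horner_coef0 t0 subrr expr0n.
Qed.

Section Curve.
Variable K : closedFieldType.
Implicit Types (x y : {poly K}) (F G : {poly {poly K}}).
Lemma curveD x y F G : curve x y (F + G) = curve x y F + curve x y G.
Proof. by rewrite /curve rmorphD hornerD. Qed.
Lemma curveM x y F G : curve x y (F * G) = curve x y F * curve x y G.
Proof. by rewrite /curve rmorphM hornerM. Qed.
Lemma curve_coord x y a b c : curve x y ((a%:P + b%:P * 'X)%:P + c%:P%:P * 'X) = a%:P + b%:P * x + c%:P * y.
Proof. by rewrite curveD curveM curveX !curveC comp_polyD comp_polyM comp_polyX !comp_polyC. Qed.
End Curve.

(** * Local divisibility along a parametrized curve *)

Section Local.
Variable R : realType.
Local Notation C := (Cplx R).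
Local Notation BP := {poly {poly C}}.
Local Notation S := (Cpoly R 3).
Local Notation X_ := (fun i : 'I_3 => mpolyX C (mnm1 i)).
Implicit Types (g h : S) (M : 'M[C]_3).

Definition along (gam : 'I_3 -> {poly C}) : S -> {poly C} := mmap (@polyC C) gam.
Lemma alongD gam g h : along gam (g + h) = along gam g + along gam h. Proof. exact: mmapD. Qed.
Lemma alongB gam g h : along gam (g - h) = along gam g - along gam h. Proof. exact: mmapB. Qed.
Lemma alongM gam g h : along gam (g * h) = along gam g * along gam h. Proof. exact: rmorphM. Qed.
Lemma alongXn gam g n : along gam (g ^+ n) = along gam g ^+ n. Proof. exact: rmorphXn. Qed.
Lemma alongZ gam c g : along gam (c *: g) = c%:P * along gam g. Proof. exact: mmapZ. Qed.
Lemma along_var gam j : along gam (X_ j) = gam j. Proof. exact: mmap_U. Qed.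
Lemma alongC gam c : along gam (mpolyC 3 c) = c%:P. Proof. exact: mmapC. Qed.
Lemma along0 gam : along gam 0 = 0. Proof. exact: mmap0. Qed.
Lemma along_sum gam (I : Type) (r : seq I) (P : pred I) (F : I -> S) :
  along gam (\sum_(i <- r | P i) F i) = \sum_(i <- r | P i) along gam (F i).
Proof. exact: rmorph_sum. Qed.
Lemma along_scale s gam d g : homogeneous d g ->
  along (fun j => s * gam j) g = s ^+ d * along gam g.
Proof. exact: mmap_homogeneous. Qed.
Lemma along_horner gam g t : (along gam g).[t] = evalv g (\row_j (gam j).[t]).
Proof.
elim/mpoly_closure_ind: g => [c|i|p q hp hq|p q hp hq].
- by rewrite alongC hornerC evalvC. - by rewrite along_var evalvX mxE.
- by rewrite alongD hornerD hp hq evalvD.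
by rewrite alongM hornerM hp hq evalvM.
Qed.

Lemma curve_plane M x y g :
  curve x y (plane M g) = along (fun j => (M k0 j)%:P + (M k1 j)%:P * x + (M k2 j)%:P * y) g.
Proof.
elim/mpoly_closure_ind: g => [c|i|p q hp hq|p q hp hq].
- by rewrite planeC alongC curveC comp_polyC.
- by rewrite along_var /plane mmap_U; exact: curve_coord.
- by rewrite planeD curveD hp hq alongD.
by rewrite planeM curveM hp hq alongM.
Qed.
End Local.

Lemma det3_neq0 (K : fieldType) (v b : 'rV[K]_3) : v != 0 ->
  (forall c, b != c *: v) -> exists a : 'rV[K]_3, (\matrix_(i, j) (if i == k0 then v else if i == k1 then a else b) ord0 j) \in unitmx.
Proof.
move=> v0 hb; have /rV0Pn[i vi] := v0.
have /rV0Pn[j] : b - (b ord0 i / v ord0 i) *: v != 0 by rewrite subr_eq0.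
rewrite !mxE => bj.
have ij : i != j by apply: contraNneq bj => <-; rewrite divfK // subrr.
have [l /andP[li lj]] : exists l : 'I_3, (l != i) && (l != j).
  move: i j ij {vi bj}; apply: ord3; apply: ord3; rewrite ?kE ?eqxx // => _;
  by [exists k0|exists k1|exists k2].
exists (delta_mx 0 l).
set M := \matrix_(i, j) _.
rewrite -row_free_unit -kermx_eq0; apply/eqP/row_matrixP => r; rewrite row0.
set u := row r _.
have hu : u *m M = 0 by apply/eqP; rewrite -sub_kermx row_sub.
clearbody u.
have E s : u ord0 k0 * v ord0 s + u ord0 k1 * (s == l)%:R + u ord0 k2 * b ord0 s = 0.
  by have := congr1 (fun A : 'rV[K]_3 => A ord0 s) hu; rewrite mxE [RHS]mxE sum3 !(mxE matrix_key) !kE !eqxx mxE eqxx /=.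
have Ei := E i; have Ej := E j; have El := E l.
rewrite eqxx in El; rewrite eq_sym (negPf li) mulr0 addr0 in Ei.
rewrite eq_sym (negPf lj) mulr0 addr0 in Ej.
have u2 : u ord0 k2 = 0.
  apply/eqP; have : u ord0 k2 * (b ord0 j - b ord0 i / v ord0 i * v ord0 j) = 0.
    have -> : u ord0 k2 * (b ord0 j - b ord0 i / v ord0 i * v ord0 j) =
       (u ord0 k0 * v ord0 j + u ord0 k2 * b ord0 j) - (u ord0 k0 * v ord0 i + u ord0 k2 * b ord0 i) / v ord0 i * v ord0 j.
      by field.
    by rewrite Ei Ej !mul0r subrr.
  by move/eqP; rewrite mulf_eq0 (negPf bj) orbF.
have u0 : u ord0 k0 = 0.
  by move/eqP: Ei; rewrite u2 mul0r addr0 mulf_eq0 (negPf vi) orbF => /eqP.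
have u1 : u ord0 k1 = 0 by move: El; rewrite u0 u2 !mul0r add0r addr0 mulr1.
by apply/rowP; apply: ord3; rewrite mxE ?u0 ?u1 ?u2.
Qed.

Section Local.
Variable R : realType.
Local Notation C := (Cplx R).
Local Notation BP := {poly {poly C}}.
Local Notation S := (Cpoly R 3).
Local Notation X_ := (fun i : 'I_3 => mpolyX C (mnm1 i)).
Implicit Types (g h : S) (M : 'M[C]_3) (rho : 'I_3 -> S).

Definition apply_field rho g : S := \sum_(j < 3) rho j * mderiv j g.

Lemma plane_coordE M j : plane_coord M j = (M k0 j)%:P%:P + (M k1 j)%:P%:P * 'X%:P + (M k2 j)%:P%:P * 'X.
Proof. by rewrite /plane_coord /inner_plane polyCD polyCM. Qed.

Lemma plane_euler M d g : homogeneous d g ->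
  \sum_(j < 3) plane_coord M j * plane M (mderiv j g) = d%:R%:P%:P * plane M g.
Proof.
move=> hg; rewrite -planeZ -(euler hg) plane_sum; apply: eq_bigr => j _.
by rewrite planeM; congr (_ * _); rewrite /plane mmap_U.
Qed.

Definition plane_component M rho k : BP := \sum_(j < 3) plane M (rho j) * (invmx M j k)%:P%:P.

Lemma plane_field M d g rho : M \in unitmx -> homogeneous d g ->
  (plane_component M rho k1 - 'X%:P * plane_component M rho k0) * dX (plane M g) +
  (plane_component M rho k2 - 'X * plane_component M rho k0) * dY (plane M g) =
  plane M (apply_field rho g) - d%:R%:P%:P * plane_component M rho k0 * plane M g.
Proof.
move=> uM hg; rewrite plane_dX plane_dY plane_sum.
have -> : \sum_(j < 3) plane M (rho j * mderiv j g) = \sum_(j < 3) plane M (rho j) * plane M (mderiv j g).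
  by apply: eq_bigr => j _; exact: planeM.
apply: (@frame_gradient BP d%:R%:P%:P (fun j => plane M (rho j)) (fun j => plane M (mderiv j g)) (plane_coord M)
   (fun k j => (M k j)%:P%:P) (fun j k => (invmx M j k)%:P%:P) 'X%:P 'X (plane M g)).
- move=> i j; rewrite -bool_polyC.
  transitivity (\sum_(k < 3) invmx M j k * M k i)%:P%:P.
    by rewrite !rmorph_sum; apply: eq_bigr => k _; rewrite /= !polyCM.
  by have := congr1 (fun A : 'M_3 => A j i) (mulVmx uM); rewrite !mxE eq_sym => ->.
- exact: plane_coordE.
exact: plane_euler.
Qed.

Lemma plane_quasihomogeneous M D g : M \in unitmx -> homogeneous D g ->
  quasihomogeneous_singularities g -> singular_point g (row k0 M) ->
  quasihomogeneous_at0 (fun x y => ev2 (plane M g) x y).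
Proof.
move=> uM hg qh [v0 gv dg]; have /rV0Pn[i vi] := v0.
have E a b : \sum_(j < 3) invmx M j a * M b j = (b == a)%:R.
  have := congr1 (fun A : 'M_3 => A b a) (mulmxV uM); rewrite !mxE => <-.
  by apply: eq_bigr => j _; rewrite mulrC.
have E' (a b : 'I_3) : \sum_(j < 3) (\row_j invmx M j a) ord0 j * row b M ord0 j = (b == a)%:R.
  by rewrite -E; apply: eq_bigr => j _; rewrite !mxE.
have sp : singular_point g (chart i (pt (row k0 M ord0 (lift i (ord0 : 'I_2)) / row k0 M ord0 i)
     (row k0 M ord0 (lift i (lift ord0 ord0 : 'I_2)) / row k0 M ord0 i))).
  rewrite (chart_point vi); split.
  - by rewrite scaler_eq0 negb_or invr_eq0 vi.
  - by rewrite (evalv_scale _ _ hg) gv mulr0.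
  by move=> j; rewrite (evalv_scale _ _ (homogeneous_mderiv j hg)) dg mulr0.
have := @quasihomogeneous_plane R g D (row k0 M) (row k1 M) (row k2 M) (\row_j invmx M j k1) (\row_j invmx M j k2) i hg vi.
rewrite !E' !kE !eqxx => /(_ erefl erefl erefl erefl erefl erefl (qh _ _ sp)).
by congr quasihomogeneous_at0; apply/funext => x; apply/funext => y; rewrite ev2_plane.
Qed.

End Local.

Lemma dvdp_congr (K : fieldType) (a b c d : {poly K}) : a - b = c * d -> d %| a -> d %| b.
Proof. by move=> h da; rewrite -(dvdp_subr _ da) h dvdp_mull. Qed.

Lemma poly_shift_factor (K : fieldType) (a b c s : {poly K}) (m n N : nat) : (m < N)%N ->
  a - s ^+ n * ('X^m * b) = c * 'X^N -> s`_0 = 1 -> b.[0] != 0 ->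
  exists b', a = 'X^m * b' /\ b'.[0] != 0.
Proof.
move=> mN h s0 b0; exists (s ^+ n * b + c * 'X^(N - m)); split.
  have -> : a = s ^+ n * ('X^m * b) + c * 'X^N by rewrite -h; ring.
  have -> : 'X^N = 'X^m * 'X^(N - m) :> {poly K} by rewrite -exprD subnKC // ltnW.
  by ring.
rewrite hornerD !hornerM horner_exp [s.[0]]horner_coef0 s0 expr1n mul1r hornerXn.
by rewrite expr0n subn_eq0 leqNgt mN mulr0 addr0.
Qed.

Lemma coprime_unit_factor (K : fieldType) (a s : {poly K}) (m n : nat) :
  s`_0 = 1 -> 'X^m %| s ^+ n * a -> 'X^m %| a.
Proof.
move=> s0; rewrite Gauss_dvdpr //; apply: coprimep_expl; apply: coprimep_expr; rewrite coprimep_sym.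
by rewrite -['X]subr0 -(polyC0 K) coprimep_XsubC /root horner_coef0 s0 oner_eq0.
Qed.

Lemma coef1_mul (K : fieldType) (s x : {poly K}) : s`_0 = 1 -> x`_0 = 0 -> (s * x)`_1 = x`_1.
Proof. by move=> s0 x0; rewrite coefM !big_ord_recl big_ord0 /= s0 x0 mul1r mulr0 !addr0. Qed.

Lemma mul_coef0_eq0 (K : fieldType) (s x : {poly K}) : x`_0 = 0 -> 'X %| s * x.
Proof.
move=> x0; apply: dvdp_mull.
by rewrite -['X]subr0 -(polyC0 K) dvdp_XsubCl /root horner_coef0 x0.
Qed.

Lemma curveB (K : closedFieldType) (x y : {poly K}) (F G : {poly {poly K}}) :
  curve x y (F - G) = curve x y F - curve x y G.
Proof. by rewrite /curve rmorphB hornerD hornerN. Qed.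

Section Local.
Variable R : realType.
Local Notation C := (Cplx R).
Local Notation BP := {poly {poly C}}.
Local Notation S := (Cpoly R 3).
Local Notation X_ := (fun i : 'I_3 => mpolyX C (mnm1 i)).
Implicit Types (g h : S) (M : 'M[C]_3) (rho : 'I_3 -> S) (gam : 'I_3 -> {poly C}).

Lemma reduced_neq0 d g : reduced_curve d g -> g != 0.
Proof.
move=> [_ _ red]; apply/eqP => g0.
have : (0 : S) \is a GRing.unit by apply: red; exists 0; rewrite g0 mul0r.
by rewrite unitr0.
Qed.

Lemma homogeneous_apply_field s d rho g : (forall j, homogeneous s (rho j)) -> homogeneous d g ->
  homogeneous (s + d.-1) (apply_field rho g).
Proof.
move=> hr hg; apply: rpred_sum => j _.
exact: homogeneousM (hr j) (homogeneous_mderiv j hg).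
Qed.

Definition frame_component M gam k : {poly C} := \sum_(j < 3) gam j * (invmx M j k)%:P.

Lemma frame_component_reconstruct M gam j : M \in unitmx ->
  (M k0 j)%:P * frame_component M gam k0 + (M k1 j)%:P * frame_component M gam k1 +
  (M k2 j)%:P * frame_component M gam k2 = gam j.
Proof.
move=> uM; rewrite -(sum3 (fun k => (M k j)%:P * frame_component M gam k)).
rewrite (eq_bigr (fun k => \sum_(i < 3) gam i * (invmx M i k * M k j)%:P)); last first.
  by move=> k _; rewrite mulr_sumr; apply: eq_bigr => i _; rewrite polyCM; ring.
have E i : (\sum_(k < 3) (invmx M i k * M k j)%:P) = (i == j)%:R%:P.
  rewrite -rmorph_sum; congr polyC.
  by have := congr1 (fun A : 'M_3 => A i j) (mulVmx uM); rewrite !mxE.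
rewrite exchange_big (bigD1 j) //= -mulr_sumr E eqxx big1 ?addr0; first exact: mulr1.
by move=> i ij; rewrite -mulr_sumr E (negPf ij); exact: mulr0.
Qed.

Lemma frame_component_coef0 M gam k : M \in unitmx ->
  (forall j, (gam j)`_0 = M k0 j) -> (frame_component M gam k)`_0 = (k0 == k)%:R.
Proof.
move=> uM h; rewrite coef_sum.
have := congr1 (fun A : 'M_3 => A k0 k) (mulmxV uM); rewrite !mxE => <-.
by apply: eq_bigr => j _; rewrite coefMC h.
Qed.

(** The curve is brought into the affine plane up to order N by multiplying with the truncated
    inverse s of its coordinate [k0]; on a form of degree d this costs s^d. *)
Lemma curve_congr M gam d g (s e : {poly C}) N : M \in unitmx -> homogeneous d g ->
  s * frame_component M gam k0 = 1 + e * 'X^N ->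
  exists c, curve (s * frame_component M gam k1) (s * frame_component M gam k2) (plane M g) - s ^+ d * along gam g
   = c * 'X^N.
Proof.
move=> uM hg hs; rewrite curve_plane -(along_scale s gam hg); apply: mmap_difference => j.
exists (- ((M k0 j)%:P * e)).
exact: (frame_curve hs (frame_component_reconstruct gam j uM)).
Qed.

Lemma frame_through f d v : homogeneous d f -> f != 0 -> v != 0 -> evalv f v = 0 ->
  exists M, [/\ M \in unitmx, row k0 M = v & evalv f (row k2 M) != 0].
Proof.
move=> hf f0 v0 fv.
have [b fb] : exists b, evalv f b != 0.
  apply: contrapT => h; case/eqP: f0; apply: mpoly_eval_eq0 => b.
  by apply/eqP/negPn/negP => fb; apply: h; exists b.
have hb c : b != c *: v.
  by apply: contra_neq fb => ->; rewrite (evalv_scale _ _ hf) fv mulr0.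
have [a ua] := det3_neq0 v0 hb; eexists; split; first exact: ua.
  by apply/rowP => j; rewrite !mxE eqxx.
suff -> : row k2 (\matrix_(i, j) (if i == k0 then v else if i == k1 then a else b) ord0 j) = b by [].
by apply/rowP => j; rewrite !mxE !kE.
Qed.

(** In an affine plane through the common point, the field induced by rho multiplies f1 by - d1
    rho_0, where rho_0 is its component [k0], and sends f2 to rho(f2) - d2 rho_0 f2. The last term
    is negligible along the curve, so [local_divisibility] applies. *)
Lemma local_field_divisibility f1 f2 d1 d2 gam rho delta m phi :
  reduced_curve d1 f1 -> homogeneous d2 f2 -> quasihomogeneous_singularities (f1 * f2) ->
  AR_deg f1 delta rho ->
  (exists j, (gam j)`_0 != 0) -> (forall c, exists j, (gam j)`_1 != c * (gam j)`_0) ->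
  along gam f2 = 0 -> along gam f1 = 'X^m * phi -> phi.[0] != 0 ->
  'X^(m.-1) %| along gam (apply_field rho f2).
Proof.
move=> rf1 hf2 qh [ar hrho] [j0 g0] imm a2 a1 phi0.
case: m a1 => [|m] a1; first by rewrite expr0 dvd1p.
have [_ hf1 _] := rf1; have f10 := reduced_neq0 rf1.
pose v : 'rV[C]_3 := \row_j (gam j).[0].
have f1v : evalv f1 v = 0 by rewrite -along_horner a1 hornerM hornerXn expr0n mul0r.
have f2v : evalv f2 v = 0 by rewrite -along_horner a2 horner0.
have v0 : v != 0 by apply/rV0Pn; exists j0; rewrite mxE horner_coef0.
have [M [uM Mv Mb]] := frame_through hf1 f10 v0 f1v.
have Mg j : (gam j)`_0 = M k0 j.
  by rewrite -horner_coef0; have := congr1 (fun A : 'rV_3 => A ord0 j) Mv; rewrite !mxE => ->.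
have [p [U [V [p0 hp]]]] := reduced_discriminant uM rf1 Mb.
have ax := plane_at_X0 hf1 Mb.
have sp : singular_point (f1 * f2) (row k0 M).
  rewrite Mv; split=> //; first by rewrite evalvM f1v mul0r.
  by move=> i; rewrite mderivM evalvD !evalvM f1v f2v mulr0 mul0r addr0.
have hq := plane_quasihomogeneous uM (homogeneousM hf1 hf2) qh sp.
have fl := flow_exists hq (fun x y => erefl _).
have fl' N : exists c1 c2 e, flow_adapted (plane M f1 * plane M f2) N c1 c2 e.
  by have := fl N; rewrite planeM.
have th1 := plane_field rho uM hf1; have th2 := plane_field rho uM hf2.
have ar0 : apply_field rho f1 = 0 := ar.
rewrite ar0 plane0 sub0r -(mulNr (d1%:R%:P%:P * plane_component M rho k0)) in th1.
have [N0 key] := local_divisibility m.+1 p0 hp ax th1 fl'.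
have c0 k := frame_component_coef0 k uM Mg.
(* Large enough for f2 to vanish to order N0 on the truncated curve and for f1 to keep its exact
   order there. *)
pose N := (N0 + m.+2)%N.
have [s [e [hs s0]]] := inverse_mod N (c0 k0).
have {}s0 : s`_0 = 1 by apply: s0; rewrite /N; clear; lia.
have [q1 h1] := curve_congr uM hf1 hs; have [q2 h2] := curve_congr uM hf2 hs.
have [q3 h3] := curve_congr uM (homogeneous_apply_field hrho hf2) hs.
rewrite a1 in h1; have [|phi' [e1 phi0']] := poly_shift_factor _ h1 s0 phi0; first by rewrite /N; clear; lia.
have dN n : (n <= N)%N -> 'X^n %| ('X^N : {poly C}) by move=> nN; exact: dvdp_exp2l.
set x := s * frame_component M gam k1 in h1 h2 h3 e1; set y := s * frame_component M gam k2 in h1 h2 h3 e1.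
have d2N : 'X^N %| curve x y (plane M f2).
  by rewrite a2 mulr0 subr0 in h2; rewrite h2 dvdp_mull.
have := key x y phi'; rewrite th2 => /(_ _ _ _ _ e1 phi0') D.
have {}D : 'X^m %| curve x y (plane M (apply_field rho f2) - d2%:R%:P%:P * plane_component M rho k0 * plane M f2).
  apply: D.
  - by apply: mul_coef0_eq0; rewrite c0 kE.
  - by apply: mul_coef0_eq0; rewrite c0 kE.
  - rewrite !coef1_mul ?c0 ?kE //.
    apply/negPn; rewrite negb_or !negbK; apply/negP => /andP[/eqP z1 /eqP z2].
    have [j /eqP[]] := imm ((frame_component M gam k0)`_1).
    rewrite Mg -[gam j](frame_component_reconstruct gam j uM) !coefD !coefCM z1 z2 !mulr0 !addr0.
    exact: mulrC.
  by apply: dvdp_trans d2N; apply: dN; rewrite /N; clear; lia.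
have mN : (m <= N)%N by rewrite /N; clear; lia.
apply: (coprime_unit_factor (n := delta + d2.-1) s0).
apply: (@dvdp_congr _ (curve x y (plane M (apply_field rho f2))) _ (q3 * 'X^(N - m))).
  by rewrite h3 -mulrA -exprD subnK.
move: D; rewrite curveB curveM dvdp_subl //.
by apply: dvdp_mull; apply: dvdp_trans d2N; apply: dN.
Qed.

End Local.

Lemma comp_shiftK (K : comNzRingType) (t : K) (p : {poly K}) :
  (p \Po ('X + t%:P)) \Po ('X - t%:P) = p.
Proof. by rewrite -comp_polyA comp_polyD comp_polyX comp_polyC subrK comp_polyXr. Qed.

Lemma comp_shift_factor (K : comNzRingType) (t : K) (p : {poly K}) m :
  (('X - t%:P) ^+ m * p) \Po ('X + t%:P) = 'X^m * (p \Po ('X + t%:P)).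
Proof.
rewrite comp_polyM rmorphXn /= comp_polyB comp_polyX comp_polyC.
by have -> : 'X + t%:P - t%:P = 'X by ring.
Qed.

Lemma horner_shift0 (K : comNzRingType) (t : K) (p : {poly K}) : (p \Po ('X + t%:P)).[0] = p.[t].
Proof. by rewrite horner_comp hornerD hornerX hornerC add0r. Qed.

Lemma dvdp_shift (K : fieldType) (t : K) (p : {poly K}) m :
  'X^m %| p \Po ('X + t%:P) -> ('X - t%:P) ^+ m %| p.
Proof.
move=> /dvdpP[q hq]; apply/dvdpP; exists (q \Po ('X - t%:P)).
by rewrite -[LHS](comp_shiftK t) hq comp_polyM rmorphXn /= comp_polyX.
Qed.

Lemma coef1_shift (K : fieldType) (t : K) (p : {poly K}) : (p \Po ('X + t%:P))`_1 = p^`().[t].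
Proof.
have <- : (p \Po ('X + t%:P))^`().[0] = (p \Po ('X + t%:P))`_1 by rewrite horner_coef0 coef_deriv mulr1n.
by rewrite deriv_comp derivD derivX derivC addr0 mulr1 horner_shift0.
Qed.

Section Local.
Variable R : realType.
Local Notation C := (Cplx R).
Local Notation S := (Cpoly R 3).
Implicit Types (g h : S) (rho : 'I_3 -> S) (gam : 'I_3 -> {poly C}).

Lemma along_comp gam g (q : {poly C}) : along (fun j => gam j \Po q) g = along gam g \Po q.
Proof.
elim/mpoly_closure_ind: g => [c|i|p1 p2 h1 h2|p1 p2 h1 h2].
- by rewrite !alongC comp_polyC. - by rewrite !along_var.
- by rewrite !alongD h1 h2 comp_polyD.
by rewrite !alongM h1 h2 comp_polyM.
Qed.

Lemma field_divisibility f1 f2 d1 d2 gam rho delta m phi t :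
  reduced_curve d1 f1 -> homogeneous d2 f2 -> quasihomogeneous_singularities (f1 * f2) ->
  AR_deg f1 delta rho ->
  (exists j, (gam j).[t] != 0) -> (forall c, exists j, (gam j)^`().[t] != c * (gam j).[t]) ->
  along gam f2 = 0 -> along gam f1 = ('X - t%:P) ^+ m * phi -> phi.[t] != 0 ->
  ('X - t%:P) ^+ m.-1 %| along gam (apply_field rho f2).
Proof.
move=> rf1 hf2 qh har [j gj] imm a2 a1 phit; apply: dvdp_shift; rewrite -along_comp.
apply: (local_field_divisibility (m := m) (phi := phi \Po ('X + t%:P)) rf1 hf2 qh har).
- by exists j; rewrite -horner_coef0 horner_shift0.
- move=> c; have [i hi] := imm c; exists i.
  by rewrite -horner_coef0 horner_shift0 coef1_shift.
- by rewrite along_comp a2 comp_polyC.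
- by rewrite along_comp a1 comp_shift_factor.
by rewrite horner_shift0.
Qed.

End Local.

(** * Parametrization of lines and smooth conics *)

Definition rows3 (K : fieldType) (r0 r1 r2 : 'rV[K]_3) : 'M[K]_3 :=
  \matrix_(i, j) (if i == k0 then r0 else if i == k1 then r1 else r2) ord0 j.

Section Rows.
Variable K : fieldType.
Implicit Types r : 'rV[K]_3.

Lemma row_rows3 r0 r1 r2 :
  [/\ row k0 (rows3 r0 r1 r2) = r0, row k1 (rows3 r0 r1 r2) = r1 & row k2 (rows3 r0 r1 r2) = r2].
Proof. by split; apply/rowP => j; rewrite !mxE. Qed.

Lemma rows3E r0 r1 r2 j :
  (rows3 r0 r1 r2 k0 j = r0 ord0 j) * (rows3 r0 r1 r2 k1 j = r1 ord0 j) * (rows3 r0 r1 r2 k2 j = r2 ord0 j).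
Proof. by rewrite !mxE. Qed.

Lemma mul_rows3 (u : 'rV[K]_3) r0 r1 r2 :
  u *m rows3 r0 r1 r2 = u ord0 k0 *: r0 + u ord0 k1 *: r1 + u ord0 k2 *: r2.
Proof. by apply/rowP => j; rewrite mxE sum3 !rows3E !mxE. Qed.

Lemma rows3_unit r0 r1 r2 :
  (forall c0 c1 c2, c0 *: r0 + c1 *: r1 + c2 *: r2 = 0 -> [/\ c0 = 0, c1 = 0 & c2 = 0]) ->
  rows3 r0 r1 r2 \in unitmx.
Proof.
move=> h; rewrite -row_free_unit -kermx_eq0; apply/eqP/row_matrixP => i; rewrite row0.
have : row i (kermx (rows3 r0 r1 r2)) *m rows3 r0 r1 r2 = 0.
  by apply/eqP; rewrite -sub_kermx row_sub.
move: (row i _) => u; rewrite mul_rows3 => /h[u0 u1 u2].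
by apply/rowP; apply: ord3; rewrite mxE.
Qed.

Lemma rows3_free r0 r1 r2 c0 c1 c2 : rows3 r0 r1 r2 \in unitmx ->
  c0 *: r0 + c1 *: r1 + c2 *: r2 = 0 -> [/\ c0 = 0, c1 = 0 & c2 = 0].
Proof.
move=> uM h; pose u : 'rV[K]_3 := \row_k (if k == k0 then c0 else if k == k1 then c1 else c2).
have : u *m rows3 r0 r1 r2 = 0 by rewrite mul_rows3 /u !mxE !kE !eqxx.
move/(canRL (mulmxK uM)); rewrite mul0mx => u0.
have e k : u ord0 k = 0 by rewrite u0 mxE.
by split; [have := e k0|have := e k1|have := e k2]; rewrite mxE ?kE ?eqxx.
Qed.

End Rows.

Section QuadraticForm.
Variable R : realType.
Local Notation C := (Cplx R).
Local Notation S := (Cpoly R 3).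
Implicit Types (g q : S) (v x y : 'rV[C]_3).

Lemma homogeneous0_eval g v : homogeneous 0 g -> evalv g v = evalv g 0.
Proof. by move=> h; have := evalv_scale 0 v h; rewrite scale0r expr0 mul1r => ->. Qed.

Lemma linear_form_eval g v : homogeneous 1 g ->
  evalv g v = \sum_(j < 3) v ord0 j * evalv (mderiv j g) 0.
Proof.
move=> hg; have E : g = \sum_(j < 3) mpolyX C (mnm1 j) * mderiv j g by rewrite (euler hg) scale1r.
rewrite {1}E /evalv raddf_sum; apply: eq_bigr => j _; rewrite /= mevalM mevalXU; congr (_ * _).
exact: (homogeneous0_eval v (homogeneous_mderiv j hg)).
Qed.

(** The second derivatives of a quadratic form are constants, so their value at 0 is the whole
    entry. *)
Definition hessian q (i j : 'I_3) : C := evalv (mderiv i (mderiv j q)) 0.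
Definition polar q x y : C := \sum_(i < 3) \sum_(j < 3) x ord0 i * y ord0 j * hessian q i j.

Lemma hessianC q i j : hessian q i j = hessian q j i.
Proof. by rewrite /hessian mderiv_comm. Qed.

Lemma polarC q x y : polar q x y = polar q y x.
Proof.
rewrite /polar exchange_big; apply: eq_bigr => i _; apply: eq_bigr => j _.
by rewrite hessianC [x _ _ * _]mulrC.
Qed.

Lemma polar_deriv q x y : homogeneous 2 q ->
  polar q x y = \sum_(j < 3) y ord0 j * evalv (mderiv j q) x.
Proof.
move=> hq; rewrite /polar exchange_big; apply: eq_bigr => j _.
rewrite (linear_form_eval x (homogeneous_mderiv j hq)) mulr_sumr; apply: eq_bigr => i _.
by rewrite mulrA [y _ _ * _]mulrC.
Qed.

Lemma polarDr q x y z : polar q x (y + z) = polar q x y + polar q x z.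
Proof.
rewrite /polar -big_split; apply: eq_bigr => i _; rewrite -big_split; apply: eq_bigr => j _ /=.
by rewrite mxE mulrDr mulrDl.
Qed.
Lemma polarZr q x c y : polar q x (c *: y) = c * polar q x y.
Proof.
rewrite /polar mulr_sumr; apply: eq_bigr => i _; rewrite mulr_sumr; apply: eq_bigr => j _ /=.
by rewrite mxE mulrCA -!mulrA mulrCA.
Qed.
Lemma polarDl q x y z : polar q (y + z) x = polar q y x + polar q z x.
Proof. by rewrite !(polarC q _ x) polarDr. Qed.
Lemma polarZl q x c y : polar q (c *: y) x = c * polar q y x.
Proof. by rewrite !(polarC q _ x) polarZr. Qed.

Lemma polar_self q x : homogeneous 2 q -> polar q x x = 2 * evalv q x.
Proof.
move=> hq; rewrite (polar_deriv _ _ hq) -evalvZ -(euler hq) /evalv raddf_sum.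
by apply: eq_bigr => j _; rewrite /= mevalM mevalXU.
Qed.

End QuadraticForm.

Lemma select0 (K : nzRingType) (a b c : {poly K}) :
  a * true%:R%:P + b * false%:R%:P + c * false%:R%:P = a.
Proof. by rewrite polyC0 polyC1 !mulr0 mulr1 !addr0. Qed.
Lemma select1 (K : nzRingType) (a b c : {poly K}) :
  a * false%:R%:P + b * true%:R%:P + c * false%:R%:P = b.
Proof. by rewrite polyC0 polyC1 !mulr0 mulr1 addr0 add0r. Qed.
Lemma select2 (K : nzRingType) (a b c : {poly K}) :
  a * false%:R%:P + b * false%:R%:P + c * true%:R%:P = c.
Proof. by rewrite polyC0 polyC1 !mulr0 mulr1 !add0r. Qed.

Section Parametrization.
Variable R : realType.
Local Notation C := (Cplx R).
Local Notation S := (Cpoly R 3).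
Local Notation X_ := (fun i : 'I_3 => mpolyX C (mnm1 i)).
Implicit Types (f g h : S) (v w : 'rV[C]_3) (M : 'M[C]_3) (gam th : 'I_3 -> {poly C}).

Definition curve_point gam t : 'rV[C]_3 := \row_j (gam j).[t].

(* [w] is the point at infinity of the parametrization [gam], of degree [d], of the curve [f = 0]. *)
Record parametrizes f (d : nat) gam w : Prop := Parametrizes {
  par_top : forall j, top_coef d (gam j) (w ord0 j);
  par_eq0 : along gam f = 0;
  par_dvd : forall k h, homogeneous k h -> along gam h = 0 -> exists q, h = q * f;
  par_lift : forall k (p : {poly C}), (size p <= (d * k).+1)%N ->
    exists h, homogeneous k h /\ along gam h = p;
  par_point : forall v, v != 0 -> evalv f v = 0 ->
    (exists c t, v = c *: curve_point gam t) \/ (exists c, v = c *: w);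
  par_tangent : forall k th, (forall j, (size (th j) <= (d * k).+1)%N) ->
    \sum_(j < 3) th j * along gam (mderiv j f) = 0 ->
    exists a b, (forall j, th j = a * gam j + b * (gam j)^`()) /\ (size b + d <= d * k + 3)%N;
  par_neq0 : forall t, exists j, (gam j).[t] != 0;
  par_immersion : forall t c, exists j, (gam j)^`().[t] != c * (gam j).[t];
  par_inj : forall s t c, (forall j, (gam j).[s] = c * (gam j).[t]) -> s = t }.

Section NormalForm.
Variables (f : S) (d : nat) (gam : 'I_3 -> {poly C}) (B : nat -> nat -> S) (M : 'M[C]_3).
(** The intended [B k n] is a form of degree k restricting to t^n, for n <= d k. Then forms of
    degree k modulo f correspond to polynomials of degree at most d k, which gives both the
    divisibility and the lifting property. *)
Definition normal_form k h := exists q, exists c : nat -> C, h = q * f + \sum_(n < (d * k).+1) c n *: B k n.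

Lemma normal_formD k g h : normal_form k g -> normal_form k h -> normal_form k (g + h).
Proof.
move=> [q1 [c1 ->]] [q2 [c2 ->]]; exists (q1 + q2), (fun n => c1 n + c2 n).
rewrite [X in _ = _ + X](eq_bigr (fun n : 'I_(d * k).+1 => c1 n *: B k n + c2 n *: B k n)); last by move=> n _ /=; rewrite scalerDl.
by rewrite big_split /= [(q1 + q2) * f](mulrDl q1 q2 f); exact: addrACA.
Qed.

Lemma normal_formZ k a h : normal_form k h -> normal_form k (a *: h).
Proof.
move=> [q [c ->]]; exists (a *: q), (fun n => a * c n).
rewrite (scalerDr a) scaler_sumr [(a *: q) * f](esym (scalerAl a q f)); congr (_ + _).
by apply: eq_bigr => n _; rewrite scalerA.
Qed.

Lemma normal_formM k q : normal_form k (q * f).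
Proof. by exists q, (fun=> 0); rewrite big1 ?addr0 // => n _; exact: scale0r. Qed.

Lemma normal_form_basis k n : (n <= d * k)%N -> normal_form k (B k n).
Proof.
rewrite -ltnS => nk; exists 0, (fun m => (m == n)%:R); rewrite mul0r add0r.
rewrite (bigD1 (Ordinal nk)) //= eqxx scale1r big1 ?addr0 // => m mn.
suff /negPf-> : (m : nat) != n by exact: scale0r.
by apply: contra_neq mn => e; apply: val_inj.
Qed.

Lemma normal_form_sum k (I : finType) (P : pred I) (F : I -> S) : (forall i, P i -> normal_form k (F i)) ->
  normal_form k (\sum_(i | P i) F i).
Proof.
move=> H; apply: (big_ind (normal_form k)) => //; last exact: normal_formD.
by have := normal_formM k 0; rewrite mul0r.
Qed.

Hypotheses (uM : M \in unitmx) (f0 : along gam f = 0) (B0 : B 0 0 = mpolyC 3 1)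
  (hB : forall k i, (i <= d * k)%N -> homogeneous k (B k i) /\ along gam (B k i) = 'X^i)
  (mulB : forall j k i, (i <= d * k)%N -> normal_form k.+1 (dual_form M j * B k i)).

Lemma normal_form_mulX j k h : normal_form k h -> normal_form k.+1 (X_ j * h).
Proof.
move=> [q [c ->]]; rewrite (mulrDr (X_ j)).
apply: normal_formD; first by rewrite mulrA; exact: normal_formM.
rewrite mulr_sumr; apply: normal_form_sum => n _.
rewrite -scalerAr -(dual_form_reconstruct uM j) mulr_suml scaler_sumr.
apply: normal_form_sum => l _; rewrite -scalerAl; apply: normal_formZ; apply: normal_formZ.
by apply: mulB; rewrite -ltnS.
Qed.

Lemma homogeneous0C h : homogeneous 0 h -> h = mpolyC 3 (evalv h 0).
Proof.
move=> hh; apply/eqP; rewrite -subr_eq0; apply/eqP; apply: mpoly_eval_eq0 => v.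
by rewrite /evalv mevalB mevalC; have := homogeneous0_eval v hh; rewrite /evalv => ->; exact: subrr.
Qed.

Lemma normal_formP k h : homogeneous k h -> normal_form k h.
Proof.
elim: k h => [|k IH] h hh.
  rewrite (homogeneous0C hh) -[evalv h 0]mulr1 mpolyCM mul_mpolyC -B0; apply: normal_formZ.
  exact: normal_form_basis.
(* Euler's relation expresses h by forms of lower degree multiplied by variables, for the
   induction. *)
have -> : h = k.+1%:R^-1 *: \sum_(j < 3) X_ j * mderiv j h.
  by rewrite (euler hh) scalerA mulVf ?scale1r // pnatr_eq0.
apply: normal_formZ; apply: normal_form_sum => j _; apply: normal_form_mulX; apply: IH.
exact: (homogeneous_mderiv j hh).
Qed.

Lemma along_basis k (c : nat -> C) :
  along gam (\sum_(n < (d * k).+1) c n *: B k n) = \poly_(n < (d * k).+1) c n.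
Proof.
rewrite along_sum poly_def; apply: eq_bigr => n _; rewrite alongZ.
by have [|_ ->] := @hB k n; [rewrite -ltnS|rewrite mul_polyC].
Qed.

Lemma normal_form_dvd k h : homogeneous k h -> along gam h = 0 -> exists q, h = q * f.
Proof.
move=> /normal_formP[q [c ->]]; rewrite alongD alongM f0 mulr0 add0r along_basis => e.
exists q; rewrite big1 ?addr0 // => n _.
have := congr1 (fun p : {poly C} => p`_n) e; rewrite coef_poly ltn_ord coef0 => ->.
exact: scale0r.
Qed.

Lemma normal_form_lift k (p : {poly C}) : (size p <= (d * k).+1)%N ->
    exists h, homogeneous k h /\ along gam h = p.
Proof.
move=> sp; exists (\sum_(n < (d * k).+1) p`_n *: B k n); split.
  by apply: rpred_sum => n _; apply: rpredZ; apply: (hB _).1; rewrite -ltnS.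
rewrite along_basis; apply/polyP => n; rewrite coef_poly; case: ltnP => // nk.
by rewrite nth_default // (leq_trans sp nk).
Qed.

End NormalForm.

Section Framed.
Variables (M : 'M[C]_3) (psi : 'I_3 -> {poly C}).
Hypothesis uM : M \in unitmx.
(** The curve with coordinates [psi] in the basis of rows of M: (1, t, 0) for a line and (1, t, t^2)
    for a conic. *)
Definition framed j : {poly C} := (M k0 j)%:P * psi k0 + (M k1 j)%:P * psi k1 + (M k2 j)%:P * psi k2.

Lemma frame_component_comb (a b c : {poly C}) k :
  frame_component M (fun j => (M k0 j)%:P * a + (M k1 j)%:P * b + (M k2 j)%:P * c) k =
  a * (k0 == k)%:R%:P + b * (k1 == k)%:R%:P + c * (k2 == k)%:R%:P.
Proof.
have E i : (\sum_(j < 3) M i j * invmx M j k)%:P = (i == k)%:R%:P.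
  by congr polyC; have := congr1 (fun A : 'M_3 => A i k) (mulmxV uM); rewrite !mxE.
rewrite -!E !rmorph_sum !mulr_sumr -!big_split; apply: eq_bigr => j _ /=.
by rewrite !polyCM; ring.
Qed.

Lemma frame_component_framed k : frame_component M framed k = psi k.
Proof.
rewrite frame_component_comb; move: k; apply: ord3; rewrite !kE !eqxx;
[exact: select0|exact: select1|exact: select2].
Qed.

Lemma frame_component_deriv k : frame_component M (fun j => (framed j)^`()) k = (psi k)^`().
Proof.
rewrite -[in RHS]frame_component_framed raddf_sum; apply: eq_bigr => j _.
by rewrite /= derivM derivC mulr0 addr0.
Qed.

Lemma frame_component_horner gam k t :
  (frame_component M gam k).[t] = \sum_(j < 3) (gam j).[t] * invmx M j k.
Proof. by rewrite horner_sum; apply: eq_bigr => j _; rewrite hornerM hornerC. Qed.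

Lemma along_dual k : along framed (dual_form M k) = psi k.
Proof.
rewrite -[RHS]frame_component_framed along_sum; apply: eq_bigr => j _.
by rewrite alongZ along_var mulrC.
Qed.

Lemma mderiv_dual j k : mderiv j (dual_form M k) = mpolyC 3 (invmx M j k).
Proof.
rewrite raddf_sum (bigD1 j) //= big1 ?addr0 => [|l lj]; rewrite mderivZ mderivX mnm1E.
  by rewrite eqxx -{1}[mnm1 j]add0m addmK mpolyX0 scale1r -mul_mpolyC; exact: mulr1.
by rewrite (negPf lj) scale0r; exact: scaler0.
Qed.

Hypotheses (psi0 : psi k0 = 1) (psi1 : psi k1 = 'X).

Lemma framed_neq0 t : exists j, (framed j).[t] != 0.
Proof.
apply: contrapT => h; have := frame_component_horner framed k0 t.
rewrite frame_component_framed psi0 hornerC big1 => [/eqP|j _]; first by rewrite oner_eq0.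
have [->|nz] := eqVneq (framed j).[t] 0; first by rewrite mul0r.
by case: h; exists j.
Qed.

Lemma framed_immersion t c : exists j, (framed j)^`().[t] != c * (framed j).[t].
Proof.
apply: contrapT => h.
have E j : (framed j)^`().[t] = c * (framed j).[t].
  by apply/eqP/negPn/negP => nz; apply: h; exists j.
have F k : (psi k)^`().[t] = c * (psi k).[t].
  rewrite -frame_component_deriv -[psi k]frame_component_framed !frame_component_horner mulr_sumr.
  by apply: eq_bigr => j _; rewrite E mulrA.
have := F k0; have := F k1; rewrite psi0 psi1 derivX derivC !hornerC hornerX mulr1 => h1 h0.
by move/eqP: h1; rewrite -h0 mul0r oner_eq0.
Qed.

Lemma framed_inj s t c : (forall j, (framed j).[s] = c * (framed j).[t]) -> s = t.
Proof.
move=> E; have F k : (psi k).[s] = c * (psi k).[t].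
  rewrite -[psi k]frame_component_framed !frame_component_horner mulr_sumr.
  by apply: eq_bigr => j _; rewrite E mulrA.
have := F k0; have := F k1; rewrite psi0 psi1 !hornerC !hornerX mulr1 => h1 h0.
by rewrite h1 -h0 mul1r.
Qed.

End Framed.

End Parametrization.

Lemma monomial_shift0 (A : comNzRingType) (x y z : A) k m : (m <= k)%N ->
  x * (x ^+ (k - m) * y * z) = x ^+ (k.+1 - m) * y * z.
Proof. by move=> mk; rewrite subSn // exprS !mulrA. Qed.

Lemma monomial_shift1 (A : comNzRingType) (x y z : A) i : y * (x * y ^+ i * z) = x * y ^+ i.+1 * z.
Proof. by rewrite exprS; ring. Qed.

Lemma monomial_shift2 (A : comNzRingType) (x y z : A) i : z * (x * y * z ^+ i) = x * y * z ^+ i.+1.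
Proof. by rewrite exprS; ring. Qed.

Lemma conic_rewrite (A : comNzRingType) (x y z c : A) k i m : (m < k.+1)%N ->
  y * (x ^+ (k - m) * y ^+ 1 * z ^+ i) =
  - (x ^+ (k - m) * z ^+ i) * (x * z - y ^+ 2) + x ^+ (k.+1 - m) * y ^+ 0 * z ^+ i.+1.
Proof.
move=> mk; rewrite subSn // [x ^+ (_ - _).+1]exprS [z ^+ i.+1]exprS expr0 expr1.
by move: (x ^+ (k - m)) (z ^+ i) => u w; ring.
Qed.

Lemma line_alongE (A : nzRingType) (x y : A) n m : 1 ^+ m * x ^+ n * y ^+ 0 = x ^+ n.
Proof. by rewrite expr1n expr0 mul1r mulr1. Qed.
Lemma conic_alongE (A : nzRingType) (x : A) n m : 1 ^+ m * x ^+ (odd n) * (x ^+ 2) ^+ n./2 = x ^+ n.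
Proof. by rewrite expr1n mul1r -exprM -exprD mul2n odd_double_half. Qed.

Lemma line_tangent (A : comNzRingType) (m0 m1 m2 a b x : A) :
  m0 * a + m1 * b + m2 * 0 = a * (m0 * 1 + m1 * x + m2 * 0) + (b - x * a) * m1.
Proof. by ring. Qed.

Lemma conic_tangent (A : comNzRingType) (m0 m1 m2 a b c x : A) : c = 2%:R * x * b - x ^+ 2 * a ->
  m0 * a + m1 * b + m2 * c = a * (m0 * 1 + m1 * x + m2 * x ^+ 2) + (b - x * a) * (m1 + m2 * (2%:R * x)).
Proof. by move=> ->; ring. Qed.

Lemma line_comb (K : fieldType) (a b v : 'rV[K]_3) (c0 c1 c2 s t : K) :
  c1 *: v + c0 *: a + (- (c0 * s) + c2 * t) *: b = c0 *: (a - s *: b) + c1 *: v + c2 *: (t *: b).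
Proof. by apply/rowP => j; rewrite !mxE; ring. Qed.

Lemma line_value (A : nzRingType) (a b c : A) : a * 0 + b * 0 + c * 1 - c = 0.
Proof. by rewrite !mulr0 !add0r mulr1 subrr. Qed.

Lemma monomial_one (A : nzRingType) (x y z : A) : x ^+ 0 * y ^+ 0 * z ^+ 0 = 1.
Proof. by rewrite !expr0 !mulr1. Qed.

Lemma line_kill (K : fieldType) (x t : K) : t != 0 -> x - x / t * t = 0.
Proof. by move=> t0; rewrite divfK // subrr. Qed.

Lemma top_coef_line (K : comNzRingType) (m0 m1 m2 : K) :
  top_coef 1 (m0%:P * 1 + m1%:P * 'X + m2%:P * 0) m1.
Proof.
rewrite mulr1 mulr0 addr0; split; last by rewrite coefD coefC coefMX coefC add0r.
rewrite (leq_trans (size_polyD _ _)) // geq_max (leq_trans (size_polyC_leq1 _)) //=.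
by rewrite mul_polyC (leq_trans (size_scale_leq _ _)) // size_polyX.
Qed.

Lemma top_coef_conic (K : comNzRingType) (m0 m1 m2 : K) :
  top_coef 2 (m0%:P * 1 + m1%:P * 'X + m2%:P * 'X ^+ 2) m2.
Proof.
rewrite mulr1; split; last by rewrite !coefD coefC coefMX coefC coefCM coefXn !add0r mulr1.
have h0 : (size m0%:P <= 3)%N by apply: leq_trans (size_polyC_leq1 _) _.
have h1 : (size (m1%:P * 'X)%R <= 3)%N.
  by rewrite mul_polyC (leq_trans (size_scale_leq _ _)) // size_polyX.
have h2 : (size (m2%:P * 'X ^+ 2)%R <= 3)%N.
  by rewrite mul_polyC (leq_trans (size_scale_leq _ _)) // size_polyXn.
by rewrite (leq_trans (size_polyD _ _)) // geq_max h2 andbT (leq_trans (size_polyD _ _)) // geq_max h0.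
Qed.

Lemma line_pointE (K : fieldType) (m0 m1 m2 a b : K) : a != 0 ->
  m0 * a + m1 * b + m2 * 0 = a * (m0 * 1 + m1 * (b / a) + m2 * 0).
Proof. by move=> a0; field. Qed.

Lemma conic_pointE (K : fieldType) (m0 m1 m2 a b c : K) : a != 0 -> a * c - b ^+ 2 = 0 ->
  m0 * a + m1 * b + m2 * c = a * (m0 * 1 + m1 * (b / a) + m2 * (b / a) ^+ 2).
Proof.
move=> a0 h; have -> : c = b ^+ 2 / a by apply: (mulfI a0); rewrite -[LHS](subrK (b ^+ 2)) h; field.
by field.
Qed.

Lemma line_infinityE (K : fieldType) (m0 m1 m2 b : K) : m0 * 0 + m1 * b + m2 * 0 = b * m1.
Proof. by ring. Qed.
Lemma conic_infinityE (K : fieldType) (m0 m1 m2 b : K) : m0 * 0 + m1 * 0 + m2 * b = b * m2.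
Proof. by ring. Qed.

Lemma line_framed_deriv (K : comNzRingType) (m0 m1 m2 : K) :
  (m0%:P * 1 + m1%:P * 'X + m2%:P * 0)^`() = m1%:P.
Proof. by rewrite mulr1 mulr0 addr0 derivD derivC derivM derivC derivX mul0r !add0r mulr1. Qed.
Lemma conic_framed_deriv (K : comNzRingType) (m0 m1 m2 : K) :
  (m0%:P * 1 + m1%:P * 'X + m2%:P * 'X ^+ 2)^`() = m1%:P + m2%:P * (2%:R * 'X).
Proof. 
rewrite mulr1 !derivD derivC !mul_polyC !derivZ derivX derivXn add0r alg_polyC -!mul_polyC.
by rewrite expr1 mulr_natl.
Qed.

Section Instances.
Variable R : realType.
Local Notation C := (Cplx R).
Local Notation S := (Cpoly R 3).
Local Notation X_ := (fun i : 'I_3 => mpolyX C (mnm1 i)).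
Implicit Types (f g h : S) (v w : 'rV[C]_3) (M : 'M[C]_3) (gam th : 'I_3 -> {poly C}).

Lemma homogeneous_dual_monomial M a b c :
  homogeneous (a + b + c) (dual_form M k0 ^+ a * dual_form M k1 ^+ b * dual_form M k2 ^+ c).
Proof.
have hX k e : homogeneous e (dual_form M k ^+ e).
  by have := dhomogMn e (dual_form_homogeneous M k); rewrite mul1n.
exact: homogeneousM (homogeneousM (hX k0 a) (hX k1 b)) (hX k2 c).
Qed.

Lemma size_frame_component M gam n k : (forall j, (size (gam j) <= n)%N) ->
  (size (frame_component M gam k) <= n)%N.
Proof.
move=> h; apply: (leq_trans (size_sum _ _ _)); apply/bigmax_leqP => j _.
by rewrite mulrC mul_polyC (leq_trans (size_scale_leq _ _)).
Qed.

Lemma along_monomial gam (l0 l1 l2 : S) a b c :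
  along gam (l0 ^+ a * l1 ^+ b * l2 ^+ c) = along gam l0 ^+ a * along gam l1 ^+ b * along gam l2 ^+ c.
Proof. by rewrite (alongM gam (l0 ^+ a * l1 ^+ b)) (alongM gam (l0 ^+ a)) !alongXn. Qed.

Lemma size_XM_le (p : {poly C}) n : (size p <= n)%N -> (size ('X * p)%R <= n.+1)%N.
Proof. by move=> h; rewrite mulrC; apply: leq_trans (size_polyMleq _ _) _; rewrite size_polyX addn2. Qed.

Lemma framed_horner M psi j t :
  (framed M psi j).[t] = M k0 j * (psi k0).[t] + M k1 j * (psi k1).[t] + M k2 j * (psi k2).[t].
Proof. by rewrite !hornerD !hornerM !hornerC. Qed.

Lemma line_parametrization f v : homogeneous 1 f -> f != 0 -> v != 0 -> evalv f v = 0 ->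
  exists gam, parametrizes f 1 gam v.
Proof.
move=> hf f0 v0 fv.
have [b fb] : exists b, evalv f b != 0.
  apply: contrapT => h; case/eqP: f0; apply: mpoly_eval_eq0 => b.
  by apply/eqP/negPn/negP => fb; apply: h; exists b.
have hb c : b != c *: v by apply: contra_neq fb => ->; rewrite (evalv_scale _ _ hf) fv mulr0.
have [a ua] := det3_neq0 v0 hb.
have addE x y : evalv f (x + y) = evalv f x + evalv f y.
  rewrite !(linear_form_eval _ hf) -big_split; apply: eq_bigr => j _ /=.
  by rewrite mxE mulrDl.
have scE c x : evalv f (c *: x) = c * evalv f x by rewrite (evalv_scale _ _ hf) expr1.
(* The basis is adjusted so that f takes the values 0, 0, 1 on it, that is, f becomes the third dual
   form. *)
pose e1 := a - (evalv f a / evalv f b) *: b; pose e3 := (evalv f b)^-1 *: b.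
pose M := rows3 e1 v e3.
have uM : M \in unitmx.
  apply: rows3_unit => c0 c1 c2 h.
  have [] := @rows3_free _ v a b c1 c0 (- (c0 * (evalv f a / evalv f b)) + c2 / evalv f b) ua.
    by rewrite -[RHS]h; exact: line_comb.
  move=> -> -> /eqP; rewrite mul0r oppr0 add0r mulf_eq0 invr_eq0 (negPf fb) orbF => /eqP ->.
  by [].
have fE : f = dual_form M k2.
  apply/eqP; rewrite -subr_eq0; apply/eqP; apply: mpoly_eval_eq0 => x.
  have -> : evalv (f - dual_form M k2) x = evalv f x - evalv (dual_form M k2) x by rewrite /evalv mevalB.
  have {1}-> : x = evalv (dual_form M k0) x *: row k0 M + evalv (dual_form M k1) x *: row k1 M +
     evalv (dual_form M k2) x *: row k2 M.
    apply/rowP => j; rewrite -(evalv_reconstruct j x uM) !mxE.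
    by rewrite ![_ * evalv _ x]mulrC.
  have [r0 r1 r2] := row_rows3 e1 v e3.
  rewrite !addE !scE r0 r1 r2 fv /e1 /e3 -scaleNr addE !scE mulNr (line_kill _ fb) mulVf //.
  exact: line_value.
pose psi (k : 'I_3) : {poly C} := if k == k0 then 1 else if k == k1 then 'X else 0.
have psi0 : psi k0 = 1 by []. have psi1 : psi k1 = 'X by []. have psi2 : psi k2 = 0 by [].
clearbody psi.
have ad k := along_dual psi uM k.
have af : along (framed M psi) f = 0 by rewrite fE ad.
pose B k n : S := dual_form M k0 ^+ (k - n) * dual_form M k1 ^+ n * dual_form M k2 ^+ 0.
have hB k n : (n <= 1 * k)%N -> homogeneous k (B k n) /\ along (framed M psi) (B k n) = 'X^n.
  rewrite mul1n => nk; split.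
    by have := homogeneous_dual_monomial M (k - n) n 0; rewrite addn0 subnK.
  by rewrite along_monomial (ad k0) (ad k1) psi0 psi1; exact: line_alongE.
have B0 : B 0 0 = mpolyC 3 1 by exact: monomial_one.
have mulB j k n : (n <= 1 * k)%N -> normal_form f 1 B k.+1 (dual_form M j * B k n).
  rewrite mul1n => nk; move: j; apply: ord3.
  - rewrite /B monomial_shift0 //; apply: normal_form_basis; rewrite mul1n; exact: leqW.
  - rewrite /B monomial_shift1 -subSS; apply: normal_form_basis; by rewrite mul1n.
  by rewrite -fE (mulrC f); exact: normal_formM.
exists (framed M psi); split.
- by move=> j; rewrite -(rows3E e1 v e3 j).1.2 /framed psi0 psi1 psi2; exact: top_coef_line.
- exact: af.
- exact: (normal_form_dvd uM af B0 hB mulB).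
- exact: (normal_form_lift hB).
- move=> x x0 fx; rewrite fE in fx.
  have E j := evalv_reconstruct j x uM.
  have [z0|z0] := eqVneq (evalv (dual_form M k0) x) 0; [right|left].
    exists (evalv (dual_form M k1) x); apply/rowP => j; rewrite -(E j) z0 fx [RHS]mxE -(rows3E e1 v e3 j).1.2.
    exact: line_infinityE.
  exists (evalv (dual_form M k0) x), (evalv (dual_form M k1) x / evalv (dual_form M k0) x).
  apply/rowP => j; rewrite -(E j) fx [RHS]mxE [in RHS](mxE matrix_key) framed_horner psi0 psi1 psi2 hornerC hornerX horner0.
  exact: line_pointE.
- move=> k th hth; rewrite fE => ht.
  have c2 : frame_component M th k2 = 0.
    rewrite -[RHS]ht; apply: eq_bigr => j _; by rewrite mderiv_dual alongC.
  exists (frame_component M th k0), (frame_component M th k1 - 'X * frame_component M th k0); split=> [j|].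
    rewrite -(frame_component_reconstruct th j uM) c2 /framed psi0 psi1 psi2 line_framed_deriv.
    exact: line_tangent.
  rewrite mul1n addn1 (_ : k + 3 = k.+3)%N ?addn3 // ltnS.
  rewrite mul1n in hth; have h0 := size_frame_component M k0 hth; have h1 := size_frame_component M k1 hth.
  rewrite (leq_trans (size_polyD _ _)) // geq_max size_polyN size_XM_le // andbT.
  exact: leqW.
- exact: (framed_neq0 uM psi0).
- exact: (framed_immersion uM psi0 psi1).
- exact: (framed_inj uM psi0 psi1).
Qed.
End Instances.

Lemma radical_value (A : nzRingType) (a b c : A) : a * 0 + b * (2 * 0) + c * 0 = 0.
Proof. by rewrite !mulr0 !addr0. Qed.

Lemma double_sub (K : comNzRingType) (a : K) : 2 * a - a - a = 0.
Proof. by ring. Qed.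

Lemma two_eq (K : numFieldType) (x y : K) : 2 * x = 2 * y -> x = y.
Proof. by apply: mulfI; rewrite pnatr_eq0. Qed.

Lemma conic_expand (K : comNzRingType) (k a b c q2 b02 : K) : q2 = - b02 -> b02 = k ->
  2 * (b * b * q2 + a * c * b02) = 2 * (k * (a * c - b ^+ 2)).
Proof. by move=> -> ->; ring. Qed.

Lemma polar_combine (K : comNzRingType) (a b c q0 q1 q2 b01 b02 b12 b10 b20 b21 : K) :
  q0 = 0 -> q2 = 0 -> b01 = 0 -> b12 = 0 -> b10 = 0 -> b21 = 0 -> b20 = b02 ->
  a * (a * (2 * q0) + b * b01 + c * b02) + b * (a * b10 + b * (2 * q1) + c * b12) +
  c * (a * b20 + b * b21 + c * (2 * q2)) = 2 * (b * b * q1 + a * c * b02).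
Proof. by move=> -> -> -> -> -> -> ->; ring. Qed.

Lemma meval_conic (K : comNzRingType) n (v : 'I_n -> K) (q a b c : mpoly n K) k :
  meval v (q - k *: (a * c - b ^+ 2)) = meval v q - k * (meval v a * meval v c - meval v b ^+ 2).
Proof. by rewrite mevalB mevalZ mevalB mevalM rmorphXn. Qed.

Section Conic.
Variable R : realType.
Local Notation C := (Cplx R).
Local Notation S := (Cpoly R 3).
Local Notation X_ := (fun i : 'I_3 => mpolyX C (mnm1 i)).
Implicit Types (f g h q : S) (v w : 'rV[C]_3) (M : 'M[C]_3) (gam th : 'I_3 -> {poly C}).

Lemma row_reconstruct M x : M \in unitmx ->
  x = evalv (dual_form M k0) x *: row k0 M + evalv (dual_form M k1) x *: row k1 M +
     evalv (dual_form M k2) x *: row k2 M.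
Proof.
move=> uM; apply/rowP => j; rewrite -(evalv_reconstruct j x uM) !mxE.
by rewrite ![_ * evalv _ x]mulrC.
Qed.

Lemma polar_comb3 q x a b c (r0 r1 r2 : 'rV[C]_3) :
  polar q x (a *: r0 + b *: r1 + c *: r2) = a * polar q x r0 + b * polar q x r1 + c * polar q x r2.
Proof. by rewrite !polarDr !polarZr. Qed.

Lemma polarBl q x y z : polar q (y - z) x = polar q y x - polar q z x.
Proof. by rewrite polarDl -scaleN1r polarZl mulN1r. Qed.
Lemma polarBr q x y z : polar q x (y - z) = polar q x y - polar q x z.
Proof. by rewrite !(polarC q x) polarBl. Qed.

(** The frame consists of two isotropic vectors e1 and v with polar product k, and of e2 orthogonal
    to both with q e2 = - k. Smoothness says that the polar form has no isotropic radical, so that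
    e1 exists and e2 is not isotropic. *)
Lemma conic_normal_form q v : homogeneous 2 q -> smooth_curve q -> v != 0 -> evalv q v = 0 ->
  exists M k, [/\ M \in unitmx, row k2 M = v, k != 0 &
    q = k *: (dual_form M k0 * dual_form M k2 - dual_form M k1 ^+ 2)].
Proof.
move=> hq sm v0 qv.
have rad x : x != 0 -> evalv q x = 0 -> exists y, polar q x y != 0.
  move=> x0 qx; apply: contrapT => h; apply: (sm x); split=> // i.
  have [e0|e0] := eqVneq (polar q x (delta_mx 0 i)) 0; last by case: h; exists (delta_mx 0 i).
  rewrite -[RHS]e0 (polar_deriv _ _ hq) (bigD1 i) //= mxE !eqxx mul1r big1 ?addr0 // => j ji.
  by rewrite mxE (negPf ji) andbF mul0r.
have [y Bvy] := rad v v0 qv.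
(* The second isotropic vector on the line through y in the direction v. *)
pose e1 := y - (evalv q y / polar q v y) *: v.
have qE x : evalv q x = polar q x x / 2 by rewrite (polar_self _ hq) [2 * _]mulrC mulfK // pnatr_eq0.
have Bvv : polar q v v = 0 by rewrite (polar_self _ hq) qv mulr0.
have Bve1 : polar q v e1 = polar q v y by rewrite /e1 polarBr polarZr Bvv mulr0 subr0.
have Be11 : polar q e1 e1 = 0.
  have -> : polar q e1 e1 = polar q y e1 - evalv q y / polar q v y * polar q v e1.
    by rewrite {1}/e1 polarBl polarZl.
  have -> : polar q y e1 = polar q y y - evalv q y / polar q v y * polar q v y.
    by rewrite /e1 polarBr polarZr (polarC q y v).
  rewrite Bve1 !divfK // (polar_self _ hq); exact: double_sub.
clearbody e1.
have B0 : polar q v e1 != 0 by rewrite Bve1.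
pose k := polar q v e1.
have e1v c : e1 != c *: v.
  by apply: contra_neq B0 => ->; rewrite polarZr Bvv mulr0.
have [u uu] := det3_neq0 v0 e1v.
pose e2' := u - (polar q u e1 / k) *: v - (polar q u v / k) *: e1.
have B21 : polar q e2' e1 = 0.
  by rewrite /e2' !polarBl !polarZl Be11 mulr0 subr0 divfK ?subrr.
have B2v : polar q e2' v = 0.
  by rewrite /e2' !polarBl !polarZl Bvv mulr0 subr0 (polarC q e1) divfK ?subrr.
have e2'0 : e2' != 0.
  apply/eqP => e20.
  have [] := @rows3_free _ v u e1 (- (polar q u e1 / k)) 1 (- (polar q u v / k)) uu.
    by rewrite -[RHS]e20 /e2' scale1r (scaleNr _ v) (scaleNr _ e1) [- _ + u]addrC.
  by move=> _ /eqP; rewrite oner_eq0.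
have frame (c : C) : c != 0 -> rows3 e1 (c *: e2') v \in unitmx.
  move=> c0; apply: rows3_unit => a0 a1 a2 h.
  have z0 : a0 = 0.
    have := congr1 (polar q v) h; rewrite polar_comb3 polarZr (polarC q v e2') B2v Bvv !mulr0 !addr0.
    have -> : polar q v 0 = 0 by rewrite -(scale0r v) polarZr mul0r.
    by move/eqP; rewrite mulf_eq0 (negPf B0) orbF => /eqP.
  have z2 : a2 = 0.
    have := congr1 (polar q e1) h; rewrite polar_comb3 polarZr (polarC q e1 e2') B21 Be11 !mulr0 !add0r.
    have -> : polar q e1 0 = 0 by rewrite -(scale0r v) polarZr mul0r.
    by move/eqP; rewrite mulf_eq0 (polarC q e1) (negPf B0) orbF => /eqP.
  split=> //; move/eqP: h; rewrite z0 z2 !scale0r add0r addr0 !scaler_eq0 (negPf e2'0) (negPf c0) !orbF.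
  by move/eqP.
have q20 : evalv q e2' != 0.
  apply/eqP => q2; have [z hz] := rad _ e2'0 q2.
  have [r0 r1 r2] := row_rows3 e1 (1 *: e2') v.
  have := row_reconstruct z (frame 1 (oner_neq0 _)); rewrite r0 r1 r2 scale1r => ez.
  move: hz; rewrite ez polar_comb3 B21 B2v (polar_self _ hq) q2; case/eqP; exact: radical_value.
(* The scaling of e2' that makes the coefficients of both terms of the normal form equal up to
   sign. *)
pose c := sqrtC (- k / evalv q e2').
have c2 : c ^+ 2 * evalv q e2' = - k by rewrite sqrtCK divfK.
have c0 : c != 0.
  by apply: contra_eq_neq c2 => ->; rewrite expr0n mul0r eq_sym oppr_eq0.
pose e2 := c *: e2'.
have uM : rows3 e1 e2 v \in unitmx := frame c c0.
have q2 : evalv q e2 = - k by rewrite (evalv_scale _ _ hq).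
have [r0 r1 r2] := row_rows3 e1 e2 v.
exists (rows3 e1 e2 v), k; split=> //.
apply/eqP; rewrite -subr_eq0; apply/eqP; apply: mpoly_eval_eq0 => x.
set l0 := dual_form _ k0; set l1 := dual_form _ k1; set l2 := dual_form _ k2.
have -> : evalv (q - k *: (l0 * l2 - l1 ^+ 2)) x = evalv q x - k * (evalv l0 x * evalv l2 x - evalv l1 x ^+ 2).
  exact: meval_conic.
have B2e1 : polar q e2 e1 = 0 by rewrite polarZl B21 mulr0.
have B2ev : polar q e2 v = 0 by rewrite polarZl B2v mulr0.
have ex := row_reconstruct x uM; rewrite r0 r1 r2 in ex.
apply/eqP; rewrite subr_eq0; apply/eqP; apply: two_eq; rewrite -(polar_self _ hq).
rewrite {1 2}ex polar_comb3 !(polarC q _ e1, polarC q _ e2, polarC q _ v) !polar_comb3.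
rewrite -/l0 -/l1 -/l2 !(polar_self _ hq).
have q10 : evalv q e1 = 0 by rewrite qE Be11 mul0r.
rewrite (@polar_combine C (evalv l0 x) (evalv l1 x) (evalv l2 x) _ _ _ _ _ _ _ _ _ q10 qv) //.
- by apply: conic_expand; [rewrite (polarC q e1)|rewrite polarC].
all: by rewrite polarC.
Qed.
End Conic.

Lemma conic_tangent_eq (K : idomainType) (k a b c x : {poly K}) :
  k != 0 -> k * (a * x ^+ 2 + c - 2%:R * x * b) = 0 -> c = 2%:R * x * b - x ^+ 2 * a.
Proof.
move=> k0 /eqP; rewrite mulf_eq0 (negPf k0) /= => /eqP h.
by apply/eqP; rewrite -subr_eq0 -h; apply/eqP; ring.
Qed.

Lemma conic_deriv_term (A : comNzRingType) (k t i0 i1 i2 x : A) :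
  t * (k * ((i0 * x ^+ 2 + 1 * i2) - (i1 * x + x * i1))) = k * (t * i0 * x ^+ 2 + t * i2 - 2%:R * x * (t * i1)).
Proof. by ring. Qed.

Lemma size_mulX_cancel (K : idomainType) (p : {poly K}) n : (size ('X * p)%R <= n.+1)%N -> (size p <= n)%N.
Proof.
have [->|p0] := eqVneq p 0; first by rewrite size_poly0.
by rewrite mulrC size_mulX.
Qed.

Lemma conic_factor (A : comNzRingType) (x a b : A) : 2%:R * x * b - x ^+ 2 * a = x * (2%:R * b - x * a).
Proof. by ring. Qed.
Lemma conic_split (A : comNzRingType) (x a b : A) : b - x * a = (2%:R * b - x * a) - b.
Proof. by ring. Qed.
Lemma conic_zero (A : nzRingType) (k x : A) : k * (1 * x - x) = 0.
Proof. by rewrite mul1r subrr mulr0. Qed.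

Lemma size_sub_le (K : nzRingType) (a b : {poly K}) n :
  (size a <= n)%N -> (size b <= n.+1)%N -> (size (a - b)%R <= n.+1)%N.
Proof.
move=> ha hb; rewrite (leq_trans (size_polyD _ _)) // geq_max size_polyN hb andbT.
exact: leqW.
Qed.

Section MmapConic.
Variables (K : comNzRingType) (n : nat) (gam : 'I_n -> {poly K}).
Implicit Types a b c : mpoly n K.
Local Notation al := (mmap (@polyC K) gam).

Lemma mmap_conic a b c k : al (k *: (a * c - b ^+ 2)) = k%:P * (al a * al c - al b ^+ 2).
Proof. by rewrite mmapZ mmapB rmorphM rmorphXn. Qed.

Lemma mmap_mderiv_conic a b c j k :
  al (mderiv j (k *: (a * c - b ^+ 2))) =
  k%:P * ((al (mderiv j a) * al c + al a * al (mderiv j c)) -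
          (al (mderiv j b) * al b + al b * al (mderiv j b))).
Proof. by rewrite mderivZ mderivB expr2 !mderivM mmapZ mmapB !mmapD !rmorphM. Qed.

End MmapConic.

Section Conic.
Variable R : realType.
Local Notation C := (Cplx R).
Local Notation S := (Cpoly R 3).
Local Notation X_ := (fun i : 'I_3 => mpolyX C (mnm1 i)).
Implicit Types (f g h q : S) (v w : 'rV[C]_3) (M : 'M[C]_3) (gam th : 'I_3 -> {poly C}).

Lemma alg_fact (k : C) (a b : S) : k != 0 -> a * b = (k^-1 *: a) * (k *: b).
Proof. by move=> k0; rewrite -scalerAl -scalerAr scalerA mulVf // scale1r. Qed.

Lemma evalv_conic_form (a b c : S) x :
  evalv (a * c - b ^+ 2) x = evalv a x * evalv c x - evalv b x ^+ 2.
Proof. by rewrite /evalv mevalB mevalM rmorphXn. Qed.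

Local Opaque along dual_form evalv mderiv.

Lemma along_conic gam (a b c : S) k :
  along gam (k *: (a * c - b ^+ 2)) = k%:P * (along gam a * along gam c - along gam b ^+ 2).
Proof. exact: mmap_conic. Qed.

Lemma along_mderiv_conic gam (a b c : S) j k :
  along gam (mderiv j (k *: (a * c - b ^+ 2))) =
  k%:P * ((along gam (mderiv j a) * along gam c + along gam a * along gam (mderiv j c)) -
          (along gam (mderiv j b) * along gam b + along gam b * along gam (mderiv j b))).
Proof. exact: mmap_mderiv_conic. Qed.

Lemma conic_parametrization f v : homogeneous 2 f -> smooth_curve f -> v != 0 -> evalv f v = 0 ->
  exists gam, parametrizes f 2 gam v.
Proof.
move=> hf sm v0 fv; have [M [k [uM Mv kn0 fE]]] := conic_normal_form hf sm v0 fv.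
pose psi (i : 'I_3) : {poly C} := if i == k0 then 1 else if i == k1 then 'X else 'X ^+ 2.
have psi0 : psi k0 = 1 by []. have psi1 : psi k1 = 'X by []. have psi2 : psi k2 = 'X ^+ 2 by [].
clearbody psi.
have ad i := along_dual psi uM i.
have af : along (framed M psi) f = 0.
  rewrite fE along_conic (ad k0) (ad k1) (ad k2) psi0 psi1 psi2; exact: conic_zero.
(* The second form occurs at most once: modulo f its square is the product of the first and the
   third, which also restricts to t^2. *)
pose B i n : S := dual_form M k0 ^+ (i - uphalf n) * dual_form M k1 ^+ (odd n) * dual_form M k2 ^+ n./2.
have hB i n : (n <= 2 * i)%N -> homogeneous i (B i n) /\ along (framed M psi) (B i n) = 'X^n.
  move=> nk; split.
    have := homogeneous_dual_monomial M (i - uphalf n) (odd n) (n./2).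
    by rewrite -addnA -uphalf_half subnK // leq_uphalf_double -mul2n.
  by rewrite along_monomial (ad k0) (ad k1) (ad k2) psi0 psi1 psi2; exact: conic_alongE.
have B0 : B 0 0 = mpolyC 3 1 by exact: monomial_one.
have uk n i : (n <= 2 * i)%N -> (uphalf n <= i)%N by rewrite leq_uphalf_double -mul2n.
have mulB j k' n : (n <= 2 * k')%N -> normal_form f 2 B k'.+1 (dual_form M j * B k' n).
  move=> nk; move: j; apply: ord3.
  - rewrite /B monomial_shift0 ?uk //.
    by apply: normal_form_basis; rewrite (leq_trans nk) // mulnS leq_addl.
  - have [/eqP on|on] := boolP (odd n == true); last first.
      have /negPf on' : ~~ odd n by move: on; case: odd.
      have -> : dual_form M k1 * B k' n = B k'.+1 n.+1.
        by rewrite /B on' monomial_shift1 /= on' uphalf_half on' /= subSS.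
      by apply: normal_form_basis; rewrite mulnS; lia.
    have un : (uphalf n < k'.+1)%N by rewrite ltnS uk.
    have -> : dual_form M k1 * B k' n =
       (k^-1 *: (- (dual_form M k0 ^+ (k' - uphalf n) * dual_form M k2 ^+ n./2))) * f + B k'.+1 n.+1.
      rewrite fE -alg_fact // {1}/B on conic_rewrite //; congr (_ + _).
      by rewrite /B /= on /= !uphalf_half on.
    apply: normal_formD; first exact: normal_formM.
    by apply: normal_form_basis; rewrite mulnS; lia.
  rewrite /B monomial_shift2.
  have -> : dual_form M k0 ^+ (k' - uphalf n) * dual_form M k1 ^+ odd n * dual_form M k2 ^+ (n./2).+1 = B k'.+1 n.+2.
    by rewrite /B /= negbK subSS.
  by apply: normal_form_basis; rewrite mulnS !add2n.
exists (framed M psi); split.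
- move=> j; rewrite (_ : v ord0 j = M k2 j); last by rewrite -Mv mxE.
  by rewrite /framed psi0 psi1 psi2; exact: top_coef_conic.
- exact: af.
- exact: (normal_form_dvd uM af B0 hB mulB).
- exact: (normal_form_lift hB).
- move=> x x0 fx.
  have E j := evalv_reconstruct j x uM.
  have cE : evalv (dual_form M k0) x * evalv (dual_form M k2) x - evalv (dual_form M k1) x ^+ 2 = 0.
    move/eqP: fx; rewrite fE evalvZ mulf_eq0 (negPf kn0) /= => /eqP fx.
    by rewrite -evalv_conic_form; exact: fx.
  have [z0|z0] := eqVneq (evalv (dual_form M k0) x) 0; [right|left].
    have z1 : evalv (dual_form M k1) x = 0.
      by move/eqP: cE; rewrite z0 mul0r sub0r oppr_eq0 expf_eq0 => /eqP.
    exists (evalv (dual_form M k2) x); apply/rowP => j.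
    rewrite -(E j) z0 z1 [RHS]mxE (_ : v ord0 j = M k2 j); last by rewrite -Mv mxE.
    exact: conic_infinityE.
  exists (evalv (dual_form M k0) x), (evalv (dual_form M k1) x / evalv (dual_form M k0) x).
  apply/rowP => j; rewrite -(E j) [RHS]mxE [in RHS](mxE matrix_key) framed_horner psi0 psi1 psi2 hornerC horner_exp hornerX.
  exact: conic_pointE.
- move=> n th hth ht.
  (* In the dual coordinates the gradient along the conic is proportional to (t^2, - 2 t, 1). *)
  have c2 : frame_component M th k2 = 2%:R * 'X * frame_component M th k1 - 'X ^+ 2 * frame_component M th k0.
    apply: (@conic_tangent_eq C k%:P); first by rewrite polyC_eq0.
    rewrite -[RHS]ht mulr_suml mulr_sumr -big_split -sumrB mulr_sumr; apply: eq_bigr => j _ /=.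
    rewrite fE along_mderiv_conic (ad k0) (ad k1) (ad k2) (mderiv_dual M j k0) (mderiv_dual M j k1) (mderiv_dual M j k2) (alongC _ (invmx M j k0)) (alongC _ (invmx M j k1)) (alongC _ (invmx M j k2)) psi0 psi1 psi2.
    exact: esym (conic_deriv_term _ _ _ _ _ _).
  exists (frame_component M th k0), (frame_component M th k1 - 'X * frame_component M th k0); split=> [j|].
    rewrite -{1}(frame_component_reconstruct th j uM) /framed psi0 psi1 psi2 conic_framed_deriv.
    exact: conic_tangent.
  have h1 := size_frame_component M k1 hth; have h2 := size_frame_component M k2 hth.
  rewrite c2 conic_factor in h2; have h3 := size_mulX_cancel h2.
  (* The naive degree of b = th_1 - t th_0 is one too large. As t (2 th_1 - t th_0) = th_2, the
     polynomial 2 th_1 - t th_0 is small, and b is its difference with th_1. *)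
  rewrite conic_split.
  have h4 := size_sub_le h3 h1.
  by rewrite addn2 addn3 !ltnS; exact: h4.
- exact: (framed_neq0 uM psi0).
- exact: (framed_immersion uM psi0 psi1).
- exact: (framed_inj uM psi0 psi1).
Qed.

Local Transparent along evalv.

Lemma curve_has_point f d : homogeneous d f -> (0 < d)%N -> exists v, v != 0 /\ evalv f v = 0.
Proof.
move=> hf d0.
have dn0 (i : 'I_3) : (delta_mx 0 i : 'rV[C]_3) != 0.
  by apply/rV0Pn; exists i; rewrite mxE !eqxx oner_eq0.
have [fe|fe] := eqVneq (evalv f (delta_mx 0 k1)) 0; first by exists (delta_mx 0 k1).
pose gam (j : 'I_3) : {poly C} := (j == k0)%:R%:P * 1 + (j == k1)%:R%:P * 'X + 0%:P * 0.
have := @top_coef_mmap C C idfun 3 1 d gam (fun j => (j == k1)%:R) f _ hf.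
have -> : mmap idfun (fun j : 'I_3 => (j == k1)%:R) f = evalv f (delta_mx 0 k1).
  by rewrite /evalv /meval; apply: eq_mmap => j; rewrite mxE eqxx.
rewrite mul1n => /(_ (fun j => top_coef_line _ _ _)) [sz tc].
have E : mmap (polyC \o idfun) gam f = along gam f by [].
rewrite E in sz tc.
have s1 : size (along gam f) != 1.
  apply/eqP => s1; move/eqP: tc; rewrite nth_default ?s1 // => /eqP e; by rewrite -e eqxx in fe.
have /closed_rootP[t] := s1; rewrite /root along_horner => /eqP ft.
exists (\row_j (gam j).[t]); split=> //; apply/rV0Pn; exists k0.
by rewrite mxE /gam kE eqxx !polyC0 !mul0r !addr0 mulr1 hornerC oner_eq0.
Qed.
End Conic.

(** * Syzygies of free curves *)

Section Cross.
Variable A : idomainType.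
Implicit Types (u w g a b c : 'I_3 -> A).

Definition succ3 (i : 'I_3) : 'I_3 := if i == k0 then k1 else if i == k1 then k2 else k0.

Lemma succ3E : (succ3 k0 = k1) * (succ3 k1 = k2) * (succ3 k2 = k0).
Proof. by []. Qed.

Definition cross u w (i : 'I_3) : A :=
  u (succ3 i) * w (succ3 (succ3 i)) - u (succ3 (succ3 i)) * w (succ3 i).

(** The trivial syzygies e_i x g, for e_i the standard basis. *)
Definition koszul g (i j : 'I_3) : A := cross (fun l => (l == i)%:R) g j.

Lemma koszul_syzygy g i : \sum_(j < 3) koszul g i j * g j = 0.
Proof.
by rewrite sum3 /koszul /cross !succ3E; move: i; apply: ord3; rewrite !kE !eqxx ?mulr0n ?mulr1n; ring.
Qed.

Lemma cross_koszul g i j : cross (koszul g i) (koszul g (succ3 i)) j = g (succ3 (succ3 i)) * g j.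
Proof.
rewrite /koszul /cross; move: j i; apply: ord3; apply: ord3;
by rewrite !succ3E !kE !eqxx ?mulr0n ?mulr1n; ring.
Qed.

Lemma cross_comb a b x1 x2 y1 y2 u w j :
  (forall i, u i = x1 * a i + x2 * b i) -> (forall i, w i = y1 * a i + y2 * b i) ->
  cross u w j = (x1 * y2 - x2 * y1) * cross a b j.
Proof. by move=> hu hw; rewrite /cross !hu !hw; ring. Qed.

(** Three vectors orthogonal to g != 0 have determinant D = 0; the left side is D times the
    Kronecker symbol of i and j. *)
Lemma cross_relation a b c g i j : (exists k, g k != 0) ->
  \sum_(l < 3) a l * g l = 0 -> \sum_(l < 3) b l * g l = 0 -> \sum_(l < 3) c l * g l = 0 ->
  cross b c i * a j + cross c a i * b j + cross a b i * c j = 0.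
Proof.
move=> [k gk]; rewrite !sum3 => ha hb hc.
pose D := a k0 * cross b c k0 + a k1 * cross b c k1 + a k2 * cross b c k2.
have D0 : D = 0.
  apply: (mulfI gk); rewrite mulr0; move: k {gk}; apply: ord3.
  - have -> : g k0 * D = (a k0 * g k0 + a k1 * g k1 + a k2 * g k2) * cross b c k0
      + (b k0 * g k0 + b k1 * g k1 + b k2 * g k2) * cross c a k0 + (c k0 * g k0 + c k1 * g k1 + c k2 * g k2) * cross a b k0.
      by rewrite /D /cross !succ3E; ring.
    by rewrite ha hb hc; ring.
  - have -> : g k1 * D = (a k0 * g k0 + a k1 * g k1 + a k2 * g k2) * cross b c k1
      + (b k0 * g k0 + b k1 * g k1 + b k2 * g k2) * cross c a k1 + (c k0 * g k0 + c k1 * g k1 + c k2 * g k2) * cross a b k1.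
      by rewrite /D /cross !succ3E; ring.
    by rewrite ha hb hc; ring.
  have -> : g k2 * D = (a k0 * g k0 + a k1 * g k1 + a k2 * g k2) * cross b c k2
      + (b k0 * g k0 + b k1 * g k1 + b k2 * g k2) * cross c a k2 + (c k0 * g k0 + c k1 * g k1 + c k2 * g k2) * cross a b k2.
    by rewrite /D /cross !succ3E; ring.
  by rewrite ha hb hc; ring.
transitivity ((i == j)%:R * D); last by rewrite D0 mulr0.
rewrite /D /cross; move: i j; apply: ord3; apply: ord3;
by rewrite !succ3E ?kE ?eqxx ?mulr0n ?mulr1n; ring.
Qed.

Lemma rank_two_basis g n (e : 'I_n -> 'I_3 -> A) : (exists k, g k != 0) ->
  (forall j, \sum_(l < 3) e j l * g l = 0) ->
  (forall a, \sum_(l < 3) a l * g l = 0 ->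
     exists! c : 'I_n -> A, forall i, a i = \sum_(j < n) c j * e j i) ->
  exists j1 j2 : 'I_n, (forall c1 c2 : A, (forall i, c1 * e j1 i + c2 * e j2 i = 0) -> c1 = 0 /\ c2 = 0) /\
    forall a, \sum_(l < 3) a l * g l = 0 -> exists c1 c2 : A, forall i, a i = c1 * e j1 i + c2 * e j2 i.
Proof.
move=> gk he hgen.
have free (c : 'I_n -> A) : (forall i, \sum_(j < n) c j * e j i = 0) -> forall j, c j = 0.
  move=> hc j; have [|c' [_ uc]] := hgen (fun=> 0); first by rewrite big1 // => l _; rewrite mul0r.
  have <- : c' = c by apply: uc => i; rewrite hc.
  have -> : c' = (fun=> 0) by apply: uc => i; rewrite big1 // => l _; rewrite mul0r.
  by [].
have pair (j1 j2 : 'I_n) : j1 != j2 -> forall c1 c2 : A, (forall i, c1 * e j1 i + c2 * e j2 i = 0) -> c1 = 0 /\ c2 = 0.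
  move=> j12 c1 c2 h.
  have F := free (fun j => if j == j1 then c1 else if j == j2 then c2 else 0).
  have {}F : forall j, (if j == j1 then c1 else if j == j2 then c2 else 0) = 0.
    have j21 : (j2 == j1) = false by rewrite eq_sym (negPf j12).
    apply: F => i; rewrite (bigD1 j1) //= eqxx (bigD1 j2) /=; last by rewrite j21.
    rewrite j21 eqxx addrA h add0r big1 // => j /andP[/negPf-> /negPf->].
    by rewrite mul0r.
  by have := F j1; have := F j2; rewrite !eqxx eq_sym (negPf j12).
have crossN (j1 j2 : 'I_n) : j1 != j2 -> exists i, cross (e j1) (e j2) i != 0.
  move=> j12; apply: contrapT => h.
  have Z i : cross (e j1) (e j2) i = 0 by apply/eqP/negPn/negP => nz; apply: h; exists i.
  have P (l i : 'I_3) : e j2 l * e j1 i + - e j1 l * e j2 i = 0.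
    have := Z k0; have := Z k1; have := Z k2; rewrite /cross !succ3E => z2 z1 z0.
    move: l i; apply: ord3; apply: ord3; try by ring.
    - by rewrite -[RHS]oppr0 -z2; ring.
    - by rewrite -[RHS]z1; ring.
    - by rewrite -[RHS]z2; ring.
    - by rewrite -[RHS]oppr0 -z0; ring.
    - by rewrite -[RHS]oppr0 -z1; ring.
    by rewrite -[RHS]z0; ring.
  have e1 l : e j1 l = 0 by have [_ /eqP] := pair _ _ j12 _ _ (P l); rewrite oppr_eq0 => /eqP.
  have [/eqP] := pair _ _ j12 1 0 (fun i => etrans (congr2 +%R (mul1r _) (mul0r _)) (etrans (addr0 _) (e1 i))).
  by rewrite oner_eq0.
have koszul0 i : exists c : 'I_n -> A, forall j, koszul g i j = \sum_(l < n) c l * e l j.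
  by have [c [hc _]] := hgen _ (koszul_syzygy g i); exists c.
have g2 : exists i j, cross (koszul g i) (koszul g (succ3 i)) j != 0.
  have [k hk] := gk; exists (succ3 k), k; rewrite cross_koszul.
  have -> : succ3 (succ3 (succ3 k)) = k by move: k {hk}; apply: ord3; rewrite !succ3E.
  by rewrite mulf_neq0.
have [i0 [j0 hij]] := g2; have [c hc] := koszul0 i0; have [c' hc'] := koszul0 (succ3 i0).
have e_eq0 : (exists x y (v : 'I_3 -> A), (forall j, koszul g i0 j = x * v j) /\ forall j, koszul g (succ3 i0) j = y * v j) -> False.
  by move=> [x [y [v [h1 h2]]]]; case/eqP: hij; rewrite /cross !h1 !h2; ring.
case: n e he hgen free pair crossN koszul0 c c' hc hc' => [|[|[|n]]] e he hgen free pair crossN koszul0 c c' hc hc'.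
- by case: e_eq0; exists 0, 0, (fun=> 0); split=> j; rewrite ?hc ?hc' big_ord0 mul0r.
- by case: e_eq0; exists (c ord0), (c' ord0), (e ord0); split=> j; rewrite ?hc ?hc' big_ord1.
- exists ord0, (lift ord0 ord0); split=> [|a ha]; first exact: pair.
  have [b [hb _]] := hgen a ha; exists (b ord0), (b (lift ord0 ord0)) => i.
  by rewrite hb !big_ord_recl big_ord0 addr0.
pose j1 : 'I_n.+3 := ord0; pose j2 : 'I_n.+3 := lift ord0 ord0; pose j3 : 'I_n.+3 := lift ord0 (lift ord0 ord0).
have [i hi] := crossN j1 j2 isT; case/eqP: hi.
have FF := free (fun j => if j == j1 then cross (e j2) (e j3) i else if j == j2 then cross (e j3) (e j1) i else
   if j == j3 then cross (e j1) (e j2) i else 0).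
suff F : forall j, (if j == j1 then cross (e j2) (e j3) i else if j == j2 then cross (e j3) (e j1) i else
   if j == j3 then cross (e j1) (e j2) i else 0) = 0 by have := F j3.
apply: FF => l; rewrite !big_ord_recl -!/j1 -/j2 -/j3 /= big1 ?addr0 => [|j _]; last by rewrite mul0r.
by rewrite addrA; exact: (cross_relation _ _ gk).
Qed.

End Cross.

(** When the G_l generate the unit ideal, a combination of the relations reads DA V_l = p G_l with p
    a nonzero constant, so each V_l divides G_l. *)
Lemma divides_by_unit_ideal (K : fieldType) (G V D al : 'I_3 -> {poly K}) (p : K) j : p != 0 ->
  \sum_(l < 3) al l * G l = p%:P -> (forall c l, D c * V l = G (succ3 (succ3 c)) * G l) ->
  V j != 0 -> (size (V j) <= size (G j))%N.
Proof.
move=> p0; rewrite sum3 => hp hD Vj.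
pose DA := al k2 * D k0 + al k0 * D k1 + al k1 * D k2.
have E l : DA * V l = p%:P * G l.
  rewrite -hp; have := hD k0 l; have := hD k1 l; have := hD k2 l; rewrite !succ3E => e2 e1 e0.
  transitivity (al k2 * (D k0 * V l) + al k0 * (D k1 * V l) + al k1 * (D k2 * V l)); first by rewrite /DA; ring.
  by rewrite e0 e1 e2; ring.
have pp : p%:P != 0 :> {poly K} by rewrite polyC_eq0.
have Gj : G j != 0.
  apply/eqP => G0; have /eqP := E j; rewrite G0 mulr0 mulf_eq0 (negPf Vj) orbF => /eqP DA0.
  have Z l : G l = 0 by apply: (mulfI pp); rewrite -E DA0 mul0r mulr0.
  by move: pp; rewrite -hp !Z !mulr0 !addr0 eqxx.
apply: dvdp_leq => //; rewrite -(dvdpZr _ _ p0) -mul_polyC -E; exact: dvdp_mull.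
Qed.

Lemma line_coefficient (K : comNzRingType) (d : K) (c0 c1 c2 m0 m1 m2 g0 g1 g2 F U V p : {poly K}) :
  p = U * F + V * (g0 * m0 + g1 * m1 + g2 * m2) -> d%:P * F = c0 * g0 + c1 * g1 + c2 * g2 ->
  d%:P * p = (U * c0 + d%:P * V * m0) * g0 + (U * c1 + d%:P * V * m1) * g1 + (U * c2 + d%:P * V * m2) * g2.
Proof.
move=> -> e; have -> : d%:P * (U * F + V * (g0 * m0 + g1 * m1 + g2 * m2)) =
  U * (d%:P * F) + d%:P * V * (g0 * m0 + g1 * m1 + g2 * m2) by ring.
by rewrite e; ring.
Qed.

Lemma curve_sum3 (K : closedFieldType) (x y G0 G1 G2 : {poly K}) (F0 F1 F2 : {poly {poly K}}) (a0 a1 a2 : K) :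
  curve x y F0 = G0 -> curve x y F1 = G1 -> curve x y F2 = G2 ->
  curve x y (F0 * a0%:P%:P + F1 * a1%:P%:P + F2 * a2%:P%:P) = G0 * a0%:P + G1 * a1%:P + G2 * a2%:P.
Proof. by move=> <- <- <-; rewrite !curveD !curveM !curveC !comp_polyC. Qed.

Section Free.
Variable R : realType.
Local Notation C := (Cplx R).
Local Notation S := (Cpoly R 3).
Local Notation X_ := (fun i : 'I_3 => mpolyX C (mnm1 i)).
Implicit Types (f g h q : S) (v w : 'rV[C]_3) (M : 'M[C]_3) (gam th : 'I_3 -> {poly C}).

Lemma homogeneous_cross s1 s2 (r1 r2 : 'I_3 -> S) i : (forall j, homogeneous s1 (r1 j)) ->
  (forall j, homogeneous s2 (r2 j)) -> homogeneous (s1 + s2) (cross r1 r2 i).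
Proof. by move=> h1 h2; apply: homogeneousB; apply: homogeneousM. Qed.

Lemma along_euler gam d g : homogeneous d g ->
  \sum_(j < 3) gam j * along gam (mderiv j g) = d%:R%:P * along gam g.
Proof.
move=> hg; rewrite -alongZ -(euler hg) along_sum; apply: eq_bigr => j _.
by rewrite (alongM gam (X_ j)) along_var.
Qed.

Lemma gradient_neq0 d f : homogeneous d f -> (0 < d)%N -> f != 0 -> exists k, mderiv k f != 0.
Proof.
move=> hf d0 f0; apply: contrapT => h; case/eqP: f0.
have Z k : mderiv k f = 0 by apply/eqP/negPn/negP => nz; apply: h; exists k.
have := euler hf; rewrite big1 => [|j _]; last by rewrite Z; exact: mulr0.
move/(congr1 (fun x => d%:R^-1 *: x)); rewrite scaler0 scalerA mulVf ?pnatr_eq0 -?lt0n //.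
by rewrite scale1r.
Qed.

(** The cross product of the two syzygies is compared with the gradient on a generic line, where the
    former keeps its full degree s1 + s2 in the component j and the latter has degree at most d -
    1. *)
Lemma syzygy_degree_bound d f (s1 s2 : nat) (r1 r2 : 'I_3 -> S) (Am : 'I_3 -> 'I_2 -> S) :
  reduced_curve d f -> (forall j, homogeneous s1 (r1 j)) -> (forall j, homogeneous s2 (r2 j)) ->
  (forall c l, (Am c ord0 * Am (succ3 c) (lift ord0 ord0) - Am c (lift ord0 ord0) * Am (succ3 c) ord0)
     * cross r1 r2 l = mderiv (succ3 (succ3 c)) f * mderiv l f) ->
  (exists l, cross r1 r2 l != 0) -> (s1 + s2 < d)%N.
Proof.
move=> rf h1 h2 hD [j Vj]; have [d0 hf _] := rf; have f0 := reduced_neq0 rf.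
have hV := homogeneous_cross j h1 h2.
have [v [v0 fv]] := curve_has_point hf d0.
have [M [uM Mv Mb]] := frame_through (homogeneousM hf hV) (mulf_neq0 f0 Vj) v0 (etrans (evalvM f _ v) (etrans (congr2 *%R fv erefl) (mul0r _))).
have [fb Vb] : evalv f (row k2 M) != 0 /\ evalv (cross r1 r2 j) (row k2 M) != 0.
  by move: Mb; rewrite (evalvM f) mulf_eq0 negb_or => /andP.
have [p [U [V [p0 hp]]]] := reduced_discriminant uM rf fb.
(* On the line X = x0 the discriminant is a nonzero constant, so f and its derivative generate the
   unit ideal; by Euler's relation so do the partial derivatives of f. *)
have [x0 px] : exists x0, p.[x0] != 0.
  apply: contrapT => h; case/eqP: p0; apply: poly_zero_everywhere => t.
  by apply/eqP/negPn/negP => nz; apply: h; exists t.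
pose gam j : {poly C} := (M k0 j)%:P + (M k1 j)%:P * x0%:P + (M k2 j)%:P * 'X.
have cE h : curve x0%:P 'X (plane M h) = along gam h := curve_plane M x0%:P 'X h.
have tc e h : homogeneous e h -> top_coef e (along gam h) (evalv h (row k2 M)).
  move=> hh; have := @top_coef_mmap C C idfun 3 1 e gam (fun j => M k2 j) h _ hh.
  have -> : mmap idfun (fun j => M k2 j) h = evalv h (row k2 M).
    by rewrite /evalv /meval; apply: eq_mmap => i; rewrite mxE.
  rewrite mul1n; apply=> i; rewrite /gam -polyCM -polyCD; have := top_coef_line (M k0 i + M k1 i * x0) (M k2 i) 0.
  by rewrite mulr1 mulr0 addr0.
have hp' := congr1 (curve x0%:P 'X) hp.
rewrite curveC comp_polyCr curveD !curveM plane_dY cE in hp'.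
have cs := curve_sum3 (M k2 k0) (M k2 k1) (M k2 k2) (cE (mderiv k0 f)) (cE (mderiv k1 f)) (cE (mderiv k2 f)).
rewrite sum3 in hp'.
rewrite cs in hp'.
have eu := along_euler gam hf; rewrite sum3 in eu.
have key := line_coefficient hp' (esym eu).
pose al (l : 'I_3) : {poly C} := curve x0%:P 'X U * gam l + d%:R%:P * curve x0%:P 'X V * (M k2 l)%:P.
have dn : (d%:R : C) != 0 by rewrite pnatr_eq0 -lt0n.
have hal : \sum_(l < 3) al l * along gam (mderiv l f) = (d%:R * p.[x0])%:P.
  by rewrite sum3 -key polyCM.
have hD' c l : along gam (Am c ord0 * Am (succ3 c) (lift ord0 ord0) - Am c (lift ord0 ord0) * Am (succ3 c) ord0)
     * along gam (cross r1 r2 l) = along gam (mderiv (succ3 (succ3 c)) f) * along gam (mderiv l f).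
  by rewrite -(alongM gam (_ - _)) hD (alongM gam (mderiv _ f)).
have [sV tV] := tc _ _ hV.
have Vn : along gam (cross r1 r2 j) != 0.
  by apply: contra_neq Vb => e; rewrite -tV e coef0.
have := @divides_by_unit_ideal C (fun l => along gam (mderiv l f)) (fun l => along gam (cross r1 r2 l)) _ al _ j
   (mulf_neq0 dn px) hal hD' Vn.
have [sG _] := tc _ _ (homogeneous_mderiv j hf).
have sV' : (s1 + s2 < size (along gam (cross r1 r2 j)))%N.
  by rewrite ltnNge; apply: contra_neqN Vb => sl; rewrite -tV nth_default.
rewrite prednK // in sG.
by move=> sVG; exact: leq_trans sV' (leq_trans sVG sG).
Qed.

Lemma free_syzygies d f : reduced_curve d f -> free_curve f ->
  exists (s1 s2 : nat) (r1 r2 : 'I_3 -> S),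
  [/\ AR_deg f s1 r1, AR_deg f s2 r2, (s1 + s2 < d)%N,
      (forall c1 c2, (forall i, c1 * r1 i + c2 * r2 i = 0) -> c1 = 0 /\ c2 = 0) &
      forall a, AR f a -> exists c1 c2, forall i, a i = c1 * r1 i + c2 * r2 i].
Proof.
move=> rf [n [deg [e [he gen]]]]; have [d0 hf _] := rf; have f0 := reduced_neq0 rf.
have gk := gradient_neq0 hf d0 f0.
have hes j : \sum_(l < 3) e j l * mderiv l f = 0 by have [] := he j.
have [j1 [j2 [free span]]] := @rank_two_basis S (fun l => mderiv l f) n e gk hes gen.
have [a1 h1] := he j1; have [a2 h2] := he j2.
exists (deg j1), (deg j2), (e j1), (e j2); split=> //.
(* Coordinates of the Koszul syzygies in the basis; the 2 x 2 minors of this matrix are the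
   quotients relating the cross product to the gradient. *)
have /choice[A1 hA1] : forall c, exists Ac : S * S, forall l, koszul (fun l => mderiv l f) c l = Ac.1 * e j1 l + Ac.2 * e j2 l.
  move=> c; have [x [y hxy]] := span _ (koszul_syzygy (fun l => mderiv l f) c).
  by exists (x, y).
pose Am c (i : 'I_2) := if i == ord0 then (A1 c).1 else (A1 c).2.
have hD c l : (Am c ord0 * Am (succ3 c) (lift ord0 ord0) - Am c (lift ord0 ord0) * Am (succ3 c) ord0)
     * cross (e j1) (e j2) l = mderiv (succ3 (succ3 c)) f * mderiv l f.
  rewrite -(@cross_koszul S (fun l => mderiv l f)); apply: esym.
  exact: (@cross_comb S (e j1) (e j2) (A1 c).1 (A1 c).2 (A1 (succ3 c)).1 (A1 (succ3 c)).2 _ _ l (hA1 c) (hA1 (succ3 c))).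
apply: (syzygy_degree_bound rf h1 h2 hD).
have [k hk] := gk; exists k; apply/eqP => z.
have := hD (succ3 k) k; rewrite z mulr0.
have -> : succ3 (succ3 (succ3 k)) = k by move: k {hk z}; apply: ord3; rewrite !succ3E.
by move/esym/eqP; rewrite mulf_eq0 orbb (negPf hk).
Qed.

End Free.

(** * Homogeneous quotients and factorization into linear factors *)

Lemma homogeneous_quotient (K : idomainType) n d e (q f : mpoly n K) :
  f \is ishomog1 d mdeg -> q * f \is ishomog1 e mdeg -> f != 0 -> q != 0 ->
  exists s, (s + d = e)%N /\ q \is ishomog1 s mdeg.
Proof.
move=> hf hqf f0 q0; have E := pihomog_partitionE (leqnn (mmeasure mdeg q)).
set k := mmeasure mdeg q in E.
have P (s : 'I_k) : pihomog mdeg s q != 0 -> (s + d)%N = e.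
  move=> nz; apply/eqP; rewrite eq_sym; apply: contraT => se.
  have : pihomog mdeg (s + d)%N (q * f) = 0 by rewrite (pihomog_ne0 se).
  rewrite {1}E mulr_suml raddf_sum (bigD1 s) //= big1 ?addr0 => [|i is'].
    rewrite pihomog_dE; last by apply: dhomogM => //; exact: pihomogP.
    by move/eqP; rewrite mulf_eq0 (negPf nz) (negPf f0).
  apply: (@pihomog_ne0 _ _ _ (i + d)%N); last by apply: dhomogM => //; exact: pihomogP.
  by rewrite eqn_add2r.
have [s nz] : exists s : 'I_k, pihomog mdeg s q != 0.
  apply: contrapT => h; case/eqP: q0; rewrite E big1 // => s _.
  by apply/eqP/negPn/negP => nz; apply: h; exists s.
exists s; split; first exact: P.
suff -> : q = pihomog mdeg s q by exact: pihomogP.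
rewrite {1}E (bigD1 s) //= big1 ?addr0 // => i is'.
apply/eqP/negPn/negP => ni; case/eqP: is'; apply: val_inj.
by apply/eqP; rewrite -(eqn_add2r d) (P _ ni) (P _ nz).
Qed.

Section Factor.
Variable K : fieldType.
Implicit Types (r : seq K) (u : {poly K}) (m : K -> nat).

Lemma coprimep_linear (s t : K) a b : s != t -> coprimep (('X - s%:P) ^+ a) (('X - t%:P) ^+ b).
Proof.
move=> st; apply: coprimep_expl; apply: coprimep_expr.
by rewrite coprimep_XsubC /root hornerD hornerX hornerN hornerC subr_eq0 eq_sym.
Qed.

Lemma coprimep_linear_prod (s : K) a r m : s \notin r ->
  coprimep (('X - s%:P) ^+ a) (\prod_(t <- r) ('X - t%:P) ^+ m t).
Proof.
elim: r => [|t r IH]; first by rewrite big_nil coprimep1.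
rewrite inE negb_or => /andP[st /IH h]; rewrite big_cons coprimepMr h andbT.
exact: coprimep_linear.
Qed.

Lemma prod_linear_dvdp r m u : uniq r -> (forall t, t \in r -> ('X - t%:P) ^+ m t %| u) ->
  \prod_(t <- r) ('X - t%:P) ^+ m t %| u.
Proof.
elim: r => [|t r IH] /=; first by rewrite big_nil dvd1p.
move=> /andP[tr ur] h; rewrite big_cons Gauss_dvdp; last exact: coprimep_linear_prod.
by rewrite h ?mem_head // IH // => s sr; apply: h; rewrite inE sr orbT.
Qed.

Lemma prod_linear_neq0 r m : \prod_(t <- r) ('X - t%:P) ^+ m t != 0.
Proof. by rewrite monic_neq0 // monic_prod // => t _; rewrite monic_exp // monicXsubC. Qed.

Lemma size_prod_linear r m : size (\prod_(t <- r) ('X - t%:P) ^+ m t) = (\sum_(t <- r) m t).+1.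
Proof.
elim: r => [|t r IH]; first by rewrite !big_nil size_poly1.
rewrite !big_cons size_mul ?prod_linear_neq0 ?expf_neq0 ?polyXsubC_eq0 // IH.
by rewrite size_exp_XsubC addSn addnS.
Qed.

End Factor.

Lemma closed_factorization (K : closedFieldType) (F : {poly K}) : F != 0 ->
  exists (c : K) (r : seq K) (m : K -> nat),
   [/\ c != 0, uniq r, (forall t, t \in r -> (0 < m t)%N), (forall t, root F t = (t \in r)) &
       F = c *: \prod_(t <- r) ('X - t%:P) ^+ m t].
Proof.
move=> F0; have [rs hF] := closed_field_poly_normal F.
exists (lead_coef F), (undup rs), (fun t => count_mem t rs); split.
- by rewrite lead_coef_eq0. - exact: undup_uniq.
- by move=> t; rewrite mem_undup -has_count has_pred1.
- by move=> t; rewrite mem_undup {1}hF rootZ ?lead_coef_eq0 // root_prod_XsubC.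
rewrite {1}hF; congr (_ *: _); rewrite -[LHS]big_undup_iterop_count.
by apply: eq_bigr.
Qed.

Lemma local_factor (K : fieldType) (c : K) (r : seq K) (m : K -> nat) (t : K) : c != 0 -> uniq r -> t \in r ->
  exists phi, c *: \prod_(s <- r) ('X - s%:P) ^+ m s = ('X - t%:P) ^+ m t * phi /\ phi.[t] != 0.
Proof.
move=> c0 ur tr; exists (c *: \prod_(s <- r | s != t) ('X - s%:P) ^+ m s); split.
  by rewrite (bigD1_seq t) //= scalerAr.
rewrite hornerZ mulf_neq0 // horner_prod prodf_seq_neq0; apply/allP => s _.
apply/implyP => st; rewrite horner_exp expf_neq0 // !hornerE subr_eq0 eq_sym; exact: st.
Qed.

(** The logarithmic derivative of F has a simple pole at t, with residue m != 0, which [be] must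
    cancel. *)
Lemma log_derivative_root (K : numFieldType) (F phi be c : {poly K}) (t : K) m : (0 < m)%N ->
  F = ('X - t%:P) ^+ m * phi -> phi.[t] != 0 -> be * F^`() = F * c -> be.[t] = 0.
Proof.
case: m => // m _ -> phit h.
have X0 : ('X - t%:P) ^+ m != 0 :> {poly K} by rewrite expf_neq0 // polyXsubC_eq0.
have : be * (m.+1%:R * phi + ('X - t%:P) * phi^`()) = ('X - t%:P) * phi * c.
  apply: (mulfI X0).
  move: h; rewrite derivM deriv_exp derivXsubC mul1r /= exprS -mulr_natl => h.
  transitivity (be * (m.+1%:R * ('X - t%:P) ^+ m * phi + ('X - t%:P) * ('X - t%:P) ^+ m * phi^`())).
    by ring.
  by rewrite h; ring.
move/(congr1 (horner^~ t)); rewrite !(hornerXsubC, hornerM, hornerD) subrr !mul0r addr0 => /eqP.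
rewrite -polyC_natr hornerC !mulf_eq0 (negPf phit) pnatr_eq0 /= orbF => /eqP.
by [].
Qed.

Lemma koszul_cross (A : idomainType) (g h : 'I_3 -> A) c :
  \sum_(j < 3) koszul g c j * h j = cross g h c.
Proof.
rewrite sum3 /koszul /cross !succ3E; move: c; apply: ord3; rewrite !succ3E !kE !eqxx ?mulr0n ?mulr1n; ring.
Qed.

Lemma cross_eq0 (A : idomainType) (g h : 'I_3 -> A) : (forall c, cross g h c = 0) ->
  forall i j, g i * h j = g j * h i.
Proof.
move=> z; have := z k0; have := z k1; have := z k2; rewrite /cross !succ3E => /eqP z2 /eqP z1 /eqP z0.
move: z0 z1 z2; rewrite !subr_eq0 => /eqP z0 /eqP z1 /eqP z2.
by apply: ord3; apply: ord3; rewrite ?z0 ?z1 ?z2 //; ring.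
Qed.

Section Field.
Variables (K : comNzRingType) (n : nat).
Implicit Types (r : 'I_n -> mpoly n K) (g : mpoly n K).
Local Notation ap r g := (\sum_(j < n) r j * mderiv j g).

Lemma sum_field_comb a b r1 r2 g : ap (fun i => a * r1 i + b * r2 i) g = a * ap r1 g + b * ap r2 g.
Proof. by rewrite !mulr_sumr -big_split; apply: eq_bigr => j _; rewrite mulrDl !mulrA. Qed.

Lemma sum_field_mul r g h : ap r (g * h) = ap r g * h + g * ap r h.
Proof. by rewrite mulr_suml mulr_sumr -big_split; apply: eq_bigr => j _; rewrite mderivM /=; ring. Qed.

Lemma sum_field_euler c d g : g \is ishomog1 d mdeg ->
  ap (fun i => c * mpolyX K (mnm1 i)) g = d%:R *: (c * g).
Proof. by move=> /euler e; rewrite scalerAr -e mulr_sumr; apply: eq_bigr => j _; rewrite mulrA. Qed.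

End Field.

(** * Syzygies of the union *)

Lemma quotient_size (K : fieldType) (u w g : {poly K}) n s : u = w * g -> w != 0 -> size g = s.+1 ->
  (size u <= n.+1)%N -> (size w + s <= n.+1)%N.
Proof.
move=> -> w0 sg; have g0 : g != 0 by rewrite -size_poly_eq0 sg.
by rewrite size_mul // sg addnS.
Qed.

Lemma swap_cancel (A : comNzRingType) (w1 w2 g : A) : w2 * (w1 * g) + - w1 * (w2 * g) = 0.
Proof. by ring. Qed.

Lemma cross_sum (A : comNzRingType) (u G H : 'I_3 -> A) j : (forall i j, G i * H j = G j * H i) ->
  (\sum_(i < 3) u i * G i) * H j = (\sum_(i < 3) u i * H i) * G j.
Proof. by move=> sw; rewrite !mulr_suml; apply: eq_bigr => i _; rewrite -!mulrA (sw i j) [H i * _]mulrC. Qed.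

Section Tangent.
Variable R : realType.
Local Notation C := (Cplx R).
Local Notation S := (Cpoly R 3).
Local Notation X_ := (fun i : 'I_3 => mpolyX C (mnm1 i)).
Implicit Types (f g h q : S) (v w : 'rV[C]_3) (gam th : 'I_3 -> {poly C}) (rho : 'I_3 -> S).

Lemma apply_field_comb (a b : S) r1 r2 g :
  apply_field (fun i => a * r1 i + b * r2 i) g = a * apply_field r1 g + b * apply_field r2 g.
Proof. exact: sum_field_comb. Qed.

Lemma apply_fieldM rho g h : apply_field rho (g * h) = apply_field rho g * h + g * apply_field rho h.
Proof. exact: sum_field_mul. Qed.

Lemma apply_field_euler (c : S) d g : homogeneous d g ->
  apply_field (fun i => c * X_ i) g = d%:R *: (c * g).
Proof. exact: sum_field_euler. Qed.

Lemma smooth_neq0 f : smooth_curve f -> f != 0.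
Proof.
move=> sm; apply/eqP => f0; apply: (sm (delta_mx 0 k0)); split.
- by apply/rV0Pn; exists k0; rewrite mxE !eqxx oner_eq0.
- by rewrite f0 evalv0.
by move=> i; rewrite f0 mderiv0 evalv0.
Qed.

Section Parametrized.
Variables (f1 f2 : S) (d1 d2 : nat) (gam : 'I_3 -> {poly C}) (w : 'rV[C]_3).
Hypotheses (rf1 : reduced_curve d1 f1) (hf2 : homogeneous d2 f2) (sm : smooth_curve f2) (d20 : (0 < d2)%N)
  (par : parametrizes f2 d2 gam w) (fw : evalv f1 w != 0)
  (qh : quasihomogeneous_singularities (f1 * f2)).
Local Notation F := (along gam f1).

Lemma along_top e h : homogeneous e h -> top_coef (d2 * e) (along gam h) (evalv h w).
Proof.
move=> hh; have := @top_coef_mmap C C idfun 3 d2 e gam (fun j => w ord0 j) h _ hh.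
exact: (fun H => H (par_top par)).
Qed.

Lemma along_size : size F = (d2 * d1).+1 /\ F != 0.
Proof.
have [_ hf1 _] := rf1; have [s t] := along_top hf1.
have F0 : F != 0 by apply: contra_neq fw => e; rewrite -t e coef0.
split=> //; apply/eqP; rewrite eqn_leq s ltnNge; apply: contra_neqN fw => s'.
by rewrite -t nth_default.
Qed.

(** Tangency of the Koszul syzygies makes the gradients of f1 and f2 parallel along C_2. Contracting
    with gamma, Euler's relations give d1 F on one side and 0 on the other, so the gradient of f2
    would vanish along C_2, against smoothness. This makes the constructed syzygy of f nonzero. *)
Lemma not_all_tangent : (forall a, AR f1 a -> along gam (apply_field a f2) = 0) -> False.
Proof.
move=> h; have [d10 hf1 _] := rf1; have [_ F0] := along_size.
pose G j := along gam (mderiv j f1); pose H j := along gam (mderiv j f2).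
have cr c : cross G H c = 0.
  rewrite -(h _ (koszul_syzygy (fun l => mderiv l f1) c)) /apply_field koszul_cross.
  exact: esym (etrans (alongB gam _ _) (congr2 (fun x y => x - y) (alongM gam _ _) (alongM gam _ _))).
have sw := cross_eq0 cr.
have E1 : \sum_(j < 3) gam j * G j = d1%:R%:P * F := along_euler gam hf1.
have E2 : \sum_(j < 3) gam j * H j = 0.
  by have := along_euler gam hf2; rewrite (par_eq0 par) mulr0.
have H0 j : H j = 0.
  have : d1%:R%:P * F * H j = 0.
    by rewrite -E1 (cross_sum gam j sw) E2; exact: mul0r.
  move/eqP; rewrite !mulf_eq0 polyC_eq0 pnatr_eq0 (negPf F0) orbF eqn0Ngt d10 /=.
  by move/eqP.
apply: (sm (v := curve_point gam 0)); split.
- by apply/rV0Pn; have [j hj] := par_neq0 par 0; exists j; rewrite mxE.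
- by rewrite -along_horner (par_eq0 par) horner0.
by move=> i; rewrite -along_horner -/(H i) H0 horner0.
Qed.

Section Roots.
Variables (c : C) (r : seq C) (m : C -> nat).
Hypotheses (c0 : c != 0) (ur : uniq r) (m0 : forall t, t \in r -> (0 < m t)%N)
  (hF : F = c *: \prod_(t <- r) ('X - t%:P) ^+ m t).

Lemma field_divisible s rho : AR_deg f1 s rho ->
  exists q : {poly C}, along gam (apply_field rho f2) = q * \prod_(t <- r) ('X - t%:P) ^+ (m t).-1.
Proof.
move=> har; apply/dvdpP; apply: prod_linear_dvdp => // t tr.
have [phi [e phit]] := local_factor m c0 ur tr.
apply: (field_divisibility rf1 hf2 qh har (par_neq0 par t) (par_immersion par t) (par_eq0 par) _ phit).
by rewrite hF.
Qed.

Lemma multiplicity_sum : (\sum_(t <- r) (m t).-1 + size r = d2 * d1)%N.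
Proof.
have [sF _] := along_size; move: sF; rewrite hF size_scale // size_prod_linear => -[<-].
rewrite -sum1_size -big_split /= big_seq [RHS]big_seq; apply: eq_bigr => t tr.
by rewrite addn1 prednK // m0.
Qed.

(** The degree of q is at most d2 (s1 + d2 - 1) minus the degree d2 d1 - |R| of the common factor.
    With s1 + s2 <= d1 - 1 this is at most d2 (k - s2), so q lifts to a form of degree k - s2. *)
Lemma lift_multiplier k s1 s2 rho (q : {poly C}) : (s1 + s2 < d1)%N -> (size r + d2 ^ 2 <= d2 * (k + 2))%N ->
  AR_deg f1 s1 rho -> along gam (apply_field rho f2) = q * \prod_(t <- r) ('X - t%:P) ^+ (m t).-1 ->
  exists L, along gam L = q /\ forall rho2, AR_deg f1 s2 rho2 -> forall i, homogeneous k (L * rho2 i).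
Proof.
move=> sd hk [_ har] hq; have [->|q0] := eqVneq q 0.
  by exists 0; split; [exact: along0|move=> rho2 _ i; rewrite mul0r; exact: dhomog0].
have [su _] := along_top (homogeneous_apply_field har hf2).
have sq := quotient_size hq q0 (size_prod_linear r (fun t => (m t).-1)) su.
have ms := multiplicity_sum; have sq0 : (0 < size q)%N by rewrite size_poly_gt0.
have key : (d2 * s2 + size q <= d2 * k + 1)%N.
  move: (\sum_(t <- r) _)%N (size q) sq (size r) ms hk => M n hsq N ms hk.
  have e1 : (d2 * (s1 + d2.-1) + d2 = d2 * s1 + d2 ^ 2)%N.
    by rewrite mulnDr -addnA [in LHS](_ : (d2 * d2.-1 + d2 = d2 ^ 2)%N) //; case: d2 d20 => // e _; rewrite /= expnS expn1; lia.
  have e2 : (d2 * (s1 + s2) + d2 <= d2 * d1)%N.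
    by rewrite -[X in (_ + X)%N]muln1 -mulnDr leq_mul2l addn1 sd orbT.
  rewrite mulnDr in e2; rewrite mulnDr in hk.
  move: e1 hsq hk; move: (d2 * (s1 + d2.-1))%N (d2 ^ 2)%N => A B e1 hsq hk; lia.
have sk : (s2 <= k)%N.
  rewrite -(leq_pmul2l d20); clear -key sq0; lia.
have [L [hL aL]] : exists h, homogeneous (k - s2) h /\ along gam h = q.
  by apply: (par_lift par); rewrite mulnBr; clear -key sk sq0; lia.
exists L; split=> // rho2 [_ h2] i; have := homogeneousM hL (h2 i).
by rewrite subnK.
Qed.

End Roots.
End Parametrized.
End Tangent.

Section Generic.
Variables (K : numFieldType) (n : nat).
Implicit Types (r : 'I_n -> mpoly n K) (c g Q f : mpoly n K).
Local Notation ap r g := (\sum_(j < n) r j * mderiv j g).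

Lemma sum_field_add_euler c r d g : g \is ishomog1 d mdeg ->
  ap (fun i => r i + c * mpolyX K (mnm1 i)) g = ap r g + d%:R *: (c * g).
Proof.
by move=> hg; rewrite -(sum_field_euler c hg) -big_split; apply: eq_bigr => j _; rewrite mulrDl.
Qed.

Lemma scale_inv_mul d Q g : (0 < d)%N -> d%:R *: ((d%:R^-1 *: Q) * g) = Q * g.
Proof. by move=> d0; rewrite -scalerAl scalerA mulfV ?scale1r // pnatr_eq0 -lt0n. Qed.

Lemma scale_mul_eq0 d c g : (0 < d)%N -> g != 0 -> d%:R *: (c * g) = 0 -> c = 0.
Proof.
move=> d0 g0 /eqP; rewrite scaler_eq0 pnatr_eq0 eqn0Ngt d0 mulf_eq0 (negPf g0) orbF /=.
by move/eqP.
Qed.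

Lemma positive_combination d1 d2 Q g : (0 < d1)%N -> g != 0 ->
  Q * g + d2%:R *: ((d1%:R^-1 *: Q) * g) = 0 -> Q = 0.
Proof.
move=> d10 g0; rewrite -scalerAl scalerA -[X in X + _]scale1r -scalerDl => /eqP.
rewrite scaler_eq0 mulf_eq0 (negPf g0) orbF => /orP[|/eqP //].
rewrite gt_eqF // ltr_pwDl //; apply: mulr_ge0; by rewrite ?invr_ge0 ler0n.
Qed.

Lemma sum_field_radial r h a f d g : g \is ishomog1 d mdeg ->
  (forall i, r i = a * mpolyX K (mnm1 i) + h i * f) ->
  ap r g = (d%:R *: a) * g + ap h g * f.
Proof.
move=> hg e; transitivity (ap (fun i => h i * f + a * mpolyX K (mnm1 i)) g).
  by apply: eq_bigr => j _; rewrite e addrC.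
rewrite (sum_field_add_euler _ _ hg) addrC scalerAl; congr (_ + _).
by rewrite mulr_suml; apply: eq_bigr => j _; rewrite mulrAC.
Qed.

End Generic.

Lemma radial_relation (A : comNzRingType) (x Q h f1 f2 : A) :
  - Q * f1 = x * f1 + h * f2 -> (Q + x) * f1 = - h * f2.
Proof. by move=> e; rewrite mulrDl -[Q * f1]opprK -mulNr e; ring. Qed.

Lemma product_field_zero (A : comNzRingType) (a f1 f2 Q : A) :
  a = 0 -> a * f2 + f1 * (Q * f2) + - Q * (f1 * f2) = 0.
Proof. by move=> ->; ring. Qed.

Lemma product_field_quotient (A : idomainType) (a b f1 f2 Q : A) : f2 != 0 ->
  a * f2 + f1 * b = 0 -> b = Q * f2 -> a = - Q * f1.
Proof.
move=> f20 h hb; apply: (mulIf f20); apply/eqP; rewrite -subr_eq0 -h hb.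
by apply/eqP; ring.
Qed.

Lemma opp_add_cancel (A : nzRingType) (Q f : A) : - Q * f + Q * f = 0.
Proof. by rewrite mulNr addNr. Qed.

Lemma tangent_sum (A : comNzRingType) (a b : A) (u v g : 'I_3 -> A) :
  \sum_(j < 3) (a * u j + b * v j) * g j = a * (\sum_(j < 3) u j * g j) + b * (\sum_(j < 3) g j * v j).
Proof. by rewrite !mulr_sumr -big_split; apply: eq_bigr => j _ /=; ring. Qed.

Lemma tangent_rearrange (A : comNzRingType) (a b d F F' q : A) :
  - q * F = a * (d * F) + b * F' -> b * F' = F * (- q - d * a).
Proof. by move=> h; rewrite -[LHS](addKr (a * (d * F))) -h; ring. Qed.

Lemma factor_out (A : idomainType) (f1 f2 h Q x B : A) : f2 != 0 -> Q + x = B * f2 ->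
  x * f1 + h * f2 = - Q * f1 -> h = - B * f1.
Proof.
move=> f20 hB e; apply: (mulIf f20).
have -> : h * f2 = (x * f1 + h * f2) - x * f1 by ring.
rewrite e; have -> : - Q * f1 - x * f1 = - (Q + x) * f1 by ring.
by rewrite hB; ring.
Qed.

Lemma radial_split (A : comNzRingType) (a h c x f : A) : h + c * x = 0 -> a * x + h * f = (a - c * f) * x.
Proof. by move/eqP; rewrite addr_eq0 => /eqP ->; ring. Qed.

Lemma along_product_zero (A : idomainType) (F a : A) (b c : A) : F != 0 -> b = 0 -> c * b + F * a = 0 -> a = 0.
Proof. by move=> F0 ->; rewrite mulr0 add0r => /eqP; rewrite mulf_eq0 (negPf F0) => /eqP. Qed.

Section Tangent.
Variable R : realType.
Local Notation C := (Cplx R).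
Local Notation S := (Cpoly R 3).
Local Notation X_ := (fun i : 'I_3 => mpolyX C (mnm1 i)).
Implicit Types (f g h q : S) (v w : 'rV[C]_3) (gam th : 'I_3 -> {poly C}) (rho : 'I_3 -> S).

Lemma apply_field_add_euler (c : S) rho d g : homogeneous d g ->
  apply_field (fun i => rho i + c * X_ i) g = apply_field rho g + d%:R *: (c * g).
Proof. exact: sum_field_add_euler. Qed.

Lemma apply_field0 rho g : (forall i, rho i = 0) -> apply_field rho g = 0.
Proof. by move=> h; rewrite /apply_field big1 // => j _; rewrite h; exact: mul0r. Qed.

(** The coefficients whose product with the Euler field has degree s; in degree s = 0 only 0
    remains. *)
Definition euler_multiplier s (c : S) := c = 0 \/ exists e, e.+1 = s /\ homogeneous e c.

Lemma euler_multiplierM s c i : euler_multiplier s c -> homogeneous s (c * X_ i).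
Proof.
move=> [->|[e [<- hc]]]; first by rewrite mul0r; exact: dhomog0.
have hX : homogeneous 1 (X_ i) by rewrite /homogeneous dhomogX; apply/eqP; exact: mdeg1.
by have := homogeneousM hc hX; rewrite (addn1 e).
Qed.

Lemma euler_multiplierZ s (x : C) c : euler_multiplier s c -> euler_multiplier s (x *: c).
Proof.
move=> [->|[e [es hc]]]; first by left; rewrite scaler0.
by right; exists e; split=> //; apply: rpredZ.
Qed.

Lemma euler_multiplierD s c1 c2 : euler_multiplier s c1 -> euler_multiplier s c2 -> euler_multiplier s (c1 + c2).
Proof.
move=> [->|[e [es h1]]] [->|[e' [es' h2]]].
- by left; rewrite addr0.
- by right; exists e'; rewrite add0r.
- by right; exists e; rewrite addr0.
right; exists e; split=> //; apply: rpredD h1 _.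
by rewrite -es in es'; case: es' => <-.
Qed.

Lemma euler_multiplier_quotient s d q f : homogeneous d f -> (0 < d)%N -> f != 0 ->
  homogeneous (s + d.-1) (q * f) -> euler_multiplier s q.
Proof.
move=> hf d0 f0 hq; have [->|q0] := eqVneq q 0; first by left.
have [e [ed he]] := homogeneous_quotient hf hq f0 q0.
by right; exists e; split=> //; lia.
Qed.

Section Parametrized.
Variables (f1 f2 : S) (d1 d2 : nat) (gam : 'I_3 -> {poly C}) (w : 'rV[C]_3).
Hypotheses (rf1 : reduced_curve d1 f1) (hf2 : homogeneous d2 f2) (sm : smooth_curve f2) (d20 : (0 < d2)%N)
  (par : parametrizes f2 d2 gam w) (fw : evalv f1 w != 0)
  (qh : quasihomogeneous_singularities (f1 * f2)).
Local Notation F := (along gam f1).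

Let d10 : (0 < d1)%N. Proof. by case: rf1. Qed.
Let hf1 : homogeneous d1 f1. Proof. by case: rf1. Qed.
Let f10 : f1 != 0. Proof. exact: reduced_neq0 rf1. Qed.
Let f20 : f2 != 0. Proof. exact: smooth_neq0. Qed.
Let F0 : F != 0. Proof. by have [] := along_size rf1 par fw. Qed.
Let d120 : (0 < d1 + d2)%N. Proof. by rewrite addn_gt0 d10. Qed.

Lemma radial_syzygy rho c : AR (f1 * f2) rho -> (forall i, rho i = c * X_ i) -> c = 0.
Proof.
move=> ar h; apply: (scale_mul_eq0 d120 (mulf_neq0 f10 f20)).
rewrite -(apply_field_euler c (homogeneousM hf1 hf2)) -[RHS]ar.
by apply: eq_bigr => j _; rewrite h.
Qed.

Lemma product_syzygy s rho : AR_deg (f1 * f2) s rho ->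
  exists Q, [/\ apply_field rho f2 = Q * f2, apply_field rho f1 = - Q * f1 & euler_multiplier s Q].
Proof.
move=> [ar hr]; have e : apply_field rho f1 * f2 + f1 * apply_field rho f2 = 0.
  by rewrite -apply_fieldM; exact: ar.
have hh := homogeneous_apply_field hr hf2.
have a0 : along gam (apply_field rho f2) = 0.
  apply: (along_product_zero F0 (par_eq0 par) (c := along gam (apply_field rho f1))).
  by rewrite -(alongM gam (apply_field rho f1) f2) -(alongM gam f1) -alongD e along0.
have [Q hQ] := par_dvd par hh a0; exists Q; split=> //.
  exact: product_field_quotient f20 e hQ.
by apply: (euler_multiplier_quotient hf2 d20 f20); rewrite -hQ.
Qed.

(** A syzygy of f multiplies f2 by some Q and f1 by - Q; adding Q / d1 times the Euler field makes
    it kill f1. If the result were zero, applying it to f2 would give (1 + d2 / d1) Q f2 = 0, hence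
    Q = 0 and rho = 0. *)
Lemma syzygy_restrict s : AR_deg_neq0 (f1 * f2) s -> AR_deg_neq0 f1 s.
Proof.
move=> /asboolP[rho har [i0 ri]]; have [ar hr] := har.
have [Q [e2 e1 hQ]] := product_syzygy har.
pose c := d1%:R^-1 *: Q; have hc : euler_multiplier s c := euler_multiplierZ _ hQ.
apply/asboolP; exists (fun i => rho i + c * X_ i).
  split; last by move=> i; apply: rpredD (hr i) (euler_multiplierM i hc).
  have : apply_field (fun i => rho i + c * X_ i) f1 = 0.
    by rewrite (apply_field_add_euler c rho hf1) e1 (scale_inv_mul Q f1 d10); exact: opp_add_cancel.
  by [].
apply: contrapT => h.
have Z i : rho i + c * X_ i = 0 by apply/eqP/negPn/negP => nz; apply: h; exists i.
have := apply_field0 f2 Z; rewrite (apply_field_add_euler c rho hf2) e2 => /(positive_combination d10 f20) Q0.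
by move/eqP: ri; apply; rewrite -[LHS]addr0 -[RHS](Z i0) /c Q0 scaler0 mul0r.
Qed.

Section Roots.
Variables (c : C) (r : seq C) (m : C -> nat).
Hypotheses (c0 : c != 0) (ur : uniq r) (m0 : forall t, t \in r -> (0 < m t)%N)
  (hF : F = c *: \prod_(t <- r) ('X - t%:P) ^+ m t).

(** The correction is - Q / (d1 + d2) times the Euler field. Were the result zero, applying it to f1
    would kill the correction, then freeness the two multipliers; all syzygies of f1 would be
    tangent to C_2, which [not_all_tangent] excludes. *)
Lemma free_product_syzygy k : free_curve f1 -> (size r + d2 ^ 2 <= d2 * (k + 2))%N ->
  AR_deg_neq0 (f1 * f2) k.
Proof.
move=> fr hk; have [s1 [s2 [r1 [r2 [h1 h2 sd free span]]]]] := free_syzygies rf1 fr.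
have [q1 e1] := field_divisible rf1 hf2 par qh c0 ur hF h1.
have [q2 e2] := field_divisible rf1 hf2 par qh c0 ur hF h2.
have [La [aLa hLa]] := lift_multiplier rf1 hf2 d20 par fw c0 ur m0 hF sd hk h1 e1.
rewrite addnC in sd.
have [Lb [aLb hLb]] := lift_multiplier rf1 hf2 d20 par fw c0 ur m0 hF sd hk h2 e2.
pose th i := Lb * r1 i + - La * r2 i.
have hth i : homogeneous k (th i).
  by rewrite /th mulNr; apply: homogeneousB; [exact: (hLb _ h1)|exact: (hLa _ h2)].
have ar1 : apply_field r1 f1 = 0 by case: h1.
have ar2 : apply_field r2 f1 = 0 by case: h2.
have th1 : apply_field th f1 = 0 by rewrite apply_field_comb ar1 ar2 !mulr0; exact: addr0.
have th2 : along gam (apply_field th f2) = 0.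
  rewrite apply_field_comb alongD (alongM gam Lb) (alongM gam (- La)).
  have -> : along gam (- La) = - q1 by rewrite -aLa -[- La]sub0r alongB along0; exact: sub0r.
  by rewrite e1 e2 aLb; exact: swap_cancel.
have hh := homogeneous_apply_field hth hf2.
have [Q hQ] := par_dvd par hh th2.
have mQ : euler_multiplier k Q by apply: (euler_multiplier_quotient hf2 d20 f20); rewrite -hQ.
pose cc := (d1 + d2)%:R^-1 *: (- Q).
have hcc : euler_multiplier k cc.
  by rewrite /cc -scaleN1r; do 2 apply: euler_multiplierZ.
apply/asboolP; exists (fun i => th i + cc * X_ i).
  split; last by move=> i; apply: rpredD (hth i) (euler_multiplierM i hcc).
  have : apply_field (fun i => th i + cc * X_ i) (f1 * f2) = 0.
    rewrite (apply_field_add_euler cc th (homogeneousM hf1 hf2)) (scale_inv_mul (- Q) (f1 * f2) d120).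
    by rewrite apply_fieldM hQ; exact: product_field_zero.
  by [].
apply: contrapT => h.
have Z i : th i + cc * X_ i = 0 by apply/eqP/negPn/negP => nz; apply: h; exists i.
have := apply_field0 f1 Z; rewrite (apply_field_add_euler cc th hf1) th1 add0r => /(scale_mul_eq0 d10 f10) cc0.
have th0 i : th i = 0 by rewrite -[LHS]addr0 -[RHS](Z i) cc0 mul0r.
have [Lb0 La0] := free _ _ th0.
have q20 : q2 = 0 by rewrite -aLb Lb0 along0.
have q10 : q1 = 0 by move/eqP: La0; rewrite oppr_eq0 => /eqP La0; rewrite -aLa La0 along0.
rewrite q20 mul0r in e2; rewrite q10 mul0r in e1.
apply: (not_all_tangent rf1 hf2 sm par fw) => a /span[c1 [c2 ha]].
have -> : apply_field a f2 = apply_field (fun i => c1 * r1 i + c2 * r2 i) f2.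
  by apply: eq_bigr => j _; rewrite ha.
rewrite apply_field_comb alongD (alongM gam c1) (alongM gam c2) e1 e2 !mulr0; exact: addr0.
Qed.

Lemma along_deriv g : (along gam g)^`() = \sum_(j < 3) along gam (mderiv j g) * (gam j)^`().
Proof.
by apply: (@mmap_derivation _ _ _ _ (@deriv C)); [exact: derivD|exact: derivM|exact: derivC].
Qed.

Lemma infinity_neq0 : exists j, w ord0 j != 0.
Proof.
apply/rV0Pn; apply: contra_neq fw => ->.
by have := evalv_scale 0 0 hf1; rewrite scale0r expr0n eqn0Ngt d10 mul0r.
Qed.

Lemma size_radial s rho (a : {poly C}) : (forall i, homogeneous s (rho i)) -> a != 0 ->
  (forall j, along gam (rho j) = a * gam j) -> (size a + d2 <= d2 * s + 1)%N.
Proof.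
move=> hr a0 h; have [j wj] := infinity_neq0.
have [sg tg] := par_top par j.
have sgj : size (gam j) = d2.+1.
  apply/eqP; rewrite eqn_leq sg ltnNge; apply: contra_neqN wj => s'.
  by rewrite -tg nth_default.
have g0 : gam j != 0 by rewrite -size_poly_eq0 sgj.
have [+ _] := along_top par (hr j).
by rewrite h size_mul // sgj addnS /= addn1.
Qed.

(** The tangential coefficient b satisfies b F' = F c for some c, hence vanishes at the |R| roots of
    F, while its degree is at most d2 s + 2 - d2. For d2 <= 2 this equals the threshold d2 s + 2 d2
    - d2^2 of the hypothesis, so b = 0. *)
Lemma tangent_field_vanishes s rho : AR_deg (f1 * f2) s rho ->
  (d2 * (s + 2) < size r + d2 ^ 2)%N -> (d2 <= 2)%N ->
  exists a : {poly C}, forall j, along gam (rho j) = a * gam j.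
Proof.
move=> har hs d22; have [ar hr] := har.
have [Q [e2 e1 hQ]] := product_syzygy har.
have st j : (size (along gam (rho j)) <= (d2 * s).+1)%N by have [] := along_top par (hr j).
have ht : \sum_(j < 3) along gam (rho j) * along gam (mderiv j f2) = 0.
  transitivity (along gam (apply_field rho f2)).
    by rewrite along_sum; apply: eq_bigr => j _; rewrite (alongM gam (rho j)).
  by rewrite e2 alongM (par_eq0 par); exact: mulr0.
have [a [b [hab sb]]] := par_tangent par st ht; exists a => j.
suff b0 : b = 0 by rewrite hab b0 mul0r; exact: addr0.
have bF : b * F^`() = F * (- along gam Q - d1%:R%:P * a).
  apply: tangent_rearrange; rewrite along_deriv -(along_euler gam hf1) -tangent_sum.
  transitivity (along gam (apply_field rho f1)).
    rewrite e1 (alongM gam (- Q)); congr (_ * _).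
    by rewrite -[- Q]sub0r alongB along0; exact: esym (sub0r _).
  by rewrite along_sum; apply: eq_bigr => i _; rewrite (alongM gam (rho i)) hab.
have rb : all (root b) r.
  apply/allP => t tr; have [phi [e phit]] := local_factor m c0 ur tr.
  by apply/eqP; apply: (log_derivative_root (m0 tr) _ phit bF); rewrite hF.
apply/eqP/negPn/negP => b0; have := max_poly_roots b0 rb ur.
move: sb hs; move: (size b) (size r) => x y.
by case: d2 d20 d22 => [|[|[|]]] // _ _; lia.
Qed.

(** The field is radial along C_2, so rho = a X + H f2 with X the Euler field, and a multiple of X
    corrects H into a syzygy of f1. If that were zero, rho would be radial everywhere, hence
    zero. *)
Lemma syzygy_drop s : AR_deg_neq0 (f1 * f2) s ->
  (d2 * (s + 2) < size r + d2 ^ 2)%N -> (d2 <= 2)%N ->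
  exists s', (s' + d2)%N = s /\ AR_deg_neq0 f1 s'.
Proof.
move=> /asboolP[rho har [i0 ri]] hs d22; have [ar hr] := har.
have [al hal] := tangent_field_vanishes har hs d22.
have [Q [e2 e1 hQ]] := product_syzygy har.
have [a [ha ala]] : exists a, euler_multiplier s a /\ along gam a = al.
  have [->|al0] := eqVneq al 0; first by exists 0; split; [left|exact: along0].
  have := size_radial hr al0 hal; have : (0 < size al)%N by rewrite size_poly_gt0.
  case: s {har hs hr hQ} => [|s] h0 h1; first by move: h1; rewrite muln0; lia.
  have [|a [ha ea]] := par_lift par (k := s) (p := al); first by move: h1; rewrite mulnS; lia.
  by exists a; split=> //; right; exists s.
have /choice[H hH] : forall i, exists H, rho i - a * X_ i = H * f2.
  move=> i; apply: (par_dvd par (homogeneousB (hr i) (euler_multiplierM i ha))).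
  by rewrite alongB (alongM gam a) along_var ala hal; exact: subrr.
have rE i : rho i = a * X_ i + H i * f2 by rewrite -hH addrC subrK.
have [j0 Hj] : exists j, H j != 0.
  apply: contrapT => h; have Z i : H i = 0 by apply/eqP/negPn/negP => nz; apply: h; exists i.
  have rX i : rho i = a * X_ i by rewrite rE Z mul0r; exact: addr0.
  by move/eqP: ri; apply; rewrite rX (radial_syzygy ar rX); exact: mul0r.
have hHf i : homogeneous s (H i * f2).
  by rewrite -hH; exact: homogeneousB (hr i) (euler_multiplierM i ha).
have [s' [es _]] := homogeneous_quotient hf2 (hHf j0) f20 Hj.
have hHi i : homogeneous s' (H i).
  have [->|Hi] := eqVneq (H i) 0; first exact: dhomog0.
  have [s2 [es2 h2]] := homogeneous_quotient hf2 (hHf i) f20 Hi.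
  by move: es2; rewrite -es => /addIn e; rewrite -e.
exists s'; split=> //.
have rf : apply_field rho f1 = d1%:R *: a * f1 + apply_field H f1 * f2 := sum_field_radial hf1 rE.
have hQa : euler_multiplier s (Q + d1%:R *: a) := euler_multiplierD hQ (euler_multiplierZ _ ha).
have aQ : along gam (Q + d1%:R *: a) = 0.
  have := congr1 (along gam) (radial_relation (etrans (esym e1) rf)).
  rewrite (alongM gam (Q + _)) (alongM gam (- _)) (par_eq0 par) mulr0 => /eqP.
  by rewrite mulf_eq0 (negPf F0) orbF => /eqP.
have [B hB] : exists B, Q + d1%:R *: a = B * f2.
  move: hQa => [e|[e [es' he]]]; first by exists 0; rewrite e mul0r.
  exact: (par_dvd par he aQ).
have HB : apply_field H f1 = - B * f1.
  by apply: (factor_out f20 hB); rewrite -rf.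
have mB : euler_multiplier s' B.
  have [->|B0] := eqVneq B 0; first by left.
  move: hQa; rewrite hB => -[/eqP|[e [es' he]]].
    by rewrite mulf_eq0 (negPf B0) (negPf f20).
  have [e' [ee' he']] := homogeneous_quotient hf2 he f20 B0.
  by right; exists e'; split=> //; move: es es' ee'; clear; lia.
pose cc := d1%:R^-1 *: B; have hcc : euler_multiplier s' cc := euler_multiplierZ _ mB.
apply/asboolP; exists (fun i => H i + cc * X_ i).
  split; last by move=> i; apply: rpredD (hHi i) (euler_multiplierM i hcc).
  have : apply_field (fun i => H i + cc * X_ i) f1 = 0.
    by rewrite (apply_field_add_euler cc H hf1) HB (scale_inv_mul B f1 d10); exact: opp_add_cancel.
  by [].
apply: contrapT => h.
have Z i : H i + cc * X_ i = 0 by apply/eqP/negPn/negP => nz; apply: h; exists i.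
have rX i : rho i = (a - cc * f2) * X_ i by rewrite rE; exact: radial_split (Z i).
by move/eqP: ri; apply; rewrite rX (radial_syzygy ar rX); exact: mul0r.
Qed.

End Roots.
End Parametrized.
End Tangent.

(** * Degree of smooth rational curves *)

Lemma bezout3 (K : fieldType) (p : 'I_3 -> {poly K}) : (exists i, p i != 0) ->
  exists (g : {poly K}) (p' al : 'I_3 -> {poly K}),
    [/\ g != 0, forall i, p i = g * p' i & \sum_(i < 3) al i * p' i = 1].
Proof.
move=> [i0 pi0].
have B (a b : {poly K}) : exists u v, [/\ u * a + v * b %| a & u * a + v * b %| b].
  have [[u v] /= /eqp_dvdl e] := Bezoutp a b; exists u, v.
  by rewrite !e dvdp_gcdl dvdp_gcdr.
have [u [v [ha hb]]] := B (p k0) (p k1).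
have [u' [v' [hc hd]]] := B (u * p k0 + v * p k1) (p k2).
pose al (i : 'I_3) := if i == k0 then u' * u else if i == k1 then u' * v else v'.
have gE : \sum_(i < 3) al i * p i = u' * (u * p k0 + v * p k1) + v' * p k2.
  by rewrite sum3 /al /=; ring.
set g := u' * _ + _ in hc hd gE.
have gd i : g %| p i.
  by move: i; apply: ord3 => //; [exact: dvdp_trans hc ha|exact: dvdp_trans hc hb].
have g0 : g != 0 by apply: contra_neq pi0 => g0; apply/eqP; rewrite -dvd0p -g0.
exists g, (fun i => p i %/ g), al; split=> //.
  by move=> i; rewrite mulrC divpK.
apply: (mulfI g0); rewrite mulr1 -[RHS]gE mulr_sumr; apply: eq_bigr => i _.
by rewrite mulrCA [g * _]mulrC divpK.
Qed.

Lemma size_deriv_le (K : nzRingType) (p : {poly K}) n : (size p <= n.+1)%N -> (size p^`() <= n)%N.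
Proof. by move=> sp; apply/leq_sizeP => j hj; rewrite coef_deriv nth_default ?mul0rn // (leq_trans sp). Qed.

Lemma cross_proportional (A : comNzRingType) (a b g : 'I_3 -> A) :
  \sum_(l < 3) a l * g l = 0 -> \sum_(l < 3) b l * g l = 0 ->
  forall i j, (a (succ3 i) * b (succ3 (succ3 i)) - a (succ3 (succ3 i)) * b (succ3 i)) * g j =
   (a (succ3 j) * b (succ3 (succ3 j)) - a (succ3 (succ3 j)) * b (succ3 j)) * g i.
Proof.
rewrite !sum3 => ha hb.
have e (x y p q : A) : x - y = p * (a k0 * g k0 + a k1 * g k1 + a k2 * g k2) +
    q * (b k0 * g k0 + b k1 * g k1 + b k2 * g k2) -> x = y.
  by rewrite ha hb !mulr0 addr0 => /eqP; rewrite subr_eq0 => /eqP.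
apply: ord3; apply: ord3; rewrite !succ3E //.
- by apply: (e _ _ (b k2) (- a k2)); ring.
- by apply: (e _ _ (- b k1) (a k1)); ring.
- by apply: (e _ _ (- b k2) (a k2)); ring.
- by apply: (e _ _ (b k0) (- a k0)); ring.
- by apply: (e _ _ (b k1) (- a k1)); ring.
by apply: (e _ _ (- b k0) (a k0)); ring.
Qed.

Lemma proportional_cancel (A : idomainType) (g a b x y u v : A) : g != 0 ->
  x = g * u -> y = g * v -> a * y = b * x -> a * v = b * u.
Proof. by move=> g0 -> -> h; apply: (mulfI g0); rewrite mulrCA h mulrCA. Qed.

(** The two leading terms, of degree 2 n - 1, cancel. This last unit makes the degree inequality for
    the curve strict. *)
Lemma bounded_coef_wronskian (K : comNzRingType) (a b : {poly K}) n : (0 < n)%N ->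
  (size a <= n.+1)%N -> (size b <= n.+1)%N -> (size (a * b^`() - b * a^`())%R <= (2 * n).-1)%N.
Proof.
case: n => // n _ sa sb.
have top (c e : {poly K}) : (size c <= n.+2)%N -> (size e <= n.+2)%N ->
    top_coef (n.+1 + n) (c * e^`()) (c`_n.+1 * (e`_n.+1 *+ n.+1)).
  move=> sc se; apply: top_coefM; split=> //; last by rewrite coef_deriv.
  exact: size_deriv_le.
have [s1 t1] := top a b sa sb; have [s2 t2] := top b a sb sa.
have s : (size (a * b^`() - b * a^`())%R <= (n.+1 + n).+1)%N.
  by rewrite (leq_trans (size_polyD _ _)) // geq_max size_polyN s1.
have t : (a * b^`() - b * a^`())`_(n.+1 + n) = 0.
  by rewrite coefB t1 t2 !mulrnAr [b`_n.+1 * _]mulrC subrr.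
apply/leq_sizeP => j hj; have [jn|jn] := leqP (n.+1 + n).+1 j; first by rewrite nth_default // (leq_trans s).
have -> : j = (n.+1 + n)%N by lia.
by [].
Qed.

Section Rational.
Variable R : realType.
Local Notation C := (Cplx R).
Local Notation S := (Cpoly R 3).
Implicit Types (f g h q : S) (v w : 'rV[C]_3).

Lemma poly_max_size (p : 'I_3 -> {poly C}) : exists n, (forall i, (size (p i) <= n.+1)%N) /\
  ((forall i, (size (p i) <= 1)%N) \/ (0 < n)%N /\ exists i, size (p i) = n.+1).
Proof.
exists (\max_(i < 3) (size (p i)).-1); split=> [i|].
  by rewrite (leq_trans (leqSpred _)) // ltnS; exact: (bigop.leq_bigmax i).
have [|i hi] := @bigop.eq_bigmax 'I_3 (fun i => (size (p i)).-1); first by rewrite card_ord.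
have [n0|n0] := posnP (\max_(i < 3) (size (p i)).-1); [left=> j|right; split=> //; exists i].
  by rewrite (leq_trans (leqSpred _)) // ltnS -n0; exact: (bigop.leq_bigmax j).
by rewrite hi prednK //; move: n0; rewrite hi; case: (size (p i)).
Qed.

(** After removing common factors, let n be the degree of gamma. By smoothness, also at infinity,
    the gradient along gamma is primitive and has a component of degree n (d - 1). It divides gamma
    x gamma', of degree at most 2 n - 2, so n (d - 1) < 2 n. *)
Lemma curve_field_degree f d (p : 'I_3 -> {poly C}) : homogeneous d f -> smooth_curve f -> along p f = 0 ->
  (forall (g : {poly C}) (v : 'I_3 -> C), ~ (forall i, p i = g * (v i)%:P)) -> (d <= 2)%N.
Proof.
move=> hf sm pf nc.
have pn0 : exists i, p i != 0.
  apply: contrapT => h; apply: (nc 0 (fun=> 0)) => i; rewrite mul0r.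
  by apply/eqP/negPn/negP => nz; apply: h; exists i.
have [g [p' [al [g0 hp hal]]]] := bezout3 pn0.
have pf' : along p' f = 0.
  have e : along p f = g ^+ d * along p' f.
    by rewrite -(along_scale g p' hf); apply: eq_mmap.
  by move/eqP: e; rewrite pf eq_sym mulf_eq0 expf_eq0 (negPf g0) andbF => /eqP.
have [n [sn [s1|[n0 [i0 si0]]]]] := poly_max_size p'.
  by case: (nc g (fun i => (p' i)`_0)) => i; rewrite hp {1}(size1_polyC (s1 i)).
pose a : 'rV[C]_3 := \row_i (p' i)`_n.
have tc e h : homogeneous e h -> top_coef (n * e) (along p' h) (evalv h a).
  move=> hh; have := @top_coef_mmap C C idfun 3 n e p' (fun j => a ord0 j) h _ hh.
  by apply=> i; split; [exact: sn|rewrite mxE].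
have fa : evalv f a = 0 by have [_ <-] := tc _ _ hf; rewrite pf' coef0.
have a0 : a != 0.
  apply/rV0Pn; exists i0; rewrite mxE; have := lead_coefE (p' i0); rewrite si0 /= => <-.
  by rewrite lead_coef_eq0 -size_poly_eq0 si0.
pose G j := along p' (mderiv j f).
have [j0 Gj0] : exists j, evalv (mderiv j f) a != 0.
  apply: contrapT => h; apply: (sm a); split=> // j.
  by apply/eqP/negPn/negP => nz; apply: h; exists j.
have sG : (n * d.-1 < size (G j0))%N.
  have [_ t] := tc _ _ (homogeneous_mderiv j0 hf).
  by rewrite ltnNge; apply: contra_neqN Gj0 => s; rewrite -t nth_default.
have Gn0 : exists j, G j != 0.
  by exists j0; rewrite -size_poly_gt0 (leq_ltn_trans _ sG).
have [g2 [G' [be [g20 hG hbe]]]] := bezout3 Gn0.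
(* A root of the common factor of the gradient would be the parameter of a singular point. *)
have sg2 : size g2 = 1.
  apply/eqP/negPn/negP => /closed_rootP[t] /rootP gt.
  apply: (sm (curve_point p' t)); split.
  - apply/eqP => z; have := congr1 (horner^~ t) hal; rewrite horner_sum hornerC big1 => [/eqP|i _].
      by rewrite eq_sym oner_eq0.
    by rewrite hornerM; have := congr1 (fun v : 'rV_3 => v ord0 i) z; rewrite !mxE => ->; rewrite mulr0.
  - by rewrite -along_horner pf' horner0.
  by move=> j; rewrite -along_horner -/(G j) hG hornerM gt mul0r.
have sGG j : size (G j) = size (G' j).
  by rewrite hG (size1_polyC (eq_leq sg2)) size_Cmul //; move: g20; rewrite {1}(size1_polyC (eq_leq sg2)) polyC_eq0.
pose W j := cross p' (fun i => (p' i)^`()) j.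
have W1 : \sum_(l < 3) p' l * G l = 0 by rewrite (along_euler p' hf) pf'; exact: mulr0.
have W2 : \sum_(l < 3) (p' l)^`() * G l = 0.
  have := along_deriv p' f; rewrite pf' deriv0 => {2}->.
  by apply: eq_bigr => l _; rewrite mulrC.
have WG i j : W i * G' j = W j * G' i.
  exact: (proportional_cancel g20 (hG i) (hG j) (cross_proportional W1 W2 i j)).
pose h := \sum_(j < 3) be j * W j.
have hW i : W i = h * G' i.
  rewrite -[LHS]mul1r -hbe !mulr_suml; apply: eq_bigr => j _.
  by rewrite -!mulrA [G' j * _]mulrC (WG i j).
(* If gamma x gamma' were zero, gamma' would be a multiple of gamma by the Bezout relation, and a
   nonconstant component would divide its own derivative. *)
have h0 : h != 0.
  apply/eqP => h0; have sw := @cross_eq0 _ p' (fun i => (p' i)^`()) (fun j => etrans (hW j) (etrans (congr1 (fun x => x * G' j) h0) (mul0r _))).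
  have e : (p' i0)^`() = p' i0 * \sum_(i < 3) al i * (p' i)^`().
    rewrite -[LHS]mul1r -hal mulr_suml mulr_sumr; apply: eq_bigr => i _.
    by rewrite -mulrA (sw i i0) mulrCA.
  have p0 : p' i0 != 0 by rewrite -size_poly_eq0 si0.
  have pd : (p' i0)^`() != 0.
    apply/eqP => z; have := coef_deriv (p' i0) n.-1; rewrite z coef0 prednK // => /esym/eqP.
    rewrite mulrn_eq0 eqn0Ngt n0 /=; have := lead_coefE (p' i0); rewrite si0 /= => <-.
    by rewrite lead_coef_eq0 (negPf p0).
  have := lt_size_deriv p0; rewrite ltnNge dvdp_leq // e; exact: dvdp_mulr.
have sW : (size (W j0) <= (2 * n).-1)%N := bounded_coef_wronskian n0 (sn _) (sn _).
have Gj : G' j0 != 0 by rewrite -size_poly_gt0 -sGG (leq_ltn_trans _ sG).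
move: sW; rewrite hW size_mul // -sGG; have : (0 < size h)%N by rewrite size_poly_gt0.
move: (size h) (size (G j0)) sG => x y h1 h2 h3.
have : (n * d.-1 < n * 2)%N by lia.
by rewrite ltn_pmul2l //; lia.
Qed.

End Rational.

Lemma linear_relation (K : fieldType) (x y : K) : x%:P * 'X = y%:P -> x = 0 /\ y = 0.
Proof.
move=> h; have := congr1 (fun p : {poly K} => p`_1) h; have := congr1 (fun p : {poly K} => p`_0) h.
by rewrite !coefMX !coefC /= => <- ->.
Qed.

Lemma scaled_relation (K : fieldType) (u : {poly K}) (x y : K) :
  u * x%:P * 'X = u * y%:P * 1 -> u * x%:P = 0 /\ u * y%:P = 0.
Proof.
have [->|u0] := eqVneq u 0; first by rewrite !mul0r.
rewrite mulr1 -mulrA => /(mulfI u0)/linear_relation[-> ->].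
by rewrite polyC0 mulr0.
Qed.

Section Binary.
Variables (K : comNzRingType).

Definition dehomogenize : mpoly 2 K -> {poly K} :=
  mmap (@polyC K) (fun k : 'I_2 => if k == ord0 then 1 else 'X).

Lemma dehomogenize_eq0 D h : h \is ishomog1 D mdeg -> dehomogenize h = 0 -> h = 0.
Proof.
move=> /dhomogP hh e; apply/mpolyP => m0; rewrite mcoeff0.
have [m0s|] := boolP (m0 \in msupp h); last by rewrite -mcoeff_eq0 => /eqP.
have := congr1 (fun p : {poly K} => p`_(m0 (lift ord0 ord0))) e; rewrite coef0 => ez; rewrite -[RHS]ez.
have mE (m : multinom 2) : mmap1 (fun k : 'I_2 => if k == ord0 then 1 else 'X) m = 'X^(m (lift ord0 ord0)) :> {poly K}.
  by rewrite /mmap1 !big_ord_recl big_ord0 /= expr1n mul1r mulr1.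
rewrite /dehomogenize /mmap coef_sum (big_rem m0) //= coefCM mE coefXn eqxx mulr1 big_seq big1 ?addr0 // => m mr.
have ms := mem_rem mr; rewrite coefCM mE coefXn; case: eqP => [mm|_]; last by rewrite mulr0.
have m01 : m0 = m.
  have := hh _ ms; have := hh _ m0s; rewrite /= !mdegE !big_ord_recl !big_ord0 !addn0 => <- /eqP.
  rewrite -mm eqn_add2r => /eqP m0m; apply/mnmP => i.
  by case: (unliftP ord0 i) => [j ->|-> //]; rewrite (_ : j = ord0) ?mm //; case: j => -[] // ?; apply: val_inj.
by move: mr; rewrite -m01 mem_rem_uniq ?msupp_uniq // inE eqxx.
Qed.

Lemma comp_homogeneous n k (m e : nat) (P : n.-tuple (mpoly k K)) (q : mpoly n K) :
  (forall i, tnth P i \is ishomog1 m mdeg) -> q \is ishomog1 e mdeg -> comp_mpoly P q \is ishomog1 (e * m) mdeg.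
Proof.
move=> hP /dhomogP hq; rewrite comp_mpolyE big_seq; apply: rpred_sum => mm /hq /= <-.
apply: rpredZ; rewrite mdegE big_distrl /=; elim: (index_enum _) => [|i r IH].
  by rewrite !big_nil; exact: dhomog1.
by rewrite !big_cons; apply: dhomogM => //; rewrite mulnC; apply: dhomogMn.
Qed.

End Binary.

Section Final.
Variable R : realType.
Local Notation C := (Cplx R).
Local Notation S := (Cpoly R 3).
Implicit Types (f g h q : S) (v w : 'rV[C]_3) (gam : 'I_3 -> {poly C}).

Lemma along_const (v : 'I_3 -> C) g : along (fun j => (v j)%:P) g = (evalv g (\row_j v j))%:P.
Proof.
elim/mpoly_closure_ind: g => [c|i|p1 p2 h1 h2|p1 p2 h1 h2].
- by rewrite alongC evalvC. - by rewrite along_var evalvX mxE.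
- by rewrite alongD h1 h2 evalvD polyCD.
by rewrite alongM h1 h2 evalvM polyCM.
Qed.

Lemma dehomogenize_comp (P : 3.-tuple (Cpoly R 2)) g :
  dehomogenize (comp_mpoly P g) = along (fun i => dehomogenize (tnth P i)) g.
Proof.
elim/mpoly_closure_ind: g => [c|i|p1 p2 h1 h2|p1 p2 h1 h2].
- by rewrite comp_mpolyC alongC /dehomogenize mmapC.
- by rewrite comp_mpolyXU along_var (tnth_nth 0).
- by rewrite alongD -h1 -h2 comp_mpolyD /dehomogenize mmapD.
by rewrite alongM -h1 -h2 /dehomogenize -rmorphM; congr (mmap _ _ _); exact: rmorphM.
Qed.

(** The inverse map rules out a constant parametrization: composing with it would give a constant
    ratio where the affine coordinate t is expected. *)
Lemma rational_degree d f : homogeneous d f -> smooth_curve f -> rational_curve f -> (d <= 2)%N.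
Proof.
move=> hf sm [_ [m [n [P [Q [[hP hQ] Pf [[j0 Qj] Qrel] _]]]]]].
apply: (curve_field_degree hf sm (p := fun i => dehomogenize (tnth P i))).
  by rewrite -dehomogenize_comp Pf /dehomogenize mmap0.
move=> g v hv; pose u j := dehomogenize (comp_mpoly P (tnth Q j)).
have uE j : u j = g ^+ n * (evalv (tnth Q j) (\row_i v i))%:P.
  rewrite /u dehomogenize_comp -along_const -(along_scale g _ (hQ j)); exact: eq_mmap.
have rel : u ord0 * 'X = u (lift ord0 ord0) * 1.
  have := congr1 (@dehomogenize C) (Qrel ord0 (lift ord0 ord0)).
  by rewrite /dehomogenize !rmorphM /= !mmap_U.
rewrite !uE in rel; have [z0 z1] := scaled_relation rel.
have uz0 : forall j, g ^+ n * (evalv (tnth Q j) (\row_i v i))%:P = 0 by exact: ord2.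
have uz j : u j = 0 := etrans (uE j) (uz0 j).
by move/eqP: Qj; apply; apply: (dehomogenize_eq0 (comp_homogeneous hP (hQ j0)) (uz j0)).
Qed.

Lemma vline_scale (c : C) v : c != 0 -> (<[c *: v]> = <[v]>)%VS.
Proof.
move=> c0; apply/eqP; rewrite eqEsubv -!memvE; apply/andP; split; apply/vlineP; first by exists c.
by exists c^-1; rewrite scalerA mulVf // scale1r.
Qed.

(** No common point is missed, because the only point of C_2 outside the parametrization is w, which
    is off C_1; injectivity prevents double counting. *)
Lemma num_intersection_roots f1 f2 d1 d2 gam w (r : seq C) : homogeneous d1 f1 ->
  parametrizes f2 d2 gam w -> evalv f1 w != 0 -> uniq r -> (forall t, root (along gam f1) t = (t \in r)) ->
  num_intersection f1 f2 = size r.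
Proof.
move=> hf1 par fw ur hr; pose P t := <[curve_point gam t]>%VS.
have E : intersection_points f1 f2 = [set` [fset x in [seq P t | t <- r]]%fset]%classic.
  apply/seteqP; split=> [x [v [v0 f1v f2v] <-]|x] /=.
    rewrite inE /=; have [[c [t vE]]|[c vE]] := par_point par v0 f2v; last first.
      case/eqP: fw; move/eqP: f1v; rewrite vE (evalv_scale _ _ hf1) mulf_eq0 expf_eq0 => /orP[/andP[_ /eqP c0]|/eqP //].
      by move: v0; rewrite vE c0 scale0r eqxx.
    have c0 : c != 0 by apply: contra_neq v0 => c0; rewrite vE c0 scale0r.
    apply/mapP; exists t; last by rewrite vE vline_scale.
    rewrite -hr /root along_horner; move/eqP: f1v; rewrite vE (evalv_scale _ _ hf1).
    by rewrite mulf_eq0 expf_eq0 (negPf c0) andbF.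
  rewrite inE => /mapP[t tr ->]; exists (curve_point gam t) => //; split.
  - by have [j hj] := par_neq0 par t; apply/rV0Pn; exists j; rewrite mxE.
  - by apply/eqP; rewrite -along_horner -/(root _ t) hr.
  by rewrite -along_horner (par_eq0 par) horner0.
rewrite /num_intersection E set_fsetK card_fseq undup_id ?size_map //.
rewrite map_inj_in_uniq // => s t _ _ st.
have /vlineP[k hk] : curve_point gam s \in P t by rewrite -st memv_line.
apply: (par_inj par (c := k)) => j.
by have := congr1 (fun v : 'rV_3 => v ord0 j) hk; rewrite !mxE.
Qed.

Lemma curve_parametrization d f v : homogeneous d f -> smooth_curve f -> (0 < d <= 2)%N ->
  v != 0 -> evalv f v = 0 -> exists gam, parametrizes f d gam v.
Proof.
case: d => [|[|[|]]] // hf sm _; first exact: line_parametrization (smooth_neq0 sm).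
exact: conic_parametrization.
Qed.

Lemma syzygy_degrees d1 d2 f1 f2 : reduced_curve d1 f1 -> free_curve f1 ->
  homogeneous d2 f2 -> smooth_curve f2 -> (0 < d2 <= 2)%N -> ~ pdvd f2 f1 ->
  quasihomogeneous_singularities (f1 * f2) ->
  [/\ (0 < num_intersection f1 f2)%N,
      forall k, (num_intersection f1 f2 + d2 ^ 2 <= d2 * (k + 2))%N -> AR_deg_neq0 (f1 * f2) k,
      forall s, AR_deg_neq0 (f1 * f2) s -> AR_deg_neq0 f1 s &
      forall s, AR_deg_neq0 (f1 * f2) s -> (d2 * (s + 2) < num_intersection f1 f2 + d2 ^ 2)%N ->
        exists s', (s' + d2)%N = s /\ AR_deg_neq0 f1 s'].
Proof.
move=> rf1 fr hf2 sm d22 nd qh; have [d20 d2le] := andP d22; have [d10 hf1 _] := rf1.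
(* An auxiliary parametrization finds a point w of C_2 off C_1, which then serves as the point at
   infinity of a second one. *)
have [v0 [v0n fv0]] := curve_has_point hf2 d20.
have [gam0 par0] := curve_parametrization hf2 sm d22 v0n fv0.
have [t0 ft0] : exists t, (along gam0 f1).[t] != 0.
  apply: contrapT => h; apply: nd; apply: (par_dvd par0 hf1); apply: poly_zero_everywhere => t.
  by apply/eqP/negPn/negP => nz; apply: h; exists t.
pose w := curve_point gam0 t0.
have fw : evalv f1 w != 0 by rewrite -along_horner.
have w0 : w != 0 by have [j hj] := par_neq0 par0 t0; apply/rV0Pn; exists j; rewrite mxE.
have f2w : evalv f2 w = 0 by rewrite -along_horner (par_eq0 par0) horner0.
have [gam par] := curve_parametrization hf2 sm d22 w0 f2w.
have [sF F0] := along_size rf1 par fw.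
have [c [r [m [c0 ur m0 hr hF]]]] := closed_factorization F0.
rewrite (num_intersection_roots hf1 par fw ur hr); split.
- have : size (along gam f1) != 1 by rewrite sF eqSS muln_eq0 !eqn0Ngt d10 d20.
  by move/closed_rootP => [t]; rewrite hr; case: (r).
- by move=> k; exact: (free_product_syzygy rf1 hf2 sm d20 par fw qh c0 ur m0 hF fr).
- by move=> s; exact: (syzygy_restrict rf1 hf2 sm d20 par fw).
by move=> s hs hlt; exact: (syzygy_drop rf1 hf2 sm d20 par fw c0 ur m0 hF hs hlt d2le).
Qed.

End Final.

(** * Numerical conclusion *)

Lemma ceil_div_bounds (N d : nat) : (0 < d)%N ->
  d%:Z * (Num.ceil (N%:R / d%:R : rat) - 1) < N%:Z <= d%:Z * Num.ceil (N%:R / d%:R : rat).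
Proof.
move=> d0; set e := Num.ceil _; have dr : (0 < d%:R :> rat) by rewrite ltr0n.
have h1 : N%:R / d%:R <= e%:~R :> rat by exact: ceil_ge.
have h2 : (e - 1)%:~R < N%:R / d%:R :> rat by exact: gt_pred_ceil.
apply/andP; split.
  by move: h2; rewrite ltr_pdivlMr // -(ltr_int rat) intrM mulrC.
by move: h1; rewrite ler_pdivrMr // -(ler_int rat) intrM mulrC.
Qed.

Section Numerical.
Variable R : realType.
Local Notation S := (Cpoly R 3).

Lemma smooth_line (l : S) : l != 0 -> homogeneous 1 l -> smooth_curve l.
Proof.
move=> l0 hl v [_ _ dv]; have [k] := gradient_neq0 hl (leqnn 1) l0; case/eqP.
have hk := homogeneous_mderiv k hl.
by rewrite (homogeneous0C hk) -(homogeneous0_eval v hk) dv mpolyC0.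
Qed.

(** A minimal syzygy of f of degree below k_0 drops to one of f1 of degree r - d2, so r < k_0
    implies r >= r_1 + d2; hence the condition under which r = k_0. *)
Lemma mdr_bounds (d1 d2 : nat) (f1 f2 : S) : reduced_curve d1 f1 -> free_curve f1 ->
  homogeneous d2 f2 -> smooth_curve f2 -> (0 < d2 <= 2)%N -> ~ pdvd f2 f1 ->
  quasihomogeneous_singularities (f1 * f2) ->
  let r1 : int := (mdr f1)%:Z in
  let r : int := (mdr (f1 * f2))%:Z in
  let N : nat := num_intersection f1 f2 in
  let k0 : int := d2%:Z - 2 + Num.ceil (N%:R / d2%:R : rat) in
  [/\ r1 <= r, r <= k0, (k0 <= r1 + d2%:Z - 1 -> r = k0) & (r1 + 1) * d2%:Z - d2%:Z ^+ 2 < N%:Z].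
Proof.
move=> rf1 fr hf2 sm d22 nd qh r1 r N k0; have [d20 d2le] := andP d22; have [_ hf1 _] := rf1.
have [N0 A B D] := syzygy_degrees rf1 fr hf2 sm d22 nd qh.
have [m1 min1] := mdrP hf1; have [m2 min2] := mdrP (homogeneousM hf1 hf2).
have r1r : r1 <= r by rewrite lez_nat; apply: min1; exact: B.
have /andP[e1 e2] := ceil_div_bounds N d20; rewrite /k0; move: (Num.ceil _) e1 e2 => e e1 e2.
have up k : (N + d2 ^ 2 <= d2 * (k + 2))%N -> (mdr (f1 * f2)%R <= k)%N by move=> h; exact/min2/A.
have down : (d2 * (mdr (f1 * f2)%R + 2) < N + d2 ^ 2)%N -> (mdr f1 + d2 <= mdr (f1 * f2)%R)%N.
  move=> h; have [s' [<- /min1]] := D _ m2 h; by rewrite leq_add2r.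
rewrite -/N in N0; rewrite /r1 /r in r1r *.
move: (mdr f1) (mdr (f1 * f2)) N r1r N0 e1 e2 up down {r1 r m1 min1 m2 min2 A B D k0}.
move=> a b n ab n0 e1 e2 up down.
(* The ceiling is positive because the curves meet; with e = e' + 1, k_0 is the natural number e'
   for a line and e' + 1 for a conic. *)
have [e' ee] : exists e' : nat, e = e'.+1%:Z.
  have : 0 < e by case: d2 d20 d2le e1 e2 {hf2 d22 up down} => [|[|[|]]] // _ _; lia.
  by case: e {e1 e2} => // -[|e'] // _; exists e'.
subst e; case: d2 d20 d2le e1 e2 up down {hf2 d22} => [|[|[|]]] // _ _ e1 e2 up down.
- have h := up e'; have bu : (b <= e')%N by apply: h; lia.
  split; [by []|lia|move=> hk|rewrite expr1n; lia].
  have [bl|] := ltnP b e'; last by lia.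
  have : (a + 1 <= b)%N by apply: down; lia.
  by lia.
have h := up e'.+1; have bu : (b <= e'.+1)%N by apply: h; rewrite !expnS expn0; lia.
split; [by []|lia|move=> hk|rewrite expr2; lia].
have [bl|] := ltnP b e'.+1; last by lia.
have : (a + 2 <= b)%N by apply: down; rewrite !expnS expn0; lia.
by lia.
Qed.

End Numerical.

Theorem corollary6p6 (R : realType) :
  (forall (d1 d2 : nat) (f1 f2 : Cpoly R 3),
     reduced_curve d1 f1 -> reduced_curve d2 f2 ->
     no_common_component f1 f2 ->
     smooth_curve f2 -> rational_curve f2 ->
     quasihomogeneous_singularities f1 ->
     quasihomogeneous_singularities (f1 * f2) ->
     free_curve f1 ->
     let r1 : int := (mdr f1)%:Z in
     let r : int := (mdr (f1 * f2))%:Z in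
     let nR : nat := num_intersection f1 f2 in
     let k0 : int := d2%:Z - 2 + Num.ceil (nR%:R / d2%:R : rat) in
     [/\ d2 = 1%N \/ d2 = 2%N,
         nR%:Z <= (r1 + 1) * d2%:Z ->
           r1 <= k0 /\ [/\ r1 <= r, r = k0 & k0 <= r1 + d2%:Z - 1] &
         (r1 + 1) * d2%:Z - d2%:Z ^+ 2 < nR%:Z]) /\
  (* case (1): C2 is a line *)
  (forall (d1 : nat) (f1 l : Cpoly R 3),
     reduced_curve d1 f1 -> free_curve f1 ->
     l != 0 -> homogeneous 1 l -> ~ pdvd l f1 ->
     quasihomogeneous_singularities f1 ->
     quasihomogeneous_singularities (f1 * l) ->
     (mdr f1 < num_intersection f1 l)%N) /\
  (* case (2): C2 is a smooth conic *)
  (forall (d1 : nat) (f1 q : Cpoly R 3),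
     reduced_curve d1 f1 -> free_curve f1 ->
     reduced_curve 2 q -> smooth_curve q -> ~ pdvd q f1 ->
     quasihomogeneous_singularities f1 ->
     quasihomogeneous_singularities (f1 * q) ->
     2 * (mdr f1)%:Z - 2 < (num_intersection f1 q)%:Z).
Proof.
split; last split.
- move=> d1 d2 f1 f2 rf1 [d20 hf2 _] nc sm rat _ qh fr.
  have d2le := rational_degree hf2 sm rat.
  have nd : ~ pdvd f2 f1.
    by have [irr _] := rat; move=> h; apply: (nc f2 irr h); exists 1; rewrite mul1r.
  have d22 : (0 < d2 <= 2)%N by rewrite d20.
  have /= := mdr_bounds rf1 fr hf2 sm d22 nd qh.
  have /andP[+ _] := ceil_div_bounds (num_intersection f1 f2) d20.
  cbv zeta; move: (mdr f1) (mdr (f1 * f2)) (num_intersection _ _) => a b n; move: (Num.ceil _) => e e1 [h1 h2 h3 h4].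
  have dd : d2 = 1%N \/ d2 = 2%N by move: d20 d2le; clear; lia.
  (* From d2 (e - 1) < |R| <= (r_1 + 1) d2 the ceiling e is at most r_1 + 1, which is the upper
     bound on k_0. *)
  split=> // hn; have k0le : d2%:Z - 2 + e <= a%:Z + d2%:Z - 1.
    by move: e1 hn; clear -dd; case: dd => ->; lia.
  by split; [exact: le_trans h1 h2|split=> //; exact: h3].
- move=> d1 f1 l rf1 fr l0 hl nd _ qh.
  have /= [_ _ _] := mdr_bounds rf1 fr hl (smooth_line l0 hl) isT nd qh.
  by rewrite expr1n; lia.
move=> d1 f1 q rf1 fr [_ hq _] sm nd _ qh.
have /= [_ _ _] := mdr_bounds rf1 fr hq sm isT nd qh.
by rewrite expr2; lia.
Qed.
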